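(* Let $\mathcal G$ and $\mathcal H$ be locally compact Hausdorff groupoids with left Haar systems which are equivalent via an equivalence $\Omega$, let $\mathcal L$ be the linking groupoid of $\Omega$ (with its induced Haar system), let $\mathcal A(\mathcal L)$ be an unconditional completion of $C_c(\mathcal L)$, and let $\mathcal A(\mathcal G)$ and $\mathcal A(\mathcal H)$ be the unconditional completions of $C_c(\mathcal G)$ and $C_c(\mathcal H)$ obtained by restricting the norm of $\mathcal A(\mathcal L)$. Let $B$ be a non-degenerate $\mathcal G$-Banach algebra. Then the Banach algebras $\mathcal A(\mathcal G,B)$ and $\mathcal A(\mathcal H,\mathrm{Ind}_{\mathcal G}^{\mathcal H}B)$ are Morita equivalent. In particular, $L^1(\mathcal G,B)$ and $L^1(\mathcal H,\mathrm{Ind}_{\mathcal G}^{\mathcal H}B)$ are Morita equivalent.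
   Context: **Groupoids.** All groupoids $\mathcal G$ have open range and source maps $r,s:\mathcal G\to\mathcal G^{(0)}$; $\mathcal G^x=r^{-1}(x)$. A left Haar system is a family $(\lambda^x)_{x\in\mathcal G^{(0)}}$ of Radon measures on $\mathcal G$ with $\operatorname{supp}\lambda^x=\mathcal G^x$, with $x\mapsto\int\varphi\,d\lambda^x$ in $C_c(\mathcal G^{(0)})$ for all $\varphi\in C_c(\mathcal G)$, and $\int\varphi(\cdot)\,d\lambda^{r(\gamma)}=\int\varphi(\gamma\,\cdot)\,d\lambda^{s(\gamma)}$. An equivalence $\Omega$ between $\mathcal G$ and $\mathcal H$ is a locally compact Hausdorff space with commuting continuous left $\mathcal G$-action (anchor map $\rho:\Omega\to\mathcal G^{(0)}$) and right $\mathcal H$-action (anchor map $\sigma:\Omega\to\mathcal H^{(0)}$), both free and proper (i.e. $(\gamma,\omega)\mapsto(\gamma\omega,\omega)$ is proper, likewise on the right), such that $\rho$ induces a homeomorphism $\Omega/\mathcal H\cong\mathcal G^{(0)}$ and $\sigma$ a homeomorphism $\mathcal G\backslash\Omega\cong\mathcal H^{(0)}$. $\Omega^{-1}$ denotes $\Omega$ with the actions interchanged, an $\mathcal H$-$\mathcal G$-bimodule. **Linking groupoid.** $\mathcal L=\mathcal G\sqcup\Omega\sqcup\Omega^{-1}\sqcup\mathcal H$, $\mathcal L^{(0)}=\mathcal G^{(0)}\sqcup\mathcal H^{(0)}$; $\omega\in\Omega$ has range $\rho(\omega)$, source $\sigma(\omega)$ and inverse $\omega^{-1}\in\Omega^{-1}$;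 products are given by the multiplications of $\mathcal G,\mathcal H$, by the actions, by $\omega^{-1}\omega'=$ the unique $\eta\in\mathcal H$ with $\omega\eta=\omega'$, and by $\omega'\omega^{-1}=$ the unique $\gamma\in\mathcal G$ with $\gamma\omega=\omega'$. Its Haar system is $\lambda_{\mathcal L}^g=\lambda_{\mathcal G}^g+\lambda_\Omega^g$ for $g\in\mathcal G^{(0)}$ and $\lambda_{\mathcal L}^h=\lambda_{\Omega^{-1}}^h+\lambda_{\mathcal H}^h$ for $h\in\mathcal H^{(0)}$, where $\lambda^g_\Omega(\varphi)=\int\varphi(\omega\eta)\,d\lambda_{\mathcal H}^{\sigma(\omega)}(\eta)$ for any $\omega$ with $\rho(\omega)=g$ and $\lambda_{\Omega^{-1}}^h(\varphi)=\int\varphi(\omega^{-1}\gamma)\,d\lambda_{\mathcal G}^{\rho(\omega)}(\gamma)$ for any $\omega$ with $\sigma(\omega)=h$. **Fields.** An upper semi-continuous (u.s.c.) field of Banach spaces over a locally compact Hausdorff space $X$ is a family $(E_x)_{x\in X}$ of Banach spaces with a linear subspace $\Gamma(X,E)\subseteq\prod_xE_x$ (''sections'') such that all evaluations $\Gamma(X,E)\to E_x$ have dense image, $x\mapsto\|\xi(x)\|$ is u.s.c. for every section $\xi$, and every selection that is locally approximable by sections (for all $x_0$ and $\varepsilon>0$ there are a section $\xi'$ and a neighbourhood $U$ of $x_0$ with $\|\xi(x)-\xi'(x)\|\le\varepsilon$ on $U$) is a section. $\Gamma_c$ denotes compactly supported sections. A continuous field of (bi)linear maps is a locally bounded family of (bi)linear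 maps between fibres sending sections to sections. For continuous $p:Y\to X$, $p^*E$ has fibres $E_{p(y)}$ and as sections the selections locally approximable by the $\xi\circ p$, $\xi\in\Gamma(X,E)$. A $\mathcal G$-Banach space is a u.s.c. field $E$ over $\mathcal G^{(0)}$ with an isometric isomorphism of fields $\alpha:s^*E\to r^*E$, $\alpha_{\gamma\gamma'}=\alpha_\gamma\alpha_{\gamma'}$; write $\gamma e=\alpha_\gamma(e)$. A $\mathcal G$-Banach algebra $B$ is a $\mathcal G$-Banach space whose fibres are Banach algebras, with multiplication a continuous field of bilinear maps and all $\alpha_\gamma$ multiplicative; it is non-degenerate if the span of $B_xB_x$ is dense in $B_x$ for all $x$. **Induction.** $\mathrm{Ind}_{\mathcal G}^{\mathcal H}B$ is the $\mathcal H$-Banach algebra whose fibre over $h\in\mathcal H^{(0)}$ consists of the families $(b_\omega)_{\omega\in\sigma^{-1}(h)}$, $b_\omega\in B_{\rho(\omega)}$, with $b_{\gamma\omega}=\gamma b_\omega$ for all $\gamma\in\mathcal G$ with $s(\gamma)=\rho(\omega)$, with componentwise multiplication and the common norm $\|b_\omega\|$; its sections are $h\mapsto(\delta(\omega))_{\omega\in\sigma^{-1}(h)}$ with $\delta\in\Gamma(\Omega,\rho^*B)$, $\delta(\gamma\omega)=\gamma\delta(\omega)$; the action is $(\eta b)_\omega=b_{\omega\eta}$. **Unconditional completions.** An unconditional completion $\mathcal A(\mathcal G)$ is a Banach algebra containing $C_c(\mathcal G)$ (with convolution $(f*g)(\gamma')=\int f(\gamma)g(\gamma^{-1}\gamma')\,d\lambda^{r(\gamma')}(\gamma)$)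 as a dense subalgebra such that $|f_1|\le|f_2|$ pointwise implies $\|f_1\|_{\mathcal A}\le\|f_2\|_{\mathcal A}$. For bounded $\varphi\ge0$ with compact support put $\|\varphi\|_{\mathcal A}=\inf\{\|\psi\|_{\mathcal A}:\psi\in C_c(\mathcal G),\psi\ge\varphi\}$. $\mathcal A(\mathcal G,B)$ is the Hausdorff completion of $\Gamma_c(\mathcal G,r^*B)$ for $\|\xi\|_{\mathcal A}=\|\gamma\mapsto\|\xi(\gamma)\|\|_{\mathcal A}$, a Banach algebra for $(\xi_1*\xi_2)(\gamma')=\int\xi_1(\gamma)\,\gamma\xi_2(\gamma^{-1}\gamma')\,d\lambda^{r(\gamma')}(\gamma)$. $L^1(\mathcal G)$ is the completion for $\|f\|_1=\sup_{x}\int|f|\,d\lambda^x$, and $L^1(\mathcal G,B)$ the corresponding algebra with coefficients. **Morita equivalence.** A Morita equivalence between Banach algebras $A,B$ is a pair $(E^<,E^>)$ with $E^>$ a Banach $A$-$B$-bimodule, $E^<$ a Banach $B$-$A$-bimodule, and contractive bilinear maps $E^<\times E^>\to B$, $E^>\times E^<\to A$, such that $\begin{pmatrix} A & E^> \\ E^< & B \end{pmatrix}$ is an associative algebra under matrix multiplication, and all the operations ($A\times A\to A$, $B\times B\to B$, the module actions, the two pairings) have images with dense linear span. *)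

(* Defs.v *)
(* Banach spaces and algebras have complex scalars R[i], with R : realType.
   Norms take their values in R[i], ordered by x <= y iff y - x is a
   nonnegative real. *)
From HB Require Import structures.
From mathcomp Require Import all_boot all_order all_algebra.
From mathcomp Require Import all_classical all_reals topology normedtype.
From mathcomp Require Import complex.

Set Implicit Arguments.
Unset Strict Implicit.
Unset Printing Implicit Defensive.
Import Order.TTheory GRing.Theory Num.Theory.
Import numFieldNormedType.Exports.
Local Open Scope classical_set_scope.
Local Open Scope ring_scope.
Local Open Scope complex_scope.

HB.mixin Record isBanachAlgebra (K : numFieldType) A
    of CompleteNormedModule K A := {
  bmul : A -> A -> A;
  bmulA : associative bmul;
  bmulDl : left_distributive bmul +%R;
  bmulDr : right_distributive bmul +%R;
  bscalerAl : forall (k : K) x y, bmul (k *: x) y = k *: bmul x y;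
  bscalerAr : forall (k : K) x y, bmul x (k *: y) = k *: bmul x y;
  ler_bnormM : forall x y, `|bmul x y| <= `|x| * `|y| }.

#[short(type="banachAlgType")]
HB.structure Definition BanachAlgebra (K : numFieldType) :=
  {A of isBanachAlgebra K A & CompleteNormedModule K A}.

Section Morita.
Context {K : numFieldType}.

Definition linspan (V : lmodType K) (S : set V) : set V :=
  [set v | exists n (a : 'I_n -> K) (u : 'I_n -> V),
     (forall i, S (u i)) /\ v = \sum_i a i *: u i].

Definition dense_image (U V : Type) (W : normedModType K) (f : U -> V -> W) :=
  dense (linspan [set w | exists u v, w = f u v]).

Record contractive_bilinear (U V W : normedModType K) (f : U -> V -> W) :
    Prop := {
  cb_l : forall k u u' v, f (k *: u + u') v = k *: f u v + f u' v;
  cb_r : forall k u v v', f u (k *: v + v') = k *: f u v + f u v';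
  cb_norm : forall u v, `|f u v| <= `|u| * `|v| }.

Record banach_bimodule (A B : banachAlgType K) (E : completeNormedModType K)
    (l : A -> E -> E) (r : E -> B -> E) : Prop := {
  bm_l : contractive_bilinear l;
  bm_r : contractive_bilinear r;
  bm_lA : forall a a' e, l (bmul a a') e = l a (l a' e);
  bm_rA : forall e b b', r e (bmul b b') = r (r e b) b';
  bm_lr : forall a e b, l a (r e b) = r (l a e) b }.

(* (a, e, f, b) stands for the matrix with rows (a e) and (f b) *)
Definition linking_mxmul (A B : banachAlgType K)
    (Eg El : completeNormedModType K)
    (lg : A -> Eg -> Eg) (rg : Eg -> B -> Eg)
    (ll : B -> El -> El) (rl : El -> A -> El)
    (pB : El -> Eg -> B) (pA : Eg -> El -> A)
    (x y : A * Eg * El * B) : A * Eg * El * B :=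
  let: (a, e, f, b) := x in let: (a', e', f', b') := y in
  (bmul a a' + pA e f', lg a e' + rg e b',
   rl f a' + ll b f', pB f e' + bmul b b').

Definition morita_equivalent (A B : banachAlgType K) : Prop :=
  exists (Eg El : completeNormedModType K)
    (lg : A -> Eg -> Eg) (rg : Eg -> B -> Eg)
    (ll : B -> El -> El) (rl : El -> A -> El)
    (pB : El -> Eg -> B) (pA : Eg -> El -> A),
  [/\ banach_bimodule lg rg /\ banach_bimodule ll rl,
      contractive_bilinear pB /\ contractive_bilinear pA,
      associative (linking_mxmul lg rg ll rl pB pA),
      [/\ dense_image (@bmul K A), dense_image (@bmul K B),
          dense_image lg & dense_image rg] &
      [/\ dense_image ll, dense_image rl, dense_image pB & dense_image pA]].

End Morita.

Section Fields.
Context {R : realType}.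
Local Notation C := R[i].

Definition compactly_supported (X : topologicalType) (E : X -> zmodType)
    (xi : forall x, E x) : Prop :=
  exists2 K : set X, compact K & forall x, ~ K x -> xi x = 0.

Definition Cc (X : topologicalType) : set (X -> C) :=
  [set f | continuous (f : X -> C^o) /\
           @compactly_supported X (fun=> C) f].

Definition locally_approximable (X : topologicalType)
    (E : X -> completeNormedModType C) (S : set (forall x, E x)) :
    set (forall x, E x) :=
  [set xi | forall (x0 : X) (eps : C), 0 < eps ->
     exists2 zeta, S zeta & \forall x \near x0, `|xi x - zeta x| <= eps].

Record usc_field (X : topologicalType) (E : X -> completeNormedModType C)
    (S : set (forall x, E x)) : Prop := {
  usc_zero : S (fun=> 0);
  usc_lin : forall (k : C) xi zeta,
    S xi -> S zeta -> S (fun x => k *: xi x + zeta x);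
  usc_dense : forall x, dense [set xi x | xi in S];
  usc_norm : forall xi, S xi -> forall x0 (c : C), `|xi x0| < c ->
    \forall x \near x0, `|xi x| < c;
  usc_closed : locally_approximable S `<=` S }.

Definition pullback_sections (X Y : topologicalType)
    (E : X -> completeNormedModType C) (p : Y -> X) (S : set (forall x, E x)) :
    set (forall y, E (p y)) :=
  @locally_approximable Y (fun y => E (p y))
    [set (fun y => xi (p y)) | xi in S].

(* Radon measures in the sense of Bourbaki: positive linear forms on Cc X.
   The values outside Cc X are irrelevant. *)
Record radon (X : topologicalType) (mu : (X -> C) -> C) : Prop := {
  radon_lin : forall (k : C) f g, Cc f -> Cc g ->
    mu (fun x => k * f x + g x) = k * mu f + mu g;
  radon_pos : forall f, Cc f -> (forall x, 0 <= f x) -> 0 <= mu f }.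

Definition msupport (X : topologicalType) (mu : (X -> C) -> C) : set X :=
  [set x | forall U, open U -> U x ->
     exists f, [/\ Cc f, forall y, ~ U y -> f y = 0 & mu f != 0]].

(* F only needs to be given on the support of mu: it is integrable with
   integral v when it is approximated there by \sum_i phi_i e_i, with phi_i in
   Cc X and e_i in V, up to a psi in Cc X of small integral.  For continuous
   compactly supported functions on the support this is the usual (Bochner)
   integral. *)
Definition has_integral (X : topologicalType) (V : normedModType C)
    (mu : (X -> C) -> C) (F : X -> V) (v : V) : Prop :=
  forall eps : C, 0 < eps ->
  exists n (phi : 'I_n -> X -> C) (e : 'I_n -> V) (psi : X -> C),
  [/\ forall i, Cc (phi i), Cc psi,
      forall x, msupport mu x ->
        `|F x - \sum_i phi i x *: e i| <= psi x,
      mu psi <= eps &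
      `|v - \sum_i mu (phi i) *: e i| <= eps].

Definition integral (X : topologicalType) (V : normedModType C)
    (mu : (X -> C) -> C) (F : X -> V) : V :=
  xget 0 (has_integral mu F).

Definition cintegral (X : topologicalType) (mu : (X -> C) -> C)
    (f : X -> C) : C := @integral X C^o mu f.

End Fields.
Arguments pullback_sections {R X Y E} p S.

Section SumTopology.
Context {X Y : topologicalType}.

Definition sum_open : set_system (X + Y)%type :=
  [set U | open (inl @^-1` U) /\ open (inr @^-1` U)].

Let sum_openT : sum_open setT.
Proof. by split; rewrite preimage_setT; exact: openT. Qed.

Let sum_openI : setI_closed sum_open.
Proof.
by move=> U V [Ul Ur] [Vl Vr]; split; rewrite preimage_setI; exact: openI.
Qed.

Let sum_open_bigU (I : Type) (f : I -> set (X + Y)%type) :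
  (forall i, sum_open (f i)) -> sum_open (\bigcup_i f i).
Proof.
by move=> fo; split; rewrite preimage_bigcup; apply: bigcup_open => i _;
  have [] := fo i.
Qed.

HB.instance Definition _ := isOpenTopological.Build (X + Y)%type
  sum_openT sum_openI sum_open_bigU.
End SumTopology.

(* gmul is total, but gmul g g' is only meaningful when src g = rng g'; the
   form haar x = lambda^x is only meaningful on Cc.  By rng_id and the
   continuity of gid and rng below, gid embeds units as a subspace of arrows. *)
Record groupoid_data (R : realType) := GroupoidData {
  arrows :> topologicalType;
  units : topologicalType;
  gid : units -> arrows;
  rng : arrows -> units;
  src : arrows -> units;
  gmul : arrows -> arrows -> arrows;
  ginv : arrows -> arrows;
  haar : units -> (arrows -> R[i]) -> R[i] }.

Arguments units {R}.
Arguments gid {R} _ _.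
Arguments rng {R _} _.
Arguments src {R _} _.
Arguments haar {R} _ _ _.

Section Groupoids.
Context {R : realType}.
Local Notation C := R[i].

Record is_lch_groupoid (G : groupoid_data R) : Prop := {
  gpd_hausdorff : hausdorff_space G;
  gpd_lc : locally_compact [set: G];
  rng_id : forall x : units G, rng (gid G x) = x;
  src_id : forall x : units G, src (gid G x) = x;
  rng_mul : forall g g' : G, src g = rng g' -> rng (gmul g g') = rng g;
  src_mul : forall g g' : G, src g = rng g' -> src (gmul g g') = src g';
  gmulA : forall g g' g'' : G, src g = rng g' -> src g' = rng g'' ->
    gmul g (gmul g' g'') = gmul (gmul g g') g'';
  gmul1l : forall g : G, gmul (gid G (rng g)) g = g;
  gmul1r : forall g : G, gmul g (gid G (src g)) = g;
  rng_inv : forall g : G, rng (ginv g) = src g;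
  src_inv : forall g : G, src (ginv g) = rng g;
  gmulVr : forall g : G, gmul g (ginv g) = gid G (rng g);
  gmulVl : forall g : G, gmul (ginv g) g = gid G (src g);
  gid_continuous : continuous (gid G);
  rng_continuous : continuous (@rng _ G);
  src_continuous : continuous (@src _ G);
  ginv_continuous : continuous (@ginv _ G);
  gmul_continuous : {within [set p : G * G | src p.1 = rng p.2],
    continuous (fun p : G * G => gmul p.1 p.2)};
  rng_open : forall U : set G, open U -> open (@rng _ G @` U);
  src_open : forall U : set G, open U -> open (@src _ G @` U) }.

Record is_haar_system (G : groupoid_data R) : Prop := {
  haar_radon : forall x, radon (haar G x);
  haar_supp : forall x, msupport (haar G x) = [set g | rng g = x];
  haar_cont : forall f, Cc f -> Cc (fun x => haar G x f);
  haar_inv : forall (g : G) f, Cc f ->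
    haar G (rng g) f = cintegral (haar G (src g)) (fun g' => f (gmul g g')) }.

Record haarGroupoid := HaarGroupoid {
  hg_data :> groupoid_data R;
  hg_lch : is_lch_groupoid hg_data;
  hg_haar : is_haar_system hg_data }.

(* The left action is written lact g w, for src g = rho w; the right action is
   ract w h, for sigma w = rng h.
   equiv_rho_inj, equiv_rho_surj and equiv_rho_quot say that rho induces a
   homeomorphism from Omega/H, with the quotient topology, onto the units of
   G; likewise for sigma. *)
Record equivalence (G H : groupoid_data R) := Equivalence {
  eqv :> topologicalType;
  rho : eqv -> units G;
  sigma : eqv -> units H;
  lact : G -> eqv -> eqv;
  ract : eqv -> H -> eqv;
  equiv_hausdorff : hausdorff_space eqv;
  equiv_lc : locally_compact [set: eqv];
  rho_continuous : continuous rho;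
  sigma_continuous : continuous sigma;
  rho_lact : forall g w, src g = rho w -> rho (lact g w) = rng g;
  lact1 : forall w, lact (gid G (rho w)) w = w;
  lactA : forall g g' w, src g = rng g' -> src g' = rho w ->
    lact (gmul g g') w = lact g (lact g' w);
  lact_continuous : {within [set p : G * eqv | src p.1 = rho p.2],
    continuous (fun p : G * eqv => lact p.1 p.2)};
  sigma_ract : forall w h, sigma w = rng h -> sigma (ract w h) = src h;
  ract1 : forall w, ract w (gid H (sigma w)) = w;
  ractA : forall w h h', sigma w = rng h -> src h = rng h' ->
    ract w (gmul h h') = ract (ract w h) h';
  ract_continuous : {within [set p : eqv * H | sigma p.1 = rng p.2],
    continuous (fun p : eqv * H => ract p.1 p.2)};
  sigma_lact : forall g w, src g = rho w -> sigma (lact g w) = sigma w;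
  rho_ract : forall w h, sigma w = rng h -> rho (ract w h) = rho w;
  lractA : forall g w h, src g = rho w -> sigma w = rng h ->
    lact g (ract w h) = ract (lact g w) h;
  lact_free : forall g w, src g = rho w -> lact g w = w -> g = gid G (rho w);
  ract_free : forall w h, sigma w = rng h -> ract w h = w ->
    h = gid H (sigma w);
  lact_proper : forall K : set (eqv * eqv), compact K ->
    compact [set p : G * eqv | src p.1 = rho p.2 /\ K (lact p.1 p.2, p.2)];
  ract_proper : forall K : set (eqv * eqv), compact K ->
    compact [set p : eqv * H | sigma p.1 = rng p.2 /\ K (p.1, ract p.1 p.2)];
  equiv_rho_inj : forall w w', rho w = rho w' ->
    exists2 h, sigma w = rng h & ract w h = w';
  equiv_rho_surj : forall x, exists w, rho w = x;
  equiv_rho_quot : forall U : set (units G), open (rho @^-1` U) -> open U;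
  equiv_sigma_inj : forall w w', sigma w = sigma w' ->
    exists2 g, src g = rho w & lact g w = w';
  equiv_sigma_surj : forall y, exists w, sigma w = y;
  equiv_sigma_quot : forall U : set (units H),
    open (sigma @^-1` U) -> open U }.

End Groupoids.
Arguments haarGroupoid : clear implicits.

Section Linking.
Context {R : realType} {G H : groupoid_data R} (Om : equivalence G H).
Local Notation C := R[i].

(* inl (inl g), inl (inr w), inr (inl w) and inr (inr h) are the elements
   g of G, w of Omega, w^-1 of Omega^-1 and h of H. *)
Definition link : topologicalType := ((G + Om) + (Om + H))%type.
Definition link_units : topologicalType := (units G + units H)%type.

Definition link_id (x : link_units) : link :=
  match x with
  | inl x => inl (inl (gid G x))
  | inr y => inr (inr (gid H y))
  end.

Definition link_rng (a : link) : link_units :=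
  match a with
  | inl (inl g) => inl (rng g)
  | inl (inr w) => inl (rho w)
  | inr (inl w) => inr (sigma w)
  | inr (inr h) => inr (rng h)
  end.

Definition link_src (a : link) : link_units :=
  match a with
  | inl (inl g) => inl (src g)
  | inl (inr w) => inr (sigma w)
  | inr (inl w) => inl (rho w)
  | inr (inr h) => inr (src h)
  end.

Definition link_inv (a : link) : link :=
  match a with
  | inl (inl g) => inl (inl (ginv g))
  | inl (inr w) => inr (inl w)
  | inr (inl w) => inl (inr w)
  | inr (inr h) => inr (inr (ginv h))
  end.

(* w^-1 g = (g^-1 w)^-1 and h w^-1 = (w h^-1)^-1.  For non-composable pairs
   the value is irrelevant. *)
Definition link_mul (a b : link) : link :=
  match a, b with
  | inl (inl g), inl (inl g') => inl (inl (gmul g g'))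
  | inl (inl g), inl (inr w) => inl (inr (lact g w))
  | inl (inr w'), inr (inl w) =>
      xget a [set c | exists g, [/\ src g = rho w, lact g w = w' &
                                    c = inl (inl g)]]
  | inl (inr w), inr (inr h) => inl (inr (ract w h))
  | inr (inl w), inl (inl g) => inr (inl (lact (ginv g) w))
  | inr (inl w), inl (inr w') =>
      xget a [set c | exists h, [/\ sigma w = rng h, ract w h = w' &
                                    c = inr (inr h)]]
  | inr (inr h), inr (inl w) => inr (inl (ract w (ginv h)))
  | inr (inr h), inr (inr h') => inr (inr (gmul h h'))
  | _, _ => a
  end.

(* lambda_Omega^x and lambda_{Omega^-1}^y; they do not depend on the choice
   of w *)
Definition haar_eqv (x : units G) (phi : Om -> C) : C :=
  xget 0 [set c | exists2 w, rho w = x &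
    c = cintegral (haar H (sigma w)) (fun h => phi (ract w h))].

Definition haar_eqv_inv (y : units H) (phi : Om -> C) : C :=
  xget 0 [set c | exists2 w, sigma w = y &
    c = cintegral (haar G (rho w)) (fun g => phi (lact (ginv g) w))].

Definition link_haar (x : link_units) (phi : link -> C) : C :=
  match x with
  | inl x => haar G x (fun g => phi (inl (inl g)))
             + haar_eqv x (fun w => phi (inl (inr w)))
  | inr y => haar_eqv_inv y (fun w => phi (inr (inl w)))
             + haar H y (fun h => phi (inr (inr h)))
  end.

Definition linking : groupoid_data R :=
  GroupoidData link_id link_rng link_src link_mul link_inv link_haar.

Definition extG (f : G -> C) (a : linking) : C :=
  if a is inl (inl g) then f g else 0.
Definition extH (f : H -> C) (a : linking) : C :=
  if a is inr (inr h) then f h else 0.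

End Linking.

Record gBanachAlgebra_data (R : realType) (G : groupoid_data R) :=
  GBanachAlgebraData {
  fiber :> units G -> banachAlgType R[i];
  sections : set (forall x, fiber x);
  gact : forall g : G, fiber (src g) -> fiber (rng g) }.
Arguments sections {R G} B : rename.

Section GBanachAlgebras.
Context {R : realType} {G : groupoid_data R}.
Local Notation C := R[i].

(* Transport between the fibres over equal points; 0 if x != y. *)
Definition tr (B : gBanachAlgebra_data G) (x y : units G) (b : B x) : B y :=
  match pselect (x = y) with
  | left e => eq_rect x (fun z => B z) b y e
  | right _ => 0
  end.
Arguments tr {B x} y b.

(* The action of g as a map from the fibre over x to the fibre over y, for
   src g = x and rng g = y. *)
Definition act (B : gBanachAlgebra_data G) (g : G) (x y : units G)
  (b : B x) : B y := tr y (gact (tr (src g) b)).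
Arguments act {B} g {x} y b.

(* The fields of maps given by the product and by the action are locally
   bounded by ler_bnormM and gact_norm. *)
Record is_gBanachAlgebra (B : gBanachAlgebra_data G) : Prop := {
  gb_usc : usc_field (sections B);
  gb_mul : forall xi zeta, sections B xi -> sections B zeta ->
    sections B (fun x => bmul (xi x) (zeta x));
  gact_lin : forall g (k : C) (b b' : B (src g)),
    gact (k *: b + b') = k *: gact b + gact b';
  gact_norm : forall g (b : B (src g)), `|gact b| = `|b|;
  gact_surj : forall g (b : B (rng g)), exists b' : B (src g), gact b' = b;
  gact_sections : forall xi : forall g : G, B (src g),
    pullback_sections (@src _ G) (sections B) xi <->
    pullback_sections (@rng _ G) (sections B) (fun g => gact (xi g));
  gactM : forall g g' (b : B (src g')), src g = rng g' ->
    act (gmul g g') (rng g) b = act g (rng g) (act g' (src g) b);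
  gact_mul : forall g (b b' : B (src g)),
    gact (bmul b b') = bmul (gact b) (gact b') }.

Definition gb_nondegenerate (B : gBanachAlgebra_data G) : Prop :=
  forall x, dense_image (@bmul _ (B x)).

Definition conv (f1 f2 : G -> C) (g' : G) : C :=
  cintegral (haar G (rng g')) (fun g => f1 g * f2 (gmul (ginv g) g')).

Record unconditional_completion (A : banachAlgType C) (i : (G -> C) -> A) :
    Prop := {
  uc_lin : forall (k : C) f1 f2, Cc f1 -> Cc f2 ->
    i (fun g => k * f1 g + f2 g) = k *: i f1 + i f2;
  uc_inj : forall f1 f2, Cc f1 -> Cc f2 -> i f1 = i f2 -> f1 = f2;
  uc_conv : forall f1 f2, Cc f1 -> Cc f2 -> i (conv f1 f2) = bmul (i f1) (i f2);
  uc_dense : dense [set i f | f in @Cc R G];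
  uc_mono : forall f1 f2, Cc f1 -> Cc f2 ->
    (forall g, `|f1 g| <= `|f2 g|) -> `|i f1| <= `|i f2| }.

Definition L1norm (f : G -> C) : R :=
  sup [set complex.Re (haar G x (fun g => `|f g|)) | x in [set: units G]].

(* extension of a norm N on Cc G to bounded compactly supported
   nonnegative functions *)
Definition upper_norm (N : (G -> C) -> R) (phi : G -> C) : R :=
  inf [set N psi | psi in
        [set psi | Cc psi /\ forall g, phi g <= psi g]].

Context (B : gBanachAlgebra_data G).

Definition Gamma_c : set (forall g : G, B (rng g)) :=
  [set xi | pullback_sections (@rng _ G) (sections B) xi /\
            @compactly_supported G (fun g => B (rng g)) xi].

Definition bconv (xi zeta : forall g : G, B (rng g)) (g' : G) : B (rng g') :=
  integral (haar G (rng g')) (fun g : G =>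
    bmul (tr (rng g') (xi g)) (act g (rng g') (zeta (gmul (ginv g) g')))).

(* i : Gamma_c -> A exhibits A as the Hausdorff completion of Gamma_c for the
   seminorm induced by the norm N on Cc G, with the product extending the
   convolution. *)
Record coefficient_algebra (N : (G -> C) -> R) (A : banachAlgType C)
    (i : (forall g : G, B (rng g)) -> A) : Prop := {
  ca_lin : forall (k : C) xi zeta, Gamma_c xi -> Gamma_c zeta ->
    i (fun g => k *: xi g + zeta g) = k *: i xi + i zeta;
  ca_norm : forall xi, Gamma_c xi ->
    `|i xi| = (upper_norm N (fun g => `|xi g|))%:C;
  ca_dense : dense [set i xi | xi in Gamma_c];
  ca_conv : forall xi zeta, Gamma_c xi -> Gamma_c zeta ->
    i (bconv xi zeta) = bmul (i xi) (i zeta) }.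

End GBanachAlgebras.
Arguments tr {R G B x} y b.
Arguments act {R G B} g {x} y b.

Record gBanachAlgebra (R : realType) (G : groupoid_data R) := GBanachAlgebra {
  gb_data :> gBanachAlgebra_data G;
  gb_axioms : is_gBanachAlgebra gb_data }.

Section TransportTheory.
Context {R : realType} {G : groupoid_data R} (B : gBanachAlgebra_data G).
Local Notation C := R[i].

Lemma tr_id (x : units G) (b : B x) : tr x b = b.
Proof. by rewrite /tr; case: pselect => // e; rewrite (Prop_irrelevance e erefl). Qed.

Lemma trK (x y : units G) (b : B x) : x = y -> tr x (tr y b) = b.
Proof. by move=> e; subst; rewrite !tr_id. Qed.

Lemma tr_norm (x y : units G) (b : B x) : x = y -> `|tr y b| = `|b|.
Proof. by move=> e; subst; rewrite tr_id. Qed.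

Lemma tr_lin (x y : units G) (k : C) (b b' : B x) :
  tr y (k *: b + b') = k *: tr y b + tr y b'.
Proof.
have [e|ne] := pselect (x = y); first by subst; rewrite !tr_id.
by rewrite /tr; case: pselect => // _; rewrite scaler0 addr0.
Qed.

Lemma tr_mul (x y : units G) (b b' : B x) :
  tr y (bmul b b') = bmul (tr y b) (tr y b').
Proof.
have [e|ne] := pselect (x = y); first by subst; rewrite !tr_id.
rewrite /tr; case: pselect => // _.
by rewrite -[X in bmul X _](scale0r (0 : B y)) bscalerAl scale0r.
Qed.

Lemma tr_act (g : G) (x y z : units G) (b : B x) :
  rng g = y -> tr z (act g y b) = act g z b.
Proof. by move=> e; subst; rewrite /act tr_id. Qed.

Lemma act_tr (g : G) (x y z : units G) (b : B x) :
  src g = y -> x = y -> act g z (tr y b) = act g z b.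
Proof. by move=> e1 e2; subst; rewrite tr_id. Qed.

Hypothesis BP : is_gBanachAlgebra B.

Lemma act_comp (g g' : G) (x y z : units G) (b : B x) :
    src g' = x -> rng g' = y -> src g = y -> rng g = z ->
  act (gmul g g') z b = act g z (act g' y b).
Proof.
move=> e1 e2 e3 e4; subst x y z; by rewrite gactM// e3.
Qed.

Lemma act_lin (g : G) (x y : units G) (k : C) (b b' : B x) :
  act g y (k *: b + b') = k *: act g y b + act g y b'.
Proof. by rewrite /act tr_lin gact_lin// tr_lin. Qed.

Lemma act_mul (g : G) (x y : units G) (b b' : B x) :
  act g y (bmul b b') = bmul (act g y b) (act g y b').
Proof. by rewrite /act tr_mul gact_mul// tr_mul. Qed.

Lemma act_norm (g : G) (x y : units G) (b : B x) :
  src g = x -> rng g = y -> `|act g y b| = `|b|.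
Proof. by move=> e1 e2; subst; rewrite /act !tr_id gact_norm. Qed.

Lemma act0 (g : G) (x y : units G) : act g y (0 : B x) = 0.
Proof.
by have := act_lin g y (-1) (0 : B x) 0; rewrite scaler0 addr0 scaleN1r addNr.
Qed.

Lemma actD (g : G) (x y : units G) (b b' : B x) :
  act g y (b + b') = act g y b + act g y b'.
Proof. by rewrite -[b]scale1r act_lin !scale1r. Qed.

Lemma actZ (g : G) (x y : units G) (k : C) (b : B x) :
  act g y (k *: b) = k *: act g y b.
Proof. by rewrite -[k *: b]addr0 act_lin act0 addr0. Qed.

Hypothesis GP : is_lch_groupoid G.

Lemma act_id (x : units G) (b : B x) : act (gid G x) x b = b.
Proof.
have sx := src_id GP x; have rx := rng_id GP x.
have [b' <-] : exists b' : B x, act (gid G x) x b' = b.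
  have [b' b'E] := gact_surj BP (tr (rng (gid G x)) b).
  by exists (tr x b'); rewrite /act trK// b'E trK.
rewrite -(@act_comp _ _ _ x)//.
by have := gmul1l GP (gid G x); rewrite rx => ->.
Qed.

End TransportTheory.

Record ind_fiber (R : realType) (G H : haarGroupoid R) (Om : equivalence G H)
    (B : gBanachAlgebra G) (h : units H) := IndFiber {
  fam :> forall w : Om, sigma w = h -> B (rho w);
  fam_equiv : forall (g : G) (w : Om) (e : sigma w = h)
      (e' : sigma (lact g w) = h), src g = rho w ->
    fam e' = act g (rho (lact g w)) (fam e) }.

Section IndFiber.
Context {R : realType} {G H : haarGroupoid R} {Om : equivalence G H}
  {B : gBanachAlgebra G} {h : units H}.
Local Notation C := R[i].
Local Notation T := (ind_fiber Om B h).
Let BP := gb_axioms B.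
Let GP := hg_lch G.

HB.instance Definition _ := gen_eqMixin T.
HB.instance Definition _ := gen_choiceMixin T.

Lemma ind_fiber_ext (b b' : T) :
  (forall w (e : sigma w = h), b w e = b' w e) -> b = b'.
Proof.
case: b b' => [b bP] [b' b'P] /= bb'.
suff E : b = b' by subst; rewrite (Prop_irrelevance bP b'P).
by apply: functional_extensionality_dep => w;
  apply: functional_extensionality_dep => e; exact: bb'.
Qed.

Program Definition ind_zero : T := @IndFiber _ _ _ Om B h (fun w _ => 0) _.
Next Obligation. by move=> g w e e' gw /=; rewrite (act0 BP). Qed.

Program Definition ind_add (b b' : T) : T :=
  @IndFiber _ _ _ Om B h (fun w e => b w e + b' w e) _.
Next Obligation.
by move=> b b' g w e e' gw /=; rewrite (fam_equiv b e)// (fam_equiv b' e)// actD.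
Qed.

Program Definition ind_scale (k : C) (b : T) : T :=
  @IndFiber _ _ _ Om B h (fun w e => k *: b w e) _.
Next Obligation.
by move=> k b g w e e' gw /=; rewrite (fam_equiv b e)// actZ.
Qed.

Program Definition ind_opp (b : T) : T :=
  @IndFiber _ _ _ Om B h (fun w e => - b w e) _.
Next Obligation.
by move=> b g w e e' gw /=; rewrite (fam_equiv b e)// -scaleN1r -actZ// scaleN1r.
Qed.

Program Definition ind_bmul (b b' : T) : T :=
  @IndFiber _ _ _ Om B h (fun w e => bmul (b w e) (b' w e)) _.
Next Obligation.
by move=> b b' g w e e' gw /=; rewrite (fam_equiv b e)// (fam_equiv b' e)// act_mul.
Qed.

Let addA : associative ind_add.
Proof. by move=> a b c; apply: ind_fiber_ext => w e /=; rewrite addrA. Qed.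
Let addC : commutative ind_add.
Proof. by move=> a b; apply: ind_fiber_ext => w e /=; rewrite addrC. Qed.
Let add0 : left_id ind_zero ind_add.
Proof. by move=> a; apply: ind_fiber_ext => w e /=; rewrite add0r. Qed.
Let addN : left_inverse ind_zero ind_opp ind_add.
Proof. by move=> a; apply: ind_fiber_ext => w e /=; rewrite addNr. Qed.

HB.instance Definition _ := GRing.isZmodule.Build T addA addC add0 addN.

Let scaleA (k l : C) (b : T) :
  ind_scale k (ind_scale l b) = ind_scale (k * l) b.
Proof. by apply: ind_fiber_ext => w e /=; rewrite scalerA. Qed.
Let scale1 : left_id 1 ind_scale.
Proof. by move=> b; apply: ind_fiber_ext => w e /=; rewrite scale1r. Qed.
Let scaleDr : right_distributive ind_scale +%R.
Proof. by move=> k b b'; apply: ind_fiber_ext => w e /=; rewrite scalerDr. Qed.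
Let scaleDl (b : T) : {morph ind_scale^~ b : k l / k + l}.
Proof. by move=> k l; apply: ind_fiber_ext => w e /=; rewrite scalerDl. Qed.

HB.instance Definition _ :=
  GRing.Zmodule_isLmodule.Build C T scaleA scale1 scaleDr scaleDl.

(* The common norm is read off at an arbitrary point of the fibre of sigma,
   see ind_normE. *)
Let w0 : Om := sval (cid (equiv_sigma_surj Om h)).
Let w0P : sigma w0 = h := svalP (cid (equiv_sigma_surj Om h)).

Definition ind_norm (b : T) : C := `|b w0 w0P|.

Let fam_irr (b : T) w (e e' : sigma w = h) : b w e = b w e'.
Proof. by rewrite (Prop_irrelevance e e'). Qed.

Let fam_w0 (b : T) w (e : sigma w = h) : exists2 g,
  src g = rho w0 & lact g w0 = w /\ b w e = act g (rho w) (b w0 w0P).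
Proof.
have [g sg gw] : exists2 g : G, src g = rho w0 & lact g w0 = w.
  by apply: equiv_sigma_inj; rewrite w0P e.
exists g => //; split=> //; case: w / gw e => e; exact: fam_equiv.
Qed.

Let norm_fam (b : T) w (e : sigma w = h) : `|b w e| = ind_norm b.
Proof.
have [g sg [gw ->]] := fam_w0 b e.
by rewrite act_norm// -gw rho_lact.
Qed.

Let norm_triangle (b b' : T) : ind_norm (b + b') <= ind_norm b + ind_norm b'.
Proof. exact: ler_normD. Qed.
Let norm_scale (k : C) (b : T) : ind_norm (k *: b) = `|k| * ind_norm b.
Proof. exact: normrZ. Qed.
Let norm_eq0 (b : T) : ind_norm b = 0 -> b = 0.
Proof.
move=> b0; apply: ind_fiber_ext => w e /=.
by apply/eqP; rewrite -normr_eq0 norm_fam b0.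
Qed.

HB.instance Definition _ :=
  @Lmodule_isNormed.Build C T ind_norm norm_triangle norm_scale norm_eq0.

Lemma ind_normE (b : T) w (e : sigma w = h) : `|b| = `|b w e|.
Proof. by rewrite norm_fam. Qed.

Let lact_inj (g g' : G) (w : Om) : src g = rho w -> src g' = rho w ->
  lact g w = lact g' w -> g = g'.
Proof.
move=> sg sg' E.
have rg : rng g = rng g' by rewrite -(rho_lact sg) E (rho_lact sg').
have si : src (ginv g) = rng g' by rewrite (src_inv GP).
have s1 : src (gmul (ginv g) g') = rho w by rewrite (src_mul GP).
have /(lact_free s1) F : lact (gmul (ginv g) g') w = w.
  rewrite lactA// -E -lactA ?(src_inv GP)// (gmulVl GP) sg; exact: lact1.
have : gmul g (gmul (ginv g) g') = g by rewrite F -sg (gmul1r GP).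
by rewrite (gmulA GP) ?(rng_inv GP)// (gmulVr GP) rg (gmul1l GP).
Qed.

Let tau w (e : sigma w = h) : {g : G | src g = rho w0 /\ lact g w0 = w}.
Proof.
apply: cid.
have : sigma w0 = sigma w by rewrite w0P e.
by case/equiv_sigma_inj => g sg gw; exists g.
Qed.

Let extend (c : B (rho w0)) : exists b : T, b w0 w0P = c.
Proof.
have eqf (g : G) (w : Om) (e : sigma w = h) (e' : sigma (lact g w) = h) :
    src g = rho w -> act (sval (tau e')) (rho (lact g w)) c =
    act g (rho (lact g w)) (act (sval (tau e)) (rho w) c).
  move=> sg; case: (tau e) => k /= [sk kw]; case: (tau e') => l /= [sl lw].
  have rk : rng k = rho w by rewrite -kw rho_lact.
  rewrite -(act_comp BP)// ?rho_lact//.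
  suff -> : l = gmul g k by [].
  apply: (@lact_inj _ _ w0) => //; first by rewrite (src_mul GP) ?sg.
  by rewrite lw lactA ?sg// kw.
exists (IndFiber eqf) => /=; case: (tau w0P) => g /= [sg gw].
have -> : g = gid G (rho w0) by exact: lact_free.
exact: (act_id BP GP).
Qed.

Let complete (F : set_system T) : ProperFilter F -> cauchy F -> cvg F.
Proof.
move=> FF Fc; pose ev (b : T) : B (rho w0) := b w0 w0P.
have evB (b b' : T) : `|b - b'| = `|ev b - ev b'| by [].
have /cauchy_cvgP/cvg_ex[c evc] : cauchy (ev @ F).
  apply/(@cauchy_ballP C) => eps eps0.
  have /(@cauchy_ballP C)/(_ eps eps0) := Fc.
  rewrite !near_simpl => -[[P Q] [/= FP FQ] PQ].
  exists (ev @` P, ev @` Q) => /=.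
    by split; [apply: filterS FP|apply: filterS FQ] => x; exists x.
  move=> [_ _] [[x Px <-] [y Qy <-]].
  by have := PQ (x, y) (conj Px Qy); rewrite /= -!ball_normE /ball_ /= evB.
have [b bc] := extend c.
apply/cvg_ex; exists b; apply/cvgrPdist_lt => eps eps0.
move/cvgrPdist_lt : evc => /(_ eps eps0).
by apply: filterS => x /=; rewrite evB /ev bc.
Qed.

HB.instance Definition _ := Uniform_isComplete.Build T complete.

Let bmulA' : associative ind_bmul.
Proof. by move=> a b c; apply: ind_fiber_ext => w e /=; rewrite bmulA. Qed.
Let bmulDl' : left_distributive ind_bmul +%R.
Proof. by move=> a b c; apply: ind_fiber_ext => w e /=; rewrite bmulDl. Qed.
Let bmulDr' : right_distributive ind_bmul +%R.
Proof. by move=> a b c; apply: ind_fiber_ext => w e /=; rewrite bmulDr. Qed.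
Let bscalerAl' (k : C) (a b : T) : ind_bmul (k *: a) b = k *: ind_bmul a b.
Proof. by apply: ind_fiber_ext => w e /=; rewrite bscalerAl. Qed.
Let bscalerAr' (k : C) (a b : T) : ind_bmul a (k *: b) = k *: ind_bmul a b.
Proof. by apply: ind_fiber_ext => w e /=; rewrite bscalerAr. Qed.
Let ler_bnormM' (a b : T) : `|ind_bmul a b| <= `|a| * `|b|.
Proof. exact: ler_bnormM. Qed.

HB.instance Definition _ := isBanachAlgebra.Build C T
  bmulA' bmulDl' bmulDr' bscalerAl' bscalerAr' ler_bnormM'.

End IndFiber.

Section Induction.
Context {R : realType} {G H : haarGroupoid R} (Om : equivalence G H)
  (B : gBanachAlgebra G).
Local Notation ind_fiber h := (ind_fiber Om B h).

Definition ind_sections : set (forall h, ind_fiber h) :=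
  [set xi | exists delta : forall w : Om, B (rho w),
    [/\ pullback_sections (@rho _ _ _ Om) (sections B) delta,
        forall g w, src g = rho w ->
          delta (lact g w) = act g (rho (lact g w)) (delta w) &
        forall h w (e : sigma w = h), xi h w e = delta w]].

Program Definition ind_act (k : H) (b : ind_fiber (src k)) :
    ind_fiber (rng k) :=
  @IndFiber _ _ _ Om B (rng k)
    (fun w e => tr (rho w) (b (ract w k) (sigma_ract e))) _.
Next Obligation.
move=> k b g w e e' sg /=.
have E : ract (lact g w) k = lact g (ract w k) by rewrite lractA.
have sgw : src g = rho (ract w k) by rewrite rho_ract.
have e1 : sigma (lact g (ract w k)) = src k by rewrite -E sigma_ract.
transitivity (tr (rho (lact g w)) (b (lact g (ract w k)) e1)).
  move: (sigma_ract e'); rewrite E => e2; by rewrite (Prop_irrelevance e2 e1).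
rewrite (fam_equiv b (sigma_ract e))// tr_act ?rho_lact//.
by rewrite act_tr// rho_ract.
Qed.

Definition Ind : gBanachAlgebra_data H :=
  GBanachAlgebraData ind_sections ind_act.

End Induction.

Definition restricted_normG (R : realType) (G H : groupoid_data R)
    (Om : equivalence G H) (A : banachAlgType R[i])
    (i : (linking Om -> R[i]) -> A) (f : G -> R[i]) : R :=
  complex.Re `|i (extG f)|.

Definition restricted_normH (R : realType) (G H : groupoid_data R)
    (Om : equivalence G H) (A : banachAlgType R[i])
    (i : (linking Om -> R[i]) -> A) (f : H -> R[i]) : R :=
  complex.Re `|i (extH f)|.

(* Main.v *)
Require Import Defs.
From HB Require Import structures.
From mathcomp Require Import all_boot all_order all_algebra.
From mathcomp Require Import all_classical all_reals topology normedtype.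
From mathcomp Require Import complex ring lra.

(* The linking groupoid L is locally compact Hausdorff with a Haar system, and B and Ind B
   are the restrictions to G and H of a single L-Banach algebra BL, whose fibres are those of
   B and of Ind B.  According to whether the range and the source of an arrow lie in G^(0) or
   in H^(0), the compactly supported sections over L split into four corners.  For the norm
   of A(L) (or of L^1), the diagonal corners complete to A(G, B) and A(H, Ind B), the
   off-diagonal ones complete to the bimodules, and convolution over L provides all the
   products; its associativity is Fubini's theorem and the invariance of the Haar system.

   The products of sections of the corners ij and jk are dense in the corner ik: by
   non-degeneracy, a section is locally a sum of sections b b' theta, and b b' theta is
   close to a multiple of (f b) * ((kappa b'') * theta), where f and kappa are supported near an
   arrow w into the part j and near w^-1, and b'' is close to w^-1 b'. *)

Set Implicit Arguments.
Unset Strict Implicit.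
Unset Printing Implicit Defensive.
Import Order.TTheory GRing.Theory Num.Theory.
Import numFieldNormedType.Exports.
Local Open Scope classical_set_scope.
Local Open Scope ring_scope.
Local Open Scope complex_scope.

(** * Real-valued norms *)

(** The norm of a section of an upper semi-continuous field need not be continuous, so every
    estimate is one-sided: norms of sections are bounded above by test functions, and continuity of
    a selection means approximability by sections ([bcv]). Measures are linear forms on test
    functions, while the integrands that occur (translates, convolutions) are meaningful only on the
    support of the measure. The integral is therefore an approximation relation, [hint]; existence,
    Fubini's theorem and continuity in parameters all come from partitions of unity whose errors are
    multiples of one fixed test function. The given algebras are known only as completions, so the
    bimodules are built as abstract completions too, and every identity between the operations is
    extended from sections by density. Of the norm only the four properties in [conv_norm] are used;
    this treats $\mathcal A(\mathcal L)$ and $L^1$ at once, and $L^1(\mathcal L)$ never has to be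
    built as an algebra. That both corners are full rests on the surjectivity of [rho] and [sigma]:
    every unit of the linking groupoid is the range of arrows from both parts. *)

Section RealNorm.
Context {R : realType}.
Local Notation C := R[i].

(** The order of [R[i]] is only partial. Estimates are carried out with this real number, for which
    infima, case distinctions and linear arithmetic are available; [nrmE] and [nrm_le] translate. *)
Definition nrm (V : normedModType C) (v : V) : R := complex.Re `|v|.

Context {V : normedModType C}.
Implicit Types u v w : V.

Lemma nrmE v : `|v| = (nrm v)%:C.
Proof. by rewrite /nrm RRe_real// normr_real. Qed.

Lemma nrm_le v (c : R) : (`|v| <= c%:C) = (nrm v <= c).
Proof. by rewrite nrmE lecR. Qed.

Lemma nrm_lt v (c : R) : (`|v| < c%:C) = (nrm v < c).
Proof. by rewrite nrmE ltcR. Qed.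

Lemma nrm_ge0 v : 0 <= nrm v.
Proof. by rewrite -ler0c -nrmE. Qed.

Lemma nrm0 : nrm (0 : V) = 0.
Proof. by rewrite /nrm normr0. Qed.

Lemma nrm_eq0 v : nrm v <= 0 -> v = 0.
Proof.
move=> v0; apply/eqP; rewrite -normr_eq0 nrmE.
by have -> : nrm v = 0 by apply/eqP; rewrite eq_le v0 nrm_ge0.
Qed.

Lemma nrmB v w : nrm (v - w) = nrm (w - v).
Proof. by rewrite /nrm distrC. Qed.

Lemma nrmD v w : nrm (v + w) <= nrm v + nrm w.
Proof. by rewrite -nrm_le rmorphD/= -!nrmE ler_normD. Qed.

Lemma nrm_dist u v w : nrm (u - w) <= nrm (u - v) + nrm (v - w).
Proof. by have := nrmD (u - v) (v - w); rewrite addrA subrK. Qed.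

Lemma nrmZ (k : C) v : nrm (k *: v) = complex.Re `|k| * nrm v.
Proof.
apply: (@complexI R); rewrite rmorphM/= -!nrmE normrZ.
by rewrite (RRe_real (normr_real k)).
Qed.

Lemma nrmZr (k : R) v : nrm (k%:C *: v) = `|k| * nrm v.
Proof. by rewrite nrmZ normc_def/= expr0n/= addr0 sqrtr_sqr. Qed.

Lemma nrm_abs_dist v w : `|nrm v - nrm w| <= nrm (v - w).
Proof.
have a := nrm_dist v w 0; have b := nrm_dist w v 0.
rewrite !subr0 (nrmB w v) in a b.
by rewrite ler_norml; apply/andP; split; lra.
Qed.

Lemma nrm_sum (I : Type) (r : seq I) (P : pred I) (f : I -> V) :
  nrm (\sum_(i <- r | P i) f i) <= \sum_(i <- r | P i) nrm (f i).
Proof.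
elim/big_ind2 : _ => [|x y z t xy zt|//]; first by rewrite nrm0.
by apply: le_trans (nrmD _ _) _; exact: lerD.
Qed.

Lemma nrm_small v : (forall e : R, 0 < e -> nrm v <= e) -> v = 0.
Proof.
move=> ve; apply: nrm_eq0; apply/ler_addgt0Pr => e e0; rewrite add0r; exact: ve.
Qed.

Lemma gt0C (e : C) : 0 < e -> exists2 r : R, 0 < r & e = r%:C.
Proof.
move=> e0; exists (complex.Re e); last by rewrite RRe_real// gtr0_real.
by move: e0; rewrite ltcE/= => /andP[].
Qed.

Lemma cvgC (Z : Type) (F : set_system Z) (FF : Filter F) (f : Z -> V) (l : V) :
  f @ F --> l <-> forall e : R, 0 < e -> \forall z \near F, nrm (f z - l) < e.
Proof.
split.
  move=> /cvgrPdist_lt fl e e0.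
  have := fl e%:C; rewrite ltcR => /(_ e0).
  by apply: filterS => z; rewrite nrm_lt nrmB.
move=> fl; apply/cvgrPdist_lt => e /gt0C [r r0 ->].
by apply: filterS (fl r r0) => z; rewrite nrm_lt nrmB.
Qed.

Lemma dense_nrmP (A : set V) :
  dense A <-> forall v (e : R), 0 < e -> exists2 a, A a & nrm (v - a) < e.
Proof.
split=> [dA v e e0|h O [v Ov] oO].
  have e0' : 0 < e%:C by rewrite ltcR.
  have [|a [/interior_subset]] := dA (ball v e%:C)° _ (open_interior _).
    by exists v; exact: nbhsx_ballx.
  by rewrite -ball_normE /= nrm_lt => va Aa; exists a.
have /nbhs_ballP[_ /gt0C[e e0 ->] eO] : nbhs v O by exact: open_nbhs_nbhs.
have [a Aa va] := h v e e0; exists a; split => //.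
by apply: eO; rewrite -ball_normE /= nrm_lt.
Qed.

End RealNorm.

(** Besides separating points, this disposes of places where a composability condition fails: anchor
    values that differ at a point differ nearby, so a claim made under their equality is void
    there. *)
Lemma cvg_neq (Z : Type) (Y : topologicalType) (F : set_system Z) {FF : Filter F}
    (f g : Z -> Y) (a b : Y) : hausdorff_space Y -> f @ F --> a -> g @ F --> b ->
  a <> b -> \forall z \near F, f z <> g z.
Proof.
rewrite open_hausdorff => Yh fa gb /eqP/Yh[[U V] /= [aU bV] [oU oV /eqP UV0]].
have Ua : nbhs a U by apply: open_nbhs_nbhs; split => //; rewrite inE in aU.
have Vb : nbhs b V by apply: open_nbhs_nbhs; split => //; rewrite inE in bV.
have A : F (f @^-1` U) := fa _ Ua.
have B : F (g @^-1` V) := gb _ Vb.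
apply: filterS2 A B => z /= Uf Vg fg.
have : (U `&` V) (f z) by split => //=; rewrite fg.
by rewrite UV0.
Qed.

Section ComplexParts.
Context {R : realType}.
Local Notation C := R[i].

Lemma nrmCE (z : C) : nrm (z : C^o) = complex.Re `|z|.
Proof. by []. Qed.

Lemma nrm_real (r : R) : nrm (r%:C : C^o) = `|r|.
Proof. by rewrite nrmCE normc_def/= expr0n/= addr0 sqrtr_sqr. Qed.

Lemma Re_le_nrm (z : C) : `|complex.Re z| <= nrm (z : C^o).
Proof. by rewrite -lecR -nrmE; exact: normc_ge_Re. Qed.

Lemma Im_le_nrm (z : C) : `|complex.Im z| <= nrm (z : C^o).
Proof.
have -> : complex.Im z = complex.Re (- (z * 'i%C)).
  by case: z => a b /=; ring.
apply: le_trans (Re_le_nrm _) _.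
rewrite nrmCE normrN normrM.
suff -> : `|'i%C : C| = 1 by rewrite mulr1.
by rewrite normc_def/= expr0n expr1n/= add0r sqrtr1.
Qed.

Lemma nrm_le_ReIm (z : C) :
  nrm (z : C^o) <= `|complex.Re z| + `|complex.Im z|.
Proof.
have E : (z : C^o) = (complex.Re z)%:C *: (1 : C^o) + (complex.Im z)%:C *: ('i%C : C^o).
  rewrite {1}[z]complexE; congr (_ + _); first by rewrite [RHS]mulr1.
  by rewrite [RHS]mulrC.
rewrite {1}E; apply: le_trans (nrmD _ _) _.
rewrite !nrmZr; have -> : nrm (1 : C^o) = 1 by rewrite nrmCE normr1.
have -> : nrm ('i%C : C^o) = 1.
  by rewrite nrmCE normc_def/= expr0n expr1n/= add0r sqrtr1.
by rewrite !mulr1.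
Qed.

Lemma cvg_ReIm (Z : Type) (F : set_system Z) (FF : Filter F) (f : Z -> C) (l : C) :
  (f : Z -> C^o) @ F --> (l : C^o) <->
  (complex.Re (f z) @[z --> F] --> complex.Re l /\
   complex.Im (f z) @[z --> F] --> complex.Im l).
Proof.
have ReB (a b : C) : complex.Re (a - b) = complex.Re a - complex.Re b by case: a; case: b.
have ImB (a b : C) : complex.Im (a - b) = complex.Im a - complex.Im b by case: a; case: b.
split=> [/cvgC fl|[/cvgrPdist_lt fR /cvgrPdist_lt fI]].
  split; apply/cvgrPdist_lt => e e0; apply: filterS (fl e e0) => z fz;
    rewrite distrC.
    by rewrite -ReB; apply: le_lt_trans fz; exact: Re_le_nrm.
  by rewrite -ImB; apply: le_lt_trans fz; exact: Im_le_nrm.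
apply/cvgC => e e0; have e20 : 0 < e / 2 by rewrite divr_gt0.
near=> z; apply: le_lt_trans (nrm_le_ReIm _) _; rewrite ReB ImB.
rewrite [e]splitr; apply: ltrD; rewrite distrC.
  by near: z; exact: fR.
by near: z; exact: fI.
Unshelve. all: by end_near. Qed.

Lemma continuous_real_complex (X : topologicalType) (f : X -> R) :
  continuous f -> continuous ((fun x => (f x)%:C) : X -> C^o).
Proof. by move=> fc x; apply/cvg_ReIm; split => /=; [exact: fc|exact: cvg_cst]. Qed.

Let complex_complete (F : set_system C^o) : ProperFilter F -> cauchy F -> cvg F.
Proof.
move=> FF Fc.
have key (g : C -> R) : (forall a b, `|g a - g b| <= nrm (a - b : C^o)) ->
    exists l : R, g @ F --> l.
  move=> gl; apply/cvg_ex/cauchy_cvgP; apply/(@cauchy_ballP R) => e e0.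
  have e0' : 0 < e%:C by rewrite ltcR.
  have /(@cauchy_ballP C)/(_ _ e0') := Fc.
  rewrite !near_simpl => -[[P Q] [/= FP FQ] PQ].
  exists (g @` P, g @` Q) => /=.
    by split; [apply: filterS FP|apply: filterS FQ] => x; exists x.
  move=> [_ _] [[x Px <-] [y Qy <-]].
  have := PQ (x, y) (conj Px Qy); rewrite /= -!ball_normE /ball_ /= nrm_lt.
  exact: le_lt_trans.
have [] := key (@complex.Re R).
  by move=> a b; apply: le_trans (Re_le_nrm _); case: a; case: b.
move=> a Fa; have [] := key (@complex.Im R).
  by move=> x b; apply: le_trans (Im_le_nrm _); case: x; case: b.
move=> b Fb; apply/cvg_ex; exists (a +i* b).
by have /= := (@cvg_ReIm C F _ id (a +i* b)).2; apply.
Qed.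

(* C^o cannot carry this instance: the key GRing.regular is already used for
   the completeness of real fields. *)
Definition cscalar : Type := C^o.
HB.instance Definition _ := NormedModule.copy cscalar C^o.
HB.instance Definition _ := isPointed.Build cscalar (0 : C^o).
HB.instance Definition _ := Uniform_isComplete.Build cscalar complex_complete.

End ComplexParts.
Arguments cscalar R : clear implicits.

(** * Compactly supported functions *)

Section RealCc.
Context {R : realType}.
Local Notation C := R[i].

(** Bounds, partitions of unity and positivity concern real functions. Complex test functions are
    reduced to these by [Cc_Re], [Cc_Im] and [Cc_ReIm]. *)
Definition rCc (X : topologicalType) : set (X -> R) :=
  [set f | continuous f /\ exists2 K : set X, compact K & forall x, ~ K x -> f x = 0].

Section Any.
Context {X : topologicalType}.
Implicit Types f g : X -> R.

Lemma rCc0 : rCc (fun _ : X => 0 : R).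
Proof. by split; [move=> x; exact: cvg_cst|exists set0 => //; exact: compact0]. Qed.

Lemma rCcD f g : rCc f -> rCc g -> rCc (fun x => f x + g x).
Proof.
move=> [fc [K Kc fK]] [gc [L Lc gL]]; split.
  by move=> x; apply: cvgD; [exact: fc|exact: gc].
exists (K `|` L); first exact: compactU.
by move=> x /not_orP[/fK -> /gL ->]; rewrite addr0.
Qed.

Lemma rCcM f g : continuous f -> rCc g -> rCc (fun x => f x * g x).
Proof.
move=> fc [gc [L Lc gL]]; split.
  by move=> x; apply: cvgM; [exact: fc|exact: gc].
by exists L => // x /gL ->; rewrite mulr0.
Qed.

Lemma rCcZ k f : rCc f -> rCc (fun x => k * f x).
Proof. by apply: rCcM => x; exact: cvg_cst. Qed.

Lemma rCc_norm f : rCc f -> rCc (fun x => `|f x|).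
Proof.
move=> [fc [L Lc fL]]; split; first by move=> x; apply: cvg_norm; exact: fc.
by exists L => // x /fL ->; rewrite normr0.
Qed.

Lemma rCc_sum (I : Type) (r : seq I) (P : pred I) (f : I -> X -> R) :
  (forall i, rCc (f i)) -> rCc (fun x => \sum_(i <- r | P i) f i x).
Proof.
move=> fC; elim: r => [|i r IH].
  suff -> : (fun x => \sum_(i <- [::] | P i) f i x) = fun=> 0 by exact: rCc0.
  by apply/funext => x; rewrite big_nil.
have [Pi|nPi] := boolP (P i).
  suff -> : (fun x => \sum_(j <- i :: r | P j) f j x) =
     fun x => f i x + \sum_(j <- r | P j) f j x by exact: rCcD.
  by apply/funext => x; rewrite big_cons Pi.
suff -> : (fun x => \sum_(j <- i :: r | P j) f j x) =
     fun x => \sum_(j <- r | P j) f j x by [].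
by apply/funext => x; rewrite big_cons (negbTE nPi).
Qed.

Lemma Cc_real f : rCc f -> Cc (fun x => (f x)%:C).
Proof.
move=> [fc [K Kc fK]]; split; first exact: continuous_real_complex.
by exists K => // x /fK ->.
Qed.

Lemma Cc_Re (f : X -> C) : Cc f -> rCc (fun x => complex.Re (f x)).
Proof.
move=> [fc [K Kc fK]]; split; last by exists K => // x /fK ->.
by move=> x; have /cvg_ReIm[] := fc x.
Qed.

Lemma Cc_Im (f : X -> C) : Cc f -> rCc (fun x => complex.Im (f x)).
Proof.
move=> [fc [K Kc fK]]; split; last by exists K => // x /fK ->.
by move=> x; have /cvg_ReIm[] := fc x.
Qed.

Lemma Cc_ReIm (f : X -> C) : rCc (fun x => complex.Re (f x)) ->
  rCc (fun x => complex.Im (f x)) -> Cc f.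
Proof.
move=> [fc [K Kc fK]] [gc [L Lc gL]]; split.
  by move=> x; apply/cvg_ReIm; split; [exact: fc|exact: gc].
exists (K `|` L); first exact: compactU.
by move=> x /not_orP[/fK a /gL b]; rewrite [f x]complexE a b mulr0 addr0.
Qed.

Lemma Cc_nrm (f : X -> C) : Cc f -> rCc (fun x => nrm (f x : C^o)).
Proof.
move=> [fc [K Kc fK]]; split; last by exists K => // x /fK ->; rewrite nrm0.
move=> x; apply/cvgrPdist_lt => e e0.
have /cvgC/(_ e e0) := fc x; apply: filterS => y fy.
by rewrite distrC; apply: le_lt_trans fy; exact: nrm_abs_dist.
Qed.

Lemma rCc_bounded f : rCc f -> exists2 M, 0 < M & forall x, `|f x| <= M.
Proof.
move=> [fc [K Kc fK]].
have : compact (f @` K) by apply: continuous_compact => //; exact: continuous_subspaceT.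
move=> /compact_bounded[M [_ HM]].
exists (`|M| + 1); first by rewrite ltr_wpDl.
have M1 : M < `|M| + 1 by rewrite (le_lt_trans (ler_norm M))// ltrDl.
move=> x; have [Kx|/fK ->] := pselect (K x); first by apply: HM => //; exists x.
by rewrite normr0 addr_ge0.
Qed.

End Any.

(** Compactness in its near-covering form, for the filter of finite families in [K] directed by
    inclusion. The indices range over ['I_n], so that no default point is needed when [K] is
    empty. *)
Lemma finite_cover (X : topologicalType) (K : set X) (P : X -> set X) :
  compact K -> (forall x, K x -> nbhs x (P x)) ->
  exists n (c : 'I_n -> X), (forall i, K (c i)) /\
    forall y, K y -> exists i, P (c i) y.
Proof.
move=> /compact_near_coveringP Kc KP.
pose F : set_system (seq X) := [set A | exists2 s0 : seq X,
  (forall x, x \in s0 -> K x) &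
  forall s : seq X, (forall x, x \in s -> K x) -> {subset s0 <= s} -> A s].
have FF : Filter F.
  split; first by exists [::].
    move=> A B [s0 s0K As] [s1 s1K Bs]; exists (s0 ++ s1).
      by move=> x; rewrite mem_cat => /orP[/s0K|/s1K].
    move=> s sK ss; split; [apply: As|apply: Bs] => // x xs; apply: ss.
      by rewrite mem_cat xs.
    by rewrite mem_cat xs orbT.
  by move=> A B AB [s0 s0K As]; exists s0 => // s sK ss; apply: AB; exact: As.
have [|s sK sP] := Kc _ F (fun s y => exists2 x, x \in s & P x y) FF.
  move=> x Kx; exists (P x, [set s : seq X | x \in s]); first split => /=.
  - exact: KP.
  - exists [:: x]; first by move=> y; rewrite inE => /eqP ->.
    by move=> s sK; apply; rewrite inE.
  - by move=> [y s] /= [Py xs]; exists x.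
exists (size s), (tnth (in_tuple s)); split.
  by move=> i; apply: sK; exact: (mem_tnth i (in_tuple s)).
have /sP Ks : forall x, x \in s -> K x by [].
move=> y /(Ks (fun _ => id))[x xs Pxy].
have /tnthP[i xE] : x \in in_tuple s by [].
by exists i; rewrite -xE.
Qed.

Section LCH.
Context {X : topologicalType}.
Hypotheses (Xh : hausdorff_space X) (Xl : locally_compact [set: X]).

Lemma compact_nbhs (x : X) : exists2 K, compact K & nbhs x K.
Proof.
have [K] := Xl (Logic.I : [set: X] x); rewrite withinET => xK [cK _].
by exists K.
Qed.

(** Complete regularity gives [f] that vanishes at [x] and is 1 off the interior of [W] intersected
    with a compact neighbourhood. Truncating [2 * (1 - f)] at 1 makes the bump equal to 1 wherever
    [f < 1/2], hence on a whole neighbourhood of [x] and not just at [x]. *)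
Lemma bump (x : X) (W : set X) : nbhs x W ->
  exists u : X -> R, [/\ rCc u, forall y, 0 <= u y <= 1,
    \forall y \near x, u y = 1 & forall y, u y != 0 -> W y].
Proof.
move=> xW; have [K Kc xK] := compact_nbhs x.
have xWK : nbhs x (W `&` K) by exact: filterI.
have clB : closed (~` (W `&` K)°) by apply: open_closedC; exact: open_interior.
have nB : ~ (~` (W `&` K)°) x by move=> /(_ xWK).
have /(uniform_separatorP (R := R))[f [fc f01 f0 f1]] :=
  locally_compact_completely_regular (R := R) Xl Xh clB nB.
have fx : f x = 0 by apply: f0; exists x.
have uW y : Num.min 1 (2 * (1 - f y)) != 0 -> (W `&` K) y.
  move=> u0; apply: contrapT => WKy; move: u0.
  have -> : f y = 1.
    by apply: f1; exists y => // yy; apply: WKy; exact: interior_subset.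
  by rewrite subrr mulr0 /Num.min ltNge ler01/= eqxx.
exists (fun y => Num.min 1 (2 * (1 - f y))); split.
- split.
    move=> y; apply: (@continuous_min _ _ (fun=> 1) (fun y => 2 * (1 - f y))).
      exact: cvg_cst.
    apply: cvgM; first exact: cvg_cst.
    by apply: cvgB; [exact: cvg_cst|exact: fc].
  exists K => // y Ky; apply/eqP; apply: contrapT => /negP/uW[_ //].
- move=> y; have : range f (f y) by exists y.
  move=> /f01; rewrite /= in_itv/= => /andP[f0y fy1].
  rewrite ge_min lexx le_min ler01/= andbT.
  by rewrite mulr_ge0// subr_ge0.
- have /cvgrPdist_lt/(_ (1/2)) := fc x; rewrite fx.
  have h : (0 : R) < 1 / 2 by rewrite divr_gt0.
  move=> /(_ h); apply: filterS => y; rewrite sub0r normrN => /ltr_normlW fy.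
  apply/min_idPl; lra.
- by move=> y /uW[].
Qed.

(** The function [chi] is chosen before the cover [P] and dominates the sum of every partition
    obtained, so that an error [e * chi] has an integral that tends to 0 with [e], however fine the
    cover. It is a sum of bumps that is at least 1 on a neighbourhood [O] of [K], to which the
    partition functions are confined. Dividing by the maximum of the total [T] and 1, not by [T],
    keeps the quotients continuous where [T] vanishes. *)
Lemma partition (K : set X) : compact K ->
  exists chi : X -> R, [/\ rCc chi, forall x, 0 <= chi x &
  forall P : X -> set X, (forall x, K x -> nbhs x (P x)) ->
  exists n (p : 'I_n -> X -> R) (c : 'I_n -> X),
  [/\ forall i, rCc (p i) /\ K (c i), forall i x, 0 <= p i x,
      forall i x, p i x != 0 -> P (c i) x,
      forall x, K x -> \sum_i p i x = 1 &
      forall x, \sum_i p i x <= chi x]].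
Proof.
move=> Kc.
pose b (W : X -> set X) (h : forall x, nbhs x (W x)) x := cid (bump (h x)).
have [n [c [cK Kcov]]] : exists n (c : 'I_n -> X), (forall i, K (c i)) /\
    forall y, K y -> exists i,
     [set y | \forall z \near y, sval (b (fun=> setT) (fun x => filterT) (c i)) z = 1] y.
  apply: (finite_cover (P := fun x => [set y | \forall z \near y,
    sval (b (fun=> setT) (fun x => filterT) x) z = 1])) => // x Kx; rewrite /b.
  by case: cid => u /= [_ _ u1 _]; exact: nbhs_interior u1.
set u := fun i => sval (b (fun=> setT) (fun x => filterT) (c i)).
have uP i : [/\ rCc (u i), forall y, 0 <= u i y <= 1 & forall y, 0 <= u i y].
  rewrite /u /b; case: cid => w /= [w1 w2 _ _]; split => // y.
  by case/andP: (w2 y).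
pose chi x := \sum_i u i x.
have chi0 x : 0 <= chi x by apply: sumr_ge0 => i _; case: (uP i).
exists chi; split => //.
  by apply: rCc_sum => i; case: (uP i).
pose O : set X := [set y | 1 <= chi y].
have OK y : K y -> nbhs y O.
  move=> /Kcov[i /=]; apply: filterS => z uz; rewrite /O/= /chi (bigD1 i)//=.
  by rewrite -/(u i) in uz; rewrite uz lerDl sumr_ge0// => j _; case: (uP j).
move=> P KP.
(* Points off [K] get the whole space; the centres are picked in [K], so this default never
   matters. *)
pose Q x := if pselect (K x) then P x `&` O else setT.
have Qn x : nbhs x (Q x).
  rewrite /Q; case: pselect => // Kx; first by apply: filterI; [exact: KP|exact: OK].
  exact: filterT.
have [m [d [dK dcov]]] : exists n (c : 'I_n -> X), (forall i, K (c i)) /\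
    forall y, K y -> exists i, [set y | sval (b Q Qn (c i)) y = 1] y.
  apply: (finite_cover (P := fun x => [set y | sval (b Q Qn x) y = 1])) => //.
  move=> x Kx; rewrite /b; by case: cid => w /= [_ _ u1 _].
pose v i := sval (b Q Qn (d i)).
have vP i : [/\ rCc (v i), forall y, 0 <= v i y & forall y, v i y != 0 -> Q (d i) y].
  rewrite /v /b; case: cid => w /= [w1 w2 _ w4]; split => // y.
  by case/andP: (w2 y).
pose T x := \sum_i v i x.
have T0 x : 0 <= T x by apply: sumr_ge0 => i _; case: (vP i).
have M0 x : 0 < Num.max (T x) 1 by rewrite lt_max ltr01 orbT.
have TC : rCc T by apply: rCc_sum => i; case: (vP i).
have vO i y : v i y != 0 -> P (d i) y /\ O y.
  move=> vy; have [_ _ /(_ y vy)] := vP i; rewrite /Q.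
  by case: pselect => [_ //|nK]; have := nK (dK i).
exists m, (fun i x => (Num.max (T x) 1)^-1 * v i x), d; split.
- move=> i; split => //; apply: rCcM; last by case: (vP i).
  move=> x; apply: cvgV; first by rewrite gt_eqF.
  apply: (@continuous_max _ _ T (fun=> 1)); last exact: cvg_cst.
  by case: TC => Tc _; exact: Tc.
- by move=> i x; apply: mulr_ge0; [rewrite invr_ge0 ltW|case: (vP i)].
- by move=> i x; rewrite mulf_eq0 negb_or => /andP[_ /vO[]].
- move=> x Kx; rewrite -mulr_sumr -/(T x); have [i /= vi] := dcov _ Kx.
  rewrite -/(v i) in vi.
  have T1 : 1 <= T x.
    by rewrite /T (bigD1 i)//= vi lerDl sumr_ge0// => j _; case: (vP j).
  by rewrite (max_idPl T1) mulVf// gt_eqF// (lt_le_trans _ T1).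
- move=> x; rewrite -mulr_sumr -/(T x).
  have [[i vi]|nv] := pselect (exists i, v i x != 0).
    have [_ Ox] := vO _ _ vi; apply: le_trans Ox.
    by rewrite ler_pdivrMl// mulr1 le_max lexx.
  suff -> : T x = 0 by rewrite mulr0.
  apply: big1 => i _; apply/eqP; apply: contrapT => /negP vi; apply: nv.
  by exists i.
Qed.

(* Partitions of unity turn local approximants of F into a global one, with
   an error supported in a fixed compact set. *)
Lemma approx_by_partition (K : set X) : compact K ->
  exists chi : X -> R, [/\ rCc chi, forall x, 0 <= chi x &
  forall (E : X -> normedModType C) (D : set X) (F : forall x, E x)
    (S : set (forall x, E x)) (e : R), 0 <= e ->
  (forall x, D x -> ~ K x -> F x = 0) ->
  (forall x0, K x0 -> exists2 b, S b &
     \forall x \near x0, D x -> nrm (F x - b x) <= e) ->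
  exists n (p : 'I_n -> X -> R) (b : 'I_n -> forall x, E x),
  [/\ forall i, rCc (p i), forall i, S (b i) &
      forall x, D x -> nrm (F x - \sum_i (p i x)%:C *: b i x) <= e * chi x]].
Proof.
move=> /partition[chi [chiC chi0 part]]; exists chi; split => //.
move=> E D F S e e0 FK FS.
pose bb x := if pselect (K x) is left Kx then
  sval (cid2 (FS x Kx)) else (fun y => 0).
pose P x := [set y | D y -> nrm (F y - bb x y) <= e].
have [|n [p [c [pC p0 pP p1 pchi]]]] := part P.
  move=> x Kx; rewrite /P /bb; case: pselect => // Kx'.
  by case: cid2 => b.
exists n, p, (fun i => bb (c i)); split.
- by move=> i; case: (pC i).
- move=> i; case: (pC i) => _ Kc; rewrite /bb; case: pselect => // Kx'.
  by case: cid2.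
- move=> x Dx.
  have -> : F x = \sum_i (p i x)%:C *: F x.
    have [Kx|nKx] := pselect (K x); last by rewrite big1// FK// => i _; rewrite scaler0.
    by rewrite -scaler_suml -rmorph_sum/= p1// scale1r.
  rewrite -sumrB; apply: le_trans (nrm_sum _ _ _) _.
  apply: (@le_trans _ _ (\sum_i p i x * e)); last by rewrite -mulr_suml mulrC ler_wpM2l.
  apply: ler_sum => i _; rewrite -scalerBr nrmZr ger0_norm//.
  have [->|/pP/(_ Dx)] := eqVneq (p i x) 0; first by rewrite !mul0r.
  by move=> h; apply: ler_wpM2l.
Qed.

End LCH.
End RealCc.

(** * Integration *)

Section Complete.
Context {R : realType} {V : completeNormedModType R[i]}.

(** Read [P e v] as: [v] approximates the sought element up to [e]. The approximants with error at
    most [e] form a base of a Cauchy filter, whose limit obeys all the bounds. Integrals and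
    extensions of maps are obtained in this way without choosing sequences. *)
Lemma approx_complete (P : R -> set V) :
  (forall e, 0 < e -> exists v, P e v) ->
  (forall e e' v v', P e v -> P e' v' -> nrm (v - v') <= e + e') ->
  exists v, forall e v', P e v' -> nrm (v - v') <= e.
Proof.
move=> Pex Pd.
pose F := filter_from [set e : R | 0 < e]
  (fun e => [set v | exists2 e', 0 < e' <= e & P e' v]).
have FF : ProperFilter F.
  apply: filter_from_proper; last first.
    by move=> e e0; have [v Pv] := Pex _ e0; exists v; exists e => //; rewrite lexx andbT.
  apply: filter_from_filter; first by exists 1 => /=.
  move=> a b a0 b0; exists (Num.min a b); first by rewrite /= lt_min a0.
  move=> v [e' /andP[e0 el] Pv]; rewrite le_min in el; case/andP: el => ea eb.
  by split; exists e' => //; rewrite e0.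
have [v Fv] : exists v : V, F --> v.
  apply/cvg_ex/cauchy_cvgP; apply/(@cauchy_ballP R[i]) => _ /gt0C[e e0 ->].
  have e30 : 0 < e / 3 by rewrite divr_gt0.
  pose A : set V := [set v | exists2 e', 0 < e' <= e / 3 & P e' v].
  have FA : F A by exists (e / 3).
  exists (A, A) => // -[x y] [/= [a /andP[a0 ae] Pa] [b /andP[b0 be] Pb]].
  rewrite -ball_normE /= nrm_lt; apply: le_lt_trans (Pd _ _ _ _ Pa Pb) _; lra.
exists v => e v' Pv'; apply/ler_addgt0Pr => d d0.
have d20 : 0 < d / 2 by rewrite divr_gt0.
have := (@cvgC R V V F _ id v).1 Fv _ d20.
move=> [c /= c0 Fc].
have m0 : 0 < Num.min c (d / 2) by rewrite lt_min c0.
have [w Pw] := Pex _ m0.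
have ww := Pd _ _ _ _ Pw Pv'.
have vw : nrm (w - v) < d / 2.
  by apply: Fc; exists (Num.min c (d / 2)) => //; rewrite m0 ge_min lexx.
have h := nrm_dist v w v'; rewrite (nrmB v w) in h.
have mm : Num.min c (d / 2) <= d / 2 by rewrite ge_min lexx orbT.
by apply: le_trans h _; lra.
Qed.
End Complete.

(** * Vector-valued integration against a Radon measure *)

Section Radon.
Context {R : realType} {X : topologicalType}.
Local Notation C := R[i].
Variable mu : (X -> C) -> C.
Hypothesis muR : radon mu.
Implicit Types f g : X -> R.

Definition rint f : R := complex.Re (mu (fun x => (f x)%:C)).

Lemma mu_lin (k : C) (f g : X -> C) : Cc f -> Cc g ->
  mu (fun x => k * f x + g x) = k * mu f + mu g.
Proof. by move=> fC gC; rewrite (radon_lin muR). Qed.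

Let mu_pos f : rCc f -> (forall x, 0 <= f x) -> 0 <= mu (fun x => (f x)%:C).
Proof.
move=> fC f0; apply: (radon_pos muR); first exact: Cc_real.
by move=> x; rewrite ler0c.
Qed.

(** Since [f] is the difference of the nonnegative functions [|f|] and [|f| - f], on which a
    positive form takes nonnegative values, its integral is real. *)
Lemma mu_rint f : rCc f -> mu (fun x => (f x)%:C) = (rint f)%:C.
Proof.
move=> fC; have nC := rCc_norm fC.
have n2C : rCc (fun x => `|f x| - f x).
  have := rCcD nC (rCcZ (-1) fC); congr rCc; apply/funext => x; ring.
have a := mu_pos nC (fun x => normr_ge0 _).
have b : 0 <= mu (fun x => (`|f x| - f x)%:C).
  by apply: mu_pos => // x; rewrite subr_ge0 ler_norm.
have E : mu (fun x => (f x)%:C) = mu (fun x => (`|f x|)%:C) - mu (fun x => (`|f x| - f x)%:C).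
  rewrite addrC -mulN1r -mu_lin; try exact: Cc_real.
  by congr mu; apply/funext => x; rewrite rmorphB/=; ring.
rewrite /rint RRe_real// E rpredB//; exact: ger0_real.
Qed.

Lemma rint_lin (k : R) f g : rCc f -> rCc g ->
  rint (fun x => k * f x + g x) = k * rint f + rint g.
Proof.
move=> fC gC; apply: (@complexI R).
rewrite rmorphD rmorphM/= -!mu_rint//; last exact: rCcD (rCcZ _ _) _.
rewrite -mu_lin; [|exact: Cc_real|exact: Cc_real].
by congr mu; apply/funext => x; rewrite rmorphD rmorphM.
Qed.

Lemma rint0 : rint (fun=> 0) = 0.
Proof.
have := rint_lin (-1) (@rCc0 R X) (@rCc0 R X).
by under [X in rint X]eq_fun do rewrite mulr0 addr0; move=> ->; ring.
Qed.

Lemma rintZ k f : rCc f -> rint (fun x => k * f x) = k * rint f.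
Proof.
move=> fC; have := rint_lin k fC (@rCc0 R X); rewrite rint0 addr0 => <-.
by congr rint; apply/funext => x; rewrite addr0.
Qed.

Lemma rintD f g : rCc f -> rCc g -> rint (fun x => f x + g x) = rint f + rint g.
Proof.
move=> fC gC; have := rint_lin 1 fC gC; rewrite mul1r => <-.
by congr rint; apply/funext => x; rewrite mul1r.
Qed.

Lemma rint_ge0 f : rCc f -> (forall x, 0 <= f x) -> 0 <= rint f.
Proof. by move=> fC f0; rewrite -ler0c -mu_rint//; exact: mu_pos. Qed.

Lemma rint_le f g : rCc f -> rCc g -> (forall x, f x <= g x) -> rint f <= rint g.
Proof.
move=> fC gC fg; rewrite -subr_ge0 -mulN1r addrC -rint_lin//.
apply: rint_ge0; first exact: rCcD (rCcZ _ _) _.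
by move=> x; have := fg x; lra.
Qed.

Lemma rint_abs f g : rCc f -> rCc g -> (forall x, `|f x| <= g x) -> `|rint f| <= rint g.
Proof.
move=> fC gC fg; rewrite ler_norml; apply/andP; split.
  rewrite lerNl -mulN1r -rintZ//; apply: rint_le => //; first exact: rCcZ.
  by move=> x; have := fg x; rewrite ler_norml => /andP[]; lra.
by apply: rint_le => // x; apply: le_trans (fg x); exact: ler_norm.
Qed.

Lemma rint_sum (I : Type) (r : seq I) (P : pred I) (f : I -> X -> R) :
  (forall i, rCc (f i)) ->
  rint (fun x => \sum_(i <- r | P i) f i x) = \sum_(i <- r | P i) rint (f i).
Proof.
move=> fC; elim: r => [|i r IH].
  rewrite big_nil -[RHS]rint0.
  by congr rint; apply/funext => x; rewrite big_nil.
rewrite big_cons -IH; case: ifP => Pi; last first.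
  by congr rint; apply/funext => x; rewrite big_cons Pi.
rewrite -rintD//; last exact: rCc_sum.
by congr rint; apply/funext => x; rewrite big_cons Pi.
Qed.

Lemma mu_ReIm (f : X -> C) : Cc f ->
  mu f = (rint (fun x => complex.Re (f x)))%:C +
         'i%C * (rint (fun x => complex.Im (f x)))%:C.
Proof.
move=> fC; rewrite -!mu_rint; [|exact: Cc_Im|exact: Cc_Re].
rewrite addrC -mu_lin; [|by apply: Cc_real; exact: Cc_Im|
  by apply: Cc_real; exact: Cc_Re].
by congr mu; apply/funext => x; rewrite {1}[f x]complexE addrC.
Qed.

Lemma not_msupport x : ~ msupport mu x -> exists U, [/\ open U, U x &
  forall f, rCc f -> (forall y, ~ U y -> f y = 0) -> rint f = 0].
Proof.
move=> /existsNP[U /not_implyP[oU /not_implyP[Ux nU]]].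
exists U; split => // f fC fU; apply: contrapT => f0; apply: nU.
exists (fun x => (f x)%:C); split; first exact: Cc_real.
  by move=> y /fU ->.
by rewrite mu_rint//; apply/eqP => /(@complexI R).
Qed.

Lemma msupport_closed : closed (msupport mu).
Proof.
move=> x xs U Uo Ux.
have [y [ys Uy]] := xs U (open_nbhs_nbhs (conj Uo Ux)).
exact: ys.
Qed.

Hypotheses (Xh : hausdorff_space X) (Xl : locally_compact [set: X]).

Section OneSpace.
Context {V : normedModType C}.
Implicit Types (F : X -> V) (v : V).

(** The value [v] is a part of the relation, because a priori it depends on how [F] is written as a
    sum; independence is a consequence of [simple_le]. *)
Definition simple F v := exists n (phi : 'I_n -> X -> R) (e : 'I_n -> V),
  [/\ forall i, rCc (phi i), F = (fun x => \sum_i (phi i x)%:C *: e i) &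
      v = \sum_i (rint (phi i))%:C *: e i].

Lemma simple1 f (v : V) : rCc f ->
  simple (fun x => (f x)%:C *: v) ((rint f)%:C *: v).
Proof.
move=> fC; exists 1%N, (fun=> f), (fun=> v); split => //.
  by apply/funext => x; rewrite big_ord1.
by rewrite big_ord1.
Qed.

Lemma simple0 : simple (fun=> 0) 0.
Proof.
exists 0%N, (fun=> fun=> 0), (fun=> 0); split; first by case.
  by apply/funext => x; rewrite big_ord0.
by rewrite big_ord0.
Qed.

Lemma simpleD (k : C) F v F' v' : simple F v -> simple F' v' ->
  simple (fun x => k *: F x + F' x) (k *: v + v').
Proof.
move=> [n [p [e [pC -> ->]]]] [m [q [d [qC -> ->]]]].
have sl (i : 'I_n) : fintype.split (lshift m i) = inl i := unsplitK (inl i).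
have sr (i : 'I_m) : fintype.split (rshift n i) = inr i := unsplitK (inr i).
exists (n + m)%N,
  (fun i : 'I_(n + m) => match fintype.split i with inl i => p i | inr j => q j end),
  (fun i : 'I_(n + m) => match fintype.split i with inl i => k *: e i | inr j => d j end).
split.
- by move=> i; case: fintype.split.
- apply/funext => x; rewrite big_split_ord/= scaler_sumr; congr (_ + _).
    by apply: eq_bigr => i _; rewrite sl !scalerA mulrC.
  by apply: eq_bigr => i _; rewrite sr.
- rewrite big_split_ord/= scaler_sumr; congr (_ + _).
    by apply: eq_bigr => i _; rewrite sl !scalerA mulrC.
  by apply: eq_bigr => i _; rewrite sr.
Qed.

Lemma simple_sum n (F : 'I_n -> X -> V) (v : 'I_n -> V) :
  (forall i, simple (F i) (v i)) -> simple (fun x => \sum_i F i x) (\sum_i v i).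
Proof.
elim: n F v => [|n IH] F v Fv.
  rewrite big_ord0; have := simple0; congr simple.
  by apply/funext => x; rewrite big_ord0.
rewrite big_ord_recl -[v ord0]scale1r.
have := simpleD 1 (Fv ord0) (IH _ _ (fun i => Fv (lift ord0 i))); congr simple.
by apply/funext => x; rewrite big_ord_recl scale1r.
Qed.

(* A partition of unity subordinate to the oscillations of F and psi reduces
   this to sums over sample points of the support. *)
Lemma simple_le F v psi : simple F v -> rCc psi ->
  (forall x, msupport mu x -> nrm (F x) <= psi x) -> nrm v <= rint psi.
Proof.
move=> [n [phi [e [phiC -> ->]]]] psiC le.
have [K Kc Kout] : exists2 K, compact K &
    forall x, ~ K x -> psi x = 0 /\ forall i, phi i x = 0.
  have [_ [K Kc K0]] : rCc (fun x => `|psi x| + \sum_i `|phi i x|).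
    by apply: rCcD; [exact: rCc_norm|apply: rCc_sum => i; exact: rCc_norm].
  exists K => // x /K0/eqP; rewrite paddr_eq0//; last exact: sumr_ge0.
  rewrite normr_eq0 psumr_eq0// => /andP[/eqP -> /allP s0]; split=> // i.
  by have := s0 i; rewrite mem_index_enum normr_eq0 => /(_ isT)/eqP.
have [chi [chiC chi0 part]] := partition (R := R) Xh Xl Kc.
pose M := \sum_i nrm (e i).
have M0 : 0 <= M by apply: sumr_ge0 => i _; exact: nrm_ge0.
have D0 : 0 <= rint chi by exact: rint_ge0.
suff key d : 0 < d -> nrm (\sum_i (rint (phi i))%:C *: e i) <= rint psi + d * ((M + 1) * rint chi).
  apply/ler_addgt0Pr => eps eps0.
  have c0 : 0 < (M + 1) * rint chi + 1 by rewrite ltr_wpDl// mulr_ge0// addr_ge0.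
  apply: le_trans (key (eps / ((M + 1) * rint chi + 1)) _) _.
    by rewrite divr_gt0.
  rewrite lerD2l mulrAC ler_pdivrMr// ler_pM2l//; lra.
move=> d0.
(* At a point of the support, the set where all functions oscillate by at most [d]. At any other
   point, an open set on which the form vanishes: the corresponding [p k] then has integral 0, which
   matters because the bound [le] says nothing about such a sample point. *)
pose P x : set X := match pselect (msupport mu x) with
  | left _ => [set y | (forall i, `|phi i y - phi i x| <= d) /\
                       `|psi y - psi x| <= d]
  | right h => sval (cid (not_msupport h)) end.
have near1 (f : X -> R) x : rCc f -> \forall y \near x, `|f y - f x| <= d.
  move=> [fc _]; have /cvgrPdist_le/(_ _ d0) := fc x.
  by apply: filterS => y; rewrite distrC.
have [|m [p [c [pC p0 pP p1 pchi]]]] := part P.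
  move=> x Kx; rewrite /P; case: pselect => [sx|nsx]; last first.
    by case: cid => U /= [oU Ux _]; exact: open_nbhs_nbhs.
  apply: filterI; last exact: near1.
  by apply: filter_forall => i; exact: near1.
have pCC k : rCc (p k) by case: (pC k).
pose A k := rint (p k).
have A0 k : 0 <= A k by exact: rint_ge0.
have pfC (f : X -> R) k : rCc f -> rCc (fun x => p k x * f x).
  by move=> fC; apply: rCcM => //; case: (pCC k).
have dec (f : X -> R) : rCc f -> (forall x, ~ K x -> f x = 0) ->
    rint f = \sum_k rint (fun x => p k x * f x).
  move=> fC fK; rewrite -rint_sum; last by move=> k; exact: pfC.
  congr rint; apply/funext => x; rewrite -mulr_suml.
  by have [Kx|/fK ->] := pselect (K x); [rewrite p1// mul1r|rewrite mulr0].
have osc (f : X -> R) k : rCc f ->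
    (forall y, P (c k) y -> msupport mu (c k) -> `|f y - f (c k)| <= d) ->
    `|rint (fun x => p k x * f x) - f (c k) * A k| <= d * A k.
  move=> fC fP; have [sk|nsk] := pselect (msupport mu (c k)).
    have E : rint (fun x => p k x * f x) - f (c k) * A k =
        rint (fun x => - f (c k) * p k x + p k x * f x).
      by rewrite rint_lin//; [rewrite /A; ring|exact: pfC].
    rewrite E -rintZ//; apply: rint_abs.
    - by apply: rCcD; [exact: rCcZ|exact: pfC].
    - exact: rCcZ.
    - move=> x; have -> : - f (c k) * p k x + p k x * f x =
        p k x * (f x - f (c k)) by ring.
      rewrite normrM ger0_norm// mulrC.
      have [->|/pP Px] := eqVneq (p k x) 0; first by rewrite !mulr0.
      by apply: ler_wpM2r => //; exact: fP.
  have pU x : p k x != 0 -> sval (cid (not_msupport nsk)) x.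
    move/pP; rewrite /P; case: pselect => [//|h].
    by rewrite (Prop_irrelevance h nsk).
  move: pU; case: cid => U /= [_ _ U0] pU.
  have pU0 y : ~ U y -> p k y = 0.
    by move=> Uy; apply/eqP; apply: contrapT => /negP/pU.
  rewrite /A (U0 (p k))// (U0 (fun x => p k x * f x)); [|exact: pfC|].
    by rewrite !mulr0 subrr normr0.
  by move=> y /pU0 ->; rewrite mul0r.
have oscphi i k : `|rint (fun x => p k x * phi i x) - phi i (c k) * A k| <= d * A k.
  apply: osc => // y; rewrite /P; case: pselect => // sk [h _] _; exact: h.
have oscpsi k : `|rint (fun x => p k x * psi x) - psi (c k) * A k| <= d * A k.
  by apply: osc => // y; rewrite /P; case: pselect => // sk [_ h] _.
have leA k : A k * nrm (\sum_i (phi i (c k))%:C *: e i) <= psi (c k) * A k.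
  have [sk|nsk] := pselect (msupport mu (c k)).
    by rewrite mulrC; apply: ler_wpM2r => //; exact: le.
  suff -> : A k = 0 by rewrite mul0r mulr0.
  have pU x : p k x != 0 -> sval (cid (not_msupport nsk)) x.
    move/pP; rewrite /P; case: pselect => [//|h].
    by rewrite (Prop_irrelevance h nsk).
  move: pU; case: cid => U /= [_ _ U0] pU; apply: U0 => // y Uy.
  by apply/eqP; apply: contrapT => /negP/pU.
(* Each integral is split along the partition into its sample terms [phi i (c k) * A k], to which
   [le] applies at the point [c k], and oscillation errors bounded by [d * A k]. *)
have -> : \sum_i (rint (phi i))%:C *: e i =
    \sum_k (\sum_i (rint (fun x => p k x * phi i x) - phi i (c k) * A k)%:C *: e i
       + (A k)%:C *: \sum_i (phi i (c k))%:C *: e i).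
  under [RHS]eq_bigr => k _ do rewrite scaler_sumr -big_split/=.
  rewrite exchange_big/=; apply: eq_bigr => i _.
  rewrite dec//; last by move=> x /Kout[].
  rewrite rmorph_sum/= scaler_suml; apply: eq_bigr => k _.
  by rewrite scalerA -scalerDl -rmorphM -rmorphD/=; congr (_%:C *: _); ring.
apply: le_trans (nrm_sum _ _ _) _.
apply: (@le_trans _ _ (\sum_k (rint (fun x => p k x * psi x) + d * (M + 1) * A k))).
  apply: ler_sum => k _; apply: le_trans (nrmD _ _) _.
  rewrite nrmZr ger0_norm//.
  have h1 : nrm (\sum_i (rint (fun x => p k x * phi i x) - phi i (c k) * A k)%:C *: e i)
     <= d * M * A k.
    apply: le_trans (nrm_sum _ _ _) _.
    rewrite mulrAC /M mulr_sumr; apply: ler_sum => i _.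
    by rewrite nrmZr; apply: ler_wpM2r; [exact: nrm_ge0|exact: oscphi].
  have := oscpsi k; rewrite ler_norml => /andP[h2 h3].
  by have := leA k; nra.
rewrite big_split/= -dec//; last by move=> x /Kout[].
rewrite lerD2l -mulr_sumr -mulrA; apply: ler_wpM2l; first exact: ltW.
apply: ler_wpM2l; first by rewrite addr_ge0.
by rewrite -rint_sum//; apply: rint_le => //; exact: rCc_sum.
Qed.

(* has_integral with real-valued scalar functions and bounds, see has_integralP *)
Definition hint F v := forall eps : R, 0 < eps ->
  exists Fs vs psi, [/\ simple Fs vs, rCc psi,
    forall x, msupport mu x -> nrm (F x - Fs x) <= psi x,
    rint psi <= eps & nrm (v - vs) <= eps].

Lemma hint_simple F v : simple F v -> hint F v.
Proof.
move=> Fv eps eps0; exists F, v, (fun=> 0); split => //.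
- exact: rCc0.
- by move=> x _; rewrite subrr nrm0.
- by rewrite rint0 ltW.
- by rewrite subrr nrm0 ltW.
Qed.

Lemma hint0 : hint (fun=> 0) 0.
Proof. exact: hint_simple simple0. Qed.

Lemma hint_dist F v F' v' th : hint F v -> hint F' v' -> rCc th ->
  (forall x, msupport mu x -> nrm (F x - F' x) <= th x) -> nrm (v - v') <= rint th.
Proof.
move=> Fv Fv' thC le; apply/ler_addgt0Pr => eps eps0.
(* Four errors: the integrals of the two bounding functions and the distances of the two values. In
   between, [simple_le] is applied to the difference of the approximants. *)
have e40 : 0 < eps / 4 by rewrite divr_gt0.
have [S [s [p [Ss pC Sp p4 s4]]]] := Fv _ e40.
have [S' [s' [p' [Ss' pC' Sp' p4' s4']]]] := Fv' _ e40.
have := simple_le (simpleD (-1) Ss' Ss) (rCcD thC (rCcD pC pC')).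
rewrite !rintD//; last exact: rCcD.
rewrite scaleN1r (addrC (- s')) => h.
have {}h : nrm (s - s') <= rint th + (rint p + rint p').
  apply: h => x sx; rewrite scaleN1r (addrC (- S' x)).
  have := nrm_dist (S x) (F x) (S' x); have := nrm_dist (F x) (F' x) (S' x).
  rewrite (nrmB (S x) (F x)); have := Sp x sx; have := Sp' x sx; have := le x sx; lra.
have := nrm_dist v s v'; have := nrm_dist s s' v'; rewrite (nrmB s' v'); lra.
Qed.

Lemma hint_uniq F v F' v' : hint F v -> hint F' v' ->
  (forall x, msupport mu x -> F x = F' x) -> v = v'.
Proof.
move=> Fv Fv' FF; apply/eqP; rewrite -subr_eq0; apply/eqP/nrm_eq0.
rewrite -rint0; apply: hint_dist Fv Fv' _ _; first exact: rCc0.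
by move=> x /FF ->; rewrite subrr nrm0.
Qed.

Lemma hint_ext F F' v : (forall x, msupport mu x -> F x = F' x) ->
  hint F v -> hint F' v.
Proof.
move=> FF Fv eps eps0; have [S [s [p [Ss pC Sp p4 s4]]]] := Fv _ eps0.
by exists S, s, p; split => // x sx; rewrite -FF//; exact: Sp.
Qed.

Lemma hintD k F v F' v' : hint F v -> hint F' v' ->
  hint (fun x => k *: F x + F' x) (k *: v + v').
Proof.
move=> Fv Fv' eps eps0; pose M := complex.Re `|k| + 1.
have k0 : 0 <= complex.Re `|k| by have := nrm_ge0 (k : C^o).
have M0 : 0 < M by rewrite /M; lra.
have e40 : 0 < eps / 2 / M by rewrite !divr_gt0.
have e20 : 0 < eps / 2 by rewrite divr_gt0.
have [S [s [p [Ss pC Sp p4 s4]]]] := Fv _ e40.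
have [S' [s' [p' [Ss' pC' Sp' p4' s4']]]] := Fv' _ e20.
have kM (a : R) : a <= eps / 2 / M -> complex.Re `|k| * a <= eps / 2.
  move=> h; apply: (@le_trans _ _ (complex.Re `|k| * (eps / 2 / M))).
    exact: ler_wpM2l.
  rewrite mulrCA ger_pMr// ler_pdivrMr// mul1r /M; lra.
exists (fun x => k *: S x + S' x), (k *: s + s'),
  (fun x => complex.Re `|k| * p x + p' x); split.
- exact: simpleD.
- exact: rCcD (rCcZ _ _) _.
- move=> x sx; rewrite opprD addrACA -scalerBr.
  apply: le_trans (nrmD _ _) _; apply: lerD; last exact: Sp'.
  by rewrite nrmZ; apply: ler_wpM2l => //; exact: Sp.
- by rewrite rint_lin// [eps]splitr; exact: lerD (kM _ p4) p4'.
- rewrite opprD addrACA -scalerBr; apply: le_trans (nrmD _ _) _.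
  by rewrite nrmZ [eps]splitr; exact: lerD (kM _ s4) s4'.
Qed.

Lemma hintZ k F v : hint F v -> hint (fun x => k *: F x) (k *: v).
Proof.
move=> Fv; have := hintD k Fv hint0; rewrite addr0; congr hint.
by apply/funext => x; rewrite addr0.
Qed.

Lemma hint_sum n (F : 'I_n -> X -> V) (v : 'I_n -> V) :
  (forall i, hint (F i) (v i)) -> hint (fun x => \sum_i F i x) (\sum_i v i).
Proof.
elim: n F v => [|n IH] F v Fv.
  rewrite big_ord0; have := hint0; congr hint.
  by apply/funext => x; rewrite big_ord0.
rewrite big_ord_recl -[v ord0]scale1r.
have := hintD 1 (Fv ord0) (IH _ _ (fun i => Fv (lift ord0 i))); congr hint.
by apply/funext => x; rewrite big_ord_recl scale1r.
Qed.

Lemma has_integralP F v : has_integral mu F v <-> hint F v.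
Proof.
split=> [H eps eps0|H _ /gt0C[eps eps0 ->]].
  have := H eps%:C; rewrite ltcR => /(_ eps0).
  move=> [n [phi [e [psi [phiC psiC le psi_eps v_eps]]]]].
  pose S x := \sum_i phi i x *: e i; pose s := \sum_i mu (phi i) *: e i.
  exists S, s, (fun x => complex.Re (psi x)); split.
  - rewrite /S /s.
    suff h i : simple (fun x => phi i x *: e i) (mu (phi i) *: e i).
      exact: simple_sum.
    (* In [simple] the coefficients are real: a complex coefficient contributes its real part times
       [e i] and its imaginary part times ['i *: e i]. *)
    have := simpleD 1 (simple1 (e i) (Cc_Re (phiC i)))
      (simple1 ('i%C *: e i) (Cc_Im (phiC i))).
    congr simple.
      apply/funext => x; rewrite scale1r scalerA -scalerDl [in RHS](complexE (phi i x)).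
      by rewrite [_ * 'i%C]mulrC.
    by rewrite scale1r scalerA -scalerDl mu_ReIm// [_ * 'i%C]mulrC.
  - exact: Cc_Re.
  - move=> x sx; have := le x sx; rewrite /S nrmE.
    by rewrite lecE/= => /andP[].
  - move: psi_eps; rewrite mu_ReIm// lecE/= => /andP[_].
    by rewrite !mul0r !mul1r !subr0 !addr0.
  - by rewrite -nrm_le.
have [S [s [p [[n [phi [e [phiC SE sE]]]] pC Sp p4 s4]]]] := H _ eps0.
exists n, (fun i x => (phi i x)%:C), e, (fun x => (p x)%:C); split.
- by move=> i; exact: Cc_real.
- exact: Cc_real.
- by move=> x sx; rewrite nrm_le; have := Sp x sx; rewrite SE.
- by rewrite mu_rint// lecR.
- rewrite nrm_le; move: s4; rewrite sE; congr (nrm (_ - _) <= _).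
  by apply: eq_bigr => i _; rewrite mu_rint.
Qed.

Lemma integralE F v : hint F v -> integral mu F = v.
Proof.
move=> Fv; rewrite /integral.
have /has_integralP h : has_integral mu F (xget 0 (has_integral mu F)).
  by apply: xgetPex; exists v; apply/has_integralP.
exact: hint_uniq h Fv _.
Qed.

End OneSpace.

(** Only real linearity of [T] is required, so that taking real parts of scalar integrals is covered
    along with the action of an arrow, multiplication by a fixed element and the scaling of a fixed
    vector. *)
Lemma hint_map (V W : normedModType C) (T : V -> W) (M : R) (F : X -> V) v :
  (forall (k : R) a b, T (k%:C *: a + b) = k%:C *: T a + T b) -> 0 <= M ->
  (forall a, nrm (T a) <= M * nrm a) ->
  hint F v -> hint (fun x => T (F x)) (T v).
Proof.
move=> Tl M0 TM Fv eps eps0.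
have T0 : T 0 = 0.
  have := Tl (-1) 0 0; rewrite scaler0 addr0 => h.
  by rewrite h rmorphN1 scaleN1r addNr.
have Tlin n (c : 'I_n -> R) (e : 'I_n -> V) :
    T (\sum_i (c i)%:C *: e i) = \sum_i (c i)%:C *: T (e i).
  elim: n c e => [|n IH] c e; first by rewrite !big_ord0.
  by rewrite !big_ord_recl Tl IH.
have TB a b : T (a - b) = T a - T b.
  by have := Tl (-1) b a; rewrite rmorphN1 !scaleN1r addrC => ->; rewrite addrC.
have M10 : 0 < M + 1 by lra.
have e10 : 0 < eps / (M + 1) by rewrite divr_gt0.
have kM (a : R) : a <= eps / (M + 1) -> M * a <= eps.
  move=> h; apply: (@le_trans _ _ (M * (eps / (M + 1)))); first exact: ler_wpM2l.
  rewrite mulrCA ger_pMr// ler_pdivrMr// mul1r; lra.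
have [S [s [p [[n [phi [e [phiC SE sE]]]] pC Sp p4 s4]]]] := Fv _ e10.
exists (fun x => T (S x)), (T s), (fun x => M * p x); split.
- by exists n, phi, (fun i => T (e i)); split => //; [
    apply/funext => x; rewrite SE|rewrite sE].
- exact: rCcZ.
- by move=> x sx; rewrite -TB; apply: le_trans (TM _) _; apply: ler_wpM2l => //; exact: Sp.
- by rewrite rintZ//; exact: kM.
- by rewrite -TB; apply: le_trans (TM _) _; exact: kM.
Qed.

Lemma hint_Cc (f : X -> C) : Cc f -> hint (f : X -> C^o) (mu f).
Proof.
move=> fC; apply: hint_simple; have := simpleD 1 (simple1 (1 : C^o) (Cc_Re fC))
      (simple1 ('i%C : C^o) (Cc_Im fC)).
congr simple.
  apply/funext => x; rewrite [RHS]complexE scale1r; congr (_ + _).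
    by rewrite [LHS]mulr1.
  by rewrite [LHS]mulrC.
by rewrite scale1r mu_ReIm//; congr (_ + _); [rewrite [LHS]mulr1|rewrite [LHS]mulrC].
Qed.

(** On the support [f] agrees with [|f|]; by [simple_le] with the bound 0 the two integrals agree,
    and the second is nonnegative. *)
Lemma rint_supp_ge0 f : rCc f -> (forall x, msupport mu x -> 0 <= f x) ->
  0 <= rint f.
Proof.
move=> fC f0; have nC := rCc_norm fC.
suff -> : rint f = rint (fun x => `|f x|) by exact: rint_ge0.
apply/eqP; rewrite eq_sym -subr_eq0 -mulN1r addrC -rint_lin//.
have dC : rCc (fun x => -1 * f x + `|f x|) by exact: rCcD (rCcZ _ _) _.
have := simple_le (simple1 (1 : C^o) dC) (@rCc0 R X).
rewrite nrmZr (_ : nrm (1 : C^o) = 1) ?nrmCE ?normr1// mulr1 rint0.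
rewrite normr_le0; apply => x /f0 fx.
by rewrite ger0_norm// mulN1r addNr scale0r nrm0.
Qed.

Let Re_lin (k : R) (a b : C) :
  complex.Re (k%:C * a + b) = k * complex.Re a + complex.Re b.
Proof. by case: a => a1 a2; case: b => b1 b2 /=; rewrite mul0r subr0. Qed.

(** Taking real parts fixes the integrand, so [v] and its real part are integrals of the same
    function. *)
Lemma hint_real (f : X -> R) (v : C) :
  hint (fun x => (f x)%:C : C^o) (v : C^o) -> v = (complex.Re v)%:C.
Proof.
move=> fv; apply: (hint_uniq fv _ (fun _ _ => erefl)).
apply: (hint_map (T := fun z : C^o => (complex.Re z)%:C : C^o) (M := 1) _ _ _ fv) => //.
  by move=> k a b; rewrite Re_lin rmorphD rmorphM.
by move=> a; rewrite mul1r nrm_real; exact: Re_le_nrm.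
Qed.

Lemma hint_lower (f g : X -> R) (v : C) :
  hint (fun x => (f x)%:C : C^o) (v : C^o) -> rCc g ->
  (forall x, msupport mu x -> g x <= f x) -> rint g <= complex.Re v.
Proof.
move=> fv gC gf; apply/ler_addgt0Pr => eps eps0.
have e20 : 0 < eps / 2 by rewrite divr_gt0.
have [S [s [p [[n [phi [e [phiC SE sE]]]] pC Sp p4 s4]]]] := fv _ e20.
have ReS (c : 'I_n -> R) : complex.Re (\sum_i (c i)%:C *: (e i : C^o)) =
    \sum_i complex.Re (e i) * c i.
  elim: n {phi S s SE sE phiC Sp s4} e c => [|n IH] e c; first by rewrite !big_ord0.
  by rewrite !big_ord_recl Re_lin IH mulrC.
(* The coefficients [e i] may be non-real. The real part of the approximating sum is the test
   function [r], and [r + p] dominates [f], hence [g], on the support. *)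
pose r x := \sum_i complex.Re (e i) * phi i x.
have rC : rCc r by apply: rCc_sum => i; exact: rCcZ.
have rE : rint r = complex.Re s.
  rewrite sE ReS /r rint_sum; last by move=> i; exact: rCcZ.
  by apply: eq_bigr => i _; rewrite rintZ.
have : 0 <= rint (fun x => -1 * g x + (r x + p x)).
  apply: rint_supp_ge0; first exact: rCcD (rCcZ _ _) (rCcD _ _).
  move=> x sx; have := Sp x sx; have := gf x sx; rewrite SE /r -ReS.
  set z := \sum_i _ => h1 h2.
  have := Re_le_nrm ((f x)%:C - z).
  have -> : complex.Re ((f x)%:C - z) = f x - complex.Re z by case: z {h2}.
  by rewrite ler_norml => /andP[_ h3]; have := le_trans h3 h2; lra.
rewrite rint_lin//; last exact: rCcD.
rewrite rintD// rE.
have := Re_le_nrm (v - s); have -> : complex.Re (v - s) = complex.Re v - complex.Re s.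
  by case: (v) (s) => ? ? [].
by rewrite ler_norml => /andP[h3 _]; have := le_trans _ s4; lra.
Qed.

(** The definition of the support provides a test function [h], supported in the neighbourhood of
    [x1], with nonzero integral; so [|h|] has positive integral. If [M] bounds [|h|], then
    [c / M * |h|] lies below [f] on the support. *)
Lemma hint_gt0 (f : X -> R) (v : C) (c : R) (x1 : X) :
  hint (fun x => (f x)%:C : C^o) (v : C^o) ->
  (forall x, msupport mu x -> 0 <= f x) -> msupport mu x1 -> 0 < c ->
  (\forall x \near x1, msupport mu x -> c <= f x) -> 0 < complex.Re v.
Proof.
move=> fv f0 sx1 c0 cf.
have : nbhs x1 [set x | msupport mu x -> c <= f x] by exact: cf.
rewrite nbhsE => -[U [oU Ux1] Uf].
have [h [hC hU mh]] := sx1 U oU Ux1.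
have hnC := Cc_nrm hC.
have h0 : 0 < rint (fun x => nrm (h x : C^o)).
  rewrite lt_neqAle rint_ge0// ?andbT; last by move=> x; exact: nrm_ge0.
  apply/eqP => h0; move: mh; rewrite mu_ReIm//.
  have z (g : X -> R) : rCc g -> (forall x, `|g x| <= nrm (h x : C^o)) -> rint g = 0.
    move=> gC gh; apply/eqP; rewrite -normr_le0 h0; exact: rint_abs.
  rewrite !z ?mulr0 ?addr0 ?eqxx//.
  - exact: Cc_Im.
  - by move=> x; exact: Im_le_nrm.
  - exact: Cc_Re.
  - by move=> x; exact: Re_le_nrm.
have [M M0 hM] := rCc_bounded hnC.
have cM0 : 0 < c / M by rewrite divr_gt0.
apply: (@lt_le_trans _ _ (rint (fun x => c / M * nrm (h x : C^o)))).
  by rewrite rintZ//; exact: mulr_gt0.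
apply: hint_lower fv _ _; first exact: rCcZ.
move=> x sx; have [Ux|/hU ->] := pselect (U x); last by rewrite nrm0 mulr0 f0.
apply: le_trans (Uf x Ux sx); rewrite mulrAC ler_pdivrMr// ler_pM2l//.
by have := hM x; rewrite ger0_norm// nrm_ge0.
Qed.

Section CompleteSpace.
Context {V : completeNormedModType C}.

(** Approximants with errors [e * chi] and [e' * chi] have integrals that differ by at most
    [(e + e') * rint chi], hence these integrals converge. The denominator [rint chi + 1] avoids a
    division by 0. *)
Lemma hint_lim (F : X -> V) chi : rCc chi -> (forall x, 0 <= chi x) ->
  (forall e : R, 0 < e -> exists F' v', hint F' v' /\
     forall x, msupport mu x -> nrm (F x - F' x) <= e * chi x) ->
  exists v, hint F v.
Proof.
move=> chiC chi0 ex; have D0 : 0 <= rint chi by exact: rint_ge0.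
have D1 : 0 < rint chi + 1 by lra.
have kD (a : R) : 0 <= a -> a / (rint chi + 1) * rint chi <= a.
  by move=> a0; rewrite mulrAC ler_pdivrMr// ler_wpM2l//; lra.
pose P e v' := 0 <= e /\ exists F', hint F' v' /\
  forall x, msupport mu x -> nrm (F x - F' x) <= e / (rint chi + 1) * chi x.
have [||v vP] := approx_complete (P := P).
- move=> e e0; have e10 : 0 < e / (rint chi + 1) by rewrite divr_gt0.
  by have [F' [v' h]] := ex _ e10; exists v'; split; [exact: ltW|exists F'].
- move=> e e' v v' [e0 [G [Gv GF]]] [e0' [G' [Gv' GF']]].
  apply: le_trans (kD _ (addr_ge0 e0 e0')); rewrite -rintZ//.
  apply: hint_dist Gv Gv' (rCcZ _ chiC) _ => x sx.
  have := nrm_dist (G x) (F x) (G' x); rewrite (nrmB (G x) (F x)).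
  have := GF x sx; have := GF' x sx; rewrite !mulrDl; lra.
exists v => eps eps0.
have e20 : 0 < eps / 2 by rewrite divr_gt0.
have e30 : 0 < eps / 2 / (rint chi + 1) by rewrite divr_gt0.
have [G [w [Gw GF]]] := ex _ e30.
have vw : nrm (v - w) <= eps / 2.
  by apply: vP; split; [exact: ltW|exists G].
have [S [s [p [Ss pC Sp p4 s4]]]] := Gw _ e20.
exists S, s, (fun x => eps / 2 / (rint chi + 1) * chi x + p x); split => //.
- exact: rCcD (rCcZ _ _) _.
- move=> x sx; have := nrm_dist (F x) (G x) (S x); have := GF x sx.
  by have := Sp x sx; lra.
- by rewrite rint_lin//; have := kD _ (ltW e20); lra.
- by have := nrm_dist v w s; lra.
Qed.

(** Since the support is closed, local approximation is vacuous near a point outside it. By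
    partition of unity, [F] is within [e * chi] of a combination of constant vectors with test
    functions as coefficients, whose integral is known. *)
Lemma hint_exists (F : X -> V) (K : set X) : compact K ->
  (forall x, msupport mu x -> ~ K x -> F x = 0) ->
  (forall x0 (e : R), K x0 -> msupport mu x0 -> 0 < e ->
    \forall x \near x0, msupport mu x -> nrm (F x - F x0) <= e) ->
  exists v, hint F v.
Proof.
move=> Kc FK Fc; have [chi [chiC chi0 part]] := approx_by_partition (R := R) Xh Xl Kc.
apply: (hint_lim chiC chi0) => e e0.
have [|||n [p [b [pC bS le]]]] := part (fun=> V) (msupport mu) F
  [set b | exists w : V, b = fun=> w] e.
- exact: ltW.
- by move=> x sx; exact: FK.
- move=> x0 Kx0; exists (fun=> F x0); first by exists (F x0).
  have [sx0|nsx0] := pselect (msupport mu x0); first exact: Fc.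
  have : nbhs x0 (~` msupport mu).
    by apply: open_nbhs_nbhs; split => //; apply: closed_openC; exact: msupport_closed.
  by apply: filterS => x nsx /nsx.
pose w i := sval (cid (bS i)).
have bE i x : b i x = w i by rewrite /w; case: cid => /= u ->.
exists (fun x => \sum_i (p i x)%:C *: w i), (\sum_i (rint (p i))%:C *: w i); split.
  by apply: hint_simple; exists n, p, w.
by move=> x /le; under eq_bigr do rewrite bE.
Qed.

End CompleteSpace.
End Radon.

(** * Fubini's theorem for two Radon measures *)

Section Fubini.
Context {R : realType} {X Y : topologicalType} {V : completeNormedModType R[i]}.
Local Notation C := R[i].
Hypotheses (Xh : hausdorff_space X) (Xl : locally_compact [set: X]).
Hypotheses (Yh : hausdorff_space Y) (Yl : locally_compact [set: Y]).
Variables (mu : (X -> C) -> C) (nu : (Y -> C) -> C).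
Hypotheses (muR : radon mu) (nuR : radon nu).
Variables (F : X -> Y -> V) (K : set X) (L : set Y).
Hypotheses (Kc : compact K) (Lc : compact L).
Hypothesis FK : forall x y, msupport mu x -> msupport nu y -> ~ K x -> F x y = 0.
Hypothesis FL : forall x y, msupport mu x -> msupport nu y -> ~ L y -> F x y = 0.
Hypothesis Fc : forall x0 y0 (e : R), msupport mu x0 -> msupport nu y0 -> 0 < e ->
  \forall x \near x0 & y \near y0, msupport mu x -> msupport nu y ->
    nrm (F x y - F x0 y0) <= e.

Let Gex x : msupport mu x -> exists v, hint nu (F x) v.
Proof.
move=> sx; apply: (hint_exists nuR Yh Yl Lc) => [y sy|y0 e Ly sy e0].
  exact: FL.
have := Fc sx sy e0; move=> -[[P Q] [/= Px Qy] PQ].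
apply: filterS Qy => y Qy sy'; apply: (PQ (x, y)) => //; split => //=.
exact: nbhs_singleton.
Qed.

Let Hex y : msupport nu y -> exists v, hint mu (fun x => F x y) v.
Proof.
move=> sy; apply: (hint_exists muR Xh Xl Kc) => [x sx|x0 e Kx sx e0].
  exact: FK.
have := Fc sx sy e0; move=> -[[P Q] [/= Px Qy] PQ].
apply: filterS Px => x Px sx'; apply: (PQ (x, y)) => //; split => //=.
exact: nbhs_singleton.
Qed.

(* F(x, y) is uniformly close to \sum_k p_k(x) F(c_k, y), for a partition of
   unity p_k with sample points c_k; for the latter function the claim is clear. *)
Lemma fubini : exists (G : X -> V) (H : Y -> V) v,
  [/\ forall x, msupport mu x -> hint nu (F x) (G x),
      forall y, msupport nu y -> hint mu (fun x => F x y) (H y),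
      hint mu G v & hint nu H v].
Proof.
pose G x := if pselect (msupport mu x) is left sx then sval (cid (Gex sx)) else 0.
pose H y := if pselect (msupport nu y) is left sy then sval (cid (Hex sy)) else 0.
have GP x : msupport mu x -> hint nu (F x) (G x).
  by move=> sx; rewrite /G; case: pselect => // sx'; case: cid.
have HP y : msupport nu y -> hint mu (fun x => F x y) (H y).
  by move=> sy; rewrite /H; case: pselect => // sy'; case: cid.
have [chi [chiC chi0 part]] := partition (R := R) Xh Xl Kc.
have [chi' [chi'C chi'0 part']] := partition (R := R) Yh Yl Lc.
have chi'1 y : L y -> 1 <= chi' y.
  move=> Ly; have [|n [p [c [_ _ _ p1 pchi]]]] := part' (fun=> setT).
    by move=> x _; exact: filterT.
  by rewrite -(p1 y Ly).
have D0 : 0 <= rint mu chi by exact: rint_ge0.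
have D0' : 0 <= rint nu chi' by exact: rint_ge0.
have key (e : R) : 0 < e -> exists n (p : 'I_n -> X -> R) (f : 'I_n -> Y -> V) w,
   [/\ forall k, rCc (p k), forall k, hint nu (f k) (w k) &
     forall x y, msupport mu x -> msupport nu y ->
       nrm (F x y - \sum_k (p k x)%:C *: f k y) <= e * (chi x * chi' y)].
  move=> e0.
  (* The oscillation in the first variable is small uniformly in [y], by compactness of [L].
     Intersecting with the second set below ensures that a piece that meets the support of [mu] has
     its centre in that support, where [F] is controlled. *)
  pose P x0 := [set x | msupport mu x0 -> msupport mu x ->
    forall y, L y -> msupport nu y -> nrm (F x y - F x0 y) <= e].
  have [|n [p [c [pC p0 pP p1 pchi]]]] := part (fun x0 => P x0 `&`
      [set x | msupport mu x -> msupport mu x0]).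
    move=> x0 Kx0; have [sx0|nsx0] := pselect (msupport mu x0); last first.
      have : nbhs x0 (~` msupport mu).
        by apply: open_nbhs_nbhs; split => //; apply: closed_openC; exact: msupport_closed.
      by apply: filterS => x nsx; split.
    apply: filterI; last by apply: filterE => x.
    have e20 : 0 < e / 2 by rewrite divr_gt0.
    have /compact_near_coveringP/(_ X (nbhs x0)
      (fun x y => msupport mu x -> msupport nu y -> nrm (F x y - F x0 y) <= e) _) := Lc.
    move=> h; have {h}: \forall x \near x0, L `<=` (fun y => msupport mu x ->
        msupport nu y -> nrm (F x y - F x0 y) <= e).
      apply: h => y0 Ly0.
      have [sy0|nsy0] := pselect (msupport nu y0); last first.
        have : nbhs y0 (~` msupport nu).
          by apply: open_nbhs_nbhs; split => //; apply: closed_openC; exact: msupport_closed.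
        move=> ny; exists (~` msupport nu, setT).
          by split => //=; exact: filterT.
        by move=> [y x] /= [ny' _] _ /ny'.
      have := Fc sx0 sy0 e20; move=> -[[A B] [/= Ax By] AB].
      exists (B, A) => // -[y x] /= [By' Ax'] sx sy.
      have h1 : nrm (F x y - F x0 y0) <= e / 2 by apply: (AB (x, y)).
      have h2 : nrm (F x0 y - F x0 y0) <= e / 2.
        by apply: (AB (x0, y)) => //; split => //=; exact: nbhs_singleton.
      have := nrm_dist (F x y) (F x0 y0) (F x0 y).
      rewrite (nrmB (F x0 y0)); lra.
    by apply: filterS => x h _ sx y Ly sy; exact: h.
  exists n, p, (fun k y => if pselect (msupport mu (c k)) then F (c k) y else 0),
    (fun k => if pselect (msupport mu (c k)) then G (c k) else 0); split.
  - by move=> k; case: (pC k).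
  - by move=> k; case: pselect => sk; [exact: GP|exact: hint0].
  - move=> x y sx sy.
    have [Ly|nLy] := pselect (L y); last first.
      rewrite FL// big1; first by rewrite subrr nrm0 mulr_ge0// ?mulr_ge0// ltW.
      by move=> k _; case: pselect => sk; rewrite ?(FL sk sy nLy) scaler0.
    have -> : F x y = \sum_k (p k x)%:C *: F x y.
      have [Kx|nKx] := pselect (K x).
        by rewrite -scaler_suml -rmorph_sum/= p1// scale1r.
      by rewrite big1 FK// => k _; rewrite scaler0.
    rewrite -sumrB; apply: le_trans (nrm_sum _ _ _) _.
    apply: (@le_trans _ _ (\sum_k p k x * e)).
      apply: ler_sum => k _; rewrite -scalerBr nrmZr ger0_norm//.
      have [->|/pP[h1 h2]] := eqVneq (p k x) 0; first by rewrite !mul0r.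
      apply: ler_wpM2l => //; case: pselect => [sk|nsk]; first exact: h1.
      by case: nsk; exact: h2.
    rewrite -mulr_suml mulrC; apply: ler_wpM2l; first exact: ltW.
    by apply: le_trans (pchi x) _; rewrite ler_peMr//; exact: chi'1.
have GS e n (p : 'I_n -> X -> R) (f : 'I_n -> Y -> V) w x : msupport mu x ->
    (forall k, hint nu (f k) (w k)) ->
    (forall x y, msupport mu x -> msupport nu y ->
       nrm (F x y - \sum_k (p k x)%:C *: f k y) <= e * (chi x * chi' y)) ->
    nrm (G x - \sum_k (p k x)%:C *: w k) <= e * rint nu chi' * chi x.
  move=> sx fw le.
  have -> : e * rint nu chi' * chi x = rint nu (fun y => e * chi x * chi' y).
    by rewrite rintZ//; ring.
  apply: hint_dist (GP x sx) _ (rCcZ _ chi'C) _ => //.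
    by apply: hint_sum => // k; exact: hintZ.
  by move=> y sy; apply: le_trans (le x y sx sy) _; rewrite mulrA.
have HS e n (p : 'I_n -> X -> R) (f : 'I_n -> Y -> V) y : msupport nu y ->
    (forall k, rCc (p k)) ->
    (forall x y, msupport mu x -> msupport nu y ->
       nrm (F x y - \sum_k (p k x)%:C *: f k y) <= e * (chi x * chi' y)) ->
    nrm (H y - \sum_k (rint mu (p k))%:C *: f k y) <= e * rint mu chi * chi' y.
  move=> sy pC le.
  have -> : e * rint mu chi * chi' y = rint mu (fun x => e * chi' y * chi x).
    by rewrite rintZ//; ring.
  apply: hint_dist (HP y sy) _ (rCcZ _ chiC) _ => //.
    by apply: hint_simple => //; exists n, p, (fun k => f k y).
  by move=> x sx; apply: le_trans (le x y sx sy) _; rewrite -mulrA [chi' y * _]mulrC.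
have small (e D : R) : 0 < e -> 0 <= D -> 0 < e / (D + 1) /\ e / (D + 1) * D <= e.
  move=> e0 D0''; have D1 : 0 < D + 1 by lra.
  split; first by rewrite divr_gt0.
  by rewrite mulrAC ler_pdivrMr// ler_pM2l//; lra.
have [v Gv] : exists v, hint mu G v.
  apply: (hint_lim muR Xh Xl chiC chi0) => e e0.
  have [e10 e1] := small _ _ e0 D0'.
  have [n [p [f [w [pC fw le]]]]] := key _ e10.
  exists (fun x => \sum_k (p k x)%:C *: w k), (\sum_k (rint mu (p k))%:C *: w k).
  split; first by apply: hint_simple => //; exists n, p, w.
  move=> x sx; apply: le_trans (GS _ _ _ _ _ _ sx fw le) _.
  exact: ler_wpM2r.
have [v' Hv'] : exists v, hint nu H v.
  apply: (hint_lim nuR Yh Yl chi'C chi'0) => e e0.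
  have [e10 e1] := small _ _ e0 D0.
  have [n [p [f [w [pC fw le]]]]] := key _ e10.
  exists (fun y => \sum_k (rint mu (p k))%:C *: f k y), (\sum_k (rint mu (p k))%:C *: w k).
  split; first by apply: hint_sum => // k; exact: hintZ.
  move=> y sy; apply: le_trans (HS _ _ _ _ _ sy pC le) _.
  exact: ler_wpM2r.
exists G, H, v; split => //; suff -> : v = v' by [].
apply/eqP; rewrite -subr_eq0; apply/eqP/nrm_small => e e0.
have e20 : 0 < e / 2 by rewrite divr_gt0.
have DD : 0 <= rint mu chi * rint nu chi' by exact: mulr_ge0.
have [e10 e1] := small _ _ e20 DD.
(* One and the same sum is close to both iterated integrals, up to [d] times the product of the
   masses of [chi] and [chi']. *)
have [n [p [f [w [pC fw le]]]]] := key _ e10.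
set d := e / 2 / _ in e10 e1 le.
have h1 : nrm (v - \sum_k (rint mu (p k))%:C *: w k) <= d * rint nu chi' * rint mu chi.
  rewrite -rintZ//; apply: hint_dist Gv _ (rCcZ _ chiC) _ => //.
    by apply: hint_simple => //; exists n, p, w.
  by move=> x sx; exact: GS le.
have h2 : nrm (v' - \sum_k (rint mu (p k))%:C *: w k) <= d * rint mu chi * rint nu chi'.
  rewrite -rintZ//; apply: hint_dist Hv' _ (rCcZ _ chi'C) _ => //.
    by apply: hint_sum => // k; exact: hintZ.
  by move=> y sy; exact: HS le.
have := nrm_dist v (\sum_k (rint mu (p k))%:C *: w k) v'.
rewrite (nrmB (\sum_k _)); move: h1 h2 e1.
rewrite -!mulrA [rint nu chi' * _]mulrC; lra.
Qed.

End Fubini.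

(** * Fields of Banach spaces *)

Section Fields.
Context {R : realType} {X : topologicalType}.
Local Notation C := R[i].
Context {E : X -> completeNormedModType C} {S : set (forall x, E x)}.
Hypothesis SP : usc_field S.

(* Convergence, along the filter F, of the elements eta z of the fibres over
   p z to the element v of the fibre over x0, in the total space of the field. *)
Definition bcv (Z : Type) (F : set_system Z) (p : Z -> X)
    (eta : forall z, E (p z)) (x0 : X) (v : E x0) : Prop :=
  p @ F --> x0 /\ forall e : R, 0 < e -> exists b, [/\ S b,
    nrm (v - b x0) <= e & \forall z \near F, nrm (eta z - b (p z)) <= e].

Let S0 : S (fun=> 0). Proof. exact: usc_zero SP. Qed.

Lemma sec_lin (k : C) b b' : S b -> S b' -> S (fun x => k *: b x + b' x).
Proof. exact: usc_lin. Qed.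

Lemma sec_sub b b' : S b -> S b' -> S (fun x => b x - b' x).
Proof.
move=> Sb Sb'; have := sec_lin (-1) Sb' Sb; congr S.
by apply: functional_extensionality_dep => x; rewrite scaleN1r addrC.
Qed.

Lemma sec_dense x (v : E x) (e : R) : 0 < e -> exists2 b, S b & nrm (v - b x) <= e.
Proof.
move=> e0; have [_ [b Sb <-] /ltW vb] := (dense_nrmP _).1 (usc_dense SP (x := x)) v e e0.
by exists b.
Qed.

Section OneFilter.
Context {Z : Type} (F : set_system Z) {FF : Filter F} (p : Z -> X).
Implicit Types eta : forall z, E (p z).

Lemma sec_near b x0 (c : R) : S b -> p @ F --> x0 -> nrm (b x0) < c ->
  \forall z \near F, nrm (b (p z)) < c.
Proof.
move=> Sb px; rewrite -nrm_lt => h.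
have {}h : F (p @^-1` [set x | `|b x| < c%:C]) := px _ (usc_norm SP Sb h).
by apply: filterS h => z; rewrite /= nrm_lt.
Qed.

Lemma bcv_sec b x0 : S b -> p @ F --> x0 -> bcv F (fun z => b (p z)) (b x0).
Proof.
move=> Sb px; split=> // e e0; exists b; split => //; first by rewrite subrr nrm0 ltW.
by apply: filterE => z; rewrite subrr nrm0 ltW.
Qed.

(** Any section that is close to the limit at [x0] approximates [eta] nearby, not just the one
    provided by the definition: two sections differ by a section, whose norm is upper
    semi-continuous. A third of the slack [e - nrm (v - b x0)] pays for the given section, two
    thirds for the difference. *)
Lemma bcv_near eta x0 (v : E x0) b e : bcv F eta v -> S b -> nrm (v - b x0) < e ->
  \forall z \near F, nrm (eta z - b (p z)) < e.
Proof.
move=> [px h] Sb ve; have d0 : 0 < (e - nrm (v - b x0)) / 3 by rewrite divr_gt0// subr_gt0.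
have [b' [Sb' vb' eb']] := h _ d0.
have : \forall z \near F, nrm (b' (p z) - b (p z)) <
    nrm (v - b x0) + 2 * ((e - nrm (v - b x0)) / 3).
  apply: (@sec_near (fun x => b' x - b x) x0) => //; first exact: sec_sub.
  by have := nrm_dist (b' x0) v (b x0); rewrite (nrmB (b' x0) v) /=; lra.
apply: filterS2 eb' => z h1 h2.
by have := nrm_dist (eta z) (b' (p z)) (b (p z)); lra.
Qed.

Lemma bcv_norm eta x0 (v : E x0) e : bcv F eta v -> nrm v < e ->
  \forall z \near F, nrm (eta z) < e.
Proof.
move=> h ve; have := bcv_near (e := e) h S0; rewrite subr0 => /(_ ve).
by apply: filterS => z; rewrite subr0.
Qed.

Lemma bcv_lim eta x0 (v : E x0) : p @ F --> x0 ->
  (forall e : R, 0 < e -> exists eta' (v' : E x0), [/\ bcv F eta' v',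
    nrm (v - v') <= e & \forall z \near F, nrm (eta z - eta' z) <= e]) ->
  bcv F eta v.
Proof.
move=> px h; split => // e e0; have e20 : 0 < e / 2 by rewrite divr_gt0.
have [eta' [v' [[_ c'] vv' ee']]] := h _ e20.
have [b [Sb vb eb]] := c' _ e20.
exists b; split => //; first by have := nrm_dist v v' (b x0); lra.
apply: filterS2 ee' eb => z h1 h2.
by have := nrm_dist (eta z) (eta' z) (b (p z)); lra.
Qed.

Lemma bcv_ext eta eta' x0 (v : E x0) : (\forall z \near F, eta z = eta' z) ->
  bcv F eta v -> bcv F eta' v.
Proof.
move=> ee [px h]; split => // e /h[b [Sb vb eb]]; exists b; split => //.
by apply: filterS2 ee eb => z <-.
Qed.

Lemma bcv0 x0 : p @ F --> x0 -> bcv F (p := p) (fun z => 0) (0 : E x0).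
Proof. exact: (@bcv_sec (fun=> 0)). Qed.

Lemma bcv_lin (k : C) eta eta' x0 (v v' : E x0) : bcv F eta v -> bcv F eta' v' ->
  bcv F (fun z => k *: eta z + eta' z) (k *: v + v').
Proof.
move=> [px h] [_ h']; split => // e e0.
have k0 : 0 <= complex.Re `|k| by have := nrm_ge0 (k : C^o).
have e20 : 0 < e / 2 by rewrite divr_gt0.
have e30 : 0 < e / 2 / (complex.Re `|k| + 1) by rewrite divr_gt0//; lra.
have kM (a : R) : a <= e / 2 / (complex.Re `|k| + 1) -> complex.Re `|k| * a <= e / 2.
  move=> ha; apply: (@le_trans _ _ (complex.Re `|k| * (e / 2 / (complex.Re `|k| + 1)))).
    exact: ler_wpM2l.
  by rewrite mulrCA ger_pMr// ler_pdivrMr ?mul1r; lra.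
have [b [Sb vb eb]] := h _ e30; have [b' [Sb' vb' eb']] := h' _ e20.
exists (fun x => k *: b x + b' x); split; first exact: sec_lin.
  rewrite opprD addrACA -scalerBr; apply: le_trans (nrmD _ _) _.
  by rewrite nrmZ; have := kM _ vb; lra.
apply: filterS2 eb eb' => z h1 h2.
rewrite opprD addrACA -scalerBr; apply: le_trans (nrmD _ _) _.
by rewrite nrmZ; have := kM _ h1; lra.
Qed.

Lemma bcv_sum n (eta : 'I_n -> forall z, E (p z)) x0 (v : 'I_n -> E x0) :
  p @ F --> x0 -> (forall i, bcv F (eta i) (v i)) ->
  bcv F (fun z => \sum_i eta i z) (\sum_i v i).
Proof.
move=> px; elim: n eta v => [|n IH] eta v h.
  rewrite big_ord0; apply: bcv_ext (bcv0 px).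
  by apply: filterE => z; rewrite big_ord0.
rewrite big_ord_recl -[v ord0]scale1r.
apply: bcv_ext (bcv_lin 1 (h ord0) (IH _ _ (fun i => h (lift ord0 i)))).
by apply: filterE => z; rewrite big_ord_recl scale1r.
Qed.

Lemma bcvZ (f : Z -> R) (c : R) eta x0 (v : E x0) : f @ F --> c -> bcv F eta v ->
  bcv F (fun z => (f z)%:C *: eta z) (c%:C *: v).
Proof.
move=> fc ev; have [px _] := ev; apply: bcv_lim => // e e0.
exists (fun z => c%:C *: eta z), (c%:C *: v); split.
- apply: bcv_ext (_ : bcv F (fun z => c%:C *: eta z + 0) _).
    by apply: filterE => z; rewrite addr0.
  by rewrite -[c%:C *: v]addr0; apply: bcv_lin => //; exact: bcv0.
- by rewrite subrr nrm0 ltW.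
- have v1 : nrm v < nrm v + 1 by rewrite ltrDl.
  have n1 : 0 < nrm v + 1 by rewrite ltr_wpDl ?nrm_ge0.
  have d0 : 0 < e / (nrm v + 1) by rewrite divr_gt0.
  have /cvgrPdist_le/(_ _ d0) := fc.
  apply: filterS2 (bcv_norm ev v1) => z h1 h2.
  rewrite -scalerBl -rmorphB nrmZr distrC.
  apply: (@le_trans _ _ (e / (nrm v + 1) * (nrm v + 1))); last by rewrite divfK ?gt_eqF.
  by apply: ler_pM => //; [exact: nrm_ge0|exact: ltW].
Qed.

End OneFilter.

(** Over a constant base point, convergence in the total space is norm convergence in one fibre.
    This is how sections satisfy the continuity hypotheses of the integration lemmas. *)
Lemma bcv_const (Z : Type) (F : set_system Z) {FF : Filter F} x0
    (eta : Z -> E x0) v e : bcv F (p := fun=> x0) eta v -> 0 < e ->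
  \forall z \near F, nrm (eta z - v) <= e.
Proof.
move=> [_ h] e0; have e20 : 0 < e / 2 by rewrite divr_gt0.
have [b [Sb vb eb]] := h _ e20; apply: filterS eb => z.
by have := nrm_dist (eta z) (b x0) v; rewrite (nrmB (b x0)); lra.
Qed.

Lemma bcv_comp (Z Z' : Type) (F : set_system Z) {FF : Filter F}
    (F' : set_system Z') {FF' : Filter F'} (h : Z' -> Z) (p : Z -> X)
    (eta : forall z, E (p z)) x0 (v : E x0) :
  h @ F' --> F -> bcv F eta v -> bcv F' (fun z => eta (h z)) v.
Proof.
move=> hF [px c]; split; first exact: cvg_trans (cvg_app _ hF) px.
by move=> e /c[b [Sb vb eb]]; exists b; split => //; exact: hF eb.
Qed.

(** Sections of the pullback field are the selections that are continuous into the total space; the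
    rest of the argument works with this description. *)
Lemma pullbackP (Y : topologicalType) (p : Y -> X) (eta : forall y, E (p y)) :
  continuous p ->
  (pullback_sections p S eta <-> forall y, bcv (nbhs y) eta (eta y)).
Proof.
move=> pc; split=> [h y|h y _ /gt0C[e e0 ->]].
  split=> [|e e0]; first exact: pc.
  have e0' : 0 < e%:C by rewrite ltcR.
  have [_ [b Sb <-] be] := h y _ e0'; exists b; split => //.
    by have := nbhs_singleton be; rewrite /= nrm_le.
  by apply: filterS be => z; rewrite nrm_le.
have [_ /(_ e e0)[b [Sb vb eb]]] := h y.
exists (fun y => b (p y)); first by exists b.
by apply: filterS eb => z; rewrite nrm_le.
Qed.

(* A parametrized integral is a section: partitions of unity in the integration
   variable reduce it to finite sums of continuous functions times sections. *)
Section Parametrized.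
Context {M : topologicalType}.
Hypotheses (Xh : hausdorff_space X).
Hypotheses (Mh : hausdorff_space M) (Ml : locally_compact [set: M]).
Variables (r : M -> X) (mu : X -> (M -> C) -> C).
Hypotheses (rc : continuous r) (muR : forall x, radon (mu x)).
Hypothesis mus : forall x, msupport (mu x) = [set g | r g = x].
Hypothesis muc : forall f, rCc f -> continuous (fun x => rint (mu x) f).

Lemma parametrized_integral (Z : topologicalType) (z0 : Z) (p : Z -> X)
    (Phi : forall z, M -> E (p z)) (v : forall z, E (p z)) (K : set M) :
  compact K -> {for z0, continuous p} ->
  (forall z, hint (mu (p z)) (Phi z) (v z)) ->
  (\forall z \near z0, forall g, r g = p z -> ~ K g -> Phi z g = 0) ->
  (forall g0, K g0 -> r g0 = p z0 ->
    bcv (within [set zg | r zg.2 = p zg.1] (nbhs (z0, g0)))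
      (fun zg : Z * M => Phi zg.1 zg.2) (Phi z0 g0)) ->
  bcv (nbhs z0) v (v z0).
Proof.
move=> Kc pc hv PhiK Phic.
have [chi [chiC chi0 part]] := partition (R := R) Mh Ml Kc.
have chin : 0 <= rint (mu (p z0)) chi by exact: rint_ge0.
(* The mass of [chi] depends continuously on the base point, so it stays below its value at [p z0]
   plus 1 near [z0]. Errors [d * chi] then integrate to at most [e] for all those [z]. *)
apply: bcv_lim => // e e0; pose d := e / (rint (mu (p z0)) chi + 1).
have d0 : 0 < d by rewrite divr_gt0//; lra.
(* Around each [g0] the integrand is within [d] of a single section [b] on the pairs with
   [r g = p z]. If [r g0] differs from [p z0], there are no such pairs nearby and the zero section
   serves. *)
have ex g0 : K g0 -> exists b (Q : set Z) (P : set M), [/\ S b, nbhs z0 Q, nbhs g0 P &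
    forall z g, Q z -> P g -> r g = p z -> nrm (Phi z g - b (p z)) <= d].
  move=> Kg0; have [rg|rg] := pselect (r g0 = p z0).
    have [_ /(_ d d0)[b [Sb vb]]] := Phic _ Kg0 rg.
    move=> -[[Q P] /= [Qz Pg] QP]; exists b, Q, P; split => // z g Qz' Pg' rz.
    exact: (QP (z, g)).
  have rz : (fun zg : Z * M => r zg.2) @ nbhs (z0, g0) --> r g0.
    by apply: (@cvg_comp _ _ _ (@snd Z M) r _ (nbhs g0)); [exact: cvg_snd|exact: rc].
  have pz : (fun zg : Z * M => p zg.1) @ nbhs (z0, g0) --> p z0.
    by apply: (@cvg_comp _ _ _ (@fst Z M) p _ (nbhs z0)); [exact: cvg_fst|exact: pc].
  have [[Q P] /= [Qz Pg] QP] := cvg_neq Xh rz pz rg.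
  exists (fun=> 0), Q, P; split => // z g Qz' Pg' rz'.
  by have := QP (z, g) (conj Qz' Pg').
pose ch g0 := if pselect (K g0) is left Kg then
    let h := cid (ex g0 Kg) in let h2 := cid (svalP h) in
    let h3 := cid (svalP h2) in (sval h, sval h2, sval h3)
  else (fun=> 0, setT, setT).
have chP g0 : K g0 -> let '(b, Q, P) := ch g0 in [/\ S b, nbhs z0 Q, nbhs g0 P &
    forall z g, Q z -> P g -> r g = p z -> nrm (Phi z g - b (p z)) <= d].
  move=> Kg; rewrite /ch; case: pselect => // Kg'.
  by case: (cid (ex g0 Kg')) => b hb /=; case: cid => Q hQ /=; case: cid.
have [|n [q [c [qC q0 qP q1 qchi]]]] := part (fun g0 => (ch g0).2).
  by move=> g0 /chP; case: (ch g0) => -[b Q] P [].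
pose b k := (ch (c k)).1.1.
have bP k : [/\ S (b k), nbhs z0 (ch (c k)).1.2 &
    forall z g, (ch (c k)).1.2 z -> (ch (c k)).2 g -> r g = p z ->
      nrm (Phi z g - b k (p z)) <= d].
  by have := chP _ (qC k).2; rewrite /b; case: (ch (c k)) => -[b' Q] P [].
have approx : \forall z \near z0, forall g, r g = p z ->
    nrm (Phi z g - \sum_k (q k g)%:C *: b k (p z)) <= d * chi g.
  have Qn : \forall z \near z0, forall k, (ch (c k)).1.2 z.
    by apply: filter_forall => k; case: (bP k).
  apply: filterS2 PhiK Qn => z hK hQ g rg.
  have -> : Phi z g = \sum_k (q k g)%:C *: Phi z g.
    have [Kg|nKg] := pselect (K g).
      by rewrite -scaler_suml -rmorph_sum/= q1// scale1r.
    by rewrite big1 hK// => k _; rewrite scaler0.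
  rewrite -sumrB; apply: le_trans (nrm_sum _ _ _) _.
  apply: (@le_trans _ _ (\sum_k q k g * d)).
    apply: ler_sum => k _; rewrite -scalerBr nrmZr ger0_norm//.
    have [->|/qP Pg] := eqVneq (q k g) 0; first by rewrite !mul0r.
    by apply: ler_wpM2l => //; have [_ _] := bP k; apply.
  by rewrite -mulr_suml mulrC; apply: ler_wpM2l => //; exact: ltW.
have diff z : (forall g, r g = p z ->
    nrm (Phi z g - \sum_k (q k g)%:C *: b k (p z)) <= d * chi g) ->
  nrm (v z - \sum_k (rint (mu (p z)) (q k))%:C *: b k (p z)) <=
    d * rint (mu (p z)) chi.
  move=> h; rewrite -rintZ//; apply: hint_dist (hv z) _ (rCcZ _ chiC) _ => //.
    apply: hint_simple => //; exists n, q, (fun k => b k (p z)).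
    by split => // k; case: (qC k).
  by move=> g; rewrite mus => /h.
exists (fun z => \sum_k (rint (mu (p z)) (q k))%:C *: b k (p z)),
  (\sum_k (rint (mu (p z0)) (q k))%:C *: b k (p z0)); split.
- apply: bcv_sum => // k; apply: bcvZ; last by apply: bcv_sec => //; case: (bP k).
  apply: (@cvg_comp _ _ _ p (fun x => rint (mu x) (q k)) _ (nbhs (p z0))) => //.
  by have [qkC _] := qC k; exact: (muc qkC).
- apply: le_trans (diff z0 (nbhs_singleton approx)) _.
  by rewrite /d mulrAC ler_pdivrMr ?ler_pM2l//; lra.
- have mc : rint (mu (p z)) chi @[z --> z0] --> rint (mu (p z0)) chi.
    by apply: (@cvg_comp _ _ _ p (fun x => rint (mu x) chi) _ (nbhs (p z0))) => //; exact: (muc chiC).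
  have /cvgrPdist_lt/(_ 1 ltr01) := mc.
  apply: filterS2 approx => z /diff h1 h2; apply: le_trans h1 _.
  rewrite /d mulrAC ler_pdivrMr; last lra.
  rewrite ler_pM2l//.
  by move: h2; rewrite ltr_norml => /andP[h2 _]; lra.
Qed.

Lemma fibre_integral x (Phi : M -> E x) (K : set M) : compact K ->
  (forall g, r g = x -> ~ K g -> Phi g = 0) ->
  (forall g0, K g0 -> r g0 = x ->
    bcv (within [set g | r g = x] (nbhs g0)) (p := fun=> x) Phi (Phi g0)) ->
  exists v, hint (mu x) Phi v.
Proof.
move=> Kc PhiK Phic; apply: (hint_exists (muR x) Mh Ml Kc).
  by move=> g; rewrite mus; exact: PhiK.
move=> g0 e Kg0; rewrite mus => rg e0.
exact: bcv_const (Phic _ Kg0 rg) e0.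
Qed.

End Parametrized.
End Fields.

(** * Groupoids and equivalences *)

Lemma cvg_nearP (Z : Type) (Y : topologicalType) (F : set_system Z) (f : Z -> Y) (y : Y) :
  f @ F --> y <-> forall U, nbhs y U -> \forall z \near F, U (f z).
Proof. by []. Qed.

Lemma within_cvg (T U : topologicalType) (A : set T) (f : T -> U) (x : T)
    (Z : Type) (F : set_system Z) {FF : Filter F} (h : Z -> T) :
  {within A, continuous f} -> A x -> h @ F --> x -> (\forall z \near F, A (h z)) ->
  f (h z) @[z --> F] --> f x.
Proof.
move=> /subspace_continuousP fc Ax hx hA; apply/cvg_nearP => V /(fc _ Ax) V'.
have := (cvg_nearP _ _ _).1 hx _ V'.
by apply: filterS2 hA => z Az; exact.
Qed.

Lemma near_snd (T U : Type) (F : set_system T) (F' : set_system U) {FF : Filter F}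
    (P : U -> Prop) :
  (\forall x \near F', P x) -> \forall q \near filter_prod F F', P q.2.
Proof. by exists (setT, P); [split => //; exact: filterT|move=> q []]. Qed.

Section SumSpace.
Context {X Y : topologicalType}.

Lemma continuous_inl : continuous (@inl X Y).
Proof. by apply/continuousP => U []. Qed.

Lemma continuous_inr : continuous (@inr X Y).
Proof. by apply/continuousP => U []. Qed.

Lemma open_inl (U : set X) : open U -> open (@inl X Y @` U).
Proof.
move=> oU; split.
  suff -> : inl @^-1` (@inl X Y @` U) = U by [].
  by apply/seteqP; split => [x [y Uy [<-]]//|x Ux]; exists x.
suff -> : inr @^-1` (@inl X Y @` U) = set0 by exact: open0.
by apply/seteqP; split => [x [y]|].
Qed.

Lemma open_inr (U : set Y) : open U -> open (@inr X Y @` U).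
Proof.
move=> oU; split.
  suff -> : inl @^-1` (@inr X Y @` U) = set0 by exact: open0.
  by apply/seteqP; split => [x [y]|].
suff -> : inr @^-1` (@inr X Y @` U) = U by [].
by apply/seteqP; split => [x [y Uy [<-]]//|x Ux]; exists x.
Qed.

Lemma nbhs_inl (x : X) (U : set X) : nbhs x U -> nbhs (inl x : X + Y) (inl @` U).
Proof.
rewrite !nbhsE => -[O [oO Ox] OU]; exists (inl @` O); last exact: image_subset.
by split; [exact: open_inl|exists x].
Qed.

Lemma nbhs_inr (x : Y) (U : set Y) : nbhs x U -> nbhs (inr x : X + Y) (inr @` U).
Proof.
rewrite !nbhsE => -[O [oO Ox] OU]; exists (inr @` O); last exact: image_subset.
by split; [exact: open_inr|exists x].
Qed.

Lemma sum_hausdorff : hausdorff_space X -> hausdorff_space Y ->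
  hausdorff_space (X + Y)%type.
Proof.
move=> Xh Yh [x|x] [y|y] cxy.
- congr inl; apply: Xh => U V /nbhs_inl xU /nbhs_inl yV.
  by have [_ [[a Ua <-] [b Vb [ab]]]] := cxy _ _ xU yV; exists a; split => //; rewrite -ab.
- have [z [[a _ <-] [b _]]] := cxy _ _ (nbhs_inl (filterT : nbhs x setT)) (nbhs_inr (filterT : nbhs y setT)).
  by [].
- have [z [[a _ <-] [b _]]] := cxy _ _ (nbhs_inr (filterT : nbhs x setT)) (nbhs_inl (filterT : nbhs y setT)).
  by [].
- congr inr; apply: Yh => U V /nbhs_inr xU /nbhs_inr yV.
  by have [_ [[a Ua <-] [b Vb [ab]]]] := cxy _ _ xU yV; exists a; split => //; rewrite -ab.
Qed.

Lemma compact_inl (K : set X) : compact K -> compact (@inl X Y @` K).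
Proof.
by apply: continuous_compact; apply: continuous_subspaceT; exact: continuous_inl.
Qed.

Lemma compact_inr (K : set Y) : compact K -> compact (@inr X Y @` K).
Proof.
by apply: continuous_compact; apply: continuous_subspaceT; exact: continuous_inr.
Qed.

Lemma sum_locally_compact : hausdorff_space X -> hausdorff_space Y ->
  locally_compact [set: X] -> locally_compact [set: Y] ->
  locally_compact [set: (X + Y)%type].
Proof.
move=> Xh Yh Xl Yl [x|y] _; rewrite withinET.
  have [K Kc xK] := compact_nbhs Xl x; exists (inl @` K); first exact: nbhs_inl.
  have c : compact (@inl X Y @` K) by exact: compact_inl.
  by split=> //; apply: compact_closed => //; exact: sum_hausdorff.
have [K Kc xK] := compact_nbhs Yl y; exists (inr @` K); first exact: nbhs_inr.
have c : compact (@inr X Y @` K) by exact: compact_inr.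
by split=> //; apply: compact_closed => //; exact: sum_hausdorff.
Qed.

(** The summand is open, so [h] eventually takes its values in it; the default value [x] elsewhere
    does not affect the limit. *)
Lemma cvg_sum_inl (Z : Type) (F : set_system Z) {FF : Filter F} (h : Z -> X + Y) x :
  h @ F --> (inl x : X + Y) -> exists2 k : Z -> X, k @ F --> x &
  \forall z \near F, h z = inl (k z).
Proof.
move=> hx; exists (fun z => if h z is inl a then a else x).
  apply/cvg_nearP => U /nbhs_inl/((cvg_nearP _ _ _).1 hx).
  by apply: filterS => z [a Ua <-].
have /((cvg_nearP _ _ _).1 hx) : nbhs (inl x : X + Y) (inl @` setT).
  by apply: nbhs_inl; exact: filterT.
by apply: filterS => z [a _ <-].
Qed.

Lemma cvg_sum_inr (Z : Type) (F : set_system Z) {FF : Filter F} (h : Z -> X + Y) x :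
  h @ F --> (inr x : X + Y) -> exists2 k : Z -> Y, k @ F --> x &
  \forall z \near F, h z = inr (k z).
Proof.
move=> hx; exists (fun z => if h z is inr a then a else x).
  apply/cvg_nearP => U /nbhs_inr/((cvg_nearP _ _ _).1 hx).
  by apply: filterS => z [a Ua <-].
have /((cvg_nearP _ _ _).1 hx) : nbhs (inr x : X + Y) (inr @` setT).
  by apply: nbhs_inr; exact: filterT.
by apply: filterS => z [a _ <-].
Qed.

Lemma cvg_inl (Z : Type) (F : set_system Z) {FF : Filter F} (h : Z -> X) x :
  h @ F --> x -> (inl (h z) : X + Y) @[z --> F] --> (inl x : X + Y).
Proof.
move=> hx; apply: (@cvg_comp _ _ _ h inl _ (nbhs x)) => //.
exact: continuous_inl.
Qed.

Lemma cvg_inr (Z : Type) (F : set_system Z) {FF : Filter F} (h : Z -> Y) x :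
  h @ F --> x -> (inr (h z) : X + Y) @[z --> F] --> (inr x : X + Y).
Proof.
move=> hx; apply: (@cvg_comp _ _ _ h inr _ (nbhs x)) => //.
exact: continuous_inr.
Qed.

Lemma sum_continuous (T : topologicalType) (f : X + Y -> T) :
  continuous (fun x => f (inl x)) -> continuous (fun y => f (inr y)) -> continuous f.
Proof.
move=> fl fr; apply/continuousP => U oU; split.
  by have /continuousP := fl; exact.
by have /continuousP := fr; exact.
Qed.

End SumSpace.

Lemma near_cvg (Z : Type) (Y : topologicalType) (F : set_system Z) {FF : Filter F}
    (f g : Z -> Y) (a : Y) :
  (\forall z \near F, f z = g z) -> f @ F --> a -> g @ F --> a.
Proof.
move=> fg fa; apply/cvg_nearP => U /((cvg_nearP _ _ _).1 fa).
by apply: filterS2 fg => z <-.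
Qed.

Section GroupoidLemmas.
Context {R : realType} {G : groupoid_data R} (GP : is_lch_groupoid G).

Lemma cvg_gmul (Z : Type) (F : set_system Z) {FF : Filter F} (a b : Z -> G)
    (a0 b0 : G) : a @ F --> a0 -> b @ F --> b0 -> src a0 = rng b0 ->
  (\forall z \near F, src (a z) = rng (b z)) ->
  gmul (a z) (b z) @[z --> F] --> gmul a0 b0.
Proof.
move=> aa bb ab nab.
apply: (within_cvg (h := fun z => (a z, b z)) (gmul_continuous GP) (x := (a0, b0))) => //.
exact: cvg_pair.
Qed.

Lemma cvg_ginv (Z : Type) (F : set_system Z) {FF : Filter F} (a : Z -> G) (a0 : G) :
  a @ F --> a0 -> ginv (a z) @[z --> F] --> ginv a0.
Proof.
move=> aa; apply: (@cvg_comp _ _ _ a (@ginv _ G) _ (nbhs a0)) => //.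
exact: (ginv_continuous GP).
Qed.

Lemma cvg_src (Z : Type) (F : set_system Z) {FF : Filter F} (a : Z -> G) (a0 : G) :
  a @ F --> a0 -> src (a z) @[z --> F] --> src a0.
Proof.
move=> aa; apply: (@cvg_comp _ _ _ a (@src _ G) _ (nbhs a0)) => //.
exact: (src_continuous GP).
Qed.

Lemma cvg_rng (Z : Type) (F : set_system Z) {FF : Filter F} (a : Z -> G) (a0 : G) :
  a @ F --> a0 -> rng (a z) @[z --> F] --> rng a0.
Proof.
move=> aa; apply: (@cvg_comp _ _ _ a (@rng _ G) _ (nbhs a0)) => //.
exact: (rng_continuous GP).
Qed.

Lemma gmulKV (g k : G) : rng g = rng k -> gmul g (gmul (ginv g) k) = k.
Proof.
move=> e; rewrite (gmulA GP) ?(rng_inv GP) ?(src_inv GP)//.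
by rewrite (gmulVr GP) e (gmul1l GP).
Qed.

Lemma gmulVK (g k : G) : src g = rng k -> gmul (ginv g) (gmul g k) = k.
Proof.
move=> e; rewrite (gmulA GP) ?(rng_inv GP) ?(src_inv GP)//.
by rewrite (gmulVl GP) e (gmul1l GP).
Qed.

Lemma ginvK (g : G) : ginv (ginv g) = g.
Proof.
rewrite -[LHS](gmul1r GP) (src_inv GP) (rng_inv GP) -(gmulVl GP).
by rewrite gmulVK// (src_inv GP).
Qed.

Lemma gmul_inj (g k k' : G) : src g = rng k -> src g = rng k' ->
  gmul g k = gmul g k' -> k = k'.
Proof. by move=> e e' h; rewrite -(gmulVK e) h gmulVK. Qed.

Lemma ginvM (g k : G) : src g = rng k -> ginv (gmul g k) = gmul (ginv k) (ginv g).
Proof.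
move=> e.
have s1 : src (gmul g k) = rng (ginv (gmul g k)) by rewrite (rng_inv GP).
have s2 : src (ginv k) = rng (ginv g) by rewrite (rng_inv GP) (src_inv GP).
apply: (gmul_inj s1).
  by rewrite (rng_mul GP)// (rng_inv GP) (src_mul GP).
rewrite (gmulVr GP) (rng_mul GP)// -(gmulA GP)//; last first.
  by rewrite (rng_mul GP)// (rng_inv GP).
by rewrite gmulKV ?(rng_inv GP)// (gmulVr GP).
Qed.

(** The map [gid] is continuous and has the left inverse [rng]; disjoint open sets around the
    identity arrows pull back. *)
Lemma units_hausdorff : hausdorff_space (units G).
Proof.
rewrite open_hausdorff => x y xy.
have := gpd_hausdorff GP; rewrite open_hausdorff => /(_ (gid G x) (gid G y)).
case.
  by apply/eqP => /(congr1 (@rng _ G)); rewrite !(rng_id GP) => /eqP; exact/negP.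
move=> [A B] /= [xA yB] [oA oB /eqP AB].
exists (gid G @^-1` A, gid G @^-1` B) => /=.
  by split; [rewrite inE in xA; rewrite inE|rewrite inE in yB; rewrite inE].
have gc : forall C, open C -> open (gid G @^-1` C).
  by apply/continuousP; exact: (gid_continuous GP).
split; [exact: gc|exact: gc|].
by rewrite -preimage_setI AB preimage_set0.
Qed.

(** The range map is continuous and open, so it maps a compact neighbourhood of an identity arrow to
    a compact neighbourhood of the unit. *)
Lemma units_locally_compact : locally_compact [set: units G].
Proof.
move=> x _; rewrite withinET.
have [K Kc xK] := compact_nbhs (gpd_lc GP) (gid G x).
have rK : compact (@rng _ G @` K).
  apply: continuous_compact Kc; apply: continuous_subspaceT.
  exact: (rng_continuous GP).
exists (@rng _ G @` K); last first.
  by split => //; apply: compact_closed rK; exact: units_hausdorff.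
rewrite nbhsE in xK; case: xK => O [oO Ox] OK; rewrite nbhsE.
exists (@rng _ G @` O); last exact: image_subset.
by split; [exact: (rng_open GP)|exists (gid G x) => //; rewrite (rng_id GP)].
Qed.

End GroupoidLemmas.

Section EquivalenceLemmas.
Context {R : realType} {G H : groupoid_data R}.
Hypotheses (GP : is_lch_groupoid G) (HP : is_lch_groupoid H).
Variable Om : equivalence G H.

Lemma cvg_lact (Z : Type) (F : set_system Z) {FF : Filter F} (a : Z -> G)
    (b : Z -> Om) a0 b0 : a @ F --> a0 -> b @ F --> b0 -> src a0 = rho b0 ->
  (\forall z \near F, src (a z) = rho (b z)) ->
  lact (a z) (b z) @[z --> F] --> lact a0 b0.
Proof.
move=> aa bb ab nab.
apply: (within_cvg (h := fun z => (a z, b z)) (@lact_continuous _ _ _ Om) (x := (a0, b0))) => //.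
exact: cvg_pair.
Qed.

Lemma cvg_ract (Z : Type) (F : set_system Z) {FF : Filter F} (a : Z -> Om)
    (b : Z -> H) a0 b0 : a @ F --> a0 -> b @ F --> b0 -> sigma a0 = rng b0 ->
  (\forall z \near F, sigma (a z) = rng (b z)) ->
  ract (a z) (b z) @[z --> F] --> ract a0 b0.
Proof.
move=> aa bb ab nab.
apply: (within_cvg (h := fun z => (a z, b z)) (@ract_continuous _ _ _ Om) (x := (a0, b0))) => //.
exact: cvg_pair.
Qed.

Lemma ract_inj (h h' : H) (w : Om) : sigma w = rng h -> sigma w = rng h' ->
  ract w h = ract w h' -> h = h'.
Proof.
move=> sh sh' E.
have sg : src h = src h' by rewrite -(sigma_ract sh) E (sigma_ract sh').
have r1 : src h = rng (ginv h') by rewrite (rng_inv HP).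
have s1 : sigma w = rng (gmul h (ginv h')) by rewrite (rng_mul HP).
have /(ract_free s1) e : ract w (gmul h (ginv h')) = w.
  by rewrite ractA// E -ractA ?(rng_inv HP)// (gmulVr HP) -sh' ract1.
have : gmul (gmul h (ginv h')) h' = h' by rewrite e sh' (gmul1l HP).
rewrite -(gmulA HP) ?(rng_inv HP) ?(src_inv HP)//.
by rewrite (gmulVl HP) -sg (gmul1r HP).
Qed.

Lemma lact_inj (g g' : G) (w : Om) : src g = rho w -> src g' = rho w ->
  lact g w = lact g' w -> g = g'.
Proof.
move=> sg sg' E.
have rg : rng g = rng g' by rewrite -(rho_lact sg) E (rho_lact sg').
have s1 : src (gmul (ginv g) g') = rho w by rewrite (src_mul GP) ?(src_inv GP).
have /(lact_free s1) e : lact (gmul (ginv g) g') w = w.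
  rewrite lactA ?(src_inv GP)// -E -lactA ?(src_inv GP)// (gmulVl GP) sg; exact: lact1.
have := gmulKV GP rg; rewrite e -sg => <-.
by rewrite (gmul1r GP).
Qed.

Lemma lactK (g : G) (w : Om) : src g = rho w -> lact (ginv g) (lact g w) = w.
Proof.
by move=> sg; rewrite -lactA ?(src_inv GP)// (gmulVl GP) sg lact1.
Qed.

Lemma lactKV (g : G) (w : Om) : rng g = rho w -> lact g (lact (ginv g) w) = w.
Proof.
by move=> rg; rewrite -lactA ?(rng_inv GP) ?(src_inv GP)// (gmulVr GP) rg lact1.
Qed.

Lemma ractK (w : Om) (h : H) : sigma w = rng h -> ract (ract w h) (ginv h) = w.
Proof.
by move=> sh; rewrite -ractA ?(rng_inv HP)// (gmulVr HP) -sh ract1.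
Qed.

Lemma ractKV (w : Om) (h : H) : sigma w = src h -> ract (ract w (ginv h)) h = w.
Proof.
by move=> sh; rewrite -ractA ?(rng_inv HP) ?(src_inv HP)// (gmulVl HP) -sh ract1.
Qed.

(* Properness makes the quotient w^-1 w' of two elements with the same
   image under rho depend continuously on them. *)
Lemma cvg_rdiv (Z : Type) (F : set_system Z) {FF : Filter F} (w w' : Z -> Om)
    (h : Z -> H) w0 w0' h0 : w @ F --> w0 -> w' @ F --> w0' ->
  sigma w0 = rng h0 -> ract w0 h0 = w0' ->
  (\forall z \near F, sigma (w z) = rng (h z) /\ ract (w z) (h z) = w' z) ->
  h @ F --> h0.
Proof.
move=> ww ww' s0 e0 hyp.
have [K Kc wK] := compact_nbhs (@equiv_lc _ _ _ Om) w0.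
have [K' Kc' wK'] := compact_nbhs (@equiv_lc _ _ _ Om) w0'.
(* By properness the pairs with first entry in [K] and product in [K'] form a compact set, in which
   [(w z, h z)] eventually lies. It remains to see that this pair stays away from every point of the
   set except [(w0, h0)]. *)
have /compact_near_coveringP cov := ract_proper (compact_setX Kc Kc').
apply/cvg_nearP => U hU.
have inU : \forall z \near F, [set p : Om * H | sigma p.1 = rng p.2 /\
    (K `*` K') (p.1, ract p.1 p.2)] `<=` (fun p => (w z, h z) = p -> U p.2).
  apply: cov => -[a b] /= [sab _].
  have [[/= -> bh]|nab] := pselect (a = w0 /\ b = h0).
    exists ([set p : Om * H | U p.2], setT) => //=.
      split; last exact: filterT.
      by exists (setT, U) => /=; [split => //; [exact: filterT|rewrite bh]|move=> p []].
    by move=> [p z] /= [].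
  (* If [a] differs from [w0], the first entries are separated. If [a = w0] and [b] differs from
     [h0], freeness gives that [ract w0 b] differs from [w0'], and continuity of the action
     separates the products from [w' z]. *)
  have far : \forall q \near filter_prod (nbhs (a, b)) F, (w q.2, h q.2) <> q.1.
    have [aw|aw] := pselect (a = w0).
      have bn : ract a b <> w0'.
        move=> e; apply: nab; split=> //; subst a.
        by apply: (@ract_inj _ _ w0) => //; rewrite e0 e.
      have c1 : (fun q : (Om * H) * Z => ract q.1.1 q.1.2) @
          within [set q | sigma q.1.1 = rng q.1.2] (filter_prod (nbhs (a, b)) F) -->
          ract a b.
        apply: cvg_ract => //.
        - apply: (cvg_within_filter (f := fun q : (Om * H) * Z => q.1.1)).
          apply: (@cvg_comp _ _ _ fst fst _ (nbhs (a, b))); [exact: cvg_fst|exact: cvg_fst].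
        - apply: (cvg_within_filter (f := fun q : (Om * H) * Z => q.1.2)).
          apply: (@cvg_comp _ _ _ fst snd _ (nbhs (a, b))); [exact: cvg_fst|exact: cvg_snd].
        - exact: withinT.
      have c2 : (fun q : (Om * H) * Z => w' q.2) @
          within [set q | sigma q.1.1 = rng q.1.2] (filter_prod (nbhs (a, b)) F) --> w0'.
        apply: (cvg_within_filter (f := fun q : (Om * H) * Z => w' q.2)).
        by apply: (@cvg_comp _ _ _ snd w' _ F); [exact: cvg_snd|exact: ww'].
      have nD : \forall q \near filter_prod (nbhs (a, b)) F,
          sigma q.1.1 = rng q.1.2 -> ract q.1.1 q.1.2 <> w' q.2.
        exact: (@cvg_neq _ _ _ (within_filter _ _) _ _ _ _ (@equiv_hausdorff _ _ _ Om) c1 c2 bn).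
      have hyp2 : \forall q \near filter_prod (nbhs (a, b)) F,
          sigma (w q.2) = rng (h q.2) /\ ract (w q.2) (h q.2) = w' q.2.
        exact: near_snd hyp.
      suff : \forall q \near filter_prod (nbhs (a, b)) F, (w q.2, h q.2) <> q.1 by [].
      apply: filterS2 hyp2 nD => -[p z] /= [s1 e1] h1 e; subst p.
      by case: (h1 s1).
    have c1 : (fun q : (Om * H) * Z => q.1.1) @ (filter_prod (nbhs (a, b)) F) --> a.
      by apply: (@cvg_comp _ _ _ fst fst _ (nbhs (a, b))); [exact: cvg_fst|exact: cvg_fst].
    have c2 : (fun q : (Om * H) * Z => w q.2) @ (filter_prod (nbhs (a, b)) F) --> w0.
      by apply: (@cvg_comp _ _ _ snd w _ F); [exact: cvg_snd|exact: ww].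
    have nD : \forall q \near filter_prod (nbhs (a, b)) F, q.1.1 <> w q.2.
      by apply: (cvg_neq (@equiv_hausdorff _ _ _ Om) c1 c2 aw).
    by apply: filterS nD => -[p z] /= h1 e; apply: h1; rewrite -e.
  suff : \forall q \near filter_prod (nbhs (a, b)) F, (w q.2, h q.2) = q.1 -> U q.1.2 by [].
  by apply: filterS far => q h1 /h1.
have wK2 := (cvg_nearP _ _ _).1 ww _ wK.
have wK2' := (cvg_nearP _ _ _).1 ww' _ wK'.
near=> z.
have [s1 e1] : sigma (w z) = rng (h z) /\ ract (w z) (h z) = w' z by near: z.
have h1 : K (w z) by near: z.
have h2 : K' (w' z) by near: z.
have h3 : [set p : Om * H | sigma p.1 = rng p.2 /\
    (K `*` K') (p.1, ract p.1 p.2)] `<=` (fun p => (w z, h z) = p -> U p.2) by near: z.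
by apply: (h3 (w z, h z)) => //; rewrite /= e1.
Unshelve. all: by end_near. Qed.

Lemma sigma_ractV (h : H) (w : Om) : src h = sigma w -> sigma (ract w (ginv h)) = rng h.
Proof. by move=> sh; rewrite sigma_ract ?(src_inv HP)// (rng_inv HP). Qed.

Lemma rho_lactV (w : Om) (g : G) : rho w = rng g -> rho (lact (ginv g) w) = src g.
Proof. by move=> rg; rewrite rho_lact ?(src_inv GP)// (rng_inv GP). Qed.

Lemma gidV (K : groupoid_data R) (KP : is_lch_groupoid K) x : ginv (gid K x) = gid K x.
Proof.
have := gmulVl KP (gid K x); rewrite (src_id KP) => e; rewrite -[in RHS]e.
have := gmul1r KP (ginv (gid K x)); rewrite (src_inv KP) (rng_id KP).
by move=> ->.
Qed.

End EquivalenceLemmas.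

(** * The opposite equivalence *)

Section Opposite.
Context {R : realType} {G H : groupoid_data R}.
Hypotheses (GP : is_lch_groupoid G) (HP : is_lch_groupoid H).
Variable Om : equivalence G H.

Let lV (h : H) (w : Om) := ract w (ginv h).
Let rV (w : Om) (g : G) := lact (ginv g) w.

Let ract_injV h w : src h = sigma w -> lV h w = w -> h = gid H (sigma w).
Proof.
move=> sh e; have := ract_free (_ : sigma w = rng (ginv h)) e.
rewrite (rng_inv HP) => /(_ (esym sh)) e'.
by rewrite -[LHS](ginvK HP) e' (gidV HP).
Qed.

Let lact_injV w g : rho w = rng g -> rV w g = w -> g = gid G (rho w).
Proof.
move=> sh e; have := lact_free (_ : src (ginv g) = rho w) e.
rewrite (src_inv GP) => /(_ (esym sh)) e'.
by rewrite -[LHS](ginvK GP) e' (gidV GP).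
Qed.

Let lVA h h' w : src h = rng h' -> src h' = sigma w ->
  lV (gmul h h') w = lV h (lV h' w).
Proof.
move=> s1 s2; rewrite /lV (ginvM HP)// ractA ?(rng_inv HP)//.
by rewrite (src_inv HP).
Qed.

Let rVA w g g' : rho w = rng g -> src g = rng g' -> rV w (gmul g g') = rV (rV w g) g'.
Proof.
move=> s1 s2; rewrite /rV (ginvM GP)// lactA ?(src_inv GP)//.
by rewrite (rng_inv GP).
Qed.

Let lV_continuous : {within [set p : H * Om | src p.1 = sigma p.2],
  continuous (fun p : H * Om => lV p.1 p.2)}.
Proof.
apply/subspace_continuousP => -[h w] /= sh.
apply: cvg_ract => //.
- by apply: (cvg_within_filter (f := snd)); exact: cvg_snd.
- apply: (cvg_ginv HP); apply: (cvg_within_filter (f := fst)); exact: cvg_fst.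
- by rewrite (rng_inv HP).
- by apply: (filterS _ (withinT _ _)) => p /= e; rewrite (rng_inv HP).
Qed.

Let rV_continuous : {within [set p : Om * G | rho p.1 = rng p.2],
  continuous (fun p : Om * G => rV p.1 p.2)}.
Proof.
apply/subspace_continuousP => -[h w] /= sh.
apply: cvg_lact => //.
- apply: (cvg_ginv GP); apply: (cvg_within_filter (f := snd)); exact: cvg_snd.
- by apply: (cvg_within_filter (f := fst)); exact: cvg_fst.
- by rewrite (src_inv GP).
- by apply: (filterS _ (withinT _ _)) => p /= e; rewrite (src_inv GP).
Qed.

Let lV_proper (K : set (Om * Om)) : compact K ->
  compact [set p : H * Om | src p.1 = sigma p.2 /\ K (lV p.1 p.2, p.2)].
Proof.
move=> Kc.
have swc : continuous (fun p : Om * Om => (p.2, p.1)).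
  by move=> p; apply: cvg_pair; [exact: cvg_snd|exact: cvg_fst].
have Kc' : compact ((fun p : Om * Om => (p.2, p.1)) @` K).
  by apply: continuous_compact Kc; exact: continuous_subspaceT.
suff -> : [set p : H * Om | src p.1 = sigma p.2 /\ K (lV p.1 p.2, p.2)] =
   (fun p : Om * H => (ginv p.2, p.1)) @` [set p : Om * H | sigma p.1 = rng p.2 /\
     ((fun p : Om * Om => (p.2, p.1)) @` K) (p.1, ract p.1 p.2)].
  apply: continuous_compact (ract_proper Kc'); apply: continuous_subspaceT => p.
  apply: cvg_pair; last exact: cvg_fst.
  by apply: (cvg_ginv HP); exact: cvg_snd.
apply/seteqP; split => [[h w] /= [sh Kp]|_ [[w h] /= [sh [[a b] Kab [e1 e2]]] <-]].
  exists (w, ginv h) => /=; last by rewrite (ginvK HP).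
  by rewrite (rng_inv HP); split => //; exists (lV h w, w).
by rewrite (src_inv HP) /lV (ginvK HP) -e1 in e2 *; subst; split.
Qed.

Let rV_proper (K : set (Om * Om)) : compact K ->
  compact [set p : Om * G | rho p.1 = rng p.2 /\ K (p.1, rV p.1 p.2)].
Proof.
move=> Kc.
have swc : continuous (fun p : Om * Om => (p.2, p.1)).
  by move=> p; apply: cvg_pair; [exact: cvg_snd|exact: cvg_fst].
have Kc' : compact ((fun p : Om * Om => (p.2, p.1)) @` K).
  by apply: continuous_compact Kc; exact: continuous_subspaceT.
suff -> : [set p : Om * G | rho p.1 = rng p.2 /\ K (p.1, rV p.1 p.2)] =
   (fun p : G * Om => (p.2, ginv p.1)) @` [set p : G * Om | src p.1 = rho p.2 /\
     ((fun p : Om * Om => (p.2, p.1)) @` K) (lact p.1 p.2, p.2)].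
  apply: continuous_compact (lact_proper Kc'); apply: continuous_subspaceT => p.
  apply: cvg_pair; first exact: cvg_snd.
  by apply: (cvg_ginv GP); exact: cvg_fst.
apply/seteqP; split => [[w g] /= [sg Kp]|_ [[g w] /= [sg [[a b] Kab [e1 e2]]] <-]].
  exists (ginv g, w) => /=; last by rewrite (ginvK GP).
  by rewrite (src_inv GP); split => //; exists (w, rV w g).
by rewrite (rng_inv GP) /rV (ginvK GP); subst; split.
Qed.

Let sigma_injV (w w' : Om) : sigma w = sigma w' -> exists2 g, rho w = rng g & rV w g = w'.
Proof.
move=> /equiv_sigma_inj[g sg <-]; exists (ginv g); first by rewrite (rng_inv GP).
by rewrite /rV (ginvK GP).
Qed.

Let rho_injV (w w' : Om) : rho w = rho w' -> exists2 h, src h = sigma w & lV h w = w'.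
Proof.
move=> /equiv_rho_inj[g sg <-]; exists (ginv g); first by rewrite (src_inv HP).
by rewrite /lV (ginvK HP).
Qed.

(** The bimodule $\Omega^{-1}$. Results on [rho], the right action and [haar_eqv] yield through it
    their mirror images for [sigma], the left action and [haar_eqv_inv]. It is transparent because
    [haar_eqv] of the opposite has to compute to [haar_eqv_inv]. *)
Definition opp_equivalence : equivalence H G.
Proof.
refine (@Equivalence R H G Om (@sigma _ _ _ Om) (@rho _ _ _ Om) lV rV
  (@equiv_hausdorff _ _ _ Om) (@equiv_lc _ _ _ Om)
  (@sigma_continuous _ _ _ Om) (@rho_continuous _ _ _ Om)
  _ _ lVA lV_continuous _ _ rVA rV_continuous _ _ _ ract_injV lact_injV
  lV_proper rV_proper sigma_injV (@equiv_sigma_surj _ _ _ Om)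
  (@equiv_sigma_quot _ _ _ Om) rho_injV (@equiv_rho_surj _ _ _ Om)
  (@equiv_rho_quot _ _ _ Om)).
- by move=> h w sh; exact: sigma_ractV.
- by move=> w; rewrite /lV (gidV HP) ract1.
- by move=> w g sg; exact: rho_lactV.
- by move=> w; rewrite /rV (gidV GP) lact1.
- by move=> h w sh; rewrite /lV rho_ract// (rng_inv HP).
- by move=> w g sg; rewrite /rV sigma_lact// (src_inv GP).
- by move=> h w g sh sg; rewrite /lV /rV -lractA ?(rng_inv HP) ?(src_inv GP).
Defined.

End Opposite.

(** * The linking groupoid *)

Section LinkingGroupoid.
Context {R : realType} {G H : groupoid_data R}.
Hypotheses (GP : is_lch_groupoid G) (HP : is_lch_groupoid H).
Variable Om : equivalence G H.
Notation L := (linking Om).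
Notation aG g := (inl (inl g) : L).
Notation aW w := (inl (inr w) : L).
Notation aV w := (inr (inl w) : L).
Notation aH h := (inr (inr h) : L).

Local Arguments gmul : simpl never.

Lemma link_mulGG (g g' : G) : gmul (aG g) (aG g') = aG (gmul g g').
Proof. by []. Qed.
Lemma link_mulGW (g : G) (w : Om) : gmul (aG g) (aW w) = aW (lact g w).
Proof. by []. Qed.
Lemma link_mulWH (w : Om) (h : H) : gmul (aW w) (aH h) = aW (ract w h).
Proof. by []. Qed.
Lemma link_mulVG (w : Om) (g : G) : gmul (aV w) (aG g) = aV (lact (ginv g) w).
Proof. by []. Qed.
Lemma link_mulHV (h : H) (w : Om) : gmul (aH h) (aV w) = aV (ract w (ginv h)).
Proof. by []. Qed.
Lemma link_mulHH (h h' : H) : gmul (aH h) (aH h') = aH (gmul h h').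
Proof. by []. Qed.
Definition link_mulE :=
  (link_mulGG, link_mulGW, link_mulWH, link_mulVG, link_mulHV, link_mulHH).

(** In this case [link_mul] picks its value by choice; by freeness there is only one candidate. *)
Lemma link_mulWV (w w' : Om) (g : G) : src g = rho w -> lact g w = w' ->
  gmul (aW w') (aV w) = aG g.
Proof.
move=> sg gw; rewrite /gmul/=; case: xgetP => [c _ [g' [sg' gw' ->]]|/(_ (aG g)) []].
  by do 2 congr inl; apply: (lact_inj GP sg' sg); rewrite gw' gw.
by exists g.
Qed.

Lemma link_mulVW (w w' : Om) (h : H) : sigma w = rng h -> ract w h = w' ->
  gmul (aV w) (aW w') = aH h.
Proof.
move=> sg gw; rewrite /gmul/=; case: xgetP => [c _ [g' [sg' gw' ->]]|/(_ (aH h)) []].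
  by do 2 congr inr; apply: (ract_inj HP sg' sg); rewrite gw' gw.
by exists h.
Qed.

Let Gh := gpd_hausdorff GP.
Let Hh := gpd_hausdorff HP.
Let Gl := gpd_lc GP.
Let Hl := gpd_lc HP.
Let Wh := @equiv_hausdorff _ _ _ Om.
Let Wl := @equiv_lc _ _ _ Om.

Lemma link_rng_mul (a b : L) : src a = rng b -> rng (gmul a b) = rng a.
Proof.
case: a => [[g|w]|[w|h]]; case: b => [[g'|w']|[w'|h']] //= [] e; rewrite ?link_mulE/=.
- by rewrite (rng_mul GP).
- by rewrite rho_lact.
- have [g sg gw] := equiv_sigma_inj (esym e); rewrite (link_mulWV sg gw)/=.
  by rewrite -gw rho_lact.
- by rewrite rho_ract.
- by rewrite sigma_lact// (src_inv GP).
- have [h sh hw] := equiv_rho_inj e.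
  by rewrite (link_mulVW sh hw)/= sh.
- by rewrite sigma_ract ?(rng_inv HP)// (src_inv HP).
- by rewrite (rng_mul HP).
Qed.

Lemma link_src_mul (a b : L) : src a = rng b -> src (gmul a b) = src b.
Proof.
case: a => [[g|w]|[w|h]]; case: b => [[g'|w']|[w'|h']] //= [] e; rewrite ?link_mulE/=.
- by rewrite (src_mul GP).
- by rewrite sigma_lact.
- have [g sg gw] := equiv_sigma_inj (esym e); rewrite (link_mulWV sg gw)/=.
  by rewrite sg.
- by rewrite sigma_ract.
- by rewrite rho_lact ?(src_inv GP)// (rng_inv GP).
- have [h sh hw] := equiv_rho_inj e.
  by rewrite (link_mulVW sh hw)/= -hw sigma_ract.
- by rewrite rho_ract// (rng_inv HP).
- by rewrite (src_mul HP).
Qed.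

(** Sixteen composable patterns. Whenever a quotient $\omega'\omega^{-1}$ or $\omega^{-1}\omega'$
    occurs, it is named and replaced by the equation that characterizes it, which reduces the claim
    to the laws of the commuting actions. *)
Lemma link_mulA (a b c : L) : src a = rng b -> src b = rng c ->
  gmul a (gmul b c) = gmul (gmul a b) c.
Proof.
case: a => [[g|w]|[w|h]]; case: b => [[g'|w']|[w'|h']];
  case: c => [[g''|w'']|[w''|h'']] //= [] e [] e'; rewrite ?link_mulE/=.
- by rewrite (gmulA GP).
- by rewrite -lactA.
- have [k sk kw] := equiv_sigma_inj (esym e'); rewrite (link_mulWV sk kw).
  have rk : rng k = rho w' by rewrite -kw rho_lact.
  rewrite (@link_mulWV _ _ (gmul g k)) ?(src_mul GP) ?rk//.
  by rewrite lactA ?rk// kw.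
- by rewrite lractA.
- have [k sk kw] := equiv_sigma_inj (esym e); rewrite (link_mulWV sk kw).
  rewrite (@link_mulWV _ _ (gmul k g'')) ?(src_mul GP) ?sk//.
    by rewrite rho_lactV.
  by rewrite lactA ?sk ?rho_lactV// lactKV.
- have [k sk kw] := equiv_sigma_inj (esym e); rewrite (link_mulWV sk kw).
  have [h sh hw] := equiv_rho_inj e'.
  rewrite (link_mulVW sh hw)/=; congr (inl (inr _)).
  by rewrite -hw -kw lractA.
- have e2 : src h' = sigma w'' by [].
  have [k sk kw] : exists2 k, src k = rho w'' & lact k w'' = ract w h'.
    by apply: equiv_sigma_inj; rewrite sigma_ract.
  rewrite (link_mulWV sk kw).
  apply: link_mulWV; first by rewrite rho_ract ?(rng_inv HP).
  by rewrite lractA ?(rng_inv HP)// kw ractK.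
- by rewrite ractA.
- by rewrite (ginvM GP)// lactA ?(src_inv GP) ?(rng_inv GP).
- have [h sh hw] : exists2 h, sigma (lact (ginv g') w) = rng h &
      ract (lact (ginv g') w) h = w''.
    by apply: equiv_rho_inj; rewrite rho_lactV.
  rewrite (link_mulVW sh hw).
  apply: link_mulVW; first by rewrite -sh sigma_lact ?(src_inv GP).
  rewrite -hw lractA; last by rewrite -sh sigma_lact ?(src_inv GP).
    by rewrite lactKV.
  by rewrite rho_lactV.
- have [k sk kw] := equiv_sigma_inj (esym e'); rewrite (link_mulWV sk kw).
  have [h sh hw] := equiv_rho_inj e; rewrite (link_mulVW sh hw)/=.
  congr (inr (inl _)).
  have rk : rho w = rng k by rewrite e -kw rho_lact.
  have s2 : sigma w'' = sigma (ract w h) by rewrite hw.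
  have sh' : sigma w'' = src h by rewrite s2 sigma_ract.
  have: lact (ginv k) (ract w h) = w'' by rewrite hw -kw lactK.
  rewrite lractA ?(src_inv GP)// => <-.
  by rewrite ractK// sigma_lact ?(src_inv GP).
- have [h sh hw] := equiv_rho_inj e; rewrite (link_mulVW sh hw).
  rewrite (@link_mulVW _ _ (gmul h h'')) ?(rng_mul HP)//.
    by rewrite -e' -hw sigma_ract.
  by rewrite ractA ?hw// -e' -hw sigma_ract.
- by rewrite lractA ?(src_inv GP)// (rng_inv HP).
- have [k sk kw] := equiv_rho_inj e'; rewrite (link_mulVW sk kw).
  rewrite (@link_mulVW _ _ (gmul h k))//.
    by rewrite (rng_mul HP) ?sigma_ractV// e.
  by rewrite ractA ?sigma_ractV// ?e// ractKV.
- by rewrite (ginvM HP)// ractA ?(src_inv HP) ?(rng_inv HP).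
- by rewrite (gmulA HP).
Qed.

Let cvg_aG (Z : Type) (F : set_system Z) {FF : Filter F} (f : Z -> G) x :
  f @ F --> x -> (fun z => aG (f z)) @ F --> aG x.
Proof. by move=> fx; apply: cvg_inl; exact: cvg_inl. Qed.
Let cvg_aW (Z : Type) (F : set_system Z) {FF : Filter F} (f : Z -> Om) x :
  f @ F --> x -> (fun z => aW (f z)) @ F --> aW x.
Proof. by move=> fx; apply: cvg_inl; exact: cvg_inr. Qed.
Let cvg_aV (Z : Type) (F : set_system Z) {FF : Filter F} (f : Z -> Om) x :
  f @ F --> x -> (fun z => aV (f z)) @ F --> aV x.
Proof. by move=> fx; apply: cvg_inr; exact: cvg_inl. Qed.
Let cvg_aH (Z : Type) (F : set_system Z) {FF : Filter F} (f : Z -> H) x :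
  f @ F --> x -> (fun z => aH (f z)) @ F --> aH x.
Proof. by move=> fx; apply: cvg_inr; exact: cvg_inr. Qed.

Section CvgTo.
Context (Z : Type) (F : set_system Z) {FF : Filter F} (h : Z -> L).

Lemma cvg_toG x : h @ F --> aG x -> exists2 k : Z -> G, k @ F --> x &
  \forall z \near F, h z = aG (k z).
Proof.
move=> /cvg_sum_inl[k /cvg_sum_inl[l lx kl] hk]; exists l => //.
by apply: filterS2 kl hk => z -> ->.
Qed.
Lemma cvg_toW x : h @ F --> aW x -> exists2 k : Z -> Om, k @ F --> x &
  \forall z \near F, h z = aW (k z).
Proof.
move=> /cvg_sum_inl[k /cvg_sum_inr[l lx kl] hk]; exists l => //.
by apply: filterS2 kl hk => z -> ->.
Qed.
Lemma cvg_toV x : h @ F --> aV x -> exists2 k : Z -> Om, k @ F --> x &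
  \forall z \near F, h z = aV (k z).
Proof.
move=> /cvg_sum_inr[k /cvg_sum_inl[l lx kl] hk]; exists l => //.
by apply: filterS2 kl hk => z -> ->.
Qed.
Lemma cvg_toH x : h @ F --> aH x -> exists2 k : Z -> H, k @ F --> x &
  \forall z \near F, h z = aH (k z).
Proof.
move=> /cvg_sum_inr[k /cvg_sum_inr[l lx kl] hk]; exists l => //.
by apply: filterS2 kl hk => z -> ->.
Qed.
End CvgTo.

(** The four parts are open, so convergent arrows eventually stay in the part of their limit.
    Products within a part and with the actions are continuous by assumption; for the two quotients
    continuity is [cvg_rdiv], applied to the opposite equivalence for $\omega'\omega^{-1}$. *)
Lemma link_mul_cvg (Z : Type) (F : set_system Z) {FF : Filter F} (a b : Z -> L) a0 b0 :
  a @ F --> a0 -> b @ F --> b0 -> src a0 = rng b0 ->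
  (\forall z \near F, src (a z) = rng (b z)) ->
  gmul (a z) (b z) @[z --> F] --> gmul a0 b0.
Proof.
move=> aa bb.
case: a0 aa => [[g|w]|[w|h]] aa; case: b0 bb => [[g'|w']|[w'|h']] bb //= [] e.
- have [k ka ak] := cvg_toG aa; have [l lb bl] := cvg_toG bb => hyp.
  apply: (near_cvg (f := fun z => aG (gmul (k z) (l z)))).
    by apply: filterS2 ak bl => z -> ->.
  apply: cvg_aG; apply: (cvg_gmul GP) => //.
  by apply: filterS3 ak bl hyp => z -> -> [].
- have [k ka ak] := cvg_toG aa; have [l lb bl] := cvg_toW bb => hyp.
  apply: (near_cvg (f := fun z => aW (lact (k z) (l z)))).
    by apply: filterS2 ak bl => z -> ->.
  apply: cvg_aW; apply: cvg_lact => //.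
  by apply: filterS3 ak bl hyp => z -> -> [].
- have [k ka ak] := cvg_toW aa; have [l lb bl] := cvg_toV bb => hyp.
  have [g sg gw] := equiv_sigma_inj (esym e); rewrite (link_mulWV sg gw).
  (* A quotient exists only where the arrows are composable; elsewhere the limit [g] serves as a
     default. *)
  have ex z : exists q : G, sigma (l z) = sigma (k z) -> src q = rho (l z) /\ lact q (l z) = k z.
    have [e1|ne] := pselect (sigma (l z) = sigma (k z)); last by exists g.
    by have [q q1 q2] := equiv_sigma_inj e1; exists q.
  pose q z := sval (cid (ex z)).
  have qP : \forall z \near F, src (q z) = rho (l z) /\ lact (q z) (l z) = k z.
    apply: filterS3 ak bl hyp => z -> -> [] e1.
    by apply: (svalP (cid (ex z))).
  apply: (near_cvg (f := fun z => aG (q z))).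
    by apply: filterS3 ak bl qP => z -> -> [q1 q2]; rewrite (link_mulWV q1 q2).
  apply: cvg_aG.
  have inv_q : (fun z => ginv (q z)) @ F --> ginv g.
    apply: (@cvg_rdiv _ _ _ GP (opp_equivalence GP HP Om) Z F _ l k _ w' w) => //=.
    - by rewrite (rng_inv GP).
    - by rewrite (ginvK GP).
    - by apply: filterS qP => z [q1 q2]; rewrite (rng_inv GP) (ginvK GP).
  apply: (near_cvg (f := fun z => ginv (ginv (q z)))).
    by apply: filterE => z; rewrite (ginvK GP).
  rewrite -[g](ginvK GP); exact: cvg_ginv.
- have [k ka ak] := cvg_toW aa; have [l lb bl] := cvg_toH bb => hyp.
  apply: (near_cvg (f := fun z => aW (ract (k z) (l z)))).
    by apply: filterS2 ak bl => z -> ->.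
  apply: cvg_aW; apply: cvg_ract => //.
  by apply: filterS3 ak bl hyp => z -> -> [].
- have [k ka ak] := cvg_toV aa; have [l lb bl] := cvg_toG bb => hyp.
  apply: (near_cvg (f := fun z => aV (lact (ginv (l z)) (k z)))).
    by apply: filterS2 ak bl => z -> ->.
  apply: cvg_aV; apply: cvg_lact => //.
  + exact: (cvg_ginv GP).
  + by rewrite (src_inv GP).
  + by apply: filterS3 ak bl hyp => z -> -> [] e1; rewrite (src_inv GP).
- have [k ka ak] := cvg_toV aa; have [l lb bl] := cvg_toW bb => hyp.
  have [h sh hw] := equiv_rho_inj e.
  have ex z : exists q : H, rho (k z) = rho (l z) -> sigma (k z) = rng q /\ ract (k z) q = l z.
    have [e1|ne] := pselect (rho (k z) = rho (l z)); last by exists h.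
    by have [q q1 q2] := equiv_rho_inj e1; exists q.
  pose q z := sval (cid (ex z)).
  have qP : \forall z \near F, sigma (k z) = rng (q z) /\ ract (k z) (q z) = l z.
    apply: filterS3 ak bl hyp => z -> -> [] e1.
    by apply: (svalP (cid (ex z))).
  have -> := link_mulVW sh hw.
  apply: (near_cvg (f := fun z => aH (q z))).
    by apply: filterS3 ak bl qP => z -> -> [q1 q2]; rewrite -(link_mulVW q1 q2).
  apply: cvg_aH.
  exact: (cvg_rdiv HP ka lb sh hw qP).
- have [k ka ak] := cvg_toH aa; have [l lb bl] := cvg_toV bb => hyp.
  apply: (near_cvg (f := fun z => aV (ract (l z) (ginv (k z))))).
    by apply: filterS2 ak bl => z -> ->.
  apply: cvg_aV; apply: cvg_ract => //.
  + exact: (cvg_ginv HP).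
  + by rewrite (rng_inv HP).
  + by apply: filterS3 ak bl hyp => z -> -> [] e1; rewrite (rng_inv HP).
- have [k ka ak] := cvg_toH aa; have [l lb bl] := cvg_toH bb => hyp.
  apply: (near_cvg (f := fun z => aH (gmul (k z) (l z)))).
    by apply: filterS2 ak bl => z -> ->.
  apply: cvg_aH; apply: (cvg_gmul HP) => //.
  by apply: filterS3 ak bl hyp => z -> -> [].
Qed.

Lemma cvg_linking_ginv (Z : Type) (F : set_system Z) {FF : Filter F} (a : Z -> L) a0 :
  a @ F --> a0 -> ginv (a z) @[z --> F] --> ginv a0.
Proof.
case: a0 => [[g|w]|[w|h]] aa.
- have [k kc ke] := cvg_toG aa.
  apply: (near_cvg (f := fun z => aG (ginv (k z)))).
    by apply: filterS ke => z /= ->.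
  by apply: cvg_aG; exact: cvg_ginv.
- have [k kc ke] := cvg_toW aa.
  apply: (near_cvg (f := fun z => aV (k z))); first by apply: filterS ke => z /= ->.
  exact: cvg_aV.
- have [k kc ke] := cvg_toV aa.
  apply: (near_cvg (f := fun z => aW (k z))); first by apply: filterS ke => z /= ->.
  exact: cvg_aW.
- have [k kc ke] := cvg_toH aa.
  apply: (near_cvg (f := fun z => aH (ginv (k z)))).
    by apply: filterS ke => z /= ->.
  by apply: cvg_aH; exact: cvg_ginv.
Qed.

End LinkingGroupoid.

(** As [rho] is a quotient map, the saturation of [U] under [H] has to be open. If [ract w1 h] lies
    in [U] and [w'] is near [w1], openness of the range map of [H] gives [h'] near [h] that is
    composable with [w'], and [ract w' h'] is again in [U]. *)
Lemma rho_open (R : realType) (G H : groupoid_data R) (HP : is_lch_groupoid H)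
    (Om : equivalence G H) (U : set Om) : open U -> open (@rho _ _ _ Om @` U).
Proof.
move=> oU; apply: (equiv_rho_quot (e := Om)).
rewrite openE => w1 [w Uw wE].
have [h sh hw] := equiv_rho_inj (esym wE).
have c : (fun p : Om * H => ract p.1 p.2) @
    within [set p : Om * H | sigma p.1 = rng p.2] (nbhs (w1, h)) --> ract w1 h.
  apply: cvg_ract => //.
  - by apply: (cvg_within_filter (f := fst)); exact: cvg_fst.
  - by apply: (cvg_within_filter (f := snd)); exact: cvg_snd.
  - exact: withinT.
have wU : nbhs (ract w1 h) U by rewrite hw; exact: open_nbhs_nbhs.
have [[A V] /= [Aw Vh] AV] := (cvg_nearP _ _ _).1 c _ wU.
rewrite nbhsE in Vh; case: Vh => V' [oV' V'h] V'V.
have sV : nbhs (sigma w1) (@rng _ H @` V').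
  by apply: open_nbhs_nbhs; split; [exact: (rng_open HP)|exists h].
have near1 : \forall w' \near w1, (@rng _ H @` V') (sigma w').
  by apply: (@sigma_continuous _ _ _ Om w1).
apply: filterS2 Aw near1 => w' Aw' [h' V'h' s'].
exists (ract w' h'); last by rewrite rho_ract.
by apply: (AV (w', h')) => //; split => //; exact: V'V.
Qed.

Lemma sigma_open (R : realType) (G H : groupoid_data R) (GP : is_lch_groupoid G)
    (HP : is_lch_groupoid H) (Om : equivalence G H) (U : set Om) :
  open U -> open (@sigma _ _ _ Om @` U).
Proof. by move=> oU; apply: (rho_open GP (Om := opp_equivalence GP HP Om)). Qed.

Section LinkingLCH.
Context {R : realType} {G H : groupoid_data R}.
Hypotheses (GP : is_lch_groupoid G) (HP : is_lch_groupoid H).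
Variable Om : equivalence G H.
Notation L := (linking Om).

Let open_link (U : set L) : open U -> [/\ open [set g | U (inl (inl g))],
  open [set w | U (inl (inr w))], open [set w | U (inr (inl w))] &
  open [set h | U (inr (inr h))]].
Proof. by move=> [[? ?] [? ?]]; split. Qed.

Lemma linking_lch : is_lch_groupoid (linking Om).
Proof.
have Wh := @equiv_hausdorff _ _ _ Om; have Wl := @equiv_lc _ _ _ Om.
have Gh := gpd_hausdorff GP; have Gl := gpd_lc GP.
have Hh := gpd_hausdorff HP; have Hl := gpd_lc HP.
split.
- by apply: sum_hausdorff; exact: sum_hausdorff.
- by apply: sum_locally_compact; [exact: sum_hausdorff|exact: sum_hausdorff|
    exact: sum_locally_compact|exact: sum_locally_compact].
- by case=> x /=; rewrite ?(rng_id GP) ?(rng_id HP).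
- by case=> x /=; rewrite ?(src_id GP) ?(src_id HP).
- exact: link_rng_mul.
- exact: link_src_mul.
- exact: link_mulA.
- case=> [[g|w]|[w|h]] /=; rewrite ?link_mulE.
  + by rewrite (gmul1l GP).
  + by rewrite lact1.
  + by rewrite (gidV HP) ract1.
  + by rewrite (gmul1l HP).
- case=> [[g|w]|[w|h]] /=; rewrite ?link_mulE.
  + by rewrite (gmul1r GP).
  + by rewrite ract1.
  + by rewrite (gidV GP) lact1.
  + by rewrite (gmul1r HP).
- by case=> [[g|w]|[w|h]] /=; rewrite ?(rng_inv GP) ?(rng_inv HP).
- by case=> [[g|w]|[w|h]] /=; rewrite ?(src_inv GP) ?(src_inv HP).
- case=> [[g|w]|[w|h]] /=; rewrite ?link_mulE.
  + by rewrite (gmulVr GP).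
  + by apply: (link_mulWV GP); rewrite ?(src_id GP) ?lact1.
  + by apply: (link_mulVW HP); rewrite ?(rng_id HP) ?ract1.
  + by rewrite (gmulVr HP).
- case=> [[g|w]|[w|h]] /=; rewrite ?link_mulE.
  + by rewrite (gmulVl GP).
  + by apply: (link_mulVW HP); rewrite ?(rng_id HP) ?ract1.
  + by apply: (link_mulWV GP); rewrite ?(src_id GP) ?lact1.
  + by rewrite (gmulVl HP).
- apply: sum_continuous => x.
    by apply: cvg_inl; apply: cvg_inl; exact: (gid_continuous GP).
  by apply: cvg_inr; apply: cvg_inr; exact: (gid_continuous HP).
- apply: sum_continuous; apply: sum_continuous => x.
  + by apply: cvg_inl; exact: (rng_continuous GP).
  + by apply: cvg_inl; exact: rho_continuous.
  + by apply: cvg_inr; exact: sigma_continuous.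
  + by apply: cvg_inr; exact: (rng_continuous HP).
- apply: sum_continuous; apply: sum_continuous => x.
  + by apply: cvg_inl; exact: (src_continuous GP).
  + by apply: cvg_inr; exact: sigma_continuous.
  + by apply: cvg_inl; exact: rho_continuous.
  + by apply: cvg_inr; exact: (src_continuous HP).
- by move=> a; apply: (cvg_linking_ginv GP HP (F := nbhs a) (a := id)); exact: cvg_id.
- apply/subspace_continuousP => -[a b] /= ab.
  apply: link_mul_cvg => //.
  + by apply: (cvg_within_filter (f := fst)); exact: cvg_fst.
  + by apply: (cvg_within_filter (f := snd)); exact: cvg_snd.
  + exact: withinT.
- move=> U /open_link[UG UW UV UH]; split.
    suff -> : inl @^-1` (@rng _ L @` U) =
       (@rng _ G @` [set g | U (inl (inl g))]) `|` (@rho _ _ _ Om @` [set w | U (inl (inr w))]).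
      by apply: openU; [exact: (rng_open GP)|exact: rho_open].
    apply/seteqP; split=> [x [[[g|w]|[w|h]] Ua //= [<-]]|x [] [g Ug <-]].
    + by left; exists g.
    + by right; exists w.
    + by exists (inl (inl g)).
    + by exists (inl (inr g)).
  suff -> : inr @^-1` (@rng _ L @` U) =
     (@sigma _ _ _ Om @` [set w | U (inr (inl w))]) `|` (@rng _ H @` [set w | U (inr (inr w))]).
    by apply: openU; [exact: sigma_open|exact: (rng_open HP)].
  apply/seteqP; split=> [x [[[g|w]|[w|h]] Ua //= [<-]]|x [] [g Ug <-]].
  + by left; exists w.
  + by right; exists h.
  + by exists (inr (inl g)).
  + by exists (inr (inr g)).
- move=> U /open_link[UG UW UV UH]; split.
    suff -> : inl @^-1` (@src _ L @` U) =
       (@src _ G @` [set g | U (inl (inl g))]) `|` (@rho _ _ _ Om @` [set w | U (inr (inl w))]).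
      by apply: openU; [exact: (src_open GP)|exact: rho_open].
    apply/seteqP; split=> [x [[[g|w]|[w|h]] Ua //= [<-]]|x [] [g Ug <-]].
    + by left; exists g.
    + by right; exists w.
    + by exists (inl (inl g)).
    + by exists (inr (inl g)).
  suff -> : inr @^-1` (@src _ L @` U) =
     (@sigma _ _ _ Om @` [set w | U (inl (inr w))]) `|` (@src _ H @` [set w | U (inr (inr w))]).
    by apply: openU; [exact: sigma_open|exact: (src_open HP)].
  apply/seteqP; split=> [x [[[g|w]|[w|h]] Ua //= [<-]]|x [] [g Ug <-]].
  + by left; exists w.
  + by right; exists h.
  + by exists (inl (inr g)).
  + by exists (inr (inr g)).
Qed.

End LinkingLCH.

(** * The Haar system of the linking groupoid *)

Lemma closed_eq (T U : topologicalType) (f g : T -> U) : hausdorff_space U ->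
  continuous f -> continuous g -> closed [set x | f x = g x].
Proof.
move=> Uh fc gc; rewrite -openC openE => x /= fg.
exact: (cvg_neq Uh (fc x) (gc x) fg).
Qed.

Section TrivialField.
Context {R : realType} {X : topologicalType}.
Local Notation C := R[i].

(** The trivial line field, with the continuous functions as sections: through it the lemmas on
    parametrized integrals of sections apply to scalar functions. *)
Definition Cfield (x : X) : completeNormedModType C := cscalar R.

Definition continuous_scalars : set (forall x : X, Cfield x) :=
  [set f | continuous (f : X -> C^o)].

Lemma continuous_scalars_usc : usc_field (E := Cfield) continuous_scalars.
Proof.
split.
- by move=> x; exact: cvg_cst.
- move=> k f g fc gc x; apply: cvgD; last exact: gc.
  by apply: cvgZr; exact: fc.
- move=> x; apply/dense_nrmP => v e e0; exists v; last by rewrite subrr nrm0.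
  by exists (fun=> v) => // y; exact: cvg_cst.
- move=> f fc x c fx; rewrite nrmE in fx.
  have /gt0C[d d0 cE] : 0 < c - (nrm (f x))%:C by rewrite subr_gt0.
  have /cvgC/(_ d d0) := fc x; apply: filterS => y yd.
  have -> : c = (d + nrm (f x))%:C by rewrite rmorphD/= -cE subrK.
  rewrite nrm_lt; have := nrm_dist (f y) (f x) 0; rewrite !subr0; lra.
- move=> f fa x; apply/cvgC => e e0.
  have e30 : 0 < e / 3 by rewrite divr_gt0.
  have e30' : 0 < (e / 3)%:C by rewrite ltcR.
  have [g gc fg] := fa x _ e30'.
  have /cvgC/(_ _ e30) := gc x.
  have fgx : nrm (f x - g x) <= e / 3 by have := nbhs_singleton fg; rewrite /= nrm_le.
  apply: filterS2 fg => y; rewrite nrm_le => h1 h2.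
  have := nrm_dist (f y) (g y) (f x); have := nrm_dist (g y) (g x) (f x).
  rewrite (nrmB (g x) (f x)); lra.
Qed.

Lemma scalar_bcv (Z : Type) (F : set_system Z) {FF : Filter F} (p : Z -> X) x0
    (f : Z -> C^o) (c : C^o) : p @ F --> x0 -> f @ F --> c ->
  @bcv R X Cfield continuous_scalars Z F p f x0 c.
Proof.
move=> px /cvgC fc; split=> // e e0; exists (fun=> c); split.
- by move=> y; exact: cvg_cst.
- by rewrite subrr nrm0 ltW.
- by apply: filterS (fc e e0) => z /ltW.
Qed.

Lemma bcv_scalar (Z : Type) (F : set_system Z) {FF : Filter F} (p : Z -> X) x0
    (f : Z -> C^o) (c : C^o) :
  @bcv R X Cfield continuous_scalars Z F p f x0 c -> f @ F --> c.
Proof.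
move=> h; apply/cvgC => e e0.
apply: (bcv_near continuous_scalars_usc (b := fun=> c) h).
  by move=> y; exact: cvg_cst.
by rewrite subrr nrm0.
Qed.
End TrivialField.

Section MoreHint.
Context {R : realType} {X : topologicalType}.
Local Notation C := R[i].
Hypotheses (Xh : hausdorff_space X) (Xl : locally_compact [set: X]).
Variable mu : (X -> C) -> C.
Hypothesis muR : radon mu.

(** Compared with the definition of [hint], the bound [P] need not be a test function but only has
    an integral. Bounds of the form [p] composed with a map are of this kind, as their support need
    not be compact. *)
Lemma hint_approx (V : normedModType C) (F : X -> V) v :
  (forall e, 0 < e -> exists F' v' (P : X -> R) (c : C), [/\ hint mu F' v',
    hint mu (fun x => (P x)%:C : C^o) (c : C^o),
    forall x, msupport mu x -> nrm (F x - F' x) <= P x,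
    complex.Re c <= e & nrm (v - v') <= e]) -> hint mu F v.
Proof.
move=> H e e0; have e40 : 0 < e / 4 by rewrite divr_gt0.
have [F' [v' [P [c [Fv' Pc FF ce vv]]]]] := H _ e40.
have [S [s [p [Ss pC Sp pe se]]]] := Fv' _ e40.
have [T [t [q [[n [phi [d [phiC TE tE]]]] qC Tq qe te]]]] := Pc _ e40.
have ReS (c' : 'I_n -> R) : complex.Re (\sum_i (c' i)%:C *: (d i : C^o)) =
    \sum_i complex.Re (d i) * c' i.
  elim: n {phi TE tE phiC} d c' => [|n IH] d c'; first by rewrite !big_ord0.
  rewrite !big_ord_recl -IH; case: (d ord0) => a b; set z := \sum_i _.
  by case: z => z1 z2 /=; rewrite mul0r subr0 mulrC.
pose r x := \sum_i complex.Re (d i) * phi i x.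
have rC : rCc r by apply: rCc_sum => i; exact: rCcZ.
have rE : rint mu r = complex.Re t.
  rewrite tE ReS /r rint_sum//; last by move=> i; exact: rCcZ.
  by apply: eq_bigr => i _; rewrite rintZ.
have Re_t : complex.Re t <= complex.Re c + e / 4.
  have := Re_le_nrm (c - t); have -> : complex.Re (c - t) = complex.Re c - complex.Re t.
    by case: (c) (t) => ? ? [].
  by rewrite ler_norml => /andP[h3 _]; have := le_trans _ te; lra.
exists S, s, (fun x => p x + (r x + q x)); split => //.
- exact: rCcD pC (rCcD _ _).
- move=> x sx; have h1 := Sp x sx; have h2 := FF x sx.
  have h3 : P x <= r x + q x.
    have := Tq x sx; rewrite TE /r -ReS; set z := \sum_i _ => h.
    have := Re_le_nrm ((P x)%:C - z).
    have -> : complex.Re ((P x)%:C - z) = P x - complex.Re z by case: z {h}.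
    by rewrite ler_norml => /andP[_ h4]; have := le_trans h4 h; lra.
  by have := nrm_dist (F x) (F' x) (S x); lra.
- rewrite !rintD//; last exact: rCcD.
  lra.
- by have := nrm_dist v v' s; lra.
Qed.

(** An identity of integrals known for scalar test functions passes to vector-valued integrands,
    since approximants and bounds are transported along [j]. Translations by arrows and orbit maps
    are the cases of interest. *)
Lemma hint_push (Y : topologicalType) (nu : (Y -> C) -> C) (nuR : radon nu)
    (j : X -> Y) (V : normedModType C) (F : Y -> V) v :
  (forall x, msupport mu x -> msupport nu (j x)) ->
  (forall f, rCc f -> hint mu (fun x => (f (j x))%:C : C^o) ((rint nu f)%:C : C^o)) ->
  hint nu F v -> hint mu (fun x => F (j x)) v.
Proof.
move=> js jh Fv; apply: hint_approx => e e0.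
have [S [s [p [[n [phi [d [phiC SE sE]]]] pC Sp pe se]]]] := Fv _ e0.
exists (fun x => \sum_i (phi i (j x))%:C *: d i), s, (fun x => p (j x)), (rint nu p)%:C.
split => //.
- rewrite sE; apply: hint_sum => // i.
  apply: (hint_map (T := fun z : C^o => z *: d i) (M := nrm (d i)) _ _ _ _ (jh _ (phiC i))) => //.
  + by move=> k a b; rewrite scalerDl scalerA.
  + exact: nrm_ge0.
  + by move=> a; rewrite nrmZ mulrC.
- exact: jh.
- by move=> x /js sx; have := Sp _ sx; rewrite SE.
Qed.

(** For the inclusion [j] of a summand, integrals are carried to the larger space by extending the
    test functions by zero. *)
Lemma hint_extend (Y : topologicalType) (nu : (Y -> C) -> C) (nuR : radon nu)
    (j : X -> Y) (ext : (X -> R) -> (Y -> R)) (V : normedModType C) (F : Y -> V) v :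
  (forall f, rCc f -> rCc (ext f) /\ rint nu (ext f) = rint mu f) ->
  (forall f x, ext f (j x) = f x) ->
  (forall f y, ~ (exists x, y = j x) -> ext f y = 0) ->
  (forall x, msupport nu (j x) -> msupport mu x) ->
  (forall y, msupport nu y -> ~ (exists x, y = j x) -> F y = 0) ->
  hint mu (fun x => F (j x)) v -> hint nu F v.
Proof.
move=> extC extj extN sj FN Fv e e0.
have [S [s [p [[n [phi [d [phiC SE sE]]]] pC Sp pe se]]]] := Fv _ e0.
exists (fun y => \sum_i (ext (phi i) y)%:C *: d i), s, (ext p); split => //.
- exists n, (fun i => ext (phi i)), d; split => //.
    by move=> i; case: (extC _ (phiC i)).
  by rewrite sE; apply: eq_bigr => i _; case: (extC _ (phiC i)) => _ ->.
- by case: (extC _ pC).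
- move=> y sy; have [[x yx]|ny] := pselect (exists x, y = j x); last first.
    rewrite FN// extN// big1 ?subrr ?nrm0// => i _; by rewrite extN// scale0r.
  rewrite yx extj; under eq_bigr do rewrite extj.
  by have := Sp x; rewrite SE; apply; apply: sj; rewrite -yx.
- by case: (extC _ pC) => _ ->.
Qed.

End MoreHint.

Section HaarLemmas.
Context {R : realType} {G : groupoid_data R}.
Local Notation C := R[i].
Hypotheses (GP : is_lch_groupoid G) (GH : is_haar_system G).
Let Gh := gpd_hausdorff GP.
Let Gl := gpd_lc GP.

Lemma msupport_haar x g : msupport (haar G x) g <-> rng g = x.
Proof. by rewrite (haar_supp GH). Qed.

Lemma haar_rcont f : rCc f -> continuous (fun x => rint (haar G x) f).
Proof. by move=> /Cc_real/(haar_cont GH)/Cc_Re[]. Qed.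

Lemma compact_gmul (K L : set G) : compact K -> compact L ->
  compact [set g | exists a b, [/\ K a, L b, src a = rng b & g = gmul a b]].
Proof.
move=> Kc Lc.
suff -> : [set g | exists a b, [/\ K a, L b, src a = rng b & g = gmul a b]] =
  (fun p : G * G => gmul p.1 p.2) @` ((K `*` L) `&` [set p | src p.1 = rng p.2]).
  apply: continuous_compact.
    apply: continuous_subspaceW (gmul_continuous GP).
    by move=> p [].
  apply: compact_closedI; first exact: compact_setX.
  apply: closed_eq; first exact: (units_hausdorff GP).
    by move=> p; apply: (cvg_src GP); exact: cvg_fst.
  by move=> p; apply: (cvg_rng GP); exact: cvg_snd.
apply/seteqP; split => [g [a [b [Ka Lb e ->]]]|_ [[a b] /= [[Ka Lb] e] <-]].
  by exists (a, b).
by exists a, b.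
Qed.

Lemma compact_ginv (K : set G) : compact K -> compact [set g | K (ginv g)].
Proof.
move=> Kc.
suff -> : [set g | K (ginv g)] = (@ginv _ G) @` K.
  by apply: continuous_compact Kc; apply: continuous_subspaceT; exact: (ginv_continuous GP).
apply/seteqP; split => [g Kg|_ [g Kg <-]] /=; last by rewrite (ginvK GP).
by exists (ginv g) => //; rewrite (ginvK GP).
Qed.

(** The product [gmul k] is meaningful only for arrows with range [src k], so the translate of [f]
    is not a test function. On the support of [mu] it is continuous, and it vanishes there off the
    preimage of the compact set of products of [ginv k] with arrows in the support of [f]. *)
Lemma hint_translate (X : topologicalType) (mu : (X -> C) -> C) (j : X -> G)
    (f : G -> C) (k : G) : hausdorff_space X -> locally_compact [set: X] -> radon mu ->
  continuous j -> (forall K, compact K -> compact (j @^-1` K)) ->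
  (forall x, msupport mu x -> src k = rng (j x)) -> Cc f ->
  exists v, hint mu (fun x => f (gmul k (j x)) : C^o) v.
Proof.
move=> Xh Xl muR jc jK js [fc [K Kc fK]].
pose L : set G := [set g | exists a b, [/\ [set ginv k] a, K b, src a = rng b & g = gmul a b]].
have Lc : compact L by apply: compact_gmul => //; exact: compact_set1.
suff : exists v : cscalar R, hint mu (fun x => f (gmul k (j x)) : cscalar R) v.
  by move=> [v h]; exists v.
apply: (hint_exists muR Xh Xl (jK _ Lc)) => [x sx nL|x0 e _ sx e0].
  apply: fK => Kx; apply: nL; exists (ginv k), (gmul k (j x)); split => //.
    by rewrite (src_inv GP) (rng_mul GP)//; exact: js.
  by rewrite (gmulVK GP)//; exact: js.
have c : (fun x => f (gmul k (j x)) : C^o) @ within (msupport mu) (nbhs x0) -->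
    (f (gmul k (j x0)) : C^o).
  apply: (@cvg_comp _ _ _ (fun x => gmul k (j x)) f _ (nbhs (gmul k (j x0)))); last exact: fc.
  apply: (cvg_gmul GP) => //.
  - exact: cvg_cst.
  - by apply: cvg_within_filter; exact: jc.
  - exact: js.
  - by apply: (filterS _ (withinT _ _)) => x; exact: js.
have h : \forall x \near x0, msupport mu x ->
    nrm (f (gmul k (j x)) - f (gmul k (j x0)) : cscalar R) < e.
  exact: ((cvgC (within_filter _ _) _ _).1 c _ e0).
by apply: filterS h => x h /h/ltW.
Qed.

(** Left invariance is postulated for scalar test functions; [hint_push] extends it to vector-valued
    integrals. *)
Lemma hint_haar_inv (V : normedModType C) (k : G) (F : G -> V) v :
  hint (haar G (rng k)) F v -> hint (haar G (src k)) (fun g => F (gmul k g)) v.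
Proof.
apply: (hint_push (haar_radon GH _) (haar_radon GH _)).
  by move=> g /msupport_haar e; apply/msupport_haar; rewrite (rng_mul GP).
move=> f fR; have fC := Cc_real fR.
have [|||v' hv'] := @hint_translate G (haar G (src k)) id (fun g => (f g)%:C) k Gh Gl (haar_radon GH _) _ _ _ fC.
- by move=> x; exact: cvg_id.
- by [].
- by move=> x /msupport_haar.
have := haar_inv GH k fC.
rewrite /cintegral (integralE (haar_radon GH _) Gh Gl hv') (mu_rint (haar_radon GH _) fR).
by move=> ->.
Qed.

End HaarLemmas.

Section HaarEquivalence.
Context {R : realType} {G H : groupoid_data R}.
Local Notation C := R[i].
Hypotheses (GP : is_lch_groupoid G) (HP : is_lch_groupoid H) (HH : is_haar_system H).
Variable Om : equivalence G H.
Let Hh := gpd_hausdorff HP.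
Let Hl := gpd_lc HP.
Let Wh := @equiv_hausdorff _ _ _ Om.
Let Wl := @equiv_lc _ _ _ Om.

Lemma compact_ract (K L : set Om) : compact K -> compact L ->
  compact [set h | exists w, [/\ K w, sigma w = rng h & L (ract w h)]].
Proof.
move=> Kc Lc; have := ract_proper (compact_setX Kc Lc).
set A := [set p | _] => Ac.
suff -> : [set h | exists w, [/\ K w, sigma w = rng h & L (ract w h)]] = snd @` A.
  apply: continuous_compact Ac; apply: continuous_subspaceT => p; exact: cvg_snd.
apply/seteqP; split => [h [w [Kw e Lw]]|_ [[w h] [/= e [Kw Lw]] <-]].
  by exists (w, h).
by exists w.
Qed.

Let orbit_bcv (phi : Om -> C) (w : Om) (h : H) : continuous (phi : Om -> C^o) ->
  sigma w = rng h ->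
  @bcv R (units H) (@Cfield R _) (continuous_scalars) _
    (within [set zg | rng zg.2 = sigma zg.1] (nbhs (w, h)))
    (fun zg : Om * H => sigma zg.1) (fun zg => phi (ract zg.1 zg.2)) (sigma w)
    (phi (ract w h)).
Proof.
move=> phic e; apply: scalar_bcv.
  apply: cvg_within_filter.
  apply: (@cvg_comp _ _ _ (@fst Om H) (@sigma _ _ _ Om) _ (nbhs w)); first exact: cvg_fst.
  exact: sigma_continuous.
apply: (@cvg_comp _ _ _ (fun zg : Om * H => ract zg.1 zg.2) phi _ (nbhs (ract w h)));
  last exact: phic.
apply: cvg_ract => //.
- by apply: (cvg_within_filter (f := fst)); exact: cvg_fst.
- by apply: (cvg_within_filter (f := snd)); exact: cvg_snd.
- by apply: (filterS _ (withinT _ _)) => p /=.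
Qed.

Let orbit_exists (phi : Om -> C) (w : Om) : Cc phi ->
  exists v, hint (haar H (sigma w)) (fun h => phi (ract w h) : C^o) v.
Proof.
move=> [phic [K Kc phiK]].
have Lc := compact_ract (@compact_set1 _ w) Kc.
suff : exists v : Cfield (sigma w), hint (haar H (sigma w))
    (fun h => phi (ract w h) : Cfield (sigma w)) v.
  by move=> [v hv]; exists v.
apply: (fibre_integral (X := units H) (E := @Cfield R _) (S := @continuous_scalars R _)
  Hh Hl (r := @rng _ H) (haar_radon HH) (haar_supp HH) (x := sigma w) Lc) => [h e nL|h Lh e].
  by apply: phiK => Kw; apply: nL; exists w.
apply: (@bcv_comp R (units H) (@Cfield R _) (@continuous_scalars R _) _ _ _ _
  (within [set h' | rng h' = sigma w] (nbhs h)) _ (fun h' => (w, h'))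
  (fun zg : Om * H => sigma zg.1) (fun zg => phi (ract zg.1 zg.2)) _ _ _
  (orbit_bcv phic (esym e))).
move=> A /=; rewrite /within/= => hA.
have c : (fun h => (w, h)) @ nbhs h --> (w, h) by apply: cvg_pair; [exact: cvg_cst|exact: cvg_id].
by have := (cvg_nearP _ _ _).1 c _ hA.
Qed.

(** The base point hidden in [haar_eqv] has the form [ract w k] for some [k]; left invariance of the
    Haar system of [H] under [k] gives the same integral at [w]. *)
Lemma haar_eqvE (phi : Om -> C) (w : Om) : Cc phi ->
  hint (haar H (sigma w)) (fun h => phi (ract w h) : C^o) (haar_eqv (rho w) phi : C^o).
Proof.
move=> phiC; rewrite /haar_eqv.
set P := [set c | _].
have [w' ww' ->] : P (xget 0 P).
  by apply: xgetPex; exists (cintegral (haar H (sigma w)) (fun h => phi (ract w h))), w.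
have [k sk kw] := equiv_rho_inj (esym ww').
have [v hv] := orbit_exists w' phiC.
rewrite /cintegral (integralE (haar_radon HH _) Hh Hl hv).
have sk' : sigma w' = src k by rewrite -kw sigma_ract.
rewrite sk' in hv.
have [v2 hv2] := orbit_exists w phiC.
suff -> : v = v2 by [].
have hv3 := hv2; rewrite sk in hv3.
have hv4 := hint_haar_inv HP HH hv3.
apply: (hint_uniq (haar_radon HH _) Hh Hl hv hv4) => h.
rewrite (msupport_haar HH) => e; rewrite -kw ractA//.
Qed.

Lemma haar_eqv_radon x : radon (haar_eqv (Om := Om) x).
Proof.
have [w <-] := equiv_rho_surj Om x.
split.
- move=> k f g fC gC.
  have fgC : Cc (fun x => k * f x + g x).
    have [fc [K Kc fK]] := fC; have [gc [L Lc gL]] := gC; split.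
      move=> y; apply: (@cvgD _ C^o); last exact: gc.
      by apply: (@cvgMr C); exact: fc.
    exists (K `|` L); first exact: compactU.
    by move=> y /not_orP[/fK -> /gL ->]; rewrite mulr0 addr0.
  apply: (hint_uniq (haar_radon HH _) Hh Hl (haar_eqvE w fgC)
    (hintD (haar_radon HH _) k (haar_eqvE w fC) (haar_eqvE w gC))).
  by [].
- move=> f fC f0; have hf := haar_eqvE w fC.
  have fE h : f h = (complex.Re (f h))%:C.
    by rewrite RRe_real// ger0_real.
  have hf' : hint (haar H (sigma w)) (fun h => (complex.Re (f (ract w h)))%:C : C^o)
      (haar_eqv (rho w) f : C^o).
    by apply: hint_ext hf => h _; rewrite -fE.
  rewrite (hint_real (haar_radon HH _) Hh Hl hf') ler0c.
  have := hint_lower (haar_radon HH _) Hh Hl hf' (@rCc0 R H).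
  rewrite rint0; last exact: haar_radon.
  apply => h _; by have := f0 (ract w h); rewrite {1}fE ler0c.
Qed.

(** Continuity is shown first for the function of [w], as a parametrized integral; it depends on
    [rho w] only and descends along the quotient map [rho]. *)
Lemma haar_eqv_cont (phi : Om -> C) : Cc phi -> Cc (fun x => haar_eqv (Om := Om) x phi).
Proof.
move=> phiC; have [phic [K Kc phiK]] := phiC; split.
  have cont : continuous (fun w : Om => haar_eqv (rho w) phi : C^o).
    move=> w0.
    have [A Ac wA] := compact_nbhs Wl w0.
    have Lc := compact_ract Ac Kc.
    apply: (@bcv_scalar R (units H) Om (nbhs w0) _ (@sigma _ _ _ Om) (sigma w0)).
    apply: (parametrized_integral (@continuous_scalars_usc R _) (units_hausdorff HP) Hh Hl
      (r := @rng _ H) (rng_continuous HP) (haar_radon HH) (haar_supp HH) (haar_rcont HH)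
      (Phi := fun w h => phi (ract w h)) Lc).
    - exact: sigma_continuous.
    - by move=> w; exact: haar_eqvE.
    - apply: filterS wA => w Aw h e nL; apply: phiK => Kw; apply: nL.
      by exists w.
    - by move=> h Lh e; apply: orbit_bcv.
  apply/continuousP => U oU; apply: (equiv_rho_quot (e := Om)).
  by have /continuousP/(_ _ oU) := cont.
exists (@rho _ _ _ Om @` K).
  by apply: continuous_compact Kc; apply: continuous_subspaceT; exact: rho_continuous.
move=> x nK; have [w wx] := equiv_rho_surj Om x; subst x.
apply: (hint_uniq (haar_radon HH _) Hh Hl (haar_eqvE w phiC) (hint0 (haar_radon HH _))).
move=> h; rewrite (msupport_haar HH) => e; apply: phiK => Kw; apply: nK.
by exists (ract w h) => //; rewrite rho_ract.
Qed.

(** The integrand [f (ract w h)] has the value [f w] at the identity arrow at [sigma w], which lies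
    in the support, and so is at least [f w / 2] around it. *)
Lemma haar_eqv_gt0 (f : Om -> R) (w : Om) : rCc f -> (forall w, 0 <= f w) -> 0 < f w ->
  0 < rint (haar_eqv (rho w)) f.
Proof.
move=> fC f0 fw; have hf := haar_eqvE w (Cc_real fC).
apply: (hint_gt0 (haar_radon HH _) Hh Hl (c := f w / 2) (x1 := gid H (sigma w)) hf).
- by [].
- by apply/(msupport_haar HH); rewrite (rng_id HP).
- by rewrite divr_gt0.
have c : (fun h => f (ract w h)) @ within [set h | sigma w = rng h] (nbhs (gid H (sigma w)))
    --> f (ract w (gid H (sigma w))).
  apply: (@cvg_comp _ _ _ (fun h => ract w h) f _ (nbhs (ract w (gid H (sigma w)))));
    last by case: fC => fc _; exact: fc.
  apply: cvg_ract.
  - exact: cvg_cst.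
  - by apply: cvg_within_filter; exact: cvg_id.
  - by rewrite (rng_id HP).
  - exact: withinT.
rewrite ract1 in c.
have f20 : 0 < f w / 2 by rewrite divr_gt0.
have h : \forall h \near gid H (sigma w), sigma w = rng h -> `|f w - f (ract w h)| < f w / 2.
  by move/cvgrPdist_lt : c => /(_ _ f20).
apply: filterS h => h hh; rewrite (msupport_haar HH) => e.
by have := hh (esym e); rewrite ltr_norml => /andP[_]; lra.
Qed.

Lemma msupport_eqv x : msupport (haar_eqv (Om := Om) x) = [set w | rho w = x].
Proof.
apply/seteqP; split=> w /=; last first.
  move=> <- U oU Uw; have [u [uC u01 u1 uU]] := bump (R := R) Wh Wl (open_nbhs_nbhs (conj oU Uw)).
  exists (fun w => (u w)%:C); split; first exact: Cc_real.
    by move=> y Uy; have [->//|/uU] := eqVneq (u y) 0.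
  rewrite (mu_rint (haar_eqv_radon _))//; apply/eqP => /(@complexI R) e.
  have : 0 < rint (haar_eqv (rho w)) u.
    apply: haar_eqv_gt0 => //; first by move=> y; case/andP: (u01 y).
    by rewrite (nbhs_singleton u1).
  by rewrite e ltxx.
move=> sw; apply: contrapT => nw.
have oU : open (~` [set w : Om | rho w = x]).
  rewrite openC; apply: (@closed_eq Om (units G) (@rho _ _ _ Om) (fun=> x)).
  - exact: units_hausdorff.
  - exact: rho_continuous.
  - by move=> y; exact: cvg_cst.
have [f [fC fU]] := sw _ oU nw.
have [w' e] := equiv_rho_surj Om x; subst x.
suff -> : haar_eqv (rho w') f = 0 by rewrite eqxx.
apply: (hint_uniq (haar_radon HH _) Hh Hl (haar_eqvE w' fC) (hint0 (haar_radon HH _))).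
move=> h; rewrite (msupport_haar HH) => e; apply: fU => /=; apply.
by rewrite rho_ract.
Qed.

Lemma hint_eqv_push (V : normedModType C) (F : Om -> V) v w :
  hint (haar_eqv (rho w)) F v -> hint (haar H (sigma w)) (fun h => F (ract w h)) v.
Proof.
apply: (hint_push (haar_radon HH _) (haar_eqv_radon _)).
  by move=> h; rewrite (msupport_haar HH) msupport_eqv /= => e; rewrite rho_ract.
move=> f fC; rewrite -(mu_rint (haar_eqv_radon _))//.
by apply: haar_eqvE; exact: Cc_real.
Qed.

Lemma haar_eqv0 x : haar_eqv (Om := Om) x (fun=> 0) = 0.
Proof.
have [w <-] := equiv_rho_surj Om x.
apply: (hint_uniq (haar_radon HH _) Hh Hl (haar_eqvE w _) (hint0 (haar_radon HH _))) => //.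
exact: (Cc_real (@rCc0 R Om)).
Qed.

(** The integral over the fibre of [rng g] may be based at [lact g w], which has the same [sigma] as
    [w]; since the actions commute, $\lambda_\Omega$ is invariant under the left action. *)
Lemma hint_eqv_lact (phi : Om -> C) g v : Cc phi ->
  hint (haar_eqv (src g)) (fun w => phi (lact g w) : C^o) v ->
  v = haar_eqv (Om := Om) (rng g) phi.
Proof.
move=> phiC hv; have [w wg] := equiv_rho_surj Om (src g).
rewrite -wg in hv; have hw := hint_eqv_push hv.
have := haar_eqvE (lact g w) phiC; rewrite rho_lact// sigma_lact// => hw'.
apply: (hint_uniq (haar_radon HH _) Hh Hl hw hw') => h.
by rewrite (msupport_haar HH) => e; rewrite lractA.
Qed.

End HaarEquivalence.

Section SumExtension.
Context {R : realType} {X Y : topologicalType}.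
Local Notation C := R[i].

Definition extl (T : zmodType) (f : X -> T) (a : X + Y) : T :=
  if a is inl x then f x else 0.
Definition extr (T : zmodType) (f : Y -> T) (a : X + Y) : T :=
  if a is inr x then f x else 0.

Lemma compact_preinl (K : set (X + Y)) : compact K -> compact (inl @^-1` K).
Proof.
move=> Kc F FF FK.
have [[x|y] [Kp cp]] := Kc (inl @ F) _ FK.
  exists x; split => // A B FA xB.
  have FA' : F (inl @^-1` (@inl X Y @` A)).
    by apply: filterS FA => z Az; exists z.
  have [_ [[a Aa <-] [b Bb [ab]]]] := cp _ _ FA' (nbhs_inl xB).
  by exists a; split => //; rewrite -ab.
have FA' : F (inl @^-1` (@inl X Y @` setT)).
  by apply: (@filterS _ F _ setT); [move=> z _; exists z|exact: filterT].
have [_ [[a _ <-] [b _]]] := cp _ _ FA' (nbhs_inr (filterT : nbhs y setT)).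
by [].
Qed.

Lemma compact_preinr (K : set (X + Y)) : compact K -> compact (inr @^-1` K).
Proof.
move=> Kc F FF FK.
have [[x|y] [Kp cp]] := Kc (inr @ F) _ FK; last first.
  exists y; split => // A B FA xB.
  have FA' : F (inr @^-1` (@inr X Y @` A)).
    by apply: filterS FA => z Az; exists z.
  have [_ [[a Aa <-] [b Bb [ab]]]] := cp _ _ FA' (nbhs_inr xB).
  by exists a; split => //; rewrite -ab.
have FA' : F (inr @^-1` (@inr X Y @` setT)).
  by apply: (@filterS _ F _ setT); [move=> z _; exists z|exact: filterT].
have [_ [[a _ <-] [b _]]] := cp _ _ FA' (nbhs_inl (filterT : nbhs x setT)).
by [].
Qed.

Lemma rCc_extl (f : X -> R) : rCc f -> rCc (extl f).
Proof.
move=> [fc [K Kc fK]]; split; first by apply: sum_continuous => // y; exact: cvg_cst.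
exists (inl @` K); first exact: compact_inl.
by move=> [x|y] nK //=; apply: fK => Kx; apply: nK; exists x.
Qed.

Lemma rCc_extr (f : Y -> R) : rCc f -> rCc (extr f).
Proof.
move=> [fc [K Kc fK]]; split; first by apply: sum_continuous => // y; exact: cvg_cst.
exists (inr @` K); first exact: compact_inr.
by move=> [x|y] nK //=; apply: fK => Kx; apply: nK; exists y.
Qed.

Lemma Cc_extl (f : X -> C) : Cc f -> Cc (extl f).
Proof.
move=> fC; apply: Cc_ReIm; [have := rCc_extl (Cc_Re fC)|have := rCc_extl (Cc_Im fC)];
  by congr rCc; apply/funext; case.
Qed.

Lemma Cc_extr (f : Y -> C) : Cc f -> Cc (extr f).
Proof.
move=> fC; apply: Cc_ReIm; [have := rCc_extr (Cc_Re fC)|have := rCc_extr (Cc_Im fC)];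
  by congr rCc; apply/funext; case.
Qed.

Lemma Cc_inl (f : X + Y -> C) : Cc f -> Cc (fun x => f (inl x)).
Proof.
move=> [fc [K Kc fK]]; split.
  move=> x; apply: (@cvg_comp _ _ _ inl f _ (nbhs (inl x : X + Y))); last exact: fc.
  exact: continuous_inl.
by exists (inl @^-1` K); [exact: compact_preinl|move=> x /fK].
Qed.

Lemma Cc_inr (f : X + Y -> C) : Cc f -> Cc (fun x => f (inr x)).
Proof.
move=> [fc [K Kc fK]]; split.
  move=> x; apply: (@cvg_comp _ _ _ inr f _ (nbhs (inr x : X + Y))); last exact: fc.
  exact: continuous_inr.
by exists (inr @^-1` K); [exact: compact_preinr|move=> x /fK].
Qed.

End SumExtension.

Lemma mu_supp0 (R : realType) (X : topologicalType) (mu : (X -> R[i]) -> R[i])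
    (f : X -> R[i]) : hausdorff_space X -> locally_compact [set: X] -> radon mu ->
  Cc f -> (forall x, msupport mu x -> f x = 0) -> mu f = 0.
Proof.
move=> Xh Xl muR fC f0.
exact: (hint_uniq muR Xh Xl (hint_Cc muR fC) (hint0 muR)).
Qed.

Section LinkingHaar.
Context {R : realType} {G H : groupoid_data R}.
Local Notation C := R[i].
Hypotheses (GP : is_lch_groupoid G) (HP : is_lch_groupoid H).
Hypotheses (GH : is_haar_system G) (HH : is_haar_system H).
Variable Om : equivalence G H.
Notation L := (linking Om).
Notation aG g := (inl (inl g) : L).
Notation aW w := (inl (inr w) : L).
Notation aV w := (inr (inl w) : L).
Notation aH h := (inr (inr h) : L).
Let OV := opp_equivalence GP HP Om.

Let Gh := gpd_hausdorff GP.
Let Gl := gpd_lc GP.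
Let Hh := gpd_hausdorff HP.
Let Hl := gpd_lc HP.
Let Wh := @equiv_hausdorff _ _ _ Om.
Let Wl := @equiv_lc _ _ _ Om.
Let LP := linking_lch GP HP Om.
Let Lh := gpd_hausdorff LP.
Let Ll := gpd_lc LP.

Let muG x := haar_radon GH x.
Let muH x := haar_radon HH x.
Let muW x := haar_eqv_radon HP HH Om x.
Let muV y : radon (haar_eqv_inv (Om := Om) y) := haar_eqv_radon GP GH OV y.

Let supW x : msupport (haar_eqv (Om := Om) x) = [set w | rho w = x].
Proof. exact: msupport_eqv. Qed.
Let supV x : msupport (haar_eqv_inv (Om := Om) x) = [set w | sigma w = x].
Proof. exact: (msupport_eqv HP GP GH OV). Qed.

Let CcG (f : L -> C) : Cc f -> Cc (fun g => f (aG g)).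
Proof. by move=> fC; exact: (Cc_inl (f := fun z => f (inl z)) (Cc_inl fC)). Qed.
Let CcW (f : L -> C) : Cc f -> Cc (fun g => f (aW g)).
Proof. by move=> fC; exact: (Cc_inr (f := fun z => f (inl z)) (Cc_inl fC)). Qed.
Let CcV (f : L -> C) : Cc f -> Cc (fun g => f (aV g)).
Proof. by move=> fC; exact: (Cc_inl (f := fun z => f (inr z)) (Cc_inr fC)). Qed.
Let CcH (f : L -> C) : Cc f -> Cc (fun g => f (aH g)).
Proof. by move=> fC; exact: (Cc_inr (f := fun z => f (inr z)) (Cc_inr fC)). Qed.

Let link_radon x : radon (haar L x).
Proof.
split.
  move=> k f g fC gC; case: x => x /=.
    rewrite (mu_lin (muG x) k (CcG fC) (CcG gC)) (mu_lin (muW x) k (CcW fC) (CcW gC)).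
    by rewrite mulrDr addrACA.
  rewrite (mu_lin (muH x) k (CcH fC) (CcH gC)) (mu_lin (muV x) k (CcV fC) (CcV gC)).
  by rewrite mulrDr addrACA.
move=> f fC f0; case: x => x /=; apply: addr_ge0.
- by apply: (radon_pos (muG x)) => //; exact: CcG.
- by apply: (radon_pos (muW x)) => //; exact: CcW.
- by apply: (radon_pos (muV x)) => //; exact: CcV.
- by apply: (radon_pos (muH x)) => //; exact: CcH.
Qed.

Let haar0 (K : groupoid_data R) (KP : is_lch_groupoid K) (KH : is_haar_system K) x :
  haar K x (fun=> 0) = 0.
Proof.
apply: (mu_supp0 (gpd_hausdorff KP) (gpd_lc KP) (haar_radon KH x)) => //.
exact: (Cc_real (@rCc0 R K)).
Qed.

Let eqv0 x : haar_eqv (Om := Om) x (fun=> 0) = 0.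
Proof. exact: haar_eqv0. Qed.
Let eqv_inv0 x : haar_eqv_inv (Om := Om) x (fun=> 0) = 0.
Proof. exact: (haar_eqv0 GP GH OV). Qed.

Let link_supp x : msupport (haar L x) = [set a | rng a = x].
Proof.
apply/seteqP; split => [a sa|a /= <- U [[oG oW] [oV oH]] Ua].
  apply: contrapT => na.
  have oU : open (~` [set a : L | rng a = x]).
    rewrite openC; apply: (@closed_eq L (units L) (@rng _ L) (fun=> x)).
    - exact: (units_hausdorff LP).
    - exact: (rng_continuous LP).
    - by move=> y; apply: (@cvg_cst (units L) x L (nbhs (y : L))).
  have [f [fC fU]] := sa _ oU na.
  have f0 b : rng b = x -> f b = 0 by move=> e; apply: fU => /=; apply.
  suff -> : haar L x f = 0 by rewrite eqxx.
  case: x f0 {fU oU na sa} => x f0 /=.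
    rewrite (mu_supp0 Gh Gl (muG x) (CcG fC)); last first.
      by move=> g; rewrite (haar_supp GH) /= => e; rewrite f0//= e.
    rewrite (mu_supp0 Wh Wl (muW x) (CcW fC)) ?addr0// => w.
    by rewrite supW /= => e; rewrite f0//= e.
  rewrite (mu_supp0 Wh Wl (muV x) (CcV fC)); last first.
    by move=> w; rewrite supV /= => e; rewrite f0//= e.
  rewrite (mu_supp0 Hh Hl (muH x) (CcH fC)) ?addr0// => g.
  by rewrite (haar_supp HH) /= => e; rewrite f0//= e.
case: a Ua => [[g|w]|[w|h]] Ua /=.
- have sg : msupport (haar G (rng g)) g by rewrite (haar_supp GH).
  have [f [fC fU f1]] := sg _ oG Ua.
  exists (extl (extl f)); split; first by do 2 apply: Cc_extl.
    by move=> [[b|b]|b] nU //=; exact: fU.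
  by rewrite /= eqv0 addr0.
- have sg : msupport (haar_eqv (Om := Om) (rho w)) w by rewrite supW.
  have [f [fC fU f1]] := sg _ oW Ua.
  exists (extl (extr f)); split; first by apply: Cc_extl; apply: Cc_extr.
    by move=> [[b|b]|b] nU //=; exact: fU.
  by rewrite /= (haar0 GP GH) add0r.
- have sg : msupport (haar_eqv_inv (Om := Om) (sigma w)) w by rewrite supV.
  have [f [fC fU f1]] := sg _ oV Ua.
  exists (extr (extl f)); split; first by apply: Cc_extr; apply: Cc_extl.
    by move=> [b|[b|b]] nU //=; exact: fU.
  by rewrite /= (haar0 HP HH) addr0.
- have sg : msupport (haar H (rng h)) h by rewrite (haar_supp HH).
  have [f [fC fU f1]] := sg _ oH Ua.
  exists (extr (extr f)); split; first by do 2 apply: Cc_extr.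
    by move=> [b|[b|b]] nU //=; exact: fU.
  by rewrite /= eqv_inv0 add0r.
Qed.

Let CcD (X : topologicalType) (f g : X -> C) : Cc f -> Cc g -> Cc (fun x => f x + g x).
Proof.
move=> [fc [K Kc fK]] [gc [K' Kc' gK]]; split.
  by move=> x; apply: (@cvgD _ C^o); [exact: fc|exact: gc].
exists (K `|` K'); first exact: compactU.
by move=> x /not_orP[/fK -> /gK ->]; rewrite addr0.
Qed.

Let link_cont f : Cc f -> Cc (fun x => haar L x f).
Proof.
move=> fC.
have c1 := CcD (haar_cont GH (CcG fC)) (haar_eqv_cont HP HH (Om := Om) (CcW fC)).
have c2 := CcD (haar_eqv_cont GP GH (Om := OV) (CcV fC)) (haar_cont HH (CcH fC)).
have := CcD (Cc_extl (Y := units H) c1) (Cc_extr (X := units G) c2).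
by congr Cc; apply/funext => -[x|x]; rewrite /= ?addr0 ?add0r.
Qed.

Section Parts.
Context {V : normedModType C}.

(** The Haar measure of the linking groupoid at a unit of [G] is a sum over two open parts;
    integrals over the parts are extended by zero and added. *)
Lemma hint_linkl x (F : L -> V) v1 v2 : hint (haar G x) (fun g => F (aG g)) v1 ->
  hint (haar_eqv (Om := Om) x) (fun w => F (aW w)) v2 ->
  hint (haar L (inl x)) F (v1 + v2).
Proof.
move=> h1 h2.
have k1 : hint (haar L (inl x)) (fun a : L => if a is inl (inl g) then F (aG g) else 0) v1.
  apply: (hint_extend (mu := haar G x) (link_radon _) (j := fun g => aG g)
    (ext := fun f => extl (extl f))) => //.
  - move=> f fC; split; first by do 2 apply: rCc_extl.
    by rewrite /rint /= eqv0 addr0.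
  - by move=> f [[g|w]|b] // nj; case: nj; exists g.
  - by move=> g; rewrite link_supp (haar_supp GH) => -[].
  - by move=> [[g|w]|b] // _ nj; case: nj; exists g.
have k2 : hint (haar L (inl x)) (fun a : L => if a is inl (inr w) then F (aW w) else 0) v2.
  apply: (hint_extend (mu := haar_eqv (Om := Om) x) (link_radon _) (j := fun w => aW w)
    (ext := fun f => extl (extr f))) => //.
  - move=> f fC; split; first by apply: rCc_extl; apply: rCc_extr.
    by rewrite /rint /= (haar0 GP GH) add0r.
  - by move=> f [[g|w]|b] // nj; case: nj; exists w.
  - by move=> g; rewrite link_supp supW => -[].
  - by move=> [[g|w]|b] // _ nj; case: nj; exists w.
have := hintD (link_radon _) 1 k1 k2; rewrite scale1r; apply: hint_ext.
by move=> a; rewrite link_supp; case: a => [[g|w]|[w|h]] //= _; rewrite scale1r ?addr0 ?add0r.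
Qed.

Lemma hint_linkr x (F : L -> V) v1 v2 : hint (haar_eqv_inv (Om := Om) x) (fun w => F (aV w)) v1 ->
  hint (haar H x) (fun h => F (aH h)) v2 ->
  hint (haar L (inr x)) F (v1 + v2).
Proof.
move=> h1 h2.
have k1 : hint (haar L (inr x)) (fun a : L => if a is inr (inl w) then F (aV w) else 0) v1.
  apply: (hint_extend (mu := haar_eqv_inv (Om := Om) x) (link_radon _) (j := fun w => aV w)
    (ext := fun f => extr (extl f))) => //.
  - move=> f fC; split; first by apply: rCc_extr; apply: rCc_extl.
    by rewrite /rint /= (haar0 HP HH) addr0.
  - by move=> f [b|[g|w]] // nj; case: nj; exists g.
  - by move=> g; rewrite link_supp supV => -[].
  - by move=> [b|[g|w]] // _ nj; case: nj; exists g.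
have k2 : hint (haar L (inr x)) (fun a : L => if a is inr (inr w) then F (aH w) else 0) v2.
  apply: (hint_extend (mu := haar H x) (link_radon _) (j := fun w => aH w)
    (ext := fun f => extr (extr f))) => //.
  - move=> f fC; split; first by do 2 apply: rCc_extr.
    by rewrite /rint /= eqv_inv0 add0r.
  - by move=> f [b|[g|w]] // nj; case: nj; exists w.
  - by move=> g; rewrite link_supp (haar_supp HH) => -[].
  - by move=> [b|[g|w]] // _ nj; case: nj; exists w.
have := hintD (link_radon _) 1 k1 k2; rewrite scale1r; apply: hint_ext.
by move=> a; rewrite link_supp; case: a => [[g|w]|[w|h]] //= _; rewrite scale1r ?addr0 ?add0r.
Qed.

End Parts.

Let transl (X : topologicalType) (mu : (X -> C) -> C) (j : X -> L) (f : L -> C) (k : L) :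
  hausdorff_space X -> locally_compact [set: X] -> radon mu -> continuous j ->
  (forall K, compact K -> compact (j @^-1` K)) ->
  (forall x, msupport mu x -> src k = rng (j x)) -> Cc f ->
  exists v, hint mu (fun x => f (gmul k (j x)) : C^o) v.
Proof. by move=> h1 h2 h3 h4 h5 h6 h7; exact: (hint_translate LP h1 h2 h3 h4 h5 h6 h7). Qed.

Let contG : continuous (fun g => aG g).
Proof. by move=> x; apply: cvg_inl; exact: continuous_inl. Qed.
Let contW : continuous (fun g => aW g).
Proof. by move=> x; apply: cvg_inl; exact: continuous_inr. Qed.
Let contV : continuous (fun g => aV g).
Proof. by move=> x; apply: cvg_inr; exact: continuous_inl. Qed.
Let contH : continuous (fun g => aH g).
Proof. by move=> x; apply: cvg_inr; exact: continuous_inr. Qed.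
Let compW (K : set L) : compact K -> compact ((fun g => aW g) @^-1` K).
Proof. by move=> Kc; exact: (compact_preinr (compact_preinl Kc)). Qed.
Let compV (K : set L) : compact K -> compact ((fun g => aV g) @^-1` K).
Proof. by move=> Kc; exact: (compact_preinl (compact_preinr Kc)). Qed.
Let eqvE := @haar_eqvE _ _ _ HP HH Om.
Let eqvVE := @haar_eqvE _ _ _ GP GH OV.

(** Translation by [w] carries the part $\Omega^{-1}$ of the fibre at [sigma w] to $\mathcal
    G^{\rho(\omega)}$ and the part in [H] to $\Omega$; the two identities are then [haar_eqvE] for
    the opposite equivalence and for the given one. Arrows of [G] and [H] preserve both parts, by
    invariance of the Haar systems and by [hint_eqv_lact]. *)
Let link_inv a f : Cc f -> haar L (rng a) f =
  cintegral (haar L (src a)) (fun b => f (gmul a b)).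
Proof.
move=> fC; apply/esym.
have intE x v F : hint (haar L x) (F : L -> C^o) v -> cintegral (haar L x) F = v.
  exact: (integralE (link_radon _) Lh Ll).
case: a => [[g|w]|[w|h]]; apply: intE.
- apply: hint_linkl.
    exact: (hint_haar_inv GP GH (hint_Cc (haar_radon GH _) (CcG fC))).
  have [v hv] := @transl _ _ _ _ (aG g) Wh Wl (muW (src g)) contW compW
    (fun w => ltac:(rewrite supW /= => ->; reflexivity)) fC.
  by rewrite -(hint_eqv_lact GP HP HH (CcW fC) hv).
- apply: hint_linkr; last exact: eqvE (CcW fC).
  have [v hv] := @transl _ _ _ _ (aW w) Wh Wl (muV (sigma w)) contV compV
    (fun w' => ltac:(rewrite supV /= => ->; reflexivity)) fC.
  suff <- : v = haar G (rho w) (fun g => f (aG g)) by [].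
  have hv' := hint_eqv_push HP GP GH (Om := OV) (w := w) hv.
  apply: (hint_uniq (muG _) Gh Gl hv' (hint_Cc (muG _) (CcG fC))) => g.
  rewrite (haar_supp GH) /= => e; congr f.
  by apply: (link_mulWV GP); [rewrite rho_lactV|rewrite lactKV].
- apply: hint_linkl; first exact: eqvVE (CcV fC).
  have [v hv] := @transl _ _ _ _ (aV w) Wh Wl (muW (rho w)) contW compW
    (fun w' => ltac:(rewrite supW /= => ->; reflexivity)) fC.
  suff <- : v = haar H (sigma w) (fun g => f (aH g)) by [].
  have hv' := hint_eqv_push GP HP HH hv.
  apply: (hint_uniq (muH _) Hh Hl hv' (hint_Cc (muH _) (CcH fC))) => h.
  rewrite (haar_supp HH) /= => e; congr f.
  by apply: (link_mulVW HP).
- apply: hint_linkr.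
    have [v hv] := @transl _ _ _ _ (aH h) Wh Wl (muV (src h)) contV compV
      (fun w => ltac:(rewrite supV /= => ->; reflexivity)) fC.
    suff <- : v = haar_eqv_inv (Om := Om) (rng h) (fun w => f (aV w)) by [].
    exact: (hint_eqv_lact HP GP GH (Om := OV) (CcV fC) hv).
  exact: (hint_haar_inv HP HH (hint_Cc (haar_radon HH _) (CcH fC))).
Qed.

Lemma linking_haar : is_haar_system L.
Proof. by split; [exact: link_radon|exact: link_supp|exact: link_cont|exact: link_inv]. Qed.

Lemma haar_extG x (f : G -> C) : haar L (inl x) (extG f) = haar G x f.
Proof. by rewrite /= eqv0 addr0. Qed.

Lemma haar_extH x (f : H -> C) : haar L (inr x) (extH f) = haar H x f.
Proof. by rewrite /= eqv_inv0 add0r. Qed.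

End LinkingHaar.

(** * The induced algebra and the linking algebra *)

Section HintUpper.
Context {R : realType} {X : topologicalType}.
Local Notation C := R[i].
Hypotheses (Xh : hausdorff_space X) (Xl : locally_compact [set: X]).
Variable mu : (X -> C) -> C.
Hypothesis muR : radon mu.

(** Turns a bound that merely has an integral, such as the integrand of a convolution, into a test
    function of almost the same integral, as [hint_dist] requires. *)
Lemma hint_upper (P : X -> R) (c : C) (e : R) :
  hint mu (fun x => (P x)%:C : C^o) (c : C^o) -> 0 < e ->
  exists th, [/\ rCc th, forall x, msupport mu x -> P x <= th x &
    rint mu th <= complex.Re c + e].
Proof.
move=> Pc e0; have e40 : 0 < e / 2 by rewrite divr_gt0.
have [T [t [q [[n [phi [d [phiC TE tE]]]] qC Tq qe te]]]] := Pc _ e40.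
have ReS (c' : 'I_n -> R) : complex.Re (\sum_i (c' i)%:C *: (d i : C^o)) =
    \sum_i complex.Re (d i) * c' i.
  elim: n {phi TE tE phiC} d c' => [|n IH] d c'; first by rewrite !big_ord0.
  rewrite !big_ord_recl -IH; case: (d ord0) => a b; set z := \sum_i _.
  by case: z => z1 z2 /=; rewrite mul0r subr0 mulrC.
pose r x := \sum_i complex.Re (d i) * phi i x.
have rC : rCc r by apply: rCc_sum => i; exact: rCcZ.
have rE : rint mu r = complex.Re t.
  rewrite tE ReS /r rint_sum//; last by move=> i; exact: rCcZ.
  by apply: eq_bigr => i _; rewrite rintZ.
have Re_t : complex.Re t <= complex.Re c + e / 2.
  have := Re_le_nrm (c - t); have -> : complex.Re (c - t) = complex.Re c - complex.Re t.
    by case: (c) (t) => ? ? [].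
  by rewrite ler_norml => /andP[h3 _]; have := le_trans _ te; lra.
exists (fun x => r x + q x); split; first exact: rCcD.
  move=> x sx; have := Tq x sx; rewrite TE /r -ReS; set z := \sum_i _ => h.
  have := Re_le_nrm ((P x)%:C - z).
  have -> : complex.Re ((P x)%:C - z) = P x - complex.Re z by case: z {h}.
  by rewrite ler_norml => /andP[_ h4]; have := le_trans h4 h; lra.
by rewrite rintD//; lra.
Qed.

Lemma hint_dist_real (V : normedModType C) (F F' : X -> V) v v' P (c : C) :
  hint mu F v -> hint mu F' v' -> hint mu (fun x => (P x)%:C : C^o) (c : C^o) ->
  (forall x, msupport mu x -> nrm (F x - F' x) <= P x) -> nrm (v - v') <= complex.Re c.
Proof.
move=> Fv Fv' Pc FP; apply/ler_addgt0Pr => e e0.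
have [th [thC Pth le]] := hint_upper Pc e0.
apply: le_trans le; apply: (hint_dist muR Xh Xl Fv Fv' thC) => x sx.
exact: le_trans (FP x sx) (Pth x sx).
Qed.

Lemma hint_le_real (V : normedModType C) (F : X -> V) v P (c : C) :
  hint mu F v -> hint mu (fun x => (P x)%:C : C^o) (c : C^o) ->
  (forall x, msupport mu x -> nrm (F x) <= P x) -> nrm v <= complex.Re c.
Proof.
move=> Fv Pc FP; rewrite -(subr0 v); apply: (hint_dist_real Fv (hint0 muR) Pc).
by move=> x sx; rewrite subr0; exact: FP.
Qed.

End HintUpper.

Section Action.
Context {R : realType} {G : groupoid_data R} (GP : is_lch_groupoid G).
Local Notation C := R[i].
Context {B : gBanachAlgebra_data G}.
Hypothesis usc : usc_field (sections B).
Hypothesis lin : forall (g : G) (k : C) (b b' : B (src g)),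
  gact (k *: b + b') = k *: gact b + gact b'.
Hypothesis norm : forall (g : G) (b : B (src g)), `|gact b| = `|b|.
Hypothesis fwd : forall b, sections B b ->
  pullback_sections (@rng _ G) (sections B) (fun g => gact (b (src g))).

Let act_section_dist g x y (e : B x) (b c : forall x, B x) : src g = x -> rng g = y ->
  nrm (act g y e - c y) <= nrm (e - b x) + nrm (gact (b (src g)) - c (rng g)).
Proof.
move=> ex ey; subst; rewrite /act !tr_id.
apply: le_trans (nrm_dist _ (gact (b (src g))) _) _; rewrite lerD2r.
suff -> : gact e - gact (b (src g)) = gact (e - b (src g)) by rewrite /nrm norm.
by rewrite -scaleN1r addrC -lin scaleN1r addrC.
Qed.

(** Joint continuity of the action on the total space. Near [m0] the element [eta z] is close to a
    section [b], the translate of [b] is close to a section [c] by [fwd], and the isometric action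
    carries the first error over to the target fibre. *)
Lemma bcv_act_sections (Z : Type) (F : set_system Z) {FF : Filter F} (m : Z -> G) (m0 : G)
    (q p : Z -> units G) (eta : forall z, B (q z)) (x0 y0 : units G) (v : B x0) :
  m @ F --> m0 -> src m0 = x0 -> rng m0 = y0 ->
  (\forall z \near F, src (m z) = q z) -> (\forall z \near F, rng (m z) = p z) ->
  bcv (S := sections B) F (p := q) eta v ->
  bcv (S := sections B) F (p := p) (fun z => act (m z) (p z) (eta z)) (act m0 y0 v).
Proof.
move=> mm sm rm mq mp [qx h]; split.
  by apply: (near_cvg (f := fun z => rng (m z))) => //; rewrite -rm; exact: cvg_rng.
move=> e e0; have e20 : 0 < e / 2 by rewrite divr_gt0.
have [b [Sb vb eb]] := h _ e20.
have [_ /(_ _ e20)[c [Sc vc ec]]] :=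
  (pullbackP _ (rng_continuous GP)).1 (fwd Sb) m0.
exists c; split => //.
  by apply: le_trans (act_section_dist _ b _ sm rm) _; lra.
have ec' : \forall z \near F, nrm (gact (b (src (m z))) - c (rng (m z))) <= e / 2.
  exact: ((cvg_nearP _ _ _).1 mm _ ec).
near=> z.
have h1 : src (m z) = q z by near: z.
have h2 : rng (m z) = p z by near: z.
apply: le_trans (act_section_dist _ b _ h1 h2) _.
rewrite [e]splitr; apply: lerD; first by near: z.
by near: z.
Unshelve. all: by end_near. Qed.

(* The converse half of gact_sections follows by acting with inverses. *)
Lemma gBanachAlgebra_of_sections :
  (forall xi zeta, sections B xi -> sections B zeta ->
    sections B (fun x => bmul (xi x) (zeta x))) ->
  (forall g g' (b : B (src g')), src g = rng g' ->
    act (gmul g g') (rng g) b = act g (rng g) (act g' (src g) b)) ->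
  (forall g (b : B (rng g)), exists b' : B (src g), gact b' = b) ->
  (forall g (b b' : B (src g)), gact (bmul b b') = bmul (gact b) (gact b')) ->
  is_gBanachAlgebra B.
Proof.
move=> mul comp surj gmulP; split => //.
move=> xi; rewrite (pullbackP xi (src_continuous GP)).
rewrite (pullbackP (fun g => gact (xi g)) (rng_continuous GP)).
have actE g (b : B (src g)) : act g (rng g) b = gact b by rewrite /act !tr_id.
split => h g.
  rewrite -actE.
  apply: (bcv_ext (eta := fun g => act g (rng g) (xi g))).
    by apply: filterE => z; exact: actE.
  apply: (bcv_act_sections (m := id) (q := @src _ G) (p := @rng _ G)) (h g) => //.
  - exact: filterE.
  - exact: filterE.
have act1 x (b : B x) : act (gid G x) x b = b.
  have sx := src_id GP x; have rx := rng_id GP x.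
  have [b' <-] : exists b' : B x, act (gid G x) x b' = b.
    have [b' b'E] := surj (gid G x) (tr (rng (gid G x)) b).
    by exists (tr x b'); rewrite /act trK// b'E trK.
  have := comp (gid G x) (gid G x) (tr (src (gid G x)) b').
  have e11 : gmul (gid G x) (gid G x) = gid G x.
    by have := gmul1l GP (gid G x); rewrite rx.
  by rewrite sx rx e11 => /(_ erefl); rewrite !act_tr.
have invE k : act (ginv k) (src k) (gact (xi k)) = xi k.
  rewrite -[gact _]actE.
  have := comp (ginv k) k (xi k); rewrite (src_inv GP) (rng_inv GP) (gmulVl GP).
  by move=> /(_ erefl) <-; rewrite act1.
suff : bcv (S := sections B) (p := @src _ G) (nbhs g) xi
    (act (ginv g) (src g) (gact (xi g))) by rewrite invE.
apply: (bcv_ext (eta := fun g => act (ginv g) (src g) (gact (xi g)))).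
  by apply: filterE => z; exact: invE.
apply: (bcv_act_sections (q := @rng _ G) (p := @src _ G)).
- by apply: (cvg_ginv GP); exact: cvg_id.
- by rewrite (src_inv GP).
- by rewrite (rng_inv GP).
- by apply: filterE => z; rewrite (src_inv GP).
- by apply: filterE => z; rewrite (rng_inv GP).
- exact: h.
Qed.

End Action.

Section GAlgebra.
Context {R : realType} {G : groupoid_data R} (GP : is_lch_groupoid G).
Context {B : gBanachAlgebra_data G} (BP : is_gBanachAlgebra B).

Lemma gact_fwd b : sections B b ->
  pullback_sections (@rng _ G) (sections B) (fun g => gact (b (src g))).
Proof.
move=> Sb; apply/(gact_sections BP)/(pullbackP _ (src_continuous GP)) => g.
by apply: bcv_sec => //; exact: (src_continuous GP).
Qed.

Lemma bcv_act (Z : Type) (F : set_system Z) {FF : Filter F} (m : Z -> G) (m0 : G)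
    (q p : Z -> units G) (eta : forall z, B (q z)) (x0 y0 : units G) (v : B x0) :
  m @ F --> m0 -> src m0 = x0 -> rng m0 = y0 ->
  (\forall z \near F, src (m z) = q z) -> (\forall z \near F, rng (m z) = p z) ->
  bcv (S := sections B) F (p := q) eta v ->
  bcv (S := sections B) F (p := p) (fun z => act (m z) (p z) (eta z)) (act m0 y0 v).
Proof.
exact: (bcv_act_sections GP (gact_lin BP) (gact_norm BP) gact_fwd).
Qed.

Lemma bcv_bmul (Z : Type) (F : set_system Z) {FF : Filter F} (p : Z -> units G)
    (eta eta' : forall z, B (p z)) x0 (v v' : B x0) :
  bcv (S := sections B) F eta v -> bcv (S := sections B) F eta' v' ->
  bcv (S := sections B) F (fun z => bmul (eta z) (eta' z)) (bmul v v').
Proof.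
move=> hv hv'; have [px _] := hv.
have bm0 x (a b : B x) : nrm (bmul a b) <= nrm a * nrm b.
  by rewrite -lecR rmorphM/= -!nrmE ler_bnormM.
have bmBl x (a a' b : B x) : bmul a b - bmul a' b = bmul (a - a') b.
  by rewrite bmulDl -[in RHS]scaleN1r bscalerAl scaleN1r.
have bmBr x (a b b' : B x) : bmul a b - bmul a b' = bmul a (b - b').
  by rewrite bmulDr -[in RHS]scaleN1r bscalerAr scaleN1r.
have bmd x (a a' b b' : B x) M d : nrm a' <= M -> nrm b <= M -> nrm (a - a') <= d ->
    nrm (b - b') <= d -> nrm (bmul a b - bmul a' b') <= 2 * M * d.
  move=> h1 h2 h3 h4; have := nrm_dist (bmul a b) (bmul a' b) (bmul a' b').
  rewrite bmBl bmBr; have := bm0 _ (a - a') b; have := bm0 _ a' (b - b').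
  have : nrm (a - a') * nrm b <= d * M by apply: ler_pM; rewrite ?nrm_ge0.
  have : nrm a' * nrm (b - b') <= M * d by apply: ler_pM; rewrite ?nrm_ge0.
  lra.
apply: bcv_lim => // e e0.
(* Since [d] is at most 1, the norms of [b x0] and [v'] are strictly below [M], and strict bounds
   persist nearby for [b] and [eta']. The product then errs by at most [2 * M * d]. *)
pose M := nrm v + nrm v' + 2.
have v0 := nrm_ge0 v; have v'0 := nrm_ge0 v'.
have M0 : 0 < M by rewrite /M; lra.
pose d := Num.min 1 (e / (2 * M)).
have d0 : 0 < d by rewrite lt_min ltr01 divr_gt0// mulr_gt0.
have d1 : d <= 1 by rewrite ge_min lexx.
have dM : 2 * M * d <= e.
  have : d <= e / (2 * M) by rewrite ge_min lexx orbT.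
  by rewrite ler_pdivlMr ?mulr_gt0// mulrC.
have [_ /(_ d d0)[b [Sb vb eb]]] := hv; have [_ /(_ d d0)[b' [Sb' vb' eb']]] := hv'.
have nb : nrm (b x0) <= M - 1.
  by have := nrm_dist (b x0) v 0; rewrite !subr0 (nrmB (b x0) v) /M; lra.
exists (fun z => bmul (b (p z)) (b' (p z))), (bmul (b x0) (b' x0)); split.
- by apply: (bcv_sec (b := fun x => bmul (b x) (b' x))) => //; exact: (gb_mul BP).
- by apply: le_trans dM; apply: bmd => //; [lra|rewrite /M; lra].
- have nb1 : nrm (b x0) < M by lra.
  have nb2 : nrm v' < M by rewrite /M; lra.
  have h1 : \forall z \near F, nrm (eta' z) < M by exact: (bcv_norm (gb_usc BP) hv' nb2).
  have h2 : \forall z \near F, nrm (b (p z)) < M by exact: (sec_near (gb_usc BP) Sb px nb1).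
  have k : \forall z \near F, nrm (eta' z) < M /\ nrm (b (p z)) < M.
    by apply: filterS2 h1 h2.
  apply: filterS3 k eb eb' => z [k1 k2] k3 k4.
  by apply: le_trans dM; apply: bmd => //; exact: ltW.
Qed.

End GAlgebra.

Section IndFibers.
Context {R : realType} {G H : haarGroupoid R} {Om : equivalence G H}
  {B : gBanachAlgebra G}.
Local Notation C := R[i].
Let BP := gb_axioms B.
Let GP := hg_lch G.
Let HP := hg_lch H.

Lemma ind_irr h (b : ind_fiber Om B h) w w' (e : sigma w = h) (e' : sigma w' = h) x :
  w = w' -> tr x (b w e) = tr x (b w' e').
Proof. by move=> ww; subst w'; rewrite (Prop_irrelevance e e'). Qed.

Lemma ind_section_irr (xi : forall h, ind_fiber Om B h) h h' w (e : sigma w = h)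
  (e' : sigma w = h') : xi h w e = xi h' w e'.
Proof. by subst h; subst h'. Qed.

(** The norm of a family can be read off at any point of the fibre of [sigma], so a single component
    determines the family. *)
Lemma ind_inj h (b b' : ind_fiber Om B h) w (e : sigma w = h) :
  b w e = b' w e -> b = b'.
Proof.
move=> bb; apply/eqP; rewrite -subr_eq0; apply/eqP/nrm_eq0.
by rewrite /nrm (ind_normE _ e) /= bb subrr normr0.
Qed.

Lemma ind_nrm h (b : ind_fiber Om B h) w (e : sigma w = h) : nrm b = nrm (b w e).
Proof. by rewrite /nrm (ind_normE _ e). Qed.

(** By freeness each point of the fibre is [lact g w] for exactly one [g]; its component has to be
    the image of [c] under [g], and uniqueness of [g] makes this family equivariant. *)
Lemma ind_extension w (c : B (rho w)) :
  exists b : ind_fiber Om B (sigma w), b w erefl = c.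
Proof.
pose tau w' (e : sigma w' = sigma w) := cid2 (equiv_sigma_inj (esym e)).
have eqf (g : G) (w' : Om) (e : sigma w' = sigma w) (e' : sigma (lact g w') = sigma w) :
    src g = rho w' -> act (s2val (tau _ e')) (rho (lact g w')) c =
    act g (rho (lact g w')) (act (s2val (tau _ e)) (rho w') c).
  move=> sg; case: (tau _ e') => l /= sl lw; case: (tau _ e) => k /= sk kw.
  have rk : rng k = rho w' by rewrite -kw rho_lact.
  rewrite -(act_comp BP)// ?rho_lact//.
  suff -> : l = gmul g k by [].
  apply: (lact_inj GP (w := w)) => //; first by rewrite (src_mul GP) ?sg.
  by rewrite lw lactA ?sg// kw.
exists (IndFiber eqf) => /=; case: (tau w _) => g /= sg gw.
by rewrite (lact_free sg gw) (act_id BP GP).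
Qed.

Definition ind_ext w (c : B (rho w)) : ind_fiber Om B (sigma w) :=
  sval (cid (ind_extension c)).

Lemma ind_extE w (c : B (rho w)) e : ind_ext c w e = c.
Proof.
rewrite (Prop_irrelevance e erefl); exact: svalP (cid (ind_extension c)).
Qed.

Lemma sigma_near (P : Om -> Prop) w0 : (\forall w \near w0, P w) ->
  \forall h \near sigma w0, exists2 w, P w & sigma w = h.
Proof.
have : nbhs w0 [set w | P w] -> nbhs (sigma w0) [set h | exists2 w, P w & sigma w = h].
  rewrite !nbhsE => -[O [oO Ow] OP]; exists (@sigma _ _ _ Om @` O).
    by split; [exact: (sigma_open GP HP)|exists w0].
  by move=> _ [w Ow' <-]; exists w => //; exact: OP.
exact.
Qed.

Notation S_I := (ind_sections (Om := Om) (B := B)).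
Notation SB := (sections B).

Lemma ind_sections_family xi : S_I xi ->
  exists2 delta : forall w : Om, B (rho w),
    forall w, bcv (S := SB) (nbhs w) (p := @rho _ _ _ Om) delta (delta w) &
    forall h w (e : sigma w = h), xi h w e = delta w.
Proof.
move=> [delta [d1 d2 d3]]; exists delta => //.
exact/(pullbackP delta (@rho_continuous _ _ _ Om)).
Qed.

Lemma ind_usc_norm xi : S_I xi -> forall h0 (c : C), `|xi h0| < c ->
  \forall h \near h0, `|xi h| < c.
Proof.
move=> /ind_sections_family[delta dc dE] h0 c xc.
have [w0 e0] := equiv_sigma_surj Om h0; subst h0.
have [r rE] : exists r, c = r%:C.
  exists (complex.Re c); rewrite RRe_real//.
  by apply: gtr0_real; apply: le_lt_trans xc; exact: normr_ge0.
rewrite rE nrm_lt (ind_nrm _ (erefl (sigma w0))) dE in xc.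
have h : \forall w \near w0, nrm (delta w) < r by exact: (bcv_norm (gb_usc BP) (dc w0) xc).
have := sigma_near h; apply: filterS => h' [w wr <-].
by rewrite rE nrm_lt (ind_nrm _ (erefl (sigma w))) dE.
Qed.

Lemma ind_usc_closed : locally_approximable S_I `<=` S_I.
Proof.
move=> xi xia; exists (fun w => xi (sigma w) w erefl); split.
- apply/(pullbackP _ (@rho_continuous _ _ _ Om)) => w0.
  apply: bcv_lim; first exact: rho_continuous.
  move=> e e0; have e0' : 0 < e%:C by rewrite ltcR.
  have [zeta /ind_sections_family[delta dc dE] xz] := xia (sigma w0) _ e0'.
  exists delta, (delta w0); split; first exact: dc.
    have := nbhs_singleton xz; rewrite /= nrm_le (ind_nrm _ (erefl (sigma w0))) /=.
    by rewrite dE.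
  have : \forall w \near w0, `|xi (sigma w) - zeta (sigma w)| <= e%:C.
    exact: ((cvg_nearP _ _ _).1 (@sigma_continuous _ _ _ Om w0) _ xz).
  apply: filterS => w; rewrite nrm_le (ind_nrm _ (erefl (sigma w))) /=.
  by rewrite dE.
- move=> g w sg.
  have e : sigma (lact g w) = sigma w by rewrite sigma_lact.
  rewrite (ind_section_irr xi _ e) (fam_equiv _ (erefl (sigma w)))//.
- by move=> h w e; exact: ind_section_irr.
Qed.

Lemma ind_usc_lin (k : C) xi zeta : S_I xi -> S_I zeta ->
  S_I (fun h => k *: xi h + zeta h).
Proof.
move=> [d [d1 d2 d3]] [d' [d1' d2' d3']]; exists (fun w => k *: d w + d' w); split.
- apply/(pullbackP _ (@rho_continuous _ _ _ Om)) => w.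
  by apply: (bcv_lin (gb_usc BP)); [have /(pullbackP d (@rho_continuous _ _ _ Om)) := d1|
    have /(pullbackP d' (@rho_continuous _ _ _ Om)) := d1'].
- by move=> g w sg; rewrite d2// d2'// (act_lin BP).
- by move=> h w e /=; rewrite d3 d3'.
Qed.

Lemma ind_usc_zero : S_I (fun=> 0).
Proof.
exists (fun=> 0); split => //.
- apply/(pullbackP _ (@rho_continuous _ _ _ Om)) => w.
  by apply: (bcv0 (gb_usc BP)); exact: rho_continuous.
- by move=> g w sg; rewrite (act0 BP).
Qed.

Lemma ind_sections_mul xi zeta : S_I xi -> S_I zeta ->
  S_I (fun h => bmul (xi h) (zeta h)).
Proof.
move=> [d [d1 d2 d3]] [d' [d1' d2' d3']]; exists (fun w => bmul (d w) (d' w)); split.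
- apply/(pullbackP _ (@rho_continuous _ _ _ Om)) => w.
  by apply: (bcv_bmul BP); [have /(pullbackP d (@rho_continuous _ _ _ Om)) := d1|
    have /(pullbackP d' (@rho_continuous _ _ _ Om)) := d1'].
- by move=> g w sg; rewrite d2// d2'// (act_mul BP).
- by move=> h w e /=; rewrite d3 d3'.
Qed.

(* Sections of Ind through prescribed values are obtained by averaging
   equivariantly: delta(w) = \int f(g^-1 w) g b(src g) dg, with f concentrated
   near a given point. *)
Section Averaging.
Variables (f : Om -> R) (b : forall x, B x).
Hypotheses (fC : rCc f) (Sb : SB b).
Let OV := opp_equivalence GP HP Om.
Let Phi (w : Om) (g : G) : B (rho w) :=
  (f (lact (ginv g) w))%:C *: act g (rho w) (b (src g)).

Let fc : continuous f. Proof. by case: fC. Qed.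

Let PhiE : exists2 K : set Om, compact K & forall w g, ~ K (lact (ginv g) w) -> Phi w g = 0.
Proof.
have [_ [K Kc fK]] := fC; exists K => // w g nK.
by rewrite /Phi fK// scale0r.
Qed.

Let Phi_bcv w g : rng g = rho w ->
  bcv (S := SB) (within [set zg | rng zg.2 = rho zg.1] (nbhs (w, g)))
    (p := fun zg : Om * G => rho zg.1) (fun zg => Phi zg.1 zg.2) (Phi w g).
Proof.
move=> rg.
have c1 : (fun zg : Om * G => zg.1) @ within [set zg | rng zg.2 = rho zg.1] (nbhs (w, g)) --> w.
  by apply: cvg_within_filter; exact: cvg_fst.
have c2 : (fun zg : Om * G => zg.2) @ within [set zg | rng zg.2 = rho zg.1] (nbhs (w, g)) --> g.
  by apply: cvg_within_filter; exact: cvg_snd.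
have dom : \forall zg \near within [set zg : Om * G | rng zg.2 = rho zg.1] (nbhs (w, g)),
    rng zg.2 = rho zg.1 by exact: withinT.
apply: (bcvZ (gb_usc BP)).
  apply: (@cvg_comp _ _ _ (fun zg : Om * G => lact (ginv zg.2) zg.1) f _
    (nbhs (lact (ginv g) w))); last exact: fc.
  apply: cvg_lact => //; first exact: cvg_ginv.
    by rewrite (src_inv GP).
  by apply: filterS dom => zg e; rewrite (src_inv GP).
apply: (bcv_act GP BP (q := fun zg : Om * G => src zg.2) c2) => //.
  exact: filterE.
by apply: bcv_sec => //; exact: cvg_src.
Qed.

Let Phi_exists w : exists v, hint (haar G (rho w)) (Phi w) v.
Proof.
have [K Kc PhiK] := PhiE.
have Lc := compact_ract (Om := OV) (@compact_set1 _ w) Kc.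
apply: (fibre_integral (S := SB) (gpd_hausdorff GP) (gpd_lc GP) (r := @rng _ G)
  (haar_radon (hg_haar G)) (haar_supp (hg_haar G)) Lc) => [g e nL|g Lg e].
  by apply: PhiK => Kw; apply: nL; exists w; split.
have := Phi_bcv e.
apply: (@bcv_comp R (units G) _ SB _ _ _ _ (within [set g | rng g = rho w] (nbhs g)) _
  (fun g' => (w, g')) (fun zg : Om * G => rho zg.1) (fun zg => Phi zg.1 zg.2)).
move=> A /=; rewrite /within/= => hA.
have c : (fun h => (w, h)) @ nbhs g --> (w, g) by apply: cvg_pair; [exact: cvg_cst|exact: cvg_id].
by have := (cvg_nearP _ _ _).1 c _ hA.
Qed.

Let delta w := sval (cid (Phi_exists w)).
Let deltaP w : hint (haar G (rho w)) (Phi w) (delta w).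
Proof. exact: svalP (cid (Phi_exists w)). Qed.

Let delta_bcv w : bcv (S := SB) (nbhs w) (p := @rho _ _ _ Om) delta (delta w).
Proof.
have [K Kc PhiK] := PhiE.
have [A Ac wA] := compact_nbhs (@equiv_lc _ _ _ Om) w.
have Lc := compact_ract (Om := OV) Ac Kc.
apply: (parametrized_integral (gb_usc BP) (units_hausdorff GP) (gpd_hausdorff GP) (gpd_lc GP)
  (r := @rng _ G) (rng_continuous GP) (haar_radon (hg_haar G)) (haar_supp (hg_haar G))
  (haar_rcont (hg_haar G)) (Phi := Phi) Lc).
- exact: rho_continuous.
- exact: deltaP.
- apply: filterS wA => w' Aw g e nL; apply: PhiK => Kw; apply: nL.
  by exists w'; split.
- by move=> g Lg e; exact: Phi_bcv.
Qed.

Let delta_equiv g w : src g = rho w -> delta (lact g w) = act g (rho (lact g w)) (delta w).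
Proof.
move=> sg; have rg : rng g = rho (lact g w) by rewrite rho_lact.
have h1 := deltaP (lact g w); rewrite -{1}rg in h1.
have h2 := hint_haar_inv GP (hg_haar G) h1.
have h3 : hint (haar G (rho w)) (fun k => act g (rho (lact g w)) (Phi w k))
    (act g (rho (lact g w)) (delta w)).
  apply: (hint_map (T := fun c => act g (rho (lact g w)) c) (M := 1) _ _ _ _ (deltaP w)) => //.
  - exact: haar_radon (hg_haar G) _.
  - by move=> k a a'; rewrite (act_lin BP).
  - by move=> a; rewrite mul1r /nrm (act_norm BP).
rewrite sg in h2.
apply: (hint_uniq (haar_radon (hg_haar G) _) (gpd_hausdorff GP) (gpd_lc GP) h2 h3) => k.
rewrite (msupport_haar (hg_haar G)) => rk; have e : src g = rng k by rewrite sg.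
rewrite /Phi (actZ BP) (ginvM GP)// lactA ?(src_inv GP)//; last by rewrite (rng_inv GP) e.
rewrite (lactK GP)// (src_mul GP)//; congr (_ *: _).
by rewrite (act_comp BP (y := rho w))// -rk.
Qed.

Lemma averaged_section : exists2 xi : forall h, ind_fiber Om B h, S_I xi &
  forall w e, hint (haar G (rho w)) (fun g => (f (lact (ginv g) w))%:C *:
    act g (rho w) (b (src g))) (xi (sigma w) w e).
Proof.
have dE h g w (e : sigma w = h) (e' : sigma (lact g w) = h) : src g = rho w ->
  delta (lact g w) = act g (rho (lact g w)) (delta w) by move=> sg; exact: delta_equiv.
exists (fun h => @IndFiber _ _ _ Om B h (fun w _ => delta w) (@dE h)).
  by exists delta; split => //; exact/(pullbackP _ (@rho_continuous _ _ _ Om)).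
by move=> w e; exact: deltaP.
Qed.

End Averaging.

(** Average a section [b] with [b (rho w0)] close to the prescribed value, using a bump at [w0]
    normalized to mass 1. Only those [g] contribute for which $g^{-1}\omega_0$ is close to
    $\omega_0$; they are close to an identity arrow, where the action moves [b] only a little. *)
Lemma ind_usc_dense h : dense [set xi h | xi in S_I].
Proof.
apply/dense_nrmP => c e e0.
have [w0 wh] := equiv_sigma_surj Om h; subst h.
pose OV := opp_equivalence GP HP Om.
have e30 : 0 < e / 3 by rewrite divr_gt0.
have [b Sb cb] := sec_dense (gb_usc BP) (c w0 erefl) e30.
(* near the unit, g b(src g) is close to b(rho w0) *)
have c1 : bcv (S := SB) (within [set g | rng g = rho w0] (nbhs (gid G (rho w0))))
    (p := fun=> rho w0) (fun g => act g (rho w0) (b (src g))) (b (rho w0)).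
  have -> : b (rho w0) = act (gid G (rho w0)) (rho w0) (b (rho w0)) by rewrite (act_id BP GP).
  have ci : id @ within [set g | rng g = rho w0] (nbhs (gid G (rho w0))) --> gid G (rho w0).
    by apply: cvg_within_filter; exact: cvg_id.
  apply: (bcv_act GP BP (q := @src _ G) ci); rewrite ?(src_id GP) ?(rng_id GP)//.
  - exact: filterE.
  - exact: withinT.
  - by apply: bcv_sec => //; have /(_ _) := cvg_src GP ci; rewrite (src_id GP); exact.
have c2 : \forall g \near gid G (rho w0), rng g = rho w0 ->
    nrm (act g (rho w0) (b (src g)) - b (rho w0)) <= e / 3.
  exact: (bcv_const c1 e30).
have c3 : \forall w \near w0, forall g, rng g = rho w0 -> lact (ginv g) w0 = w ->
    nrm (act g (rho w0) (b (src g)) - b (rho w0)) <= e / 3.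
  (* The arrow [g] is the product of $\omega_0$ with the inverse of $g^{-1}\omega_0$, so that
     continuity of the multiplication of the linking groupoid brings [g] close to the identity
     arrow. *)
  have cL : (fun w => gmul (inl (inr w0) : linking Om) (inr (inl w) : linking Om)) @
      within [set w | sigma w = sigma w0] (nbhs w0) -->
      gmul (inl (inr w0) : linking Om) (inr (inl w0) : linking Om).
    apply: (link_mul_cvg GP HP) => //.
    - exact: cvg_cst.
    - by apply: cvg_inr; apply: cvg_inl; apply: cvg_within_filter; exact: cvg_id.
    - by apply: (filterS _ (withinT _ _)) => w /= ->.
  rewrite (link_mulWV GP (g := gid G (rho w0))) ?(src_id GP) ?lact1// in cL.
  have N : nbhs (inl (inl (gid G (rho w0))) : linking Om) (inl @` (inl @` [set g : G |
      rng g = rho w0 -> nrm (act g (rho w0) (b (src g)) - b (rho w0)) <= e / 3])).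
    by apply: nbhs_inl; apply: nbhs_inl; exact: c2.
  have near1 : \forall w \near w0, sigma w = sigma w0 -> (inl @` (inl @` [set g : G |
      rng g = rho w0 -> nrm (act g (rho w0) (b (src g)) - b (rho w0)) <= e / 3]))
      (gmul (inl (inr w0) : linking Om) (inr (inl w) : linking Om)).
    exact: ((cvg_nearP _ _ _).1 cL _ N).
  apply: filterS near1 => w hw g rg gw.
  have sw : sigma w = sigma w0 by rewrite -gw sigma_lact ?(src_inv GP).
  have [_ [g' hg' <-]] := hw sw.
  rewrite (link_mulWV GP (g := g)); first by case=> e'; move: hg'; rewrite /= e'; exact.
    by rewrite -gw (rho_lactV GP).
  by rewrite -gw (lactKV GP).
have [u [uC u01 u1 uU]] := bump (R := R) (@equiv_hausdorff _ _ _ Om) (@equiv_lc _ _ _ Om) c3.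
have u0 w : 0 <= u w by case/andP: (u01 w).
have m0 : 0 < rint (haar_eqv (Om := OV) (sigma w0)) u.
  apply: (haar_eqv_gt0 GP (hg_haar G) (Om := OV)) => //.
  by rewrite (nbhs_singleton u1).
(* The mass of the bump along the orbit of [w0], positive because [u] is 1 at [w0]; dividing by it
   makes the weights integrate to 1. *)
set m := rint _ _ in m0.
have fC : rCc (fun w => m^-1 * u w) by exact: rCcZ.
have [xi Sxi xiE] := averaged_section fC Sb.
exists (xi (sigma w0)); first by exists xi.
rewrite (ind_nrm _ (erefl (sigma w0))) /=.
have hx := xiE w0 erefl.
have h1 : hint (haar G (rho w0)) (fun g => (m^-1 * u (lact (ginv g) w0))%:C : C^o) (1 : C^o).
  have := haar_eqvE GP (hg_haar G) (Om := OV) w0 (Cc_real fC).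
  rewrite (mu_rint (haar_eqv_radon GP (hg_haar G) OV _) fC).
  rewrite (rintZ (haar_eqv_radon GP (hg_haar G) OV _))//.
  by rewrite -/m mulVf ?gt_eqF.
have h2 : hint (haar G (rho w0)) (fun g => (m^-1 * u (lact (ginv g) w0))%:C *: b (rho w0)) (b (rho w0)).
  rewrite -[X in hint _ _ X]scale1r.
  apply: (hint_map (T := fun z : C^o => z *: b (rho w0)) (M := nrm (b (rho w0))) _ _ _ _ h1).
  - exact: haar_radon (hg_haar G) _.
  - by move=> k a a'; rewrite scalerDl scalerA.
  - exact: nrm_ge0.
  - by move=> a; rewrite nrmZ mulrC.
have h3 : hint (haar G (rho w0)) (fun g => (e / 3 * (m^-1 * u (lact (ginv g) w0)))%:C : C^o)
    ((e / 3)%:C : C^o).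
  have h := hintZ (haar_radon (hg_haar G) _) (e / 3)%:C h1.
  have E : (e / 3)%:C *: (1 : C^o) = (e / 3)%:C by exact: mulr1.
  rewrite E in h; apply: hint_ext h => g _.
  by rewrite [in RHS]rmorphM.
have h4 : nrm (xi (sigma w0) w0 erefl - b (rho w0)) <= e / 3.
  apply: (hint_dist_real (gpd_hausdorff GP) (gpd_lc GP) (haar_radon (hg_haar G) _) hx h2 h3).
  move=> g; rewrite (msupport_haar (hg_haar G)) => rg.
  rewrite -scalerBr nrmZr ger0_norm ?mulr_ge0 ?invr_ge0 ?(ltW m0)//.
  rewrite [e / 3 * _]mulrC.
  have [->|ug] := eqVneq (u (lact (ginv g) w0)) 0; first by rewrite !mulr0 !mul0r.
  apply: ler_wpM2l; first by rewrite mulr_ge0 ?invr_ge0 ?(ltW m0).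
  exact: (uU _ ug g rg).
have := nrm_dist (c w0 erefl) (b (rho w0)) (xi (sigma w0) w0 erefl).
by rewrite (nrmB (b (rho w0))); lra.
Qed.

Lemma ind_usc : usc_field S_I.
Proof.
split; [exact: ind_usc_zero|exact: ind_usc_lin|exact: ind_usc_dense|
  exact: ind_usc_norm|exact: ind_usc_closed].
Qed.

End IndFibers.

Section LinkingAlgebra.
Context {R : realType} {G H : haarGroupoid R} (Om : equivalence G H)
  (B : gBanachAlgebra G).
Local Notation C := R[i].
Notation L := (linking Om).
Notation aG g := (inl (inl g) : L).
Notation aW w := (inl (inr w) : L).
Notation aV w := (inr (inl w) : L).
Notation aH h := (inr (inr h) : L).
Let BP := gb_axioms B.
Let GP := hg_lch G.
Let HP := hg_lch H.
Let LP := linking_lch GP HP Om.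

Definition link_fiber (x : units L) : banachAlgType C :=
  match x with
  | inl x => B x
  | inr y => ind_fiber Om B y
  end.

Definition link_sections : set (forall x : units L, link_fiber x) :=
  [set xi | sections B (fun x => xi (inl x)) /\
            ind_sections (fun y => xi (inr y))].

(** Evaluation at [w] is an isometric isomorphism of the induced fibre over [sigma w] onto the fibre
    of [B] over [rho w]. It is the action of [w], and its inverse [ind_ext] is that of
    $\omega^{-1}$. *)
Definition link_gact (a : L) : link_fiber (src a) -> link_fiber (rng a) :=
  match a as a0 return link_fiber (src (a0 : L)) -> link_fiber (rng (a0 : L)) with
  | inl (inl g) => fun b : B (src g) => (gact b : B (rng g))
  | inl (inr w) => fun b : ind_fiber Om B (sigma w) => b w erefl
  | inr (inl w) => fun b : B (rho w) => ind_ext b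
  | inr (inr h) => fun b : ind_fiber Om B (src h) => ind_act b
  end.

Definition link_algebra : gBanachAlgebra_data L :=
  GBanachAlgebraData link_sections link_gact.

Local Notation BL := link_algebra.
Local Arguments gmul : simpl never.

Lemma link_trl (x y : units G) (b : B x) :
  tr (B := BL) (inl y) (b : BL (inl x)) = tr y b.
Proof.
have [e|ne] := pselect (x = y); first by subst; rewrite !tr_id.
rewrite /tr; case: pselect => [e|_]; last by case: pselect.
by have [] : False by apply: ne; case: e.
Qed.

Lemma link_trr (x y : units H) (b : ind_fiber Om B x) :
  tr (B := BL) (inr y) (b : BL (inr x)) = tr (B := Ind Om B) y (b : Ind Om B x).
Proof.
have [e|ne] := pselect (x = y); first by subst; rewrite !tr_id.
rewrite /tr; case: pselect => [e|_]; last by case: pselect.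
by have [] : False by apply: ne; case: e.
Qed.

Lemma ind_trE (x y : units H) (b : ind_fiber Om B x) w (e : sigma w = y) (e' : sigma w = x) :
  (tr (B := Ind Om B) y (b : Ind Om B x) : ind_fiber Om B y) w e = b w e'.
Proof. by subst x; subst y; rewrite tr_id. Qed.

Lemma link_actG g (x y : units G) (b : B x) :
  act (B := BL) (aG g) (inl y) (b : BL (inl x)) = act g y b.
Proof. by rewrite /act link_trl /= link_trl. Qed.

Lemma link_actW w x h (b : ind_fiber Om B h) (e : sigma w = h) :
  act (B := BL) (aW w) (inl x) (b : BL (inr h)) = tr x (b w e).
Proof. by subst h; rewrite /act link_trr /= link_trl tr_id. Qed.

Lemma link_actV w x h (c : B x) (e : sigma w = h) : rho w = x ->
  (act (B := BL) (aV w) (inr h) (c : BL (inl x)) : ind_fiber Om B h) w e = tr (rho w) c.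
Proof.
move=> ex; subst h; rewrite /act link_trl /= link_trr.
by rewrite (ind_trE _ _ erefl) ind_extE.
Qed.

Lemma link_actH k h h' (b : ind_fiber Om B h') w (e : sigma w = h)
    (e' : sigma (ract w k) = h') : rng k = h ->
  (act (B := BL) (aH k) (inr h) (b : BL (inr h')) : ind_fiber Om B h) w e =
  tr (rho w) (b (ract w k) e').
Proof.
move=> rk; have sk : src k = h' by rewrite -e' sigma_ract// e rk.
case: h / rk e; case: h' / sk b e' => b e' e.
rewrite /act link_trr /= link_trr !tr_id /=.
by rewrite (Prop_irrelevance e' (sigma_ract e)).
Qed.

Lemma link_actH_ind k h h' (b : ind_fiber Om B h') :
  act (B := BL) (aH k) (inr h) (b : BL (inr h')) =
  act (B := Ind Om B) k h (b : Ind Om B h').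
Proof. by rewrite /act link_trr /= link_trr. Qed.

(** When the target is an induced fibre, both sides are compared at one component, chosen so that
    the defining equations of the actions apply; [ind_inj] does the rest. *)
Let link_gactM (a b : L) (v : BL (src b)) : src a = rng b ->
  act (gmul a b) (rng a) v = act a (rng a) (act b (src a) v).
Proof.
case: a => [[g|w]|[w|h]]; case: b v => [[g'|w']|[w'|h']] //= v [] e.
- by rewrite link_mulGG !link_actG (gactM BP).
- rewrite link_mulGW link_actG.
  have e1 : sigma (lact g w') = sigma w' by rewrite sigma_lact.
  rewrite (link_actW _ _ e1) (link_actW _ _ erefl).
  rewrite (fam_equiv v erefl)// tr_act//; last by rewrite rho_lact.
  by rewrite act_tr.
- have [q sq qw] := equiv_sigma_inj (esym e); rewrite (link_mulWV GP sq qw) link_actG.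
  have e1 : sigma w = sigma w by [].
  rewrite (link_actW _ _ e1) tr_id.
  pose c : ind_fiber Om B (sigma w) :=
    act (B := BL) (aV w') (inr (sigma w)) (v : BL (inl (rho w'))).
  rewrite -[RHS]/(c w e1).
  have cE : c w' (esym e) = v by rewrite /c link_actV// tr_id.
  subst w; by rewrite (fam_equiv c (esym e))// cE.
- rewrite link_mulWH.
  have e1 : sigma (ract w h') = src h' by rewrite sigma_ract.
  rewrite (link_actW _ _ e1) (link_actW _ _ erefl) (link_actH _ erefl e1)//.
  by rewrite tr_id.
- have [w1 rw1 ww1] : exists2 w1, src g' = rho w1 & w = lact g' w1.
    by exists (lact (ginv g') w); [rewrite (rho_lactV GP)|rewrite (lactKV GP)].
  subst w; rewrite link_mulVG (lactK GP)//.
  have e1 : sigma w1 = sigma (lact g' w1) by rewrite sigma_lact.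
  apply: (ind_inj (e := erefl)).
  rewrite link_actV// link_actG tr_id.
  by rewrite (fam_equiv _ e1)// link_actV// act_tr//.
- have [k sk kw] := equiv_rho_inj e; rewrite (link_mulVW HP sk kw).
  apply: (ind_inj (e := erefl)); subst w'.
  have e1 : sigma (ract w k) = sigma (ract w k) by [].
  rewrite (link_actH _ erefl e1)// link_actV// tr_id.
  by rewrite (link_actW _ _ e1).
- have [w1 sw1 ww1] : exists2 w1, sigma w1 = rng h & w' = ract w1 h.
    by exists (ract w' (ginv h)); [rewrite (sigma_ractV HP)|rewrite (ractKV HP)].
  subst w'; rewrite link_mulHV (ractK HP)//.
  apply: (ind_inj (e := sw1)).
  have e1 : sigma (ract w1 h) = src h by rewrite sigma_ract.
  rewrite link_actV; last by rewrite rho_ract.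
  rewrite (link_actH _ sw1 e1)// link_actV// tr_id.
  by [].
- have [w0 e0] := equiv_sigma_surj Om (rng h).
  apply: (ind_inj (e := e0)).
  have e1 : sigma (ract w0 h) = src h by rewrite sigma_ract.
  have e2 : sigma (ract (ract w0 h) h') = src h' by rewrite sigma_ract// e1.
  have e3 : sigma (ract w0 (gmul h h')) = src h'.
    by rewrite sigma_ract ?(src_mul HP)// (rng_mul HP).
  rewrite link_mulHH (link_actH _ e0 e3); last by rewrite (rng_mul HP).
  rewrite (link_actH _ e0 e1)// (link_actH _ e1 e2)//.
  have r1 : rho (ract w0 h) = rho w0 by rewrite rho_ract.
  have t (x y z : units G) (c : B x) : y = z -> x = y -> tr z (tr y c) = tr z c.
    by move=> yz xy; subst; rewrite !tr_id.
  rewrite t//; last by rewrite rho_ract// e1.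
  by apply: ind_irr; rewrite ractA.
Qed.

Let link_lin (a : L) (k : C) (b b' : BL (src a)) :
  gact (k *: b + b') = k *: gact b + gact b'.
Proof.
case: a b b' => [[g|w]|[w|h]] /= b b'.
- exact: (gact_lin BP).
- by [].
- by apply: (ind_inj (e := erefl)) => /=; rewrite !ind_extE.
- by apply: ind_fiber_ext => w e /=; rewrite tr_lin.
Qed.

Let link_norm (a : L) (b : BL (src a)) : `|gact b| = `|b|.
Proof.
case: a b => [[g|w]|[w|h]] /= b.
- exact: (gact_norm BP).
- by rewrite (ind_normE _ (erefl (sigma w))).
- by rewrite (ind_normE _ (erefl (sigma w))) ind_extE.
- have [w e] := equiv_sigma_surj Om (rng h).
  rewrite (ind_normE _ e) /= tr_norm; last by rewrite rho_ract.
  by rewrite -(ind_normE b (sigma_ract e)).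
Qed.

Let link_bmul (a : L) (b b' : BL (src a)) : gact (bmul b b') = bmul (gact b) (gact b').
Proof.
case: a b b' => [[g|w]|[w|h]] /= b b'.
- exact: (gact_mul BP).
- by [].
- by apply: (ind_inj (e := erefl)) => /=; rewrite !ind_extE.
- by apply: ind_fiber_ext => w e /=; rewrite tr_mul.
Qed.

Let link_surj (a : L) (b : BL (rng a)) : exists b' : BL (src a), gact b' = b.
Proof.
case: a b => [[g|w]|[w|h]] /= b.
- exact: (gact_surj BP).
- by exists (ind_ext b); rewrite ind_extE.
- exists (b w erefl); apply: (ind_inj (e := erefl)); exact: ind_extE.
- pose c : ind_fiber Om B (src h) := act (B := BL) (aH (ginv h)) (inr (src h)) (b : BL (inr (rng h))).
  exists c; have [w e] := equiv_sigma_surj Om (rng h).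
  apply: (ind_inj (e := e)) => /=.
  have e1 : sigma (ract w h) = src h by rewrite sigma_ract.
  have e2 : sigma (ract (ract w h) (ginv h)) = rng h by rewrite (ractK HP).
  rewrite (Prop_irrelevance (sigma_ract e) e1) (link_actH _ e1 e2); last by rewrite (rng_inv HP).
  have r1 : rho (ract w h) = rho w by rewrite rho_ract.
  have t (x y z : units G) (d : B x) : y = z -> x = y -> tr z (tr y d) = tr z d.
    by move=> yz xy; subst; rewrite !tr_id.
  rewrite t//; last by rewrite (ractK HP).
  by rewrite (ind_irr _ _ e) ?tr_id// (ractK HP).
Qed.

Let secr (c : forall x, ind_fiber Om B x) : ind_sections c ->
  sections BL (fun z : units L => match z return BL z with inl y => 0 | inr y => c y end).
Proof. by move=> Sc; split; [exact: (usc_zero (gb_usc BP))|exact: Sc]. Qed.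

Let link_usc : usc_field (sections BL).
Proof.
have uB := gb_usc BP; have uI := ind_usc (Om := Om) (B := B).
have s0B := usc_zero uB; have s0I := usc_zero uI.
split.
- by split.
- move=> k xi zeta [x1 x2] [z1 z2]; split; first exact: (usc_lin uB).
  exact: (usc_lin uI).
- case=> x; apply/dense_nrmP => v e e0.
    have [_ [b Sb <-] vb] := (dense_nrmP _).1 (usc_dense uB (x := x)) v e e0.
    exists (b x) => //.
    exists (fun z : units L => match z return BL z with inl y => b y | inr y => 0 end) => //.
  have [_ [b Sb <-] vb] := (dense_nrmP _).1 (usc_dense uI (x := x)) v e e0.
  exists (b x) => //.
  exists (fun z : units L => match z return BL z with inl y => 0 | inr y => b y end) => //.
- move=> xi [x1 x2] [x|x] c xc.
    have := usc_norm uB x1 xc => h.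
    by have := nbhs_inl (Y := units H) h; apply: filterS => _ [y /= hy <-].
  have := usc_norm uI x2 xc => h.
  by have := nbhs_inr (X := units G) h; apply: filterS => _ [y /= hy <-].
- move=> xi xa; split.
    apply: (usc_closed uB) => x e e0.
    have [zeta [z1 z2] hz] := xa (inl x) e e0.
    exists (fun x => zeta (inl x)) => //.
    exact: ((cvg_nearP _ _ _).1 (@continuous_inl (units G) (units H) x) _ hz).
  apply: (usc_closed uI) => x e e0.
  have [zeta [z1 z2] hz] := xa (inr x) e e0.
  exists (fun x => zeta (inr x)) => //.
  exact: ((cvg_nearP _ _ _).1 (@continuous_inr (units G) (units H) x) _ hz).
Qed.

Let link_mul_sections xi zeta : sections BL xi -> sections BL zeta ->
    sections BL (fun x => bmul (xi x) (zeta x)).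
Proof.
move=> [x1 x2] [z1 z2]; split; first exact: (gb_mul BP x1 z1).
exact: (ind_sections_mul x2 z2).
Qed.

Let nearL (P : L -> Prop) (X : topologicalType) (j : X -> L) (x : X) :
  (forall U, nbhs x U -> nbhs (j x) (j @` U)) -> (\forall y \near x, P (j y)) ->
  \forall a \near j x, P a.
Proof. by move=> jn h; have := jn _ h; apply: filterS => _ [y hy <-]. Qed.

(** For arrows of [G] and arrows [w] the image is a section of [B] or a component of one of [Ind].
    For the other two kinds a section [d] of [Ind] close to the image at the given arrow is compared
    on components: at the point $\omega$ itself for $\omega^{-1}$, and for [h'] near [h] at points
    [w'] near [w0] with [sigma w' = rng h'], which exist because [sigma] is open. *)
Let link_fwd b : sections BL b ->
  pullback_sections (@rng _ L) (sections BL) (fun a : L => gact (b (src a))).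
Proof.
move=> [b1 b2]; apply/(pullbackP _ (rng_continuous LP)) => a.
split; first exact: (rng_continuous LP).
move=> e e0; have e0' : 0 < e%:C by rewrite ltcR.
have e20 : 0 < e / 2 by rewrite divr_gt0.
have s0B := usc_zero (gb_usc BP); have s0I := usc_zero (ind_usc (Om := Om) (B := B)).
have [delta dc dE] := ind_sections_family b2.
case: a => [[g|w]|[w|h]].
- have [_ /(_ e e0)[c [Sc vc ec]]] :=
    (pullbackP _ (rng_continuous GP)).1 (gact_fwd GP BP b1) g.
  exists (fun z : units L => match z return BL z with inl y => c y | inr y => 0 end).
  split => //.
  apply: (nearL (j := fun g => aG g)) => // U gU.
  by have := nbhs_inl (Y := (Om + H)%type) (nbhs_inl (Y := Om) gU); apply: filterS => _ [_ [y hy <-] <-]; exists y.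
- have [_ /(_ e e0)[c [Sc vc ec]]] := dc w.
  exists (fun z : units L => match z return BL z with inl y => c y | inr y => 0 end).
  split => //; first by rewrite /= dE.
  apply: (nearL (j := fun g => aW g)); last by apply: filterS ec => w' /=; rewrite dE.
  move=> U gU.
  by have := nbhs_inl (Y := (Om + H)%type) (nbhs_inr (X := G) gU); apply: filterS => _ [_ [y hy <-] <-]; exists y.
- have [d Sd vd] := sec_dense (ind_usc (Om := Om) (B := B)) (ind_ext (b (inl (rho w)))) e20.
  have [delta' dc' dE'] := ind_sections_family Sd.
  exists (fun z : units L => match z return BL z with inl y => 0 | inr y => d y end).
  split; first exact: secr.
    by apply: le_trans vd _; lra.
  have vw : nrm (b (inl (rho w)) - delta' w) < e.
    move: vd; rewrite (ind_nrm _ (erefl (sigma w))) /= ind_extE dE'; lra.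
  have h : bcv (S := sections B) (nbhs w) (p := @rho _ _ _ Om)
      (fun w' => -1 *: delta' w' + (b (inl (rho w')) : B (rho w'))) (-1 *: delta' w + b (inl (rho w))).
    apply: (bcv_lin (gb_usc BP)); first exact: dc'.
    apply: (bcv_sec (b := fun x => b (inl x))) => //; exact: rho_continuous.
  have near1 : \forall w' \near w, nrm (-1 *: delta' w' + (b (inl (rho w')) : B (rho w'))) < e.
    apply: (bcv_norm (gb_usc BP) h); by rewrite scaleN1r addrC.
  apply: (nearL (j := fun g => aV g)).
    move=> U gU.
    by have := nbhs_inr (X := (G + Om)%type) (nbhs_inl (Y := H) gU); apply: filterS => _ [_ [y hy <-] <-]; exists y.
  apply: filterS near1 => w' hw'.
  rewrite (ind_nrm _ (erefl (sigma w'))) /= ind_extE dE'.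
  by move: hw'; rewrite scaleN1r addrC => /ltW.
- have [w0 e0w] := equiv_sigma_surj Om (rng h).
  have r0 : rho (ract w0 h) = rho w0 by rewrite rho_ract.
  have [d Sd vd] := sec_dense (ind_usc (Om := Om) (B := B)) (ind_act (b (inr (src h)))) e20.
  have [delta' dc' dE'] := ind_sections_family Sd.
  exists (fun z : units L => match z return BL z with inl y => 0 | inr y => d y end).
  split; first exact: secr.
    by apply: le_trans vd _; lra.
  have dr (w' : Om) (h' : H) (x : units G) : rho (ract w' h') = x ->
      nrm (tr x (delta (ract w' h')) - tr x (delta' w')) =
      nrm (tr x (delta (ract w' h')) - tr x (delta' w')) by [].
  have val h' w' (s : sigma w' = rng h') :
      nrm (ind_act (b (inr (src h'))) - d (rng h')) =
      nrm (tr (rho w') (delta (ract w' h')) - delta' w').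
    by rewrite (ind_nrm _ s) /= dE dE'.
  pose D : set (Om * H) := [set p | sigma p.1 = rng p.2].
  have cr : (fun p : Om * H => ract p.1 p.2) @ within D (nbhs (w0, h)) --> ract w0 h.
    apply: cvg_ract => //.
    - by apply: cvg_within_filter; exact: cvg_fst.
    - by apply: cvg_within_filter; exact: cvg_snd.
    - exact: withinT.
  have cw : (fun p : Om * H => p.1) @ within D (nbhs (w0, h)) --> w0.
    by apply: cvg_within_filter; exact: cvg_fst.
  have h1 : bcv (S := sections B) (within D (nbhs (w0, h))) (p := fun p => rho p.1)
      (fun p => -1 *: delta' p.1 + tr (rho p.1) (delta (ract p.1 p.2)))
      (-1 *: delta' w0 + tr (rho w0) (delta (ract w0 h))).
    apply: (bcv_lin (gb_usc BP)); first exact: (bcv_comp cw (dc' w0)).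
    have := bcv_comp cr (dc (ract w0 h)) => -[q1 q2]; split.
      by apply: (@cvg_comp _ _ _ (fun p : Om * H => p.1) (@rho _ _ _ Om) _ (nbhs w0)) => //; exact: rho_continuous.
    move=> e' /q2[c [Sc vc ec]]; exists c; split => //.
      move: vc; set x := rho w0 in r0 *; case: x / r0; by rewrite tr_id.
    have dom : \forall p \near within D (nbhs (w0, h)), D p by exact: withinT.
    apply: filterS2 dom ec => -[w' h'] /= s.
    have : rho (ract w' h') = rho w' by rewrite rho_ract.
    move: (delta (ract w' h')); move: (rho (ract w' h')) => x v xr; subst x.
    by rewrite tr_id.
  have near1 : \forall p \near (w0, h), D p ->
      nrm (-1 *: delta' p.1 + tr (rho p.1) (delta (ract p.1 p.2))) < e.
    apply: (bcv_norm (gb_usc BP) h1).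
    move: vd; rewrite (val _ _ e0w) scaleN1r addrC; lra.
  have [[U V] /= [Uw Vh] UV] := near1.
  have near2 : \forall h' \near h, exists2 w', U w' & sigma w' = rng h'.
    have := sigma_near Uw; rewrite e0w => k.
    exact: ((cvg_nearP _ _ _).1 (@rng_continuous _ _ HP h) _ k).
  apply: (nearL (j := fun g => aH g)).
    move=> U' gU.
    by have := nbhs_inr (X := (G + Om)%type) (nbhs_inr (X := Om) gU); apply: filterS => _ [_ [y hy <-] <-]; exists y.
  apply: filterS2 Vh near2 => h' Vh' [w' Uw' s'] /=.
  have := UV (w', h') (conj Uw' Vh') s'; rewrite /= scaleN1r addrC => /ltW.
  by rewrite (val _ _ s').
Qed.

Lemma link_algebraP : is_gBanachAlgebra BL.
Proof.
exact: (gBanachAlgebra_of_sections LP link_usc link_lin link_norm link_fwd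
  link_mul_sections link_gactM link_surj link_bmul).
Qed.

End LinkingAlgebra.

(** * Convolution *)

Section BanachAlgebra.
Context {R : realType} {A : banachAlgType R[i]}.
Implicit Types a b : A.

Lemma nrm_bmul a b : nrm (bmul a b) <= nrm a * nrm b.
Proof. by rewrite -lecR rmorphM/= -!nrmE ler_bnormM. Qed.

Lemma bmul0l b : bmul 0 b = 0 :> A.
Proof. by have := bscalerAl 0 (0 : A) b; rewrite !scale0r. Qed.

Lemma bmul0r a : bmul a 0 = 0 :> A.
Proof. by have := bscalerAr 0 a (0 : A); rewrite !scale0r. Qed.

Lemma bmul_linl (k : R[i]) a a' b : bmul (k *: a + a') b = k *: bmul a b + bmul a' b.
Proof. by rewrite bmulDl bscalerAl. Qed.

Lemma bmul_linr (k : R[i]) a b b' : bmul a (k *: b + b') = k *: bmul a b + bmul a b'.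
Proof. by rewrite bmulDr bscalerAr. Qed.

End BanachAlgebra.

Section Convolution.
Context {R : realType} {G : groupoid_data R}.
Local Notation C := R[i].
Hypotheses (GP : is_lch_groupoid G) (GH : is_haar_system G).
Context {B : gBanachAlgebra_data G}.
Hypothesis BP : is_gBanachAlgebra B.
Let Gh := gpd_hausdorff GP.
Let Gl := gpd_lc GP.
Notation SB := (sections B).
Notation secs := (forall g : G, B (rng g)).
Implicit Types xi zeta theta : secs.

Lemma bcv_tr (Z : Type) (F : set_system Z) {FF : Filter F} (p q : Z -> units G)
    (eta : forall z, B (p z)) x0 y0 (v : B x0) : x0 = y0 ->
  (\forall z \near F, p z = q z) -> bcv (S := SB) F eta v ->
  bcv (S := SB) F (p := q) (fun z => tr (q z) (eta z)) (tr y0 v).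
Proof.
move=> xy pq [px h]; subst y0; split; first exact: near_cvg pq px.
move=> e /h[b [Sb vb eb]]; exists b; split => //; first by rewrite tr_id.
apply: filterS2 pq eb => z.
by move=> pq hb; move: hb; move: (eta z) => c; move: (p z) c pq => y c pq; subst y; rewrite tr_id.
Qed.

Lemma tr0 (x y : units G) : tr (B := B) y (0 : B x) = 0.
Proof. by rewrite /tr; case: pselect => // e; case: _ / e. Qed.

Lemma trtr (x y z : units G) (b : B x) : y = z -> x = y -> tr z (tr y b) = tr z b.
Proof. by move=> yz xy; subst; rewrite !tr_id. Qed.

Lemma Gamma_cP xi : Gamma_c xi <->
  (forall g, bcv (S := SB) (nbhs g) (p := @rng _ G) xi (xi g)) /\
  exists2 K : set G, compact K & forall g, ~ K g -> xi g = 0.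
Proof.
split=> [[h1 h2]|[h1 h2]]; split => //.
  exact/(pullbackP xi (rng_continuous GP)).
exact/(pullbackP xi (rng_continuous GP)).
Qed.

Lemma Gamma_c_bcv xi (Z : Type) (F : set_system Z) {FF : Filter F} (a : Z -> G) a0 :
  Gamma_c xi -> a @ F --> a0 ->
  bcv (S := SB) F (p := fun z => rng (a z)) (fun z => xi (a z)) (xi a0).
Proof. by move=> /Gamma_cP[h _] aa; exact: bcv_comp aa (h a0). Qed.

Definition integrand xi zeta (g' g : G) : B (rng g') :=
  bmul (tr (rng g') (xi g)) (act g (rng g') (zeta (gmul (ginv g) g'))).

Lemma act_zeta_bcv zeta (Z : Type) (F : set_system Z) {FF : Filter F} (a c : Z -> G) a0 c0
    (p : Z -> units G) x0 : Gamma_c zeta -> a @ F --> a0 -> c @ F --> c0 ->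
  rng a0 = rng c0 -> (\forall z \near F, rng (a z) = rng (c z)) ->
  rng c0 = x0 -> (\forall z \near F, rng (c z) = p z) ->
  bcv (S := SB) F (p := p) (fun z => act (a z) (p z) (zeta (gmul (ginv (a z)) (c z))))
    (act a0 x0 (zeta (gmul (ginv a0) c0))).
Proof.
move=> zG aa cc e ne ex nx.
apply: (bcv_act GP BP (q := fun z => rng (gmul (ginv (a z)) (c z))) aa).
- by rewrite (rng_mul GP) ?(rng_inv GP)// (src_inv GP).
- by rewrite e.
- by apply: filterS ne => z h; rewrite (rng_mul GP) ?(rng_inv GP)// (src_inv GP).
- by apply: filterS2 ne nx => z ->.
- apply: Gamma_c_bcv => //; apply: (cvg_gmul GP) => //.
  + exact: cvg_ginv.
  + by rewrite (src_inv GP).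
  + by apply: filterS ne => z h; rewrite (src_inv GP).
Qed.

Lemma integrand_bcv xi zeta (Z : Type) (F : set_system Z) {FF : Filter F} (a c : Z -> G) a0 c0 :
  Gamma_c xi -> Gamma_c zeta -> a @ F --> a0 -> c @ F --> c0 ->
  rng a0 = rng c0 -> (\forall z \near F, rng (a z) = rng (c z)) ->
  bcv (S := SB) F (p := fun z => rng (c z)) (fun z => integrand xi zeta (c z) (a z))
    (integrand xi zeta c0 a0).
Proof.
move=> xG zG aa cc e ne; apply: (bcv_bmul BP).
  by apply: bcv_tr => //; exact: Gamma_c_bcv.
by apply: act_zeta_bcv => //; exact: filterE.
Qed.

Lemma bconv_hint xi zeta g' : Gamma_c xi -> Gamma_c zeta ->
  hint (haar G (rng g')) (integrand xi zeta g') (bconv xi zeta g').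
Proof.
move=> xG zG; have [_ [K Kc xK]] := (Gamma_cP xi).1 xG.
have [||v hv] := fibre_integral (S := SB) Gh Gl (r := @rng _ G) (haar_radon GH)
    (haar_supp GH) (x := rng g') (Phi := integrand xi zeta g') Kc.
- by move=> g e nK; rewrite /integrand xK// tr0 bmul0l.
- move=> g Kg e; have := @integrand_bcv xi zeta G (within [set g | rng g = rng g'] (nbhs g)) _
    id (fun=> g') g g' xG zG.
  apply => //.
  + by apply: cvg_within_filter; exact: cvg_id.
  + exact: cvg_cst.
  + exact: withinT.
by rewrite /bconv -/(integrand xi zeta g') (integralE (haar_radon GH _) Gh Gl hv).
Qed.

Lemma bconv_Gamma_c xi zeta : Gamma_c xi -> Gamma_c zeta -> Gamma_c (bconv xi zeta).
Proof.
move=> xG zG; have [_ [K Kc xK]] := (Gamma_cP xi).1 xG.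
have [_ [L Lc zL]] := (Gamma_cP zeta).1 zG.
apply/Gamma_cP; split.
  move=> g'; apply: (parametrized_integral (gb_usc BP) (units_hausdorff GP) Gh Gl
    (r := @rng _ G) (rng_continuous GP) (haar_radon GH) (haar_supp GH) (haar_rcont GH)
    (Phi := integrand xi zeta) Kc).
  - exact: (rng_continuous GP).
  - by move=> z; exact: bconv_hint.
  - by apply: filterE => z g e nK; rewrite /integrand xK// tr0 bmul0l.
  - move=> g Kg e; apply: integrand_bcv => //.
    + by apply: cvg_within_filter; exact: cvg_snd.
    + by apply: cvg_within_filter; exact: cvg_fst.
    + exact: withinT.
exists [set g | exists a b, [/\ K a, L b, src a = rng b & g = gmul a b]].
  exact: compact_gmul.
move=> g' nK; apply: (hint_uniq (haar_radon GH _) Gh Gl (bconv_hint g' xG zG)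
  (hint0 (haar_radon GH _))) => g.
rewrite (msupport_haar GH) => e; rewrite /integrand.
have [Kg|nKg] := pselect (K g); last by rewrite xK// tr0 bmul0l.
rewrite zL ?(act0 BP) ?bmul0r// => Lg; apply: nK.
exists g, (gmul (ginv g) g'); split => //.
  by rewrite (rng_mul GP) ?(rng_inv GP)// (src_inv GP).
by rewrite (gmulKV GP).
Qed.

Lemma Gamma_c_lin (k : C) xi zeta : Gamma_c xi -> Gamma_c zeta ->
  Gamma_c (fun g => k *: xi g + zeta g).
Proof.
move=> /Gamma_cP[x1 [K Kc xK]] /Gamma_cP[z1 [L Lc zL]]; apply/Gamma_cP; split.
  by move=> g; apply: (bcv_lin (gb_usc BP)).
exists (K `|` L); first exact: compactU.
by move=> g /not_orP[/xK -> /zL ->]; rewrite scaler0 addr0.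
Qed.

Lemma Gamma_c0 : Gamma_c (fun g => 0 : B (rng g)).
Proof.
apply/Gamma_cP; split.
  by move=> g; apply: (bcv0 (gb_usc BP)); exact: (rng_continuous GP).
by exists set0 => //; exact: compact0.
Qed.

Lemma bconv_linl (k : C) xi xi' zeta : Gamma_c xi -> Gamma_c xi' -> Gamma_c zeta ->
  bconv (fun g => k *: xi g + xi' g) zeta = fun g => k *: bconv xi zeta g + bconv xi' zeta g.
Proof.
move=> xG xG' zG; apply: functional_extensionality_dep => g'.
apply: (hint_uniq (haar_radon GH _) Gh Gl (bconv_hint g' (Gamma_c_lin k xG xG') zG)
  (hintD (haar_radon GH _) k (bconv_hint g' xG zG) (bconv_hint g' xG' zG))) => g _.
by rewrite /integrand tr_lin bmul_linl.
Qed.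

Lemma bconv_linr (k : C) xi zeta zeta' : Gamma_c xi -> Gamma_c zeta -> Gamma_c zeta' ->
  bconv xi (fun g => k *: zeta g + zeta' g) = fun g => k *: bconv xi zeta g + bconv xi zeta' g.
Proof.
move=> xG zG zG'; apply: functional_extensionality_dep => g'.
apply: (hint_uniq (haar_radon GH _) Gh Gl (bconv_hint g' xG (Gamma_c_lin k zG zG'))
  (hintD (haar_radon GH _) k (bconv_hint g' xG zG) (bconv_hint g' xG zG'))) => g _.
by rewrite /integrand (act_lin BP) bmul_linr.
Qed.

(** With $x = r(g')$, both sides are iterated integrals over $g,k\in\mathcal G^x$ of $F(g,k) =
    \xi(g)\,g\zeta(g^{-1}k)\,k\theta(k^{-1}g')$. Integrating over $g$ first gives the right-hand
    side at once; integrating over $k$ first gives the left-hand side after substituting $gk$ for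
    $k$. *)
Lemma bconvA xi zeta theta : Gamma_c xi -> Gamma_c zeta -> Gamma_c theta ->
  bconv xi (bconv zeta theta) = bconv (bconv xi zeta) theta.
Proof.
move=> xG zG tG; apply: functional_extensionality_dep => g'.
have [_ [K Kc xK]] := (Gamma_cP xi).1 xG.
have [_ [T Tc tT]] := (Gamma_cP theta).1 tG.
pose x := rng g'.
pose F g k : B x := bmul (bmul (tr x (xi g)) (act g x (zeta (gmul (ginv g) k))))
  (act k x (theta (gmul (ginv k) g'))).
(* Where [F] does not vanish, [gmul (ginv k) g'] lies in the support of [theta]; this confines [k]
   to a compact set. *)
pose L : set G := [set g | exists a b, [/\ [set g'] a, [set h | T (ginv h)] b,
  src a = rng b & g = gmul a b]].
have Lc : compact L by apply: (compact_gmul GP); [exact: compact_set1|exact: (compact_ginv GP)].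
have [| | |G1 [G2 [v [h1 h2 h3 h4]]]] := @fubini R G G (B x) Gh Gl Gh Gl (haar G x) (haar G x)
  (haar_radon GH _) (haar_radon GH _) F K L Kc Lc.
- by move=> g k _ _ nK; rewrite /F xK// tr0 !bmul0l.
- move=> g k _; rewrite (msupport_haar GH) => rk nL.
  rewrite /F tT ?(act0 BP) ?bmul0r// => Tk; apply: nL.
  exists g', (gmul (ginv g') k); split => //.
  + by rewrite /= (ginvM GP) ?(ginvK GP)// (src_inv GP).
  + by rewrite (rng_mul GP) ?(rng_inv GP)// (src_inv GP).
  + by rewrite (gmulKV GP).
- move=> g k e; rewrite !(msupport_haar GH) => rg rk e0.
  pose D : set (G * G) := [set p | rng p.1 = x /\ rng p.2 = x].
  have c1 : (fun p : G * G => p.1) @ within D (nbhs (g, k)) --> g.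
    by apply: cvg_within_filter; exact: cvg_fst.
  have c2 : (fun p : G * G => p.2) @ within D (nbhs (g, k)) --> k.
    by apply: cvg_within_filter; exact: cvg_snd.
  have dom : \forall p \near within D (nbhs (g, k)), D p by exact: withinT.
  have : bcv (S := SB) (within D (nbhs (g, k))) (p := fun=> x) (fun p => F p.1 p.2) (F g k).
    apply: (bcv_bmul BP); first apply: (bcv_bmul BP).
    - apply: bcv_tr => //; last exact: (Gamma_c_bcv xG c1).
      by apply: filterS dom => p [].
    - apply: (act_zeta_bcv zG c1 c2) => //; first by rewrite rg rk.
        by apply: filterS dom => p [-> ->].
      by apply: filterS dom => p [].
    - apply: (act_zeta_bcv tG c2 (cvg_cst g')) => //.
        by apply: filterS dom => p [].
      exact: filterE.
  move=> h; have := bcv_const h e0 => h'.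
  have {}h' : \forall p \near (g, k), D p -> nrm (F p.1 p.2 - F g k) <= e by exact: h'.
  suff : \forall p \near nbhs (g, k), msupport (haar G x) p.1 -> msupport (haar G x) p.2 ->
    nrm (F p.1 p.2 - F g k) <= e by [].
  by apply: filterS h' => p hp; rewrite !(msupport_haar GH) => q1 q2; apply: hp.
have e1 : bconv (bconv xi zeta) theta g' = v.
  apply: (hint_uniq (haar_radon GH _) Gh Gl
    (bconv_hint g' (bconv_Gamma_c xG zG) tG) h4) => k.
  move=> sk; have rk : rng k = x by move: sk; rewrite (msupport_haar GH).
  have := h2 _ sk => hk; rewrite /integrand -/x.
  have hk' := bconv_hint k xG zG.
  have hk2 : hint (haar G (rng k)) (fun g => F g k)
      (bmul (tr x (bconv xi zeta k)) (act k x (theta (gmul (ginv k) g')))).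
    pose S (b : B (rng k)) := bmul (tr x b) (act k x (theta (gmul (ginv k) g'))).
    have : hint (haar G (rng k)) (fun g => S (integrand xi zeta k g)) (S (bconv xi zeta k)).
      apply: (hint_map (T := S) (M := nrm (act k x (theta (gmul (ginv k) g')))) _ _ _ _ hk').
      - exact: haar_radon.
      - by move=> c a a'; rewrite /S tr_lin bmul_linl.
      - exact: nrm_ge0.
      - move=> a; apply: le_trans (nrm_bmul _ _) _; rewrite mulrC.
        have -> : nrm (tr x a) = nrm a by rewrite /nrm (tr_norm _ rk).
        exact: lexx.
    apply: hint_ext => g; rewrite (msupport_haar GH) => rg.
    by rewrite /S /F /integrand tr_mul trtr// ?rg// tr_act.
  have {}hk2 : hint (haar G x) (fun g => F g k)
      (bmul (tr x (bconv xi zeta k)) (act k x (theta (gmul (ginv k) g')))).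
    by move: hk2; move: (bmul _ _) => b; rewrite rk.
  exact: (hint_uniq (haar_radon GH _) Gh Gl hk2 hk).
rewrite e1; apply: (hint_uniq (haar_radon GH _) Gh Gl
    (bconv_hint g' xG (bconv_Gamma_c zG tG)) h3) => g sg.
have rg : rng g = x by move: sg; rewrite (msupport_haar GH).
have hg := h1 _ sg; rewrite -{1}rg in hg.
(* The substitution: left invariance turns the integral over the fibre of [x] into one over the
   fibre of [src g]. *)
have hg1 := hint_haar_inv GP GH hg.
have rgg : rng (gmul (ginv g) g') = src g.
  by rewrite (rng_mul GP) ?(rng_inv GP)// (src_inv GP) rg.
have hg2 := bconv_hint (gmul (ginv g) g') zG tG.
pose S (b : B (rng (gmul (ginv g) g'))) := bmul (tr x (xi g)) (act g x b).
have hg3 : hint (haar G (rng (gmul (ginv g) g'))) (fun k => F g (gmul g k))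
    (S (bconv zeta theta (gmul (ginv g) g'))).
  have : hint (haar G (rng (gmul (ginv g) g')))
      (fun k => S (integrand zeta theta (gmul (ginv g) g') k))
      (S (bconv zeta theta (gmul (ginv g) g'))).
    apply: (hint_map (T := S) (M := nrm (tr x (xi g))) _ _ _ _ hg2).
    - exact: haar_radon.
    - by move=> c a a'; rewrite /S (act_lin BP) bmul_linr.
    - exact: nrm_ge0.
    - move=> a; apply: le_trans (nrm_bmul _ _) _.
      have -> : nrm (act g x a) = nrm a by rewrite /nrm (act_norm BP).
      exact: lexx.
  apply: hint_ext => k; rewrite (msupport_haar GH) rgg => rk.
  rewrite /S /F /integrand (act_mul BP) bmulA (gmulVK GP)//.
  rewrite act_tr ?rk//; congr bmul.
  have e2 : gmul (ginv (gmul g k)) g' = gmul (ginv k) (gmul (ginv g) g').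
    by rewrite (ginvM GP)// -(gmulA GP) ?(src_inv GP) ?(rng_inv GP).
  rewrite e2 (act_comp BP (y := src g))//; first by rewrite rgg.
  by rewrite (rng_mul GP) ?(rng_inv GP)// (src_inv GP) rk rgg.
rewrite rgg in hg3.
exact: (hint_uniq (haar_radon GH _) Gh Gl hg3 hg1 (fun _ _ => erefl)).
Qed.

End Convolution.

(** * Selections as a module, and additive spans *)

Section DependentProduct.
Context {R : realType} {T : Type} (E : T -> lmodType R[i]).
Local Notation C := R[i].

(** The ambient module of all selections: it makes finite sums of sections and the abstract
    completion available, while [Gamma_c] and the corners remain predicates on it. *)
Definition dprod := forall t, E t.
Implicit Types f g : dprod.

HB.instance Definition _ := gen_eqMixin dprod.
HB.instance Definition _ := gen_choiceMixin dprod.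

Definition dprod_zero : dprod := fun t => 0.
Definition dprod_add f g : dprod := fun t => f t + g t.
Definition dprod_opp f : dprod := fun t => - f t.
Definition dprod_scale (k : C) f : dprod := fun t => k *: f t.

Let ext f g : (forall t, f t = g t) -> f = g.
Proof. by move=> fg; apply: functional_extensionality_dep. Qed.

Let addA : associative dprod_add.
Proof. by move=> a b c; apply: ext => t; exact: addrA. Qed.
Let addC : commutative dprod_add.
Proof. by move=> a b; apply: ext => t; exact: addrC. Qed.
Let add0 : left_id dprod_zero dprod_add.
Proof. by move=> a; apply: ext => t; exact: add0r. Qed.
Let addN : left_inverse dprod_zero dprod_opp dprod_add.
Proof. by move=> a; apply: ext => t; exact: addNr. Qed.

HB.instance Definition _ := GRing.isZmodule.Build dprod addA addC add0 addN.

Let scaleA (k l : C) f : dprod_scale k (dprod_scale l f) = dprod_scale (k * l) f.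
Proof. by apply: ext => t; exact: scalerA. Qed.
Let scale1 : left_id 1 dprod_scale.
Proof. by move=> f; apply: ext => t; exact: scale1r. Qed.
Let scaleDr : right_distributive dprod_scale +%R.
Proof. by move=> k f g; apply: ext => t; exact: scalerDr. Qed.
Let scaleDl f : {morph dprod_scale^~ f : k l / k + l}.
Proof. by move=> k l; apply: ext => t; exact: scalerDl. Qed.

HB.instance Definition _ :=
  GRing.Zmodule_isLmodule.Build C dprod scaleA scale1 scaleDr scaleDl.

Lemma dprodE (k : C) f g t : (k *: f + g) t = k *: f t + g t.
Proof. by []. Qed.

Lemma dprod_sumE n (f : 'I_n -> dprod) t : (\sum_i f i) t = \sum_i f i t.
Proof. by elim/big_ind2 : _ => // f1 x f2 y <- <-. Qed.

End DependentProduct.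

Section AdditiveSpan.
Context {V : zmodType}.

(** Sums without coefficients suffice for density, because the sets considered consist of products,
    which absorb scalars; proofs by induction become shorter than with [linspan]. *)
Inductive aspan (S : set V) : set V :=
| aspan0 : aspan S 0
| aspanD s v : S s -> aspan S v -> aspan S (s + v).

Lemma aspan_gen (S : set V) s : S s -> aspan S s.
Proof. by move=> Ss; rewrite -[s]addr0; apply: aspanD => //; exact: aspan0. Qed.

Lemma aspan_add (S : set V) u v : aspan S u -> aspan S v -> aspan S (u + v).
Proof.
move=> + Sv; elim=> [|s w Ss _ IH]; first by rewrite add0r.
by rewrite -addrA; apply: aspanD.
Qed.

Lemma aspan_sum (S : set V) n (u : 'I_n -> V) : (forall i, aspan S (u i)) ->
  aspan S (\sum_i u i).
Proof.
by move=> Su; elim/big_ind : _ => // [|x y]; [exact: aspan0|exact: aspan_add].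
Qed.

End AdditiveSpan.

Lemma aspan_hom (V W : zmodType) (S : set V) (S' : set W) (f : V -> W) v :
  f 0 = 0 -> (forall a b, f (a + b) = f a + f b) -> (forall s, S s -> aspan S' (f s)) ->
  aspan S v -> aspan S' (f v).
Proof.
move=> f0 fD fS; elim=> [|s w Ss _ IH]; first by rewrite f0; exact: aspan0.
by rewrite fD; apply: aspan_add => //; exact: fS.
Qed.

(** * Scalar convolution and the norm of sections *)

Section ScalarConvolution.
Context {R : realType} {G : groupoid_data R}.
Local Notation C := R[i].
Hypotheses (GP : is_lch_groupoid G) (GH : is_haar_system G).
Let Gh := gpd_hausdorff GP.
Let Gl := gpd_lc GP.
Implicit Types f : G -> R.

Definition rconv f1 f2 (g' : G) : R :=
  complex.Re (conv (fun g => (f1 g)%:C) (fun g => (f2 g)%:C) g').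

Let integrand_cvg f1 f2 (Z : Type) (F : set_system Z) {FF : Filter F} (a c : Z -> G) a0 c0 :
  rCc f1 -> rCc f2 -> a @ F --> a0 -> c @ F --> c0 ->
  rng a0 = rng c0 -> (\forall z \near F, rng (a z) = rng (c z)) ->
  (fun z => (f1 (a z) * f2 (gmul (ginv (a z)) (c z)))%:C : C^o) @ F -->
    ((f1 a0 * f2 (gmul (ginv a0) c0))%:C : C^o).
Proof.
move=> [f1c _] [f2c _] aa cc e ne; apply/cvg_ReIm; split => /=; last exact: cvg_cst.
apply: cvgM; first by apply: (@cvg_comp _ _ _ a f1 _ (nbhs a0)); [exact: aa|exact: f1c].
apply: (@cvg_comp _ _ _ _ f2 _ (nbhs (gmul (ginv a0) c0))); last exact: f2c.
apply: (cvg_gmul GP) => //.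
- exact: cvg_ginv.
- by rewrite (src_inv GP).
- by apply: filterS ne => z h; rewrite (src_inv GP).
Qed.

Lemma rconv_hint f1 f2 g' : rCc f1 -> rCc f2 ->
  hint (V := C^o) (haar G (rng g')) (fun g => (f1 g * f2 (gmul (ginv g) g'))%:C : C^o)
    ((rconv f1 f2 g')%:C : C^o).
Proof.
move=> f1C f2C; have [_ [K Kc fK]] := f1C.
have [||v hv] := fibre_integral (S := @continuous_scalars R (units G)) Gh Gl (r := @rng _ G)
    (haar_radon GH) (haar_supp GH) (x := rng g')
    (Phi := fun g => (f1 g * f2 (gmul (ginv g) g'))%:C : Cfield (rng g')) Kc.
- by move=> g e nK; rewrite fK// mul0r.
- move=> g Kg e; apply: scalar_bcv; first exact: cvg_cst.
  apply: (integrand_cvg f1C f2C _ (cvg_cst g')) => //.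
  + by apply: cvg_within_filter; exact: cvg_id.
  + exact: withinT.
rewrite /rconv /conv /cintegral.
have -> : (fun g : G => (f1 g)%:C * (f2 (gmul (ginv g) g'))%:C) =
    (fun g : G => (f1 g * f2 (gmul (ginv g) g'))%:C).
  by apply/funext => g; rewrite rmorphM.
have hv' : hint (V := C^o) (haar G (rng g'))
   (fun g => (f1 g * f2 (gmul (ginv g) g'))%:C : C^o) v by exact: hv.
have -> := integralE (haar_radon GH _) Gh Gl hv'.
by rewrite -(hint_real (haar_radon GH _) Gh Gl hv').
Qed.

Lemma conv_real f1 f2 : rCc f1 -> rCc f2 ->
  conv (fun g => (f1 g)%:C) (fun g => (f2 g)%:C) = fun g => (rconv f1 f2 g)%:C.
Proof.
move=> f1C f2C; apply/funext => g'.
rewrite {1}/conv /cintegral.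
have -> : (fun g : G => (f1 g)%:C * (f2 (gmul (ginv g) g'))%:C) =
    (fun g : G => (f1 g * f2 (gmul (ginv g) g'))%:C).
  by apply/funext => g; rewrite rmorphM.
exact: (integralE (haar_radon GH _) Gh Gl (rconv_hint g' f1C f2C)).
Qed.

Lemma rconv_rCc f1 f2 : rCc f1 -> rCc f2 -> rCc (rconv f1 f2).
Proof.
move=> f1C f2C; have [_ [K Kc f1K]] := f1C; have [_ [L Lc f2L]] := f2C.
split.
  suff h : forall g', (fun g => (rconv f1 f2 g)%:C : C^o) @ g' --> ((rconv f1 f2 g')%:C : C^o).
    by move=> g'; have /cvg_ReIm[] := h g'.
  move=> g'; apply: (@bcv_scalar R (units G) G (nbhs g') _ (@rng _ G) (rng g')).
  apply: (parametrized_integral (@continuous_scalars_usc R _) (units_hausdorff GP) Gh Gl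
    (r := @rng _ G) (rng_continuous GP) (haar_radon GH) (haar_supp GH) (haar_rcont GH)
    (Phi := fun g' g => (f1 g * f2 (gmul (ginv g) g'))%:C) Kc).
  - exact: (rng_continuous GP).
  - by move=> z; exact: rconv_hint.
  - by apply: filterE => z g e nK; rewrite f1K// mul0r.
  - move=> g Kg e; apply: scalar_bcv.
      apply: (@cvg_comp _ _ _ (fun zg : G * G => zg.1) (@rng _ G) _ (nbhs g')).
        by apply: cvg_within_filter; exact: cvg_fst.
      exact: (rng_continuous GP).
    apply: (integrand_cvg f1C f2C) => //.
    + by apply: cvg_within_filter; exact: cvg_snd.
    + by apply: cvg_within_filter; exact: cvg_fst.
    + exact: withinT.
exists [set g | exists a b, [/\ K a, L b, src a = rng b & g = gmul a b]].
  exact: compact_gmul.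
move=> g' nK; apply: (@complexI R).
apply: (hint_uniq (V := C^o) (haar_radon GH _) Gh Gl (rconv_hint g' f1C f2C)
  (hint0 (haar_radon GH _))) => g.
rewrite (msupport_haar GH) => e.
have [Kg|nKg] := pselect (K g); last by rewrite f1K// mul0r.
rewrite f2L ?mulr0// => Lg; apply: nK.
exists g, (gmul (ginv g) g'); split => //.
  by rewrite (rng_mul GP) ?(rng_inv GP)// (src_inv GP).
by rewrite (gmulKV GP).
Qed.

End ScalarConvolution.

Section UpperNorm.
Context {R : realType} {G : groupoid_data R}.
Local Notation C := R[i].
Hypotheses (GP : is_lch_groupoid G) (GH : is_haar_system G).
Context {B : gBanachAlgebra_data G}.
Hypothesis BP : is_gBanachAlgebra B.
Let Gh := gpd_hausdorff GP.
Let Gl := gpd_lc GP.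
Variable N : (G -> C) -> R.

Definition rnorm_of (f : G -> R) : R := N (fun g => (f g)%:C).
Local Notation Nr := rnorm_of.

(** What the norms of $\mathcal A(\mathcal L)$ and $L^1(\mathcal L)$ have in common. It concerns
    real functions, and monotonicity only nonnegative ones, since [N] is evaluated on functions that
    dominate the norms of sections. *)
Record conv_norm : Prop := {
  cn_Z : forall (k : R) f, 0 <= k -> rCc f -> Nr (fun g => k * f g) <= k * Nr f;
  cn_D : forall f1 f2, rCc f1 -> rCc f2 -> Nr (fun g => f1 g + f2 g) <= Nr f1 + Nr f2;
  cn_mono : forall f1 f2, rCc f1 -> rCc f2 -> (forall g, 0 <= f1 g <= f2 g) -> Nr f1 <= Nr f2;
  cn_conv : forall f1 f2, rCc f1 -> rCc f2 -> (forall g, 0 <= f1 g) -> (forall g, 0 <= f2 g) ->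
    Nr (rconv f1 f2) <= Nr f1 * Nr f2 }.

Hypothesis NP : conv_norm.
Notation secs := (dprod (fun g : G => B (rng g))).
Implicit Types xi zeta theta : secs.

(** Monotonicity gives that [Nr f] is at least [Nr 0], and the scaling rule with factor 2, applied
    to the zero function, gives [Nr 0 <= 2 * Nr 0]. *)
Lemma cn_ge0 f : rCc f -> (forall g, 0 <= f g) -> 0 <= Nr f.
Proof.
move=> fC f0; have h0 := cn_Z NP (lexx 0) fC; rewrite mul0r in h0.
have := cn_mono NP (@rCc0 R G) fC; rewrite (_ : Nr _ = Nr (fun g => 0 * f g)); last first.
  by congr N; apply/funext => g; rewrite mul0r.
move=> h1.
have h2 : Nr (fun g => 0 * f g) <= Nr f by apply: h1 => g; rewrite lexx f0.
have := cn_Z NP (ler0n _ 2) (rCcZ 0 fC).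
rewrite (_ : (fun g => _) = fun g => 0 * f g); last by apply/funext => g; ring.
by lra.
Qed.

Definition unorm xi : R := upper_norm N (fun g => `|xi g|).

Let dom xi : set (G -> C) := [set psi | Cc psi /\ forall g, `|xi g| <= psi g].

Let dom_real xi psi : dom xi psi -> exists f, [/\ rCc f, psi = fun g => (f g)%:C &
  forall g, nrm (xi g) <= f g].
Proof.
move=> [pC xp]; exists (fun g => complex.Re (psi g)); split.
- exact: Cc_Re.
- apply/funext => g; rewrite RRe_real//; apply: ger0_real.
  by apply: le_trans (xp g); exact: normr_ge0.
- by move=> g; have := xp g; rewrite lecE => /andP[_]; rewrite /nrm.
Qed.

Let lbd xi : has_lbound [set N psi | psi in dom xi].
Proof.
exists 0 => _ [psi /dom_real[f [fC -> xf]] <-]; apply: cn_ge0 => // g.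
exact: le_trans (nrm_ge0 _) (xf g).
Qed.

Lemma unorm_le xi f : rCc f -> (forall g, nrm (xi g) <= f g) -> unorm xi <= Nr f.
Proof.
move=> fC xf; apply: (ge_inf (lbd xi)).
exists (fun g => (f g)%:C) => //; split; first exact: Cc_real.
by move=> g; rewrite nrm_le.
Qed.

(** The norm of a section is only upper semi-continuous, hence locally bounded; finitely many local
    bounds cover the compact support, and their sum times [chi] dominates. Without such a function
    the infimum defining the norm would be over the empty set. *)
Lemma Gamma_c_dominated xi : Gamma_c xi ->
  exists2 f, rCc f & forall g, nrm (xi g) <= f g.
Proof.
move=> xG; have [xc [K Kc xK]] := (Gamma_cP GP xi).1 xG.
have [chi [chiC chi0 part]] := @partition R G Gh Gl K Kc.
have [n [c [_ cov]]] : exists n (c : 'I_n -> G), (forall i, K (c i)) /\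
    forall g, K g -> exists i, nrm (xi g) < nrm (xi (c i)) + 1.
  apply: (@finite_cover _ _ (fun g0 => [set g | nrm (xi g) < nrm (xi g0) + 1]) Kc).
  by move=> g0 _; apply: (bcv_norm (gb_usc BP) (xc g0)); rewrite ltrDl.
have [m [p [d [_ p0 _ p1 pchi]]]] := part (fun=> setT) (fun _ _ => filterT).
exists (fun g => (\sum_i (nrm (xi (c i)) + 1)) * chi g); first exact: rCcZ.
move=> g; have M0 : 0 <= \sum_i (nrm (xi (c i)) + 1).
  by apply: sumr_ge0 => i _; rewrite addr_ge0// nrm_ge0.
have [Kg|nKg] := pselect (K g); last by rewrite xK// nrm0 mulr_ge0.
have [i hi] := cov _ Kg.
have c1 : 1 <= chi g by rewrite -(p1 _ Kg).
apply: le_trans (ltW hi) _; apply: le_trans (_ : \sum_i (nrm (xi (c i)) + 1) <= _); last first.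
  by rewrite ler_peMr.
rewrite (bigD1 i)//= lerDl; apply: sumr_ge0 => j _; by rewrite addr_ge0// nrm_ge0.
Qed.

Lemma unorm_approx xi e : Gamma_c xi -> 0 < e ->
  exists f, [/\ rCc f, forall g, nrm (xi g) <= f g & Nr f < unorm xi + e].
Proof.
move=> /Gamma_c_dominated[f0 f0C xf0] e0.
have ne : has_inf [set N psi | psi in dom xi].
  split; last exact: lbd.
  exists (Nr f0); exists (fun g => (f0 g)%:C) => //; split; first exact: Cc_real.
  by move=> g; rewrite nrm_le.
have [_ [psi /dom_real[f [fC -> xf]] <-] lt] := inf_adherent e0 ne.
by exists f.
Qed.

Lemma unorm_ge0 xi : Gamma_c xi -> 0 <= unorm xi.
Proof.
move=> xG; apply/ler_addgt0Pr => e e0; have [f [fC xf lt]] := unorm_approx xG e0.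
apply: le_trans (ltW lt); apply: cn_ge0 => // g; exact: le_trans (nrm_ge0 _) (xf g).
Qed.

Lemma unorm0 : unorm 0 = 0.
Proof.
apply/eqP; rewrite eq_le (unorm_ge0 (Gamma_c0 GP BP)) andbT.
apply: (@le_trans _ _ (Nr (fun=> 0))).
  by apply: unorm_le; [exact: rCc0|move=> g; rewrite nrm0].
by have := cn_Z NP (lexx 0) (@rCc0 R G); rewrite /rnorm_of /= !mul0r.
Qed.

Lemma unorm_lin (k : C) xi zeta : Gamma_c xi -> Gamma_c zeta ->
  unorm (k *: xi + zeta) <= complex.Re `|k| * unorm xi + unorm zeta.
Proof.
move=> xG zG; apply/ler_addgt0Pr => e e0.
have k0 : 0 <= complex.Re `|k| by exact: (nrm_ge0 (k : C^o)).
set r := complex.Re `|k| in k0 *.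
have d0 : 0 < e / (r + 1) by rewrite divr_gt0// ltr_wpDl.
have [f [fC xf lf]] := unorm_approx xG d0.
have e20 : 0 < e / (r + 1) by [].
have [f' [fC' xf' lf']] := unorm_approx zG d0.
apply: le_trans (_ : Nr (fun g => r * f g + f' g) <= _).
  apply: unorm_le; first by apply: rCcD => //; exact: rCcZ.
  move=> g; rewrite dprodE; apply: le_trans (nrmD _ _) _.
  by rewrite nrmZ lerD// ler_wpM2l.
apply: le_trans (cn_D NP (rCcZ _ fC) fC') _.
have := cn_Z NP k0 fC => h1.
have h2 : r * Nr f <= r * (unorm xi + e / (r + 1)) by rewrite ler_wpM2l// ltW.
have h3 : e = r * (e / (r + 1)) + e / (r + 1).
  by field; rewrite gt_eqF// ltr_wpDl.
lra.
Qed.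

(** If [f] and [f'] dominate the norms of the factors, then [rconv f f'] dominates that of the
    convolution, because the action is isometric and the products of the fibres are
    submultiplicative. Now take nearly optimal [f] and [f']. *)
Lemma unorm_bconv xi zeta : Gamma_c xi -> Gamma_c zeta ->
  unorm (bconv xi zeta) <= unorm xi * unorm zeta.
Proof.
move=> xG zG; apply/ler_addgt0Pr => e e0.
have x0 := unorm_ge0 xG; have z0 := unorm_ge0 zG.
(* With [d] at most 1, the product of [unorm xi + d] and [unorm zeta + d] exceeds that of the norms
   by at most [d * (unorm xi + unorm zeta + 1)]. *)
pose d := Num.min 1 (e / (unorm xi + unorm zeta + 1)).
have s0 : 0 < unorm xi + unorm zeta + 1 by lra.
have d0 : 0 < d by rewrite lt_min ltr01 divr_gt0.
have d1 : d <= 1 by rewrite /d ge_min lexx.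
have de : d * (unorm xi + unorm zeta + 1) <= e.
  by rewrite -ler_pdivlMr// /d ge_min lexx orbT.
have [f [fC xf lf]] := unorm_approx xG d0.
have [f' [fC' xf' lf']] := unorm_approx zG d0.
have f0 g : 0 <= f g by exact: le_trans (nrm_ge0 _) (xf g).
have f0' g : 0 <= f' g by exact: le_trans (nrm_ge0 _) (xf' g).
apply: le_trans (_ : Nr (rconv f f') <= _).
  apply: unorm_le; first exact: rconv_rCc.
  move=> g'; apply: (hint_le_real Gh Gl (haar_radon GH _) (bconv_hint GP GH BP g' xG zG)
    (rconv_hint GP GH g' fC fC')) => g; rewrite (msupport_haar GH) => rg.
  rewrite /integrand; apply: le_trans (nrm_bmul _ _) _.
  have -> : nrm (tr (rng g') (xi g)) = nrm (xi g) by rewrite /nrm (tr_norm _ rg).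
  have -> : nrm (act g (rng g') (zeta (gmul (ginv g) g'))) = nrm (zeta (gmul (ginv g) g')).
    rewrite /nrm (act_norm BP)//.
    by rewrite (rng_mul GP) ?(rng_inv GP)// (src_inv GP).
  by apply: ler_pM; rewrite ?nrm_ge0.
apply: le_trans (cn_conv NP fC fC' f0 f0') _.
have n0 := cn_ge0 fC f0; have n0' := cn_ge0 fC' f0'.
apply: le_trans (_ : (unorm xi + d) * (unorm zeta + d) <= _).
  by apply: ler_pM => //; exact: ltW.
have : d * d <= d by rewrite ler_piMl// ltW.
by move: de; lra.
Qed.

End UpperNorm.

(** * Density of products *)

Lemma plateau (R : realType) (X : topologicalType) (K : set X) :
  hausdorff_space X -> locally_compact [set: X] -> compact K ->
  exists chi : X -> R, [/\ rCc chi, forall x, 0 <= chi x & forall x, K x -> 1 <= chi x].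
Proof.
move=> Xh Xl Kc; have [chi [chiC chi0 part]] := @partition R X Xh Xl K Kc.
exists chi; split => // x Kx.
have [n [p [d [_ _ _ p1 pchi]]]] := part (fun=> setT) (fun _ _ => filterT).
by rewrite -(p1 _ Kx).
Qed.

Lemma compact_neighborhood (X : topologicalType) (K : set X) :
  locally_compact [set: X] -> compact K ->
  exists2 L, compact L & forall x, K x -> nbhs x L.
Proof.
move=> Xl Kc.
have ex (x : X) : exists L, compact L /\ nbhs x L.
  by have [L cL xL] := compact_nbhs Xl x; exists L.
pose L (x : X) := sval (cid (ex x)).
have LP (x : X) : compact (L x) /\ nbhs x (L x) := svalP (cid (ex x)).
have [n [c [_ cov]]] := @finite_cover X K (fun x : X => (L x)°) Kc
  (fun x _ => nbhs_interior (LP x).2).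
exists (\big[setU/set0]_i L (c i)).
  by apply: bigsetU_compact => i _; case: (LP (c i)).
move=> x Kx; have [i Li] := cov x Kx; move: Li; apply: filterS => y Ly.
by rewrite (bigD1 i)//=; left.
Qed.

Lemma rint_ext (R : realType) (X : topologicalType) (mu : (X -> R[i]) -> R[i])
    (f g : X -> R) : radon mu -> hausdorff_space X -> locally_compact [set: X] ->
  rCc f -> rCc g -> (forall x, msupport mu x -> f x = g x) -> rint mu f = rint mu g.
Proof.
move=> muR Xh Xl fC gC fg; apply: (@complexI R); rewrite -!(mu_rint muR)//.
apply: (hint_uniq (V := R[i]^o) muR Xh Xl (hint_Cc muR (Cc_real fC))
  (hint_Cc muR (Cc_real gC))).
by move=> x /fg ->.
Qed.

Section LocalProduct.
Context {R : realType} {G : groupoid_data R}.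
Local Notation C := R[i].
Hypotheses (GP : is_lch_groupoid G) (GH : is_haar_system G).
Context {B : gBanachAlgebra_data G}.
Hypothesis BP : is_gBanachAlgebra B.
Let Gh := gpd_hausdorff GP.
Let Gl := gpd_lc GP.
Notation SB := (sections B).
Notation secs := (dprod (fun g : G => B (rng g))).
Implicit Types (xi zeta theta : secs) (beta : forall x, B x).

(** The translate of [theta] by [m] depends continuously on [m] and [g'] and is [theta] when [m] is
    an identity arrow. Uniformity in [g'] comes from compactness: for [m] in the compact
    neighbourhood [L] of the identity arrows over [Q], both terms vanish off [K']. Hence [chi] can
    be fixed before [e] and [x0]. *)
Lemma uniform_translation theta (Q : set (units G)) : Gamma_c theta -> compact Q ->
  exists chi : G -> R, [/\ rCc chi, forall g, 0 <= chi g &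
    forall e x0, 0 < e -> Q x0 -> \forall m \near gid G x0, forall g', rng g' = rng m ->
      nrm (act m (rng g') (theta (gmul (ginv m) g')) - theta g') <= e * chi g'].
Proof.
move=> tG Qc; have [tc [K Kc tK]] := (Gamma_cP GP theta).1 tG.
have [L Lc QL] : exists2 L, compact L & forall x, Q x -> nbhs (gid G x) L.
  have [|L Lc gL] := @compact_neighborhood G (gid G @` Q) Gl.
    by apply: continuous_compact => //; apply: continuous_subspaceT; exact: gid_continuous.
  by exists L => // x Qx; apply: gL; exists x.
pose K' := K `|` [set g | exists a b, [/\ L a, K b, src a = rng b & g = gmul a b]].
have Kc' : compact K' by apply: compactU => //; exact: compact_gmul.
have [chi [chiC chi0 chi1]] := @plateau R G K' Gh Gl Kc'.
exists chi; split => // e x0 e0 Qx0.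
have /compact_near_coveringP cov := Kc'.
have near1 : \forall m \near gid G x0, K' `<=` (fun g' => rng g' = rng m ->
    nrm (act m (rng g') (theta (gmul (ginv m) g')) - theta g') <= e).
  apply: cov => g0 _.
  have c1 : (fun p : G * G => rng p.1) @ nbhs (g0, gid G x0) --> rng g0.
    by apply: (cvg_rng GP); exact: cvg_fst.
  have c2 : (fun p : G * G => rng p.2) @ nbhs (g0, gid G x0) --> rng (gid G x0).
    by apply: (cvg_rng GP); exact: cvg_snd.
  have [e1|ne] := pselect (rng g0 = x0); last first.
    have h : \forall p \near (g0, gid G x0), rng p.1 <> rng p.2.
      apply: (cvg_neq (units_hausdorff GP) c1 c2); by rewrite (rng_id GP).
    suff : \forall p \near filter_prod (nbhs g0) (nbhs (gid G x0)), rng p.1 = rng p.2 ->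
      nrm (act p.2 (rng p.1) (theta (gmul (ginv p.2) p.1)) - theta p.1) <= e by [].
    by apply: filterS h => p ne' e'; case: ne'.
  pose D : set (G * G) := [set p | rng p.1 = rng p.2].
  have d1 : (fun p : G * G => p.1) @ within D (nbhs (g0, gid G x0)) --> g0.
    by apply: cvg_within_filter; exact: cvg_fst.
  have d2 : (fun p : G * G => p.2) @ within D (nbhs (g0, gid G x0)) --> gid G x0.
    by apply: cvg_within_filter; exact: cvg_snd.
  have dom : \forall p \near within D (nbhs (g0, gid G x0)), D p by exact: withinT.
  have b1 : bcv (S := SB) (within D (nbhs (g0, gid G x0))) (p := fun p => rng p.1)
      (fun p => act p.2 (rng p.1) (theta (gmul (ginv p.2) p.1)))
      (act (gid G x0) (rng g0) (theta (gmul (ginv (gid G x0)) g0))).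
    apply: (act_zeta_bcv GP BP tG d2 d1) => //.
    - by rewrite (rng_id GP) e1.
    - by apply: filterS dom => p /= ->.
    - exact: filterE.
  have z0 : nrm (-1 *: theta g0 +
      act (gid G x0) (rng g0) (theta (gmul (ginv (gid G x0)) g0))) = 0.
    rewrite (gidV GP) -e1 (gmul1l GP) (act_id BP GP) scaleN1r addNr.
    exact: nrm0.
  have h : \forall p \near within D (nbhs (g0, gid G x0)),
      nrm (-1 *: theta p.1 + act p.2 (rng p.1) (theta (gmul (ginv p.2) p.1))) < e.
    apply: (bcv_norm (gb_usc BP) (bcv_lin (gb_usc BP) (-1) (Gamma_c_bcv GP tG d1) b1)).
    by rewrite z0.
  have {}h : \forall p \near (g0, gid G x0), D p ->
      nrm (-1 *: theta p.1 + act p.2 (rng p.1) (theta (gmul (ginv p.2) p.1))) < e by exact: h.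
  suff : \forall p \near filter_prod (nbhs g0) (nbhs (gid G x0)), rng p.1 = rng p.2 ->
    nrm (act p.2 (rng p.1) (theta (gmul (ginv p.2) p.1)) - theta p.1) <= e by [].
  apply: filterS h => p hp e'; apply: ltW.
  by have := hp e'; rewrite scaleN1r addrC.
apply: filterS2 (QL _ Qx0) near1 => m Lm hm g' e'.
have [Kg|nKg] := pselect (K' g').
  apply: le_trans (hm _ Kg e') _.
  by rewrite ler_peMr ?(ltW e0)//; exact: chi1.
rewrite !tK ?(act0 BP) ?subrr ?nrm0 ?mulr_ge0 ?(ltW e0)//.
  by move=> Kg; apply: nKg; left.
move=> Kg; apply: nKg; right; exists m, (gmul (ginv m) g'); split => //.
  by rewrite (rng_mul GP) ?(rng_inv GP)// (src_inv GP).
by rewrite (gmulKV GP).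
Qed.

Definition scal_sec (f : G -> R) beta : secs := fun g => (f g)%:C *: beta (rng g).

Lemma scal_sec_Gamma_c f beta : rCc f -> SB beta -> Gamma_c (scal_sec f beta).
Proof.
move=> [fc [K Kc fK]] Sb; apply/(Gamma_cP GP); split.
  move=> g; apply: (bcvZ (gb_usc BP)); first exact: fc.
  by apply: bcv_sec => //; exact: (rng_continuous GP).
by exists K => // g /fK; rewrite /scal_sec => ->; rewrite scale0r.
Qed.

Lemma tr_sec beta (x y : units G) : x = y -> tr y (beta x) = beta y.
Proof. by move=> e; subst; rewrite tr_id. Qed.

Lemma trZ (x y : units G) (k : C) (b : B x) : tr y (k *: b) = k *: tr y b.
Proof. by rewrite -[k *: b]addr0 tr_lin tr0 addr0. Qed.

Lemma bmulZl (A : banachAlgType C) (k : C) (a b : A) : bmul (k *: a) b = k *: bmul a b.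
Proof. exact: bscalerAl. Qed.

(* Since r(h) = s(g), g beta(r(h)) = g beta(s(g)) is constant in the integral over h. *)
Lemma inner_estimate f beta theta g g' (V : B (rng g')) (P : R) :
  rCc f -> (forall h, 0 <= f h) -> SB beta -> Gamma_c theta -> rng g = rng g' ->
  (forall h, rng h = src g -> f h != 0 ->
    nrm (bmul (act g (rng g') (beta (src g)))
      (act (gmul g h) (rng g') (theta (gmul (ginv (gmul g h)) g'))) - V) <= P) ->
  nrm (act g (rng g') (bconv (scal_sec f beta) theta (gmul (ginv g) g')) -
    (rint (haar G (src g)) f)%:C *: V) <= P * rint (haar G (src g)) f.
Proof.
move=> fC f0 Sb tG rg hP.
have rgg : rng (gmul (ginv g) g') = src g.
  by rewrite (rng_mul GP) ?(rng_inv GP)// (src_inv GP).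
pose S (b : B (rng (gmul (ginv g) g'))) := act g (rng g') b.
have h1 : hint (haar G (src g))
    (fun h => S (integrand (scal_sec f beta) theta (gmul (ginv g) g') h))
    (S (bconv (scal_sec f beta) theta (gmul (ginv g) g'))).
  have hq := bconv_hint GP GH BP (gmul (ginv g) g') (scal_sec_Gamma_c fC Sb) tG.
  rewrite -[X in haar G X]rgg; apply: (hint_map (T := S) (M := 1) _ _ _ _ hq).
  - exact: haar_radon.
  - by move=> k a b; rewrite /S (act_lin BP).
  - by [].
  - move=> a; rewrite mul1r.
    have -> : nrm (S a) = nrm a by rewrite /S /nrm (act_norm BP).
    exact: lexx.
have h2 := hint_simple (haar_radon GH (src g)) (simple1 (haar G (src g)) V fC).
have h3 := hint_Cc (haar_radon GH (src g)) (Cc_real (rCcZ P fC)).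
have := hint_dist_real Gh Gl (haar_radon GH _) h1 h2 h3.
rewrite (mu_rint (haar_radon GH _) (rCcZ P fC)) (rintZ (haar_radon GH _) _ fC)/=.
apply => h; rewrite (msupport_haar GH) => rh.
have -> : S (integrand (scal_sec f beta) theta (gmul (ginv g) g') h) =
    (f h)%:C *: bmul (act g (rng g') (beta (src g)))
      (act (gmul g h) (rng g') (theta (gmul (ginv (gmul g h)) g'))).
  have e2 : gmul (ginv (gmul g h)) g' = gmul (ginv h) (gmul (ginv g) g').
    by rewrite (ginvM GP)// -(gmulA GP) ?(src_inv GP) ?(rng_inv GP).
  rewrite /S /integrand (act_mul BP) /scal_sec trZ (actZ BP) bmulZl; congr (_ *: bmul _ _).
    by rewrite tr_sec ?rh// rgg.
  rewrite e2 (act_comp BP (y := src g))//; first by rewrite rgg.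
  by rewrite (rng_mul GP) ?(rng_inv GP)// (src_inv GP) rh rgg.
rewrite -scalerBr nrmZr ger0_norm// mulrC.
have [->|fh] := eqVneq (f h) 0; first by rewrite !mulr0.
by rewrite ler_wpM2r//; exact: hP.
Qed.

(** The weight [K (src g)] produced by the inner integral joins [f] under the outer one, where
    [beta (rng g)] is constant and [V] does not depend on [g]. *)
Lemma outer_estimate f beta zeta (K : units G -> R) g' (V : B (rng g')) (P : R) :
  rCc f -> (forall g, 0 <= f g) -> continuous K -> SB beta -> Gamma_c zeta ->
  (forall g, rng g = rng g' -> f g != 0 ->
    nrm (act g (rng g') (zeta (gmul (ginv g) g')) - (K (src g))%:C *: V) <= P * K (src g)) ->
  nrm (bconv (scal_sec f beta) zeta g' -
    (rint (haar G (rng g')) (fun g => K (src g) * f g))%:C *: bmul (beta (rng g')) V) <=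
  nrm (beta (rng g')) * P * rint (haar G (rng g')) (fun g => K (src g) * f g).
Proof.
move=> fC f0 Kc Sb zG hP.
have KfC : rCc (fun g => K (src g) * f g).
  apply: rCcM fC => g; apply: (@cvg_comp _ _ _ (@src _ G) K _ (nbhs (src g))).
    exact: (src_continuous GP).
  exact: Kc.
have h1 := bconv_hint GP GH BP g' (scal_sec_Gamma_c fC Sb) zG.
have h2 := hint_simple (haar_radon GH (rng g'))
  (simple1 (haar G (rng g')) (bmul (beta (rng g')) V) KfC).
have h3 := hint_Cc (haar_radon GH (rng g')) (Cc_real (rCcZ (nrm (beta (rng g')) * P) KfC)).
have := hint_dist_real Gh Gl (haar_radon GH _) h1 h2 h3.
rewrite (mu_rint (haar_radon GH _) (rCcZ _ KfC)) (rintZ (haar_radon GH _) _ KfC)/=.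
apply => g; rewrite (msupport_haar GH) => rg.
rewrite /integrand /scal_sec trZ tr_sec// bmulZl rmorphM/= mulrC -scalerA -scalerBr nrmZr.
rewrite ger0_norm//.
have [->|fg] := eqVneq (f g) 0; first by rewrite !mulr0 mul0r.
rewrite mulrA [X in _ <= X]mulrC ler_wpM2l//.
have -> : bmul (beta (rng g')) (act g (rng g') (zeta (gmul (ginv g) g'))) -
    (K (src g))%:C *: bmul (beta (rng g')) V =
    bmul (beta (rng g')) (act g (rng g') (zeta (gmul (ginv g) g')) - (K (src g))%:C *: V).
  by rewrite bmulDr -[- (_ *: V)]scaleN1r !bscalerAr scaleN1r.
apply: le_trans (nrm_bmul _ _) _; rewrite -mulrA ler_wpM2l ?nrm_ge0//.
exact: hP.
Qed.

End LocalProduct.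

Lemma rint_gt0 (R : realType) (X : topologicalType) (mu : (X -> R[i]) -> R[i])
    (f : X -> R) (x : X) (r : R) : radon mu -> hausdorff_space X ->
  locally_compact [set: X] -> rCc f -> (forall x, 0 <= f x) -> msupport mu x -> 0 < r ->
  (\forall y \near x, r <= f y) -> 0 < rint mu f.
Proof.
move=> muR Xh Xl fC f0 sx r0 fr.
apply: (hint_gt0 muR Xh Xl (hint_Cc muR (Cc_real fC)) _ sx r0) => [y _|]; first exact: f0.
by apply: filterS fr.
Qed.

Lemma bmul_estimate (R : realType) (A : banachAlgType R[i]) (a a0 t t0 : A) (M r p q : R) :
  nrm a <= M -> nrm (a - a0) <= r -> nrm (t - t0) <= p -> nrm t0 <= q ->
  nrm (bmul a t - bmul a0 t0) <= M * p + r * q.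
Proof.
move=> aM ar tp tq.
have -> : bmul a t - bmul a0 t0 = bmul a (t - t0) + bmul (a - a0) t0.
  rewrite bmulDr bmulDl -[- t0]scaleN1r -[- a0]scaleN1r bscalerAr bscalerAl !scaleN1r.
  by rewrite addrA subrK.
apply: le_trans (nrmD _ _) _; apply: lerD; apply: le_trans (nrm_bmul _ _) _.
  exact: ler_pM (nrm_ge0 _) (nrm_ge0 _) aM tp.
exact: ler_pM (nrm_ge0 _) (nrm_ge0 _) ar tq.
Qed.

Section Corners.
Context {R : realType} {G : groupoid_data R}.
Local Notation C := R[i].
Hypotheses (GP : is_lch_groupoid G) (GH : is_haar_system G).
Context {B : gBanachAlgebra_data G}.
Hypothesis BP : is_gBanachAlgebra B.
Let Gh := gpd_hausdorff GP.
Let Gl := gpd_lc GP.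
Notation SB := (sections B).
Notation secs := (dprod (fun g : G => B (rng g))).
Implicit Types (xi zeta theta : secs) (beta : forall x, B x).
Variable c : units G -> bool.
Hypothesis cloc : forall x, \forall y \near x, c y = c x.

(** The locally constant [c] cuts the units into two clopen parts. For [c = in_H] the value [true]
    stands for [H], and sections over the linking groupoid become matrices of size two with entries
    in the corners. *)
Definition corner (i j : bool) : set secs :=
  [set xi | Gamma_c xi /\ forall g, ~ (c (rng g) = i /\ c (src g) = j) -> xi g = 0].

Lemma corner_lin i j (k : C) xi zeta : corner i j xi -> corner i j zeta ->
  corner i j (k *: xi + zeta).
Proof.
move=> [xG x0] [zG z0]; split; first exact: Gamma_c_lin.
by move=> g ng; rewrite dprodE x0// z0// scaler0 addr0.
Qed.

Lemma corner0 i j : corner i j 0.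
Proof. by split => //; exact: Gamma_c0. Qed.

Lemma bconv_corner i k xi zeta : Gamma_c xi -> Gamma_c zeta ->
  (forall g, c (rng g) <> i -> xi g = 0) -> (forall g, c (src g) <> k -> zeta g = 0) ->
  corner i k (bconv xi zeta).
Proof.
move=> xG zG x0 z0; split; first exact: bconv_Gamma_c.
move=> g' ng; apply: (hint_uniq (haar_radon GH _) Gh Gl (bconv_hint GP GH BP g' xG zG)
  (hint0 (haar_radon GH _))) => g.
rewrite (msupport_haar GH) => rg; rewrite /integrand.
have [ci|ci] := pselect (c (rng g) = i); last by rewrite x0// tr0 bmul0l.
rewrite z0 ?(act0 BP) ?bmul0r// => ck; apply: ng; split; first by rewrite -rg.
by rewrite -ck (src_mul GP)// (src_inv GP).
Qed.

Lemma corner_bconv i j k xi zeta : corner i j xi -> corner j k zeta ->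
  corner i k (bconv xi zeta).
Proof.
by move=> [xG x0] [zG z0]; apply: bconv_corner => // g ng; [apply: x0|apply: z0] => -[].
Qed.

(* With an arrow w from x0 into the part j of the units, f and kap supported near w and
   w^-1, and beta2 (src w) close to w^-1 (beta' x0), the product (f beta) * ((kap beta2) * theta)
   is close to F(r(g')) beta beta' theta(g') near x0, where
   F(x) = \int f(g) K(s(g)) dlambda^x(g) and K(y) = \int kap dlambda^y. *)
Lemma local_product i j k theta beta beta' (Q : set (units G)) :
  (forall x, c x = i -> exists2 w : G, rng w = x & c (src w) = j) ->
  corner i k theta -> SB beta -> SB beta' -> compact Q ->
  exists chi : G -> R, [/\ rCc chi, forall g, 0 <= chi g &
    forall e x0, 0 < e -> Q x0 -> c x0 = i -> exists2 U, nbhs x0 U &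
      forall u : units G -> R, rCc u -> (forall x, 0 <= u x) -> (forall x, u x != 0 -> U x) ->
      exists a b, [/\ corner i j a, corner j k b & forall g',
        nrm ((u (rng g'))%:C *: bmul (beta (rng g')) (bmul (beta' (rng g')) (theta g')) -
          bconv a b g') <= e * (u (rng g') * chi g')]].
Proof.
move=> full [tG tk] Sb Sb' Qc.
have [chi1 [chi1C chi10 UC]] := uniform_translation GP BP tG Qc.
have [psi psiC tpsi] := Gamma_c_dominated GP BP tG.
have psi0 g : 0 <= psi g by exact: le_trans (nrm_ge0 _) (tpsi g).
exists (fun g => chi1 g + psi g); split; first exact: rCcD.
  by move=> g; rewrite addr_ge0.
move=> e x0 e0 Qx0 cx0; have [w rw cw] := full _ cx0.
(* The added 1 turns the values at [x0] into strict bounds, which persist nearby by upper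
   semi-continuity of the norm. *)
pose Mb := nrm (beta x0) + 1; pose Mb' := nrm (beta' x0) + 1.
have Mb0 : 0 < Mb by rewrite /Mb ltr_wpDl// nrm_ge0.
have Mb0' : 0 < Mb' by rewrite /Mb' ltr_wpDl// nrm_ge0.
pose e1 := Num.min 1 (e / Mb).
have e10 : 0 < e1 by rewrite lt_min ltr01 divr_gt0.
have e11 : e1 <= 1 by rewrite /e1 ge_min lexx.
have e1e : Mb * e1 <= e by rewrite mulrC -ler_pdivlMr// /e1 ge_min lexx orbT.
have [beta2 Sb2 hb2] := sec_dense (gb_usc BP) (act (ginv w) (src w) (beta' x0))
  (divr_gt0 e10 (ltr0n _ 2)).
have hw : nrm (act w x0 (beta2 (src w)) - beta' x0) < e1.
  have e2 : act w x0 (act (ginv w) (src w) (beta' x0)) = beta' x0.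
    rewrite -(act_comp BP) ?(src_inv GP) ?(rng_inv GP)//.
    by rewrite (gmulVr GP) rw (act_id BP GP).
  rewrite -{1}e2 -scaleN1r addrC -(act_lin BP) scaleN1r addrC.
  have -> : nrm (act w x0 (beta2 (src w) - act (ginv w) (src w) (beta' x0))) =
     nrm (beta2 (src w) - act (ginv w) (src w) (beta' x0)) by rewrite /nrm (act_norm BP).
  by rewrite nrmB; apply: le_lt_trans hb2 _; lra.
have crng : (@rng _ G) @ w --> x0 by rewrite -rw; exact: (rng_continuous GP).
have csrc : (@src _ G) @ w --> src w by exact: (src_continuous GP).
have bA : bcv (S := SB) (nbhs w) (p := @rng _ G) (fun g => act g (rng g) (beta2 (src g)))
    (act w x0 (beta2 (src w))).
  apply: (bcv_act GP BP (q := @src _ G)) => //; try exact: filterE.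
  exact: bcv_sec.
have n1 : \forall g \near w, nrm (act g (rng g) (beta2 (src g))) < Mb'.
  apply: (bcv_norm (gb_usc BP) bA).
  rewrite -[act w x0 _](subrK (beta' x0)); apply: le_lt_trans (nrmD _ _) _.
  by rewrite /Mb'; lra.
have n2 : \forall g \near w, nrm (act g (rng g) (beta2 (src g)) - beta' (rng g)) < e1.
  exact: (bcv_near (gb_usc BP) bA Sb' hw).
have n3 : \forall g \near w, c (src g) = j.
  by rewrite -cw; exact: (csrc _ (cloc (src w))).
have n4 : \forall g \near w, c (rng g) = i.
  by rewrite -cx0; exact: (crng _ (cloc x0)).
(* The tolerance is divided by [Mb'] because this error gets multiplied by the translate of [beta2],
   whose norm is below [Mb']; the two contributions then add up to [P = e1 * (chi1 g' + psi g')]. *)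
have UC' := UC _ _ (divr_gt0 e10 Mb0') Qx0.
pose D : set (G * G) := [set p | src p.1 = rng p.2].
have n5 : \forall p \near within D (nbhs (w, ginv w)),
    forall g', rng g' = rng (gmul p.1 p.2) ->
      nrm (act (gmul p.1 p.2) (rng g') (theta (gmul (ginv (gmul p.1 p.2)) g')) - theta g') <=
        e1 / Mb' * chi1 g'.
  have cc : (fun p : G * G => gmul p.1 p.2) @ within D (nbhs (w, ginv w)) --> gid G x0.
    rewrite -rw -(gmulVr GP); apply: (cvg_gmul GP) => //.
    - by apply: cvg_within_filter; exact: cvg_fst.
    - by apply: cvg_within_filter; exact: cvg_snd.
    - by rewrite (rng_inv GP).
    - exact: withinT.
  exact: (cc _ UC').
have [[W1 W2] [/= w1 w2] W12] : \forall p \near (w, ginv w), D p ->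
    forall g', rng g' = rng (gmul p.1 p.2) ->
      nrm (act (gmul p.1 p.2) (rng g') (theta (gmul (ginv (gmul p.1 p.2)) g')) - theta g') <=
        e1 / Mb' * chi1 g' by exact: n5.
have n6 : \forall h \near ginv w, c (rng h) = j.
  have cr : (@rng _ G) @ ginv w --> src w.
    by rewrite -(rng_inv GP); exact: (rng_continuous GP).
  by rewrite -cw; exact: (cr _ (cloc (src w))).
(* The neighbourhoods [W1] of [w] and [W2] of its inverse are such that products of their composable
   elements are nearly identity arrows, so that they translate [theta] only a little. *)
have [kap [kapC kap01 kap1 kapW]] := @bump R G Gh Gl _ _ (filterI w2 n6).
have [f [fC f01 f1 fW]] := @bump R G Gh Gl _ _ (filterI w1 (filterI (filterI n1 n2) (filterI n3 n4))).
have kap0 h : 0 <= kap h by case/andP: (kap01 h).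
have f0 g : 0 <= f g by case/andP: (f01 g).
pose K y := rint (haar G y) kap.
have Kc : continuous K by exact: haar_rcont.
have K0 y : 0 <= K y by exact: (rint_ge0 (haar_radon GH _)).
have Kw : 0 < K (src w).
  apply: (rint_gt0 (x := ginv w) (haar_radon GH _) Gh Gl kapC kap0 _ (ltr0n _ 1)).
    by rewrite (msupport_haar GH) (rng_inv GP).
  by apply: filterS kap1 => h ->.
have Ksrc : continuous (fun g : G => K (src g)).
  move=> g; apply: (@cvg_comp _ _ _ (@src _ G) K _ (nbhs (src g))); last exact: Kc.
  exact: (src_continuous GP).
have KfC : rCc (fun g => K (src g) * f g) by exact: rCcM.
pose F x := rint (haar G x) (fun g => K (src g) * f g).
have Fc : continuous F by exact: haar_rcont.
have F0 : 0 < F x0.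
  apply: (rint_gt0 (x := w) (haar_radon GH _) Gh Gl KfC _ _ (divr_gt0 Kw (ltr0n _ 2))).
  - by move=> g; rewrite mulr_ge0.
  - by rewrite (msupport_haar GH).
  - have : \forall g \near w, K (src w) / 2 < K (src g).
      by apply: (cvgr_gt _ (Ksrc w)); lra.
    by apply: filterS2 f1 => g -> /ltW; rewrite mulr1.
pose d := F x0 / 2; have d0 : 0 < d by rewrite divr_gt0.
have nU1 : \forall x \near x0, d < F x by apply: (cvgr_gt _ (Fc x0)); rewrite /d; lra.
have nU2 : \forall x \near x0, nrm (beta x) < Mb.
  by apply: (sec_near (gb_usc BP) Sb (@cvg_id _ _)); rewrite /Mb; lra.
exists [set x | d < F x /\ nrm (beta x) < Mb]; first exact: filterI.
move=> u uC u0 uU.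
(* The double convolution carries the unwanted factor [F (rng g')]; dividing by it leaves
   [u (rng g')]. The maximum with [d] keeps [s] continuous and changes nothing where [u] is nonzero,
   as there [F] exceeds [d]. *)
pose s x := u x / Num.max (F x) d.
have max0 x : 0 < Num.max (F x) d by rewrite lt_max d0 orbT.
have s0 x : 0 <= s x by rewrite /s divr_ge0// ltW.
have sc : continuous (fun g : G => s (rng g)).
  move=> g; apply: (@cvg_comp _ _ _ (@rng _ G) s _ (nbhs (rng g))).
    exact: (rng_continuous GP).
  apply: cvgM; first by have [uc _] := uC; exact: uc.
  apply: cvgV; first by rewrite gt_eqF.
  by apply: continuous_max; [exact: Fc|exact: cvg_cst].
have sfC : rCc (fun g => s (rng g) * f g) by exact: rCcM.
have bG : Gamma_c (bconv (scal_sec kap beta2) theta).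
  by apply: bconv_Gamma_c => //; exact: scal_sec_Gamma_c.
exists (scal_sec (fun g => s (rng g) * f g) beta), (bconv (scal_sec kap beta2) theta); split.
- split; first exact: scal_sec_Gamma_c.
  move=> g ng; rewrite /scal_sec; have [->|fg] := eqVneq (f g) 0.
    by rewrite mulr0 scale0r.
  by case: ng; have [_ [_ [cj ci]]] := fW _ fg.
- apply: bconv_corner => //; first exact: scal_sec_Gamma_c.
    move=> h nh; rewrite /scal_sec; have [->|kh] := eqVneq (kap h) 0; first by rewrite scale0r.
    by case: nh; have [] := kapW _ kh.
  by move=> g ng; apply: tk => -[].
- move=> g'; pose V := bmul (beta' (rng g')) (theta g').
  pose P := e1 * (chi1 g' + psi g').
  have inner g : rng g = rng g' -> s (rng g) * f g != 0 ->
      nrm (act g (rng g') (bconv (scal_sec kap beta2) theta (gmul (ginv g) g')) -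
        (K (src g))%:C *: V) <= P * K (src g).
    move=> rg sf; apply: (inner_estimate GP GH BP) => // h rh kh.
    have fg : f g != 0 by apply: contra sf => /eqP ->; rewrite mulr0.
    have [Wg [[A1 A2] _]] := fW _ fg.
    have [Wh _] := kapW _ kh.
    have := W12 (g, h) (conj Wg Wh) (esym rh) g'.
    rewrite /= (rng_mul GP) ?rh// rg => /(_ erefl).
    rewrite rg in A1 A2.
    move=> hT; have := bmul_estimate (ltW A1) (ltW A2) hT (tpsi g').
    have -> : Mb' * (e1 / Mb' * chi1 g') + e1 * psi g' = P.
      by rewrite /P; field; rewrite gt_eqF.
    by [].
  have := outer_estimate GP GH BP sfC _ Kc Sb bG inner.
  have -> : rint (haar G (rng g')) (fun g => K (src g) * (s (rng g) * f g)) = u (rng g').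
    have -> : rint (haar G (rng g')) (fun g => K (src g) * (s (rng g) * f g)) =
        rint (haar G (rng g')) (fun g => s (rng g') * (K (src g) * f g)).
      apply: (rint_ext (haar_radon GH _) Gh Gl); first exact: rCcM.
        exact: rCcZ.
      by move=> g; rewrite (msupport_haar GH) => ->; ring.
    rewrite (rintZ (haar_radon GH _) _ KfC) -/(F (rng g')) /s.
    have [->|/uU[dF _]] := eqVneq (u (rng g')) 0; first by rewrite !mul0r.
    by rewrite max_l ?(ltW dF)// divfK// gt_eqF// (lt_trans d0).
  move=> /(_ _) hh; rewrite nrmB; apply: le_trans (hh _) _.
    by move=> g; rewrite mulr_ge0.
  have [->|/uU[_ bM]] := eqVneq (u (rng g')) 0; first by rewrite mul0r !mulr0.
  have -> : e * (u (rng g') * (chi1 g' + psi g')) = e * (chi1 g' + psi g') * u (rng g') by ring.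
  rewrite ler_wpM2r//.
  apply: le_trans (_ : Mb * (e1 * (chi1 g' + psi g')) <= _).
    by rewrite /P ler_wpM2r ?(ltW bM)// mulr_ge0 ?(ltW e10)// addr_ge0.
  by rewrite mulrA ler_wpM2r// addr_ge0.
Qed.

End Corners.

(* D is where q is a seminorm; it need not be all of V. *)
Lemma aspan_approx (R : realType) (V : zmodType) (D : set V) (q : V -> R) (S S' : set V) :
  D 0 -> q 0 <= 0 ->
  (forall a b, D a -> D b -> D (a + b) /\ q (a + b) <= q a + q b) ->
  (forall s e, S s -> 0 < e -> exists w, [/\ aspan S' w, D (s - w) & q (s - w) <= e]) ->
  forall v e, aspan S v -> 0 < e -> exists w, [/\ aspan S' w, D (v - w) & q (v - w) <= e].
Proof.
move=> D0 q0 DD SS v e Sv; elim: Sv e => [|s u Ss _ IH] e e0.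
  by exists 0; split; rewrite ?subr0//; [exact: aspan0|exact: le_trans q0 (ltW e0)].
have e20 : 0 < e / 2 by rewrite divr_gt0.
have [w [Sw Dw qw]] := SS _ _ Ss e20.
have [w' [Sw' Dw' qw']] := IH _ e20.
exists (w + w').
have -> : s + u - (w + w') = (s - w) + (u - w') by rewrite opprD addrACA.
have [DD1 DD2] := DD _ _ Dw Dw'; split => //; first exact: aspan_add.
by apply: le_trans DD2 _; lra.
Qed.

Section ProductApproximation.
Context {R : realType} {A : banachAlgType R[i]}.

Lemma bmul_approx (P Q : set A) (a b : A) :
  (forall e, 0 < e -> exists2 a', P a' & nrm (a - a') <= e) ->
  (forall e, 0 < e -> exists2 b', Q b' & nrm (b - b') <= e) ->
  forall e, 0 < e -> exists a' b', [/\ P a', Q b' & nrm (bmul a b - bmul a' b') <= e].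
Proof.
move=> aP bQ e e0; pose d := Num.min 1 (e / (nrm a + nrm b + 1)).
have a0 := nrm_ge0 a; have b0 := nrm_ge0 b.
have s0 : 0 < nrm a + nrm b + 1 by lra.
have d0 : 0 < d by rewrite lt_min ltr01 divr_gt0.
have d1 : d <= 1 by rewrite /d ge_min lexx.
have de : d * (nrm a + nrm b + 1) <= e by rewrite -ler_pdivlMr// /d ge_min lexx orbT.
have [a' Pa' aa'] := aP _ d0; have [b' Qb' bb'] := bQ _ d0.
exists a', b'; split => //; apply: le_trans (nrm_dist _ (bmul a b') _) _.
have -> : bmul a b - bmul a b' = bmul a (b - b').
  by rewrite bmulDr -[- b']scaleN1r bscalerAr scaleN1r.
have -> : bmul a b' - bmul a' b' = bmul (a - a') b'.
  by rewrite bmulDl -[- a']scaleN1r bscalerAl scaleN1r.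
have l1 := le_trans (nrm_bmul a (b - b')) (ler_wpM2l a0 bb').
have b'b : nrm b' <= nrm b + d.
  by have := nrm_dist b' b 0; rewrite !subr0 (nrmB b' b); lra.
have l2 : nrm (bmul (a - a') b') <= d * (nrm b + d).
  by apply: le_trans (nrm_bmul _ _) _; apply: ler_pM => //; exact: nrm_ge0.
have dd : d * d <= d by rewrite ler_piMl// ltW.
by move: de; lra.
Qed.

Lemma dense_bmul_aspan : dense_image (@bmul _ A) -> forall (v : A) (e : R), 0 < e ->
  exists2 w, aspan [set w | exists a b : A, w = bmul a b] w & nrm (v - w) <= e.
Proof.
move=> /dense_nrmP dA v e e0; have [_ [n [k [u [Su ->]]]] h] := dA v e e0.
exists (\sum_i k i *: u i); last exact: ltW.
apply: aspan_sum => i; apply: aspan_gen; have [a [b ->]] := Su i.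
by exists (k i *: a), b; rewrite bscalerAl.
Qed.

End ProductApproximation.

Section Density.
Context {R : realType} {G : groupoid_data R}.
Local Notation C := R[i].
Hypotheses (GP : is_lch_groupoid G) (GH : is_haar_system G).
Context {B : gBanachAlgebra_data G}.
Hypothesis BP : is_gBanachAlgebra B.
Hypothesis Bnd : gb_nondegenerate B.
Let Gh := gpd_hausdorff GP.
Let Gl := gpd_lc GP.
Notation SB := (sections B).
Notation secs := (dprod (fun g : G => B (rng g))).
Notation fsecs := (dprod (fun x : units G => B x)).
Implicit Types (xi zeta theta : secs) (beta : fsecs).
Variable c : units G -> bool.
Hypothesis cloc : forall x, \forall y \near x, c y = c x.

Let pairs x : set (B x) :=
  [set w | exists beta beta', [/\ SB beta, SB beta' & w = bmul (beta x) (beta' x)]].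

(** Of the three factors, the first two are those that [local_product] distributes over the two
    factors of a convolution; the third, multiplied by a partition function, becomes its [theta]. *)
Definition triple_sections : set fsecs :=
  [set t | exists beta beta' tau, [/\ SB beta, SB beta', SB tau &
     t = (fun x => bmul (beta x) (bmul (beta' x) (tau x)))]].

Let at_sections x (v : B x) e : 0 < e -> exists2 v', [set b x | b in SB] v' & nrm (v - v') <= e.
Proof.
move=> e0; have [b Sb vb] := sec_dense (gb_usc BP) v e0; exists (b x) => //; by exists b.
Qed.

Let nrm_aspan (A : normedModType C) (S S' : set A) :
  (forall s e, S s -> 0 < e -> exists2 w, aspan S' w & nrm (s - w) <= e) ->
  forall v e, aspan S v -> 0 < e -> exists2 w, aspan S' w & nrm (v - w) <= e.
Proof.
move=> SS v e Sv e0.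
have [| | | |w [? _ ?]] := @aspan_approx R A setT (@nrm R A) S S' _ _ _ _ v e Sv e0.
- by [].
- by rewrite nrm0.
- by move=> a b _ _; split => //; exact: nrmD.
- by move=> s d Ss d0; have [w] := SS _ _ Ss d0; exists w.
by exists w.
Qed.

Let pairs_dense x (v : B x) e : 0 < e ->
  exists2 w, aspan (@pairs x) w & nrm (v - w) <= e.
Proof.
move=> e0; have e20 : 0 < e / 2 by rewrite divr_gt0.
have [w Sw vw] := dense_bmul_aspan (@Bnd x) v e20.
have [|w' Sw' ww'] := @nrm_aspan (B x) _ (@pairs x) _ w (e / 2) Sw e20.
  move=> _ d [a [b ->]] d0.
  have [_ [_ [[b1 Sb1 <-] [b2 Sb2 <-] h]]] :=
    bmul_approx (@at_sections x a) (@at_sections x b) d0.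
  by exists (bmul (b1 x) (b2 x)) => //; apply: aspan_gen; exists b1, b2.
exists w' => //; apply: le_trans (nrm_dist _ w _) _; lra.
Qed.

Let eval_aspan (x : units G) (w : B x) : aspan [set b x | b in triple_sections] w ->
  exists2 b : fsecs, aspan triple_sections b & b x = w.
Proof.
elim=> [|_ v [b Tb <-] _ [b' Tb' <-]]; first by exists 0 => //; exact: aspan0.
by exists (b + b') => //; exact: aspanD.
Qed.

(** Non-degeneracy is used twice: elements of the fibre are close to sums of products, and the
    second factor of each product is again close to such a sum. Elements are replaced by values of
    sections, which are dense in the fibre. *)
Lemma triple_sections_dense x (v : B x) e : 0 < e ->
  exists2 b : fsecs, aspan triple_sections b & nrm (v - b x) <= e.
Proof.
move=> e0; have e20 : 0 < e / 2 by rewrite divr_gt0.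
have [w Sw vw] := pairs_dense v e20.
have [|w' /eval_aspan[b Tb <-] ww'] :=
    @nrm_aspan (B x) _ [set b x | b in triple_sections] _ w (e / 2) Sw e20.
  move=> _ d [b1 [b2 [S1 S2 ->]]] d0.
  have d0' : 0 < d / (nrm (b1 x) + 1) by rewrite divr_gt0// ltr_wpDl// nrm_ge0.
  have [u Su h] := pairs_dense (b2 x) d0'.
  exists (bmul (b1 x) u).
    apply: aspan_hom Su; first exact: bmul0r.
      by move=> a b; rewrite bmulDr.
    move=> _ [b [b' [Sb Sb' ->]]]; apply: aspan_gen.
    by exists (fun y => bmul (b1 y) (bmul (b y) (b' y))) => //; exists b1, b, b'.
  have -> : bmul (b1 x) (b2 x) - bmul (b1 x) u = bmul (b1 x) (b2 x - u).
    by rewrite bmulDr -[- u]scaleN1r bscalerAr scaleN1r.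
  apply: le_trans (nrm_bmul _ _) _.
  apply: le_trans (ler_wpM2l (nrm_ge0 _) h) _.
  rewrite mulrCA ger_pMr// ler_pdivrMr ?mul1r; first by rewrite lerDl.
  by rewrite ltr_wpDl// nrm_ge0.
exists b => //; apply: le_trans (nrm_dist _ w _) _; lra.
Qed.

Let triple_SB b : aspan triple_sections b -> SB b.
Proof.
elim=> [|_ v [b1 [b2 [b3 [S1 S2 S3 ->]]]] _ Sv]; first exact: (usc_zero (gb_usc BP)).
have := usc_lin (gb_usc BP) 1 (gb_mul BP S1 (gb_mul BP S2 S3)) Sv.
by congr (SB _); apply: functional_extensionality_dep => x; rewrite scale1r.
Qed.

Definition pieces (i k : bool) : set secs :=
  [set t | exists beta beta' theta, [/\ SB beta, SB beta', corner c i k theta &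
    t = (fun g => bmul (beta (rng g)) (bmul (beta' (rng g)) (theta g)))]].

(** A partition function need not vanish outside the corner. Multiplying by this locally constant
    indicator puts the approximants into the corner and does not increase the error. *)
Definition corner_ind (i k : bool) (g : G) : R :=
  if (c (rng g) == i) && (c (src g) == k) then 1 else 0.

Lemma corner_ind_continuous i k : continuous (corner_ind i k).
Proof.
move=> g.
have cr : (@rng _ G) @ g --> rng g by exact: (rng_continuous GP).
have cs : (@src _ G) @ g --> src g by exact: (src_continuous GP).
have nr : \forall h \near g, c (rng h) = c (rng g) by exact: (cr _ (cloc _)).
have ns : \forall h \near g, c (src h) = c (src g) by exact: (cs _ (cloc _)).
apply: (@cvg_trans _ (corner_ind i k g @[_ --> g])); last exact: cvg_cst.
apply: near_eq_cvg; apply: filterS2 nr ns => h hr hs.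
by rewrite /corner_ind /= in hr hs *; rewrite hr hs.
Qed.

(** Near each arrow [theta] is close to the pullback along [rng] of a sum of triple products; a
    partition of unity on the support glues these approximations. *)
Lemma pieces_dense i k theta : corner c i k theta ->
  exists chi : G -> R, [/\ rCc chi, forall g, 0 <= chi g & forall e, 0 < e ->
    exists2 w, aspan (pieces i k) w & forall g, nrm (theta g - w g) <= e * chi g].
Proof.
move=> [tG tz]; have [tc [K Kc tK]] := (Gamma_cP GP theta).1 tG.
have [chi [chiC chi0 ap]] := @approx_by_partition R G Gh Gl K Kc.
exists chi; split => // e e0.
have [|||n [p [b [pC Sb hb]]]] := ap (fun g => B (rng g)) setT theta
    [set b | exists2 beta, aspan triple_sections beta & b = (fun g => beta (rng g))] e.
- exact: ltW.
- by move=> g _; exact: tK.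
- move=> g0 Kg0; have e20 : 0 < e / 2 by rewrite divr_gt0.
  have [beta Sb hb] := triple_sections_dense (theta g0) e20.
  exists (fun g => beta (rng g)); first by exists beta.
  have lt : nrm (theta g0 - beta (rng g0)) < e by apply: le_lt_trans hb _; lra.
  have h : \forall g \near g0, nrm (theta g - beta (rng g)) < e.
    exact: (bcv_near (gb_usc BP) (tc g0) (triple_SB Sb) lt).
  by apply: filterS h => g /ltW.
pose ci := corner_ind i k.
pose w : secs := \sum_m ((fun g => (ci g * p m g)%:C *: b m g) : secs).
exists w.
  apply: aspan_sum => m; have [beta Tb ->] := Sb m.
  apply: (aspan_hom (f := fun (bb : fsecs) => (fun g => (ci g * p m g)%:C *: bb (rng g)) : secs)) Tb.
  - by apply: functional_extensionality_dep => g; rewrite scaler0.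
  - by move=> b1 b2; apply: functional_extensionality_dep => g; exact: scalerDr.
  - move=> _ [b1 [b2 [b3 [S1 S2 S3 ->]]]]; apply: aspan_gen.
    exists b1, b2, (scal_sec (fun g => ci g * p m g) b3); split => //.
      split.
        apply: scal_sec_Gamma_c => //; apply: rCcM => //; exact: corner_ind_continuous.
      move=> g ng; rewrite /scal_sec /ci /corner_ind.
      case: ifP => [/andP[/eqP a /eqP a']|_]; first by case: ng.
      by rewrite mul0r scale0r.
    by apply: functional_extensionality_dep => g; rewrite /scal_sec !bscalerAr.
move=> g; rewrite /w dprod_sumE.
have -> : theta g - \sum_m (ci g * p m g)%:C *: b m g =
    (ci g)%:C *: (theta g - \sum_m (p m g)%:C *: b m g).
  rewrite scalerBr scaler_sumr; congr (_ - _).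
    rewrite /ci /corner_ind; case: ifP => [_|nc]; first by rewrite scale1r.
    by rewrite tz ?scaler0// => -[a a']; move: nc; rewrite a a' !eqxx.
  by apply: eq_bigr => m _; rewrite rmorphM scalerA.
rewrite nrmZr /ci /corner_ind; case: ifP => _.
  by rewrite normr1 mul1r; exact: hb.
by rewrite normr0 mul0r mulr_ge0// ltW.
Qed.

Variable N : (G -> C) -> R.
Hypothesis NP : conv_norm N.

Definition products (i j k : bool) : set secs :=
  [set w | exists a b, [/\ corner c i j a, corner c j k b & w = bconv a b]].

Lemma products_corner i j k w : aspan (products i j k) w -> corner c i k w.
Proof.
elim=> [|_ v [a [b [ca cb ->]]] _ cv]; first exact: corner0.
have := corner_lin GP BP 1 (corner_bconv GP GH BP ca cb) cv.
by rewrite scale1r.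
Qed.

Let corner_sub i k xi zeta : corner c i k xi -> corner c i k zeta -> corner c i k (xi - zeta).
Proof. by move=> cx cz; have := corner_lin GP BP (-1) cz cx; rewrite scaleN1r addrC. Qed.

Let small (chi : G -> R) e : rCc chi -> (forall g, 0 <= chi g) -> 0 < e ->
  exists2 d, 0 < d & rnorm_of N (fun g => d * chi g) <= e.
Proof.
move=> chiC chi0 e0; have n0 := cn_ge0 NP chiC chi0.
have s0 : 0 < rnorm_of N chi + 1 by lra.
exists (e / (rnorm_of N chi + 1)); first by rewrite divr_gt0.
apply: le_trans (cn_Z NP (ltW (divr_gt0 e0 s0)) chiC) _.
by rewrite mulrAC ler_pdivrMr// ler_pM2l// lerDl.
Qed.

Lemma piece_corner i k beta beta' theta : SB beta -> SB beta' -> corner c i k theta ->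
  corner c i k (fun g => bmul (beta (rng g)) (bmul (beta' (rng g)) (theta g))).
Proof.
move=> Sb Sb' [tG tz]; split; last by move=> g ng; rewrite tz// !bmul0r.
have [tc [K Kc tK]] := (Gamma_cP GP theta).1 tG; apply/(Gamma_cP GP); split.
  move=> g; apply: (bcv_bmul BP); first exact: bcv_sec (rng_continuous GP (x := g)).
  by apply: (bcv_bmul BP) (tc g); exact: bcv_sec (rng_continuous GP (x := g)).
by exists K => // g /tK ->; rewrite !bmul0r.
Qed.

(** Here [local_product], which handles functions concentrated near one unit, is globalized by a
    partition of unity on the compact set [Q] of ranges. The partition sums to at most [M], so that
    the errors add up to at most [d * M * chi]. *)
Lemma piece_products i j k t e :
  (forall x, c x = i -> exists2 w : G, rng w = x & c (src w) = j) ->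
  pieces i k t -> 0 < e ->
  exists w, [/\ aspan (products i j k) w, corner c i k (t - w) & unorm N (t - w) <= e].
Proof.
move=> full [beta [beta' [theta [Sb Sb' ct tE]]]] e0.
have ctt : corner c i k t by rewrite tE; exact: piece_corner.
have [tc [K Kc tK]] := (Gamma_cP GP theta).1 ct.1.
pose Q : set (units G) := (@rng _ G) @` K.
have Qc : compact Q.
  by apply: continuous_compact => //; apply: continuous_subspaceT; exact: rng_continuous.
have [chi [chiC chi0 loc]] := local_product GP GH BP cloc full ct Sb Sb' Qc.
have [chiQ [chiQC chiQ0 part]] :=
  @partition R (units G) (units_hausdorff GP) (units_locally_compact GP) Q Qc.
have [M M0 chiQM] := rCc_bounded chiQC.
have [d d0 dN] := small (rCcZ M chiC) (fun g => mulr_ge0 (ltW M0) (chi0 g)) e0.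
have ex x : Q x -> exists2 U, nbhs x U &
    forall u : units G -> R, rCc u -> (forall x, 0 <= u x) -> (forall x, u x != 0 -> U x) ->
    exists2 w, aspan (products i j k) w & forall g,
      nrm ((u (rng g))%:C *: t g - w g) <= d * (u (rng g) * chi g).
  move=> Qx; have [cx|cx] := pselect (c x = i).
    have [U xU hU] := loc d x d0 Qx cx; exists U => // u uC u0 uU.
    have [a [b [ca cb hab]]] := hU u uC u0 uU.
    exists (bconv a b); first by apply: aspan_gen; exists a, b.
    by rewrite tE.
  (* The part of [x] is not [i]: over this neighbourhood [t] vanishes, and the empty sum of products
     serves. *)
  exists [set y | c y = c x]; first exact: cloc.
  move=> u uC u0 uU; exists 0; first exact: aspan0.
  move=> g; have [->|ug] := eqVneq (u (rng g)) 0.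
    by rewrite scale0r subr0 nrm0 mul0r mulr0.
  rewrite (ctt.2 g) ?scaler0 ?subr0 ?nrm0 ?mulr_ge0 ?(ltW d0)//.
  by move=> [cg _]; apply: cx; rewrite -(uU _ ug).
pose P x : set (units G) := if pselect (Q x) is left q then sval (cid2 (ex x q)) else setT.
have [|n [p [z [pC p0 pP p1 pchi]]]] := part P.
  by move=> x Qx; rewrite /P; case: pselect => // q; case: cid2.
have exw m : exists w, aspan (products i j k) w /\ forall g,
    nrm ((p m (rng g))%:C *: t g - w g) <= d * (p m (rng g) * chi g).
  have [pmC Qz] := pC m; have := pP m; rewrite /P; case: pselect => // q.
  case: cid2 => U zU hU /= pU; have [w ? ?] := hU (p m) pmC (p0 m) pU; by exists w.
pose w : secs := \sum_m sval (cid (exw m)).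
have Sw : aspan (products i j k) w by apply: aspan_sum => m; case: cid => v [].
exists w; split => //; first by apply: corner_sub => //; exact: products_corner Sw.
apply: le_trans dN; apply: unorm_le => //; first by apply: rCcZ; exact: rCcZ.
move=> g; have -> : (t - w) g = \sum_m ((p m (rng g))%:C *: t g - sval (cid (exw m)) g).
  rewrite sumrB -(dprod_sumE (fun m => sval (cid (exw m)) : secs)) -scaler_suml -rmorph_sum/=.
  rewrite -[LHS]/(t g - w g).
  have [Qg|nQ] := pselect (Q (rng g)); first by rewrite p1// scale1r.
  have -> : t g = 0 by rewrite tE tK ?bmul0r// => Kg; apply: nQ; exists g.
  by rewrite scaler0.
apply: le_trans (nrm_sum _ _ _) _.
apply: le_trans (_ : \sum_m d * (p m (rng g) * chi g) <= _).
  by apply: ler_sum => m _; case: cid => v [].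
rewrite -mulr_sumr -mulr_suml ler_wpM2l ?(ltW d0)// ler_wpM2r//.
by apply: le_trans (pchi _) _; apply: le_trans (ler_norm _) (chiQM _).
Qed.

Lemma corner_density i j k theta e :
  (forall x, c x = i -> exists2 w : G, rng w = x & c (src w) = j) ->
  corner c i k theta -> 0 < e ->
  exists2 w, aspan (products i j k) w & unorm N (theta - w) <= e.
Proof.
move=> full ct e0; have e20 : 0 < e / 2 by rewrite divr_gt0.
have [chi [chiC chi0 ap]] := pieces_dense ct.
have [d d0 dN] := small chiC chi0 e20.
have [w Sw tw] := ap d d0.
have ps t : aspan (pieces i k) t -> corner c i k t.
  elim=> [|_ v [b [b' [th [Sb Sb' cth ->]]]] _ cv]; first exact: corner0.
  by have := corner_lin GP BP 1 (piece_corner Sb Sb' cth) cv; rewrite scale1r.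
have [| | | |v [Sv cwv wv]] := @aspan_approx R secs (corner c i k) (unorm N) (pieces i k)
  (products i j k) _ _ _ _ w (e / 2) Sw e20.
- exact: corner0.
- by rewrite (unorm0 GP BP NP).
- move=> a b ca cb; have := corner_lin GP BP 1 ca cb; have := unorm_lin GP BP NP 1 ca.1 cb.1.
  by rewrite scale1r normr1 mul1r.
- by move=> t d' pt d0'; exact: piece_products.
exists v => //; have := unorm_lin GP BP NP 1 (corner_sub ct (ps _ Sw)).1 cwv.1.
rewrite scale1r normr1 mul1r addrA subrK => h; apply: le_trans h _.
have : unorm N (theta - w) <= e / 2.
  by apply: le_trans dN; apply: unorm_le => //; exact: rCcZ.
by lra.
Qed.

End Density.

(** * Completions *)

Section Completion.
Context {R : realType}.
Local Notation C := R[i].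

(** The seminorm is given on a subspace of an ambient module: all corners share the module of
    selections and the function [unorm], which is known to be a seminorm on compactly supported
    sections only. *)
Record seminormed := Seminormed {
  sn_space :> lmodType C;
  sn_dom : set sn_space;
  sn_norm : sn_space -> R;
  sn_dom0 : sn_dom 0;
  sn_dom_lin : forall k a b, sn_dom a -> sn_dom b -> sn_dom (k *: a + b);
  sn_norm0 : sn_norm 0 = 0;
  sn_norm_lin : forall k a b, sn_dom a -> sn_dom b ->
    sn_norm (k *: a + b) <= complex.Re `|k| * sn_norm a + sn_norm b }.

Section Point.
Variable X : seminormed.
Local Notation S := (@sn_dom X).
Local Notation q := (@sn_norm X).
Implicit Types a b c : X.

(* A point x of the completion is given by its distance function a |-> ||x - a||. *)
Record point := Point {
  pt :> X -> R;
  pt_out : forall a, ~ S a -> pt a = 0;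
  pt_dist : forall a b, S a -> S b -> pt a <= pt b + q (a - b);
  pt_sep : forall a b, S a -> S b -> q (a - b) <= pt a + pt b;
  pt_small : forall e, 0 < e -> exists2 a, S a & pt a <= e }.

HB.instance Definition _ := gen_eqMixin point.
HB.instance Definition _ := gen_choiceMixin point.

Lemma domZ k a : S a -> S (k *: a).
Proof. by move=> Sa; rewrite -[k *: a]addr0; apply: sn_dom_lin => //; exact: sn_dom0. Qed.

Lemma domD a b : S a -> S b -> S (a + b).
Proof. by move=> Sa Sb; rewrite -[a]scale1r; exact: sn_dom_lin. Qed.

Lemma domN a : S a -> S (- a).
Proof. by move=> Sa; rewrite -scaleN1r; exact: domZ. Qed.

Lemma domB a b : S a -> S b -> S (a - b).
Proof. by move=> Sa Sb; apply: domD => //; exact: domN. Qed.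

Lemma qD a b : S a -> S b -> q (a + b) <= q a + q b.
Proof.
by move=> Sa Sb; have := sn_norm_lin 1 Sa Sb; rewrite scale1r normr1 mul1r.
Qed.

Lemma qZ k a : S a -> q (k *: a) <= complex.Re `|k| * q a.
Proof.
move=> Sa; have := sn_norm_lin k Sa (sn_dom0 X).
by rewrite !addr0 sn_norm0 addr0.
Qed.

Lemma qB a b : S a -> S b -> q (a - b) <= q (b - a).
Proof.
move=> Sa Sb; have := qZ (-1) (domB Sb Sa).
by rewrite normrN normr1 mul1r scaleN1r opprB.
Qed.

Lemma q_triangle a b c : S a -> S b -> S c -> q (a - c) <= q (a - b) + q (b - c).
Proof.
by move=> Sa Sb Sc; have := qD (domB Sa Sb) (domB Sb Sc); rewrite addrA subrK.
Qed.

Lemma q_ge0 a : S a -> 0 <= q a.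
Proof.
move=> Sa; have := qD Sa (domN Sa); rewrite subrr sn_norm0.
have := qZ (-1) Sa; rewrite normrN normr1 mul1r scaleN1r; lra.
Qed.

Implicit Types f g h : point.

Lemma pt_ge0 f a : S a -> 0 <= f a.
Proof. by move=> Sa; have := pt_sep f Sa Sa; rewrite subrr sn_norm0; lra. Qed.

Lemma pt_eq f g : (forall e, 0 < e -> exists a, [/\ S a, f a <= e & g a <= e]) -> f = g.
Proof.
move=> fg; have le u v : (forall e, 0 < e -> exists a, [/\ S a, pt u a <= e & pt v a <= e]) ->
    forall a, S a -> u a <= v a.
  move=> uv a Sa; apply/ler_addgt0Pr => e e0.
  have e20 : 0 < e / 2 by rewrite divr_gt0.
  have [b [Sb ub vb]] := uv _ e20.
  have := pt_dist u Sa Sb; have := pt_sep v Sa Sb; lra.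
have E : pt f = pt g.
  apply/funext => a; have [Sa|nSa] := pselect (S a); last by rewrite !pt_out.
  apply/eqP; rewrite eq_le !le// => e /fg[b [? ? ?]]; by exists b.
case: f g E {fg} => f f1 f2 f3 f4 [g g1 g2 g3 g4] /= E; subst g.
by congr Point; exact: Prop_irrelevance.
Qed.

(** Read [P e v] as: [v] approximates the point up to [e]. The distance function of the limit is
    $a\mapsto\inf\,(e + q(v - a))$ over all such pairs. All points of the completion are made in
    this way. *)
Lemma pt_lim (P : R -> set X) : (forall e v, P e v -> S v) ->
  (forall e, 0 < e -> exists v, P e v) ->
  (forall e e' v v', P e v -> P e' v' -> q (v - v') <= e + e') ->
  exists f, forall e v, P e v -> f v <= e.
Proof.
move=> PS Pex Pd.
pose A a := [set r | exists e v, P e v /\ r = e + q (v - a)].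
have Age0 a r : S a -> A a r -> 0 <= r.
  move=> Sa [e [v [Pv ->]]]; have Sv := PS _ _ Pv.
  have := Pd _ _ _ _ Pv Pv; rewrite subrr sn_norm0; have := q_ge0 (domB Sv Sa); lra.
have Alb a : S a -> has_lbound (A a) by move=> Sa; exists 0 => r; exact: Age0.
have Ainf a : S a -> has_inf (A a).
  move=> Sa; split; last exact: Alb.
  by have [v Pv] := Pex _ ltr01; exists (1 + q (v - a)), 1, v.
pose f a := if `[< S a >] then inf (A a) else 0.
have fE a : S a -> f a = inf (A a) by move=> Sa; rewrite /f asboolT.
have f1 a : ~ S a -> f a = 0 by move=> Sa; rewrite /f asboolF.
have f2 a b : S a -> S b -> f a <= f b + q (a - b).
  move=> Sa Sb; rewrite !fE//; apply/ler_addgt0Pr => e e0.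
  have [_ [d [v [Pv ->]]] h] := inf_adherent e0 (Ainf _ Sb).
  have Sv := PS _ _ Pv.
  have : inf (A a) <= d + q (v - a) by apply: (ge_inf (Alb _ Sa)); exists d, v.
  have := q_triangle Sv Sb Sa; have := qB Sb Sa; lra.
have f3 a b : S a -> S b -> q (a - b) <= f a + f b.
  move=> Sa Sb; rewrite !fE//; apply/ler_addgt0Pr => e e0.
  have e20 : 0 < e / 2 by rewrite divr_gt0.
  have [_ [d [v [Pv ->]]] h] := inf_adherent e20 (Ainf _ Sa).
  have [_ [d' [v' [Pv' ->]]] h'] := inf_adherent e20 (Ainf _ Sb).
  have Sv := PS _ _ Pv; have Sv' := PS _ _ Pv'.
  have := q_triangle Sa Sv Sb; have := q_triangle Sv Sv' Sb; have := qB Sa Sv.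
  have := Pd _ _ _ _ Pv Pv'; lra.
have f5 e v : P e v -> f v <= e.
  move=> Pv; have Sv := PS _ _ Pv; rewrite fE//; apply: (ge_inf (Alb _ Sv)).
  by exists e, v; rewrite subrr sn_norm0 addr0.
have f4 e : 0 < e -> exists2 a, S a & f a <= e.
  by move=> /Pex[v Pv]; exists v; [exact: PS Pv|exact: f5].
by exists (Point f1 f2 f3 f4).
Qed.

Lemma pt_small_mul f (M e : R) : 0 <= M -> 0 < e -> exists2 a, S a & M * f a <= e.
Proof.
move=> M0 e0; have s0 : 0 < M + 1 by lra.
have [a Sa fa] := pt_small f (divr_gt0 e0 s0); exists a => //.
apply: le_trans (ler_wpM2l M0 fa) _.
by rewrite mulrCA ger_pMr// ler_pdivrMr// mul1r lerDl.
Qed.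

Let emb_ex a0 : exists f, S a0 -> forall a, S a -> f a <= q (a0 - a).
Proof.
pose a1 := if `[< S a0 >] then a0 else 0.
have Sa1 : S a1 by rewrite /a1; case: asboolP => // _; exact: sn_dom0.
have [|||f hf] := @pt_lim (fun e v => S v /\ q (a1 - v) <= e).
- by move=> e v [].
- by move=> e e0; exists a1; rewrite subrr sn_norm0; split => //; exact: ltW.
- move=> e e' v v' [Sv ve] [Sv' ve']; have := q_triangle Sv Sa1 Sv'; have := qB Sv Sa1; lra.
exists f => Sa0 a Sa; apply: hf; split => //; rewrite /a1; case: asboolP => // nS.
Qed.

Definition emb a0 : point := sval (cid (emb_ex a0)).

Lemma emb_le a0 a : S a0 -> S a -> emb a0 a <= q (a0 - a).
Proof. by move=> Sa0 Sa; exact: (svalP (cid (emb_ex a0))). Qed.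

Lemma emb_self a : S a -> emb a a <= 0.
Proof. by move=> Sa; rewrite -(sn_norm0 X) -(subrr a); exact: emb_le. Qed.

(** The sum is the limit of the sums of approximants, with error [f a + g b]; scaling is treated
    alike. The module axioms follow from [pt_eq], by exhibiting a common approximant of both
    sides. *)
Let add_ex f g : exists h, forall a b, S a -> S b -> h (a + b) <= f a + g b.
Proof.
have [|||h hh] := @pt_lim (fun e v => exists a b, [/\ S a, S b, v = a + b & f a + g b <= e]).
- by move=> e v [a [b [Sa Sb -> _]]]; exact: domD.
- move=> e e0; have e20 : 0 < e / 2 by rewrite divr_gt0.
  have [a Sa fa] := pt_small f e20; have [b Sb gb] := pt_small g e20.
  by exists (a + b), a, b; split => //; lra.
- move=> e e' _ _ [a [b [Sa Sb -> h]]] [a' [b' [Sa' Sb' -> h']]].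
  have -> : a + b - (a' + b') = (a - a') + (b - b') by rewrite opprD addrACA.
  have := qD (domB Sa Sa') (domB Sb Sb'); have := pt_sep f Sa Sa'.
  have := pt_sep g Sb Sb'; lra.
by exists h => a b Sa Sb; apply: hh; exists a, b.
Qed.

Definition pt_add f g : point := sval (cid (add_ex f g)).

Lemma pt_add_le f g a b : S a -> S b -> pt_add f g (a + b) <= f a + g b.
Proof. exact: (svalP (cid (add_ex f g))). Qed.

Let scale_ex (k : C) f : exists h, forall a, S a -> h (k *: a) <= complex.Re `|k| * f a.
Proof.
have k0 : 0 <= complex.Re `|k| by exact: (nrm_ge0 (k : C^o)).
have [|||h hh] := @pt_lim (fun e v => exists a,
    [/\ S a, v = k *: a & complex.Re `|k| * f a <= e]).
- by move=> e v [a [Sa -> _]]; exact: domZ.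
- move=> e e0; have [a Sa fa] := pt_small_mul f k0 e0; by exists (k *: a), a.
- move=> e e' _ _ [a [Sa -> h]] [a' [Sa' -> h']].
  rewrite -scalerBr; have := qZ k (domB Sa Sa').
  have := ler_wpM2l k0 (pt_sep f Sa Sa'); rewrite mulrDr; lra.
by exists h => a Sa; apply: hh; exists a.
Qed.

Definition pt_scale k f : point := sval (cid (scale_ex k f)).

Lemma pt_scale_le k f a : S a -> pt_scale k f (k *: a) <= complex.Re `|k| * f a.
Proof. exact: (svalP (cid (scale_ex k f))). Qed.

Definition pt_zero := emb 0.
Definition pt_opp f := pt_scale (-1) f.

Lemma pt_opp_le f a : S a -> pt_opp f (- a) <= f a.
Proof. by move=> Sa; have := pt_scale_le (-1) f Sa; rewrite scaleN1r normrN normr1 mul1r. Qed.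

Let addA : associative pt_add.
Proof.
move=> f g h; apply: pt_eq => e e0; have e30 : 0 < e / 3 by rewrite divr_gt0.
have [a Sa fa] := pt_small f e30; have [b Sb gb] := pt_small g e30.
have [c Sc hc] := pt_small h e30.
exists (a + (b + c)); split; first by apply: domD => //; exact: domD.
  have := pt_add_le f (pt_add g h) Sa (domD Sb Sc); have := pt_add_le g h Sb Sc; lra.
rewrite addrA.
have := pt_add_le (pt_add f g) h (domD Sa Sb) Sc; have := pt_add_le f g Sa Sb; lra.
Qed.

Let addC : commutative pt_add.
Proof.
move=> f g; apply: pt_eq => e e0; have e20 : 0 < e / 2 by rewrite divr_gt0.
have [a Sa fa] := pt_small f e20; have [b Sb gb] := pt_small g e20.
exists (a + b); split; first exact: domD.
  have := pt_add_le f g Sa Sb; lra.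
rewrite addrC; have := pt_add_le g f Sb Sa; lra.
Qed.

Let add0 : left_id pt_zero pt_add.
Proof.
move=> f; apply: pt_eq => e e0; have [a Sa fa] := pt_small f e0.
exists a; split => //; rewrite -[a in X in X <= _]add0r.
have := pt_add_le pt_zero f (sn_dom0 X) Sa; have := emb_self (sn_dom0 X).
rewrite -/pt_zero; lra.
Qed.

Let addN : left_inverse pt_zero pt_opp pt_add.
Proof.
move=> f; apply: pt_eq => e e0; have e20 : 0 < e / 2 by rewrite divr_gt0.
have [a Sa fa] := pt_small f e20; exists (- a + a); rewrite addNr; split.
- exact: sn_dom0.
- rewrite -[0 in X in X <= _](addNr a).
  have := pt_add_le (pt_opp f) f (domN Sa) Sa; have := pt_opp_le f Sa; lra.
- by apply: le_trans (emb_self (sn_dom0 X)) _; exact: ltW.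
Qed.

HB.instance Definition _ := GRing.isZmodule.Build point addA addC add0 addN.

Let absM (k l : C) : complex.Re `|k * l| = complex.Re `|k| * complex.Re `|l|.
Proof. exact: (nrmZ k (l : C^o)). Qed.

Let abs0 (k : C) : 0 <= complex.Re `|k|.
Proof. exact: (nrm_ge0 (k : C^o)). Qed.

Let scaleA (k l : C) f : pt_scale k (pt_scale l f) = pt_scale (k * l) f.
Proof.
apply: pt_eq => e e0; have [a Sa fa] := pt_small_mul f (abs0 (k * l)) e0.
exists ((k * l) *: a); split; first exact: domZ.
  rewrite -scalerA; have := pt_scale_le k (pt_scale l f) (domZ l Sa).
  have := ler_wpM2l (abs0 k) (pt_scale_le l f Sa); rewrite absM -mulrA in fa *; lra.
have := pt_scale_le (k * l) f Sa; lra.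
Qed.

Let scale1 : left_id 1 pt_scale.
Proof.
move=> f; apply: pt_eq => e e0; have [a Sa fa] := pt_small f e0.
exists a; split => //; rewrite -[a in X in X <= _]scale1r.
have := pt_scale_le 1 f Sa; rewrite normr1 mul1r; lra.
Qed.

Let scaleDr : right_distributive pt_scale +%R.
Proof.
move=> k f g; apply: pt_eq => e e0; have e20 : 0 < e / 2 by rewrite divr_gt0.
have [a Sa fa] := pt_small_mul f (abs0 k) e20; have [b Sb gb] := pt_small_mul g (abs0 k) e20.
exists (k *: (a + b)); split; first by apply: domZ; exact: domD.
  have := pt_scale_le k (f + g) (domD Sa Sb).
  have := ler_wpM2l (abs0 k) (pt_add_le f g Sa Sb); rewrite mulrDr -[pt_add f g]/(f + g); lra.
rewrite scalerDr; have := pt_add_le (pt_scale k f) (pt_scale k g) (domZ k Sa) (domZ k Sb).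
have := pt_scale_le k f Sa; have := pt_scale_le k g Sb.
rewrite -[pt_add (pt_scale k f) (pt_scale k g)]/(pt_scale k f + pt_scale k g); lra.
Qed.

Let scaleDl f : {morph pt_scale^~ f : k l / k + l}.
Proof.
move=> k l; apply: pt_eq => e e0; have e30 : 0 < e / 3 by rewrite divr_gt0.
have M0 : 0 <= complex.Re `|k + l| + complex.Re `|k| + complex.Re `|l|.
  by rewrite !addr_ge0.
have [a Sa fa] := pt_small_mul f M0 e0; rewrite !mulrDl in fa.
have f0 := pt_ge0 f Sa.
have h1 := mulr_ge0 (abs0 (k + l)) f0; have h2 := mulr_ge0 (abs0 k) f0.
have h3 := mulr_ge0 (abs0 l) f0.
exists ((k + l) *: a); split; first exact: domZ.
  have := pt_scale_le (k + l) f Sa; lra.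
rewrite scalerDl; have := pt_add_le (pt_scale k f) (pt_scale l f) (domZ k Sa) (domZ l Sa).
have := pt_scale_le k f Sa; have := pt_scale_le l f Sa.
rewrite -[pt_add (pt_scale k f) (pt_scale l f)]/(pt_scale k f + pt_scale l f); lra.
Qed.

HB.instance Definition _ :=
  GRing.Zmodule_isLmodule.Build C point scaleA scale1 scaleDr scaleDl.

Definition pt_norm f : C := (f 0)%:C.

Let norm_triangle f g : pt_norm (f + g) <= pt_norm f + pt_norm g.
Proof.
rewrite /pt_norm -rmorphD lecR; have := pt_add_le f g (sn_dom0 X) (sn_dom0 X).
by rewrite addr0.
Qed.

Let norm_scale_le (k : C) f : (k *: f) 0 <= complex.Re `|k| * f 0.
Proof. by have := pt_scale_le k f (sn_dom0 X); rewrite scaler0. Qed.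

(** The inequality for [k] is an equality because the same inequality holds for the inverse of
    [k]. *)
Let norm_scale (k : C) f : pt_norm (k *: f) = `|k| * pt_norm f.
Proof.
have -> : `|k| = (complex.Re `|k|)%:C by exact: (nrmE (k : C^o)).
rewrite /pt_norm -rmorphM; congr (_%:C).
apply/eqP; rewrite eq_le norm_scale_le andTb.
have [->|k0] := eqVneq k 0.
  by rewrite normr0 mul0r; apply: pt_ge0; exact: sn_dom0.
have := ler_wpM2l (abs0 k) (norm_scale_le k^-1 (k *: f)).
by rewrite scalerA mulVf// scale1r mulrA -absM mulfV// normr1 mul1r.
Qed.

Let norm_eq0 f : pt_norm f = 0 -> f = 0.
Proof.
move=> /(@complexI R) f0; apply: pt_eq => e e0; exists 0; split.
- exact: sn_dom0.
- by rewrite f0 ltW.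
- by apply: le_trans (emb_self (sn_dom0 X)) _; exact: ltW.
Qed.

HB.instance Definition _ :=
  @Lmodule_isNormed.Build C point pt_norm norm_triangle norm_scale norm_eq0.

Lemma pt_nrmE f : nrm f = f 0.
Proof. by []. Qed.

Lemma pt_dist_le f g a : S a -> nrm (f - g) <= f a + g a.
Proof.
move=> Sa; rewrite pt_nrmE -(subrr a); apply: le_trans (pt_add_le f (- g) Sa (domN Sa)) _.
by rewrite lerD2l; exact: pt_opp_le.
Qed.

Lemma pt_le f g a : S a -> f a <= g a + nrm (f - g).
Proof.
move=> Sa; rewrite pt_nrmE.
have := pt_add_le (f - g) g (sn_dom0 X) Sa; rewrite add0r [X in _ <= X]addrC.
by have -> : pt_add (f - g) g = f by rewrite -[LHS]/(f - g + g) subrK.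
Qed.

(** An element [v] approximates the limit up to [e] as soon as it does so for almost all points of
    the filter. *)
Let complete (F : set_system point) : ProperFilter F -> cauchy F -> cvg F.
Proof.
move=> FF Fc.
have [|||f hf] := @pt_lim (fun e v => S v /\ \forall g \near F, pt g v <= e).
- by move=> e v [].
- move=> e e0; have e20 : 0 < (e / 2)%:C :> C by rewrite ltcR divr_gt0.
  have [f Ff] := (cauchyP F).1 Fc _ e20.
  have [a Sa fa] := pt_small f (divr_gt0 e0 (ltr0n _ 2)).
  exists a; split => //; apply: filterS Ff => g.
  rewrite -ball_normE /= nrm_lt => fg; have := pt_le g f Sa; rewrite nrmB; lra.
- move=> e e' v v' [Sv Fv] [Sv' Fv'].
  have [g [gv gv']] := filter_ex (filterI Fv Fv').
  by have := pt_sep g Sv Sv'; lra.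
apply/cvg_ex; exists f; apply/(cvgC _ id) => e e0.
have e20 : 0 < (e / 4)%:C :> C by rewrite ltcR divr_gt0.
have [g Fg] := (cauchyP F).1 Fc _ e20.
have [a Sa ga] := pt_small g (divr_gt0 e0 (ltr0n _ 8)).
have e4 : e / 4 = e / 8 + e / 8 by field.
have hnear : \forall h \near F, pt h a <= e / 4 + e / 8.
  apply: filterS Fg => h; rewrite -ball_normE /= nrm_lt => gh.
  have := pt_le h g Sa; rewrite nrmB; lra.
have fa := hf _ _ (conj Sa hnear).
apply: filterS hnear => h ha; have := pt_dist_le h f Sa; lra.
Qed.

HB.instance Definition _ := Uniform_isComplete.Build point complete.

Lemma emb_lin k a b : S a -> S b -> emb (k *: a + b) = k *: emb a + emb b.
Proof.
move=> Sa Sb; apply: pt_eq => e e0; exists (k *: a + b).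
have Sc : S (k *: a + b) by exact: sn_dom_lin.
split => //; first by apply: le_trans (emb_self Sc) _; exact: ltW.
apply: le_trans (pt_add_le _ _ (domZ k Sa) Sb) _.
have := pt_scale_le k (emb a) Sa; have := ler_wpM2l (abs0 k) (emb_self Sa).
have := emb_self Sb; rewrite mulr0 -[pt_scale k (emb a)]/(k *: emb a); lra.
Qed.

Lemma nrm_emb a : S a -> nrm (emb a) = q a.
Proof.
move=> Sa; rewrite pt_nrmE; apply/eqP; rewrite eq_le; apply/andP; split.
  by have := emb_le Sa (sn_dom0 X); rewrite subr0.
have := pt_sep (emb a) Sa (sn_dom0 X); have := emb_self Sa; rewrite subr0; lra.
Qed.

Lemma emb_dense f e : 0 < e -> exists2 a, S a & nrm (f - emb a) <= e.
Proof.
move=> e0; have [a Sa fa] := pt_small f e0; exists a => //.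
have := pt_dist_le f (emb a) Sa; have := emb_self Sa; lra.
Qed.

End Point.
End Completion.

(** * Extension of linear and bilinear maps to completions *)

Section BilinearExtension.
Context {R : realType}.
Local Notation C := R[i].

(** One interface for two sources: the completions built above serve for the off-diagonal corners,
    the given coefficient algebras for the diagonal ones. *)
Record completion_of (V : lmodType C) (S : set V) (q : V -> R)
    (E : completeNormedModType C) (i : V -> E) : Prop := {
  co_lin : forall k a b, S a -> S b -> i (k *: a + b) = k *: i a + i b;
  co_nrm : forall a, S a -> nrm (i a) = q a;
  co_dense : forall v e, 0 < e -> exists2 a, S a & nrm (v - i a) <= e }.

Lemma completion_exists (X : seminormed (R := R)) :
  exists (E : completeNormedModType C) (i : X -> E), completion_of (@sn_dom R X) (@sn_norm R X) i.
Proof.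
exists (point X), (@emb R X); split.
- by move=> k a b; exact: emb_lin.
- by move=> a; exact: nrm_emb.
- by move=> f e; exact: emb_dense.
Qed.

Lemma lipschitz_eq (V : lmodType C) (S : set V) (q : V -> R) (E F : completeNormedModType C)
    (i : V -> E) (M M' : R) (f g : E -> F) : completion_of S q i ->
  (forall x y, nrm (f x - f y) <= M * nrm (x - y)) ->
  (forall x y, nrm (g x - g y) <= M' * nrm (x - y)) ->
  (forall a, S a -> f (i a) = g (i a)) -> forall x, f x = g x.
Proof.
move=> iP fM gM fg x; apply/eqP; rewrite -subr_eq0; apply/eqP/nrm_small => e e0.
have s0 : 0 < `|M| + `|M'| + 1 by rewrite ltr_wpDl// addr_ge0.
have [a Sa xa] := co_dense iP x (divr_gt0 e0 s0).
apply: le_trans (nrm_dist _ (f (i a)) _) _; rewrite {2}(fg _ Sa).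
have h1 := le_trans (fM x (i a)) (ler_wpM2r (nrm_ge0 _) (ler_norm M)).
have h2 := le_trans (gM (i a) x) (ler_wpM2r (nrm_ge0 _) (ler_norm M')).
rewrite (nrmB (i a)) in h2.
have h3 : (`|M| + `|M'| + 1) * nrm (x - i a) <= e by rewrite mulrC -ler_pdivlMr.
have := nrm_ge0 (x - i a); lra.
Qed.

Section Contractive.
Context {U V W : normedModType C} (f : U -> V -> W).
Hypothesis fP : contractive_bilinear f.

Lemma cb_nrm u v : nrm (f u v) <= nrm u * nrm v.
Proof. by rewrite -lecR rmorphM/= -!nrmE; exact: (cb_norm fP). Qed.

Lemma cb_Dl u u' v : f (u + u') v = f u v + f u' v.
Proof. by have := cb_l fP 1 u u' v; rewrite !scale1r. Qed.

Lemma cb_Dr u v v' : f u (v + v') = f u v + f u v'.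
Proof. by have := cb_r fP 1 u v v'; rewrite !scale1r. Qed.

Lemma cb_Bl u u' v : f (u - u') v = f u v - f u' v.
Proof. by rewrite addrC -scaleN1r (cb_l fP) scaleN1r addrC. Qed.

Lemma cb_Br u v v' : f u (v - v') = f u v - f u v'.
Proof. by rewrite addrC -scaleN1r (cb_r fP) scaleN1r addrC. Qed.

Lemma cb_lipl v u u' : nrm (f u v - f u' v) <= nrm v * nrm (u - u').
Proof. by rewrite -cb_Bl mulrC; exact: cb_nrm. Qed.

Lemma cb_lipr u v v' : nrm (f u v - f u v') <= nrm u * nrm (v - v').
Proof. by rewrite -cb_Br; exact: cb_nrm. Qed.

End Contractive.

Lemma completion_distB (V : lmodType C) (S : set V) (q : V -> R) (E : completeNormedModType C)
    (i : V -> E) a b : completion_of S q i -> S a -> S b -> i (a - b) = i a - i b.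
Proof.
by move=> iP Sa Sb; rewrite addrC -scaleN1r (co_lin iP)// scaleN1r addrC.
Qed.

(** The value at [x] is obtained by [approx_complete] from the elements [T a] with [i a] close to
    [x]; the bound of its distance to [T a] by [M * nrm (x - i a)] gives linearity and the norm
    estimate. *)
Lemma linear_extension (V : lmodType C) (S : set V) (q : V -> R)
    (E F : completeNormedModType C) (i : V -> E) (T : V -> F) (M : R) :
  completion_of S q i -> (forall k a b, S a -> S b -> S (k *: a + b)) ->
  (forall k a b, S a -> S b -> T (k *: a + b) = k *: T a + T b) -> 0 <= M ->
  (forall a, S a -> nrm (T a) <= M * q a) ->
  exists L : E -> F, [/\ forall k x y, L (k *: x + y) = k *: L x + L y,
    forall x, nrm (L x) <= M * nrm x & forall a, S a -> L (i a) = T a].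
Proof.
move=> iP Sl Tl M0 Tq.
have TB a b : S a -> S b -> nrm (T a - T b) <= M * nrm (i a - i b).
  move=> Sa Sb; rewrite -(completion_distB iP)//.
  have -> : T a - T b = T (a - b).
    by rewrite [a - b]addrC -scaleN1r Tl// scaleN1r addrC.
  have Sab : S (a - b) by rewrite addrC -scaleN1r; exact: Sl.
  by rewrite (co_nrm iP)//; exact: Tq.
have ex x : exists w, forall a, S a -> nrm (w - T a) <= M * nrm (x - i a).
  have [||w hw] := @approx_complete R F
    (fun e w => exists a, [/\ S a, w = T a & M * nrm (x - i a) <= e]).
  - move=> e e0; have s0 : 0 < M + 1 by lra.
    have [a Sa xa] := co_dense iP x (divr_gt0 e0 s0); exists (T a), a; split => //.
    apply: le_trans (ler_wpM2l M0 xa) _.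
    by rewrite mulrCA ger_pMr// ler_pdivrMr// mul1r lerDl.
  - move=> e e' _ _ [a [Sa -> ha]] [b [Sb -> hb]].
    apply: le_trans (TB _ _ Sa Sb) _; apply: le_trans (_ : M * (nrm (x - i a) + nrm (x - i b)) <= _).
      by apply: ler_wpM2l => //; rewrite (nrmB x (i a)); exact: nrm_dist.
    by rewrite mulrDr; exact: lerD.
  by exists w => a Sa; apply: hw; exists a.
pose L x := sval (cid (ex x)).
have LP x a : S a -> nrm (L x - T a) <= M * nrm (x - i a) by exact: (svalP (cid (ex x))).
have app x e : 0 < e -> exists a, [/\ S a, nrm (x - i a) <= e & nrm (L x - T a) <= e].
  move=> e0; have s0 : 0 < M + 1 by lra.
  have [a Sa xa] := co_dense iP x (divr_gt0 e0 s0); exists a; split => //.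
    by apply: le_trans xa _; rewrite ler_pdivrMr// ler_peMr ?(ltW e0)//; lra.
  apply: le_trans (LP _ _ Sa) _; apply: le_trans (ler_wpM2l M0 xa) _.
  by rewrite mulrCA ger_pMr// ler_pdivrMr// mul1r lerDl.
exists L; split.
- move=> k x y; apply/eqP; rewrite -subr_eq0; apply/eqP/nrm_small => e e0.
  set r := complex.Re `|k|; have r0 : 0 <= r by exact: (nrm_ge0 (k : C^o)).
  have D0 : 0 < (M + 1) * (r + 1) by rewrite mulr_gt0//; lra.
  have [a [Sa xa La]] := app x _ (divr_gt0 e0 D0).
  have [b [Sb yb Lb]] := app y _ (divr_gt0 e0 D0).
  set d := e / _ in xa La yb Lb.
  have dE : (M + 1) * (r + 1) * d = e by rewrite mulrC divfK// gt_eqF.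
  have d0 : 0 < d by rewrite divr_gt0.
  have h1 := LP (k *: x + y) _ (Sl k _ _ Sa Sb).
  rewrite Tl// (co_lin iP)// in h1.
  have h2 : nrm (k *: x + y - (k *: i a + i b)) <= r * d + d.
    have -> : k *: x + y - (k *: i a + i b) = k *: (x - i a) + (y - i b).
      by rewrite scalerBr opprD addrACA.
    by apply: le_trans (nrmD _ _) _; rewrite nrmZ; apply: lerD => //; exact: ler_wpM2l.
  have h3 : nrm (k *: T a + T b - (k *: L x + L y)) <= r * d + d.
    have -> : k *: T a + T b - (k *: L x + L y) = k *: (T a - L x) + (T b - L y).
      by rewrite scalerBr opprD addrACA.
    apply: le_trans (nrmD _ _) _; rewrite nrmZ (nrmB (T a)) (nrmB (T b)).
    by apply: lerD => //; exact: ler_wpM2l.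
  apply: le_trans (nrm_dist _ (k *: T a + T b) _) _.
  have h4 := ler_wpM2l M0 h2.
  have : M * (r * d + d) + (r * d + d) = e by rewrite -dE; ring.
  lra.
- move=> x; apply/ler_addgt0Pr => e e0.
  have s0 : 0 < M + 1 by lra.
  have [a [Sa xa La]] := app x _ (divr_gt0 e0 s0).
  set d := e / _ in xa La.
  have dE : M * d + d = e by rewrite -[X in _ + X]mul1r -mulrDl mulrC divfK// gt_eqF.
  have h1 := nrm_dist (L x) (T a) 0; rewrite !subr0 in h1.
  have h2 := Tq _ Sa; rewrite -(co_nrm iP)// in h2.
  have h3 := nrm_dist (i a) x 0; rewrite !subr0 (nrmB (i a)) in h3.
  have h4 : M * nrm (i a) <= M * (d + nrm x) by apply: ler_wpM2l => //; lra.
  lra.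
- move=> a Sa; apply/eqP; rewrite -subr_eq0; apply/eqP/nrm_eq0.
  by have := LP (i a) a Sa; rewrite subrr nrm0 mulr0.
Qed.

(** Two linear extensions in turn: for fixed [a] in the second variable, giving [L a], then of
    [a |-> L a y] in the first variable. Linearity in the variable that is held fixed is recovered
    by density each time. *)
Lemma bilinear_extension (V : lmodType C) (S1 S2 S3 : set V) (q : V -> R)
    (E1 E2 E3 : completeNormedModType C) (i1 : V -> E1) (i2 : V -> E2) (i3 : V -> E3)
    (m : V -> V -> V) :
  completion_of S1 q i1 -> completion_of S2 q i2 -> completion_of S3 q i3 ->
  (forall k a b, S1 a -> S1 b -> S1 (k *: a + b)) ->
  (forall k a b, S2 a -> S2 b -> S2 (k *: a + b)) ->
  (forall a b, S1 a -> S2 b -> S3 (m a b)) ->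
  (forall k a a' b, S1 a -> S1 a' -> S2 b -> m (k *: a + a') b = k *: m a b + m a' b) ->
  (forall k a b b', S1 a -> S2 b -> S2 b' -> m a (k *: b + b') = k *: m a b + m a b') ->
  (forall a b, S1 a -> S2 b -> q (m a b) <= q a * q b) ->
  exists2 f : E1 -> E2 -> E3, contractive_bilinear f &
    forall a b, S1 a -> S2 b -> f (i1 a) (i2 b) = i3 (m a b).
Proof.
move=> P1 P2 P3 S1l S2l mS ml mr mq.
have exL a : exists L : E2 -> E3, S1 a ->
    [/\ forall k x y, L (k *: x + y) = k *: L x + L y,
      forall x, nrm (L x) <= q a * nrm x & forall b, S2 b -> L (i2 b) = i3 (m a b)].
  have [Sa|nS] := pselect (S1 a); last by exists (fun=> 0).
  have [| | |L hL] := @linear_extension V S2 q E2 E3 i2 (fun b => i3 (m a b)) (q a) P2 S2l.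
  - by move=> k b b' Sb Sb'; rewrite mr// (co_lin P3)//; exact: mS.
  - by rewrite -(co_nrm P1)// nrm_ge0.
  - by move=> b Sb; rewrite (co_nrm P3); [exact: mq|exact: mS].
  by exists L.
pose L a := sval (cid (exL a)).
have LP a : S1 a -> [/\ forall k x y, L a (k *: x + y) = k *: L a x + L a y,
      forall x, nrm (L a x) <= q a * nrm x & forall b, S2 b -> L a (i2 b) = i3 (m a b)].
  exact: (svalP (cid (exL a))).
have LB a x y : S1 a -> nrm (L a x - L a y) <= q a * nrm (x - y).
  move=> /LP[Ll Ln _]; have -> : L a x - L a y = L a (x - y).
    by rewrite [x - y]addrC -(scaleN1r y) Ll scaleN1r addrC.
  exact: Ln.
have L_lin k a a' y : S1 a -> S1 a' -> L (k *: a + a') y = k *: L a y + L a' y.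
  move=> Sa Sa'; have Sc := S1l k _ _ Sa Sa'.
  apply: (lipschitz_eq (f := L (k *: a + a')) (g := fun y => k *: L a y + L a' y) P2
    (M := q (k *: a + a')) (M' := complex.Re `|k| * q a + q a')).
  - by move=> x z; exact: LB.
  - move=> x z; have -> : k *: L a x + L a' x - (k *: L a z + L a' z) =
        k *: (L a x - L a z) + (L a' x - L a' z) by rewrite scalerBr opprD addrACA.
    apply: le_trans (nrmD _ _) _; rewrite nrmZ mulrDl -mulrA; apply: lerD; last exact: LB.
    by apply: ler_wpM2l; [exact: (nrm_ge0 (k : C^o))|exact: LB].
  - move=> b Sb; have [_ _ ->] := LP _ Sc; rewrite //.
    have [_ _ ->] := LP _ Sa; rewrite //; have [_ _ ->] := LP _ Sa'; rewrite //.
    by rewrite ml// (co_lin P3)//; exact: mS.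
have exf y : exists f : E1 -> E3, [/\ forall k x x', f (k *: x + x') = k *: f x + f x',
      forall x, nrm (f x) <= nrm y * nrm x & forall a, S1 a -> f (i1 a) = L a y].
  apply: (@linear_extension V S1 q E1 E3 i1 (fun a => L a y) (nrm y) P1 S1l).
  - by move=> k a b Sa Sb; exact: L_lin.
  - exact: nrm_ge0.
  - by move=> a /LP[_ h _]; rewrite mulrC.
pose f x y := sval (cid (exf y)) x.
have fP y : [/\ forall k x x', f (k *: x + x') y = k *: f x y + f x' y,
      forall x, nrm (f x y) <= nrm y * nrm x & forall a, S1 a -> f (i1 a) y = L a y].
  exact: (svalP (cid (exf y))).
have fB y x x' : nrm (f x y - f x' y) <= nrm y * nrm (x - x').
  have [fl fn _] := fP y; have -> : f x y - f x' y = f (x - x') y.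
    by rewrite [x - x']addrC -(scaleN1r x') fl scaleN1r addrC.
  exact: fn.
exists f; last first.
  move=> a b Sa Sb; have [_ _ ->] := fP (i2 b); rewrite //.
  by have [_ _ ->] := LP _ Sa.
split.
- by move=> k u u' v; have [-> _ _] := fP v.
- move=> k u v v'.
  apply: (lipschitz_eq (f := fun x => f x (k *: v + v')) (g := fun x => k *: f x v + f x v') P1
    (M := nrm (k *: v + v')) (M' := complex.Re `|k| * nrm v + nrm v')).
  - by move=> x z; exact: fB.
  - move=> x z; have -> : k *: f x v + f x v' - (k *: f z v + f z v') =
        k *: (f x v - f z v) + (f x v' - f z v') by rewrite scalerBr opprD addrACA.
    apply: le_trans (nrmD _ _) _; rewrite nrmZ mulrDl -mulrA; apply: lerD; last exact: fB.
    by apply: ler_wpM2l; [exact: (nrm_ge0 (k : C^o))|exact: fB].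
  - move=> a Sa; have [_ _ ->] := fP (k *: v + v'); rewrite //.
    have [_ _ ->] := fP v; rewrite //; have [_ _ ->] := fP v'; rewrite //.
    by have [-> _ _] := LP _ Sa.
- move=> u v; rewrite !nrmE -rmorphM lecR mulrC.
  by have [_ h _] := fP v; exact: h.
Qed.

End BilinearExtension.

(** * Morita equivalence of corners *)

Lemma aspan_linspan (K : numFieldType) (V : lmodType K) (S : set V) :
  aspan S `<=` linspan S.
Proof.
move=> v; elim=> [|s w Ss _ [n [k [u [Su ->]]]]].
  by exists 0%N, (fun=> 0), (fun=> 0); split; [case|rewrite big_ord0].
exists n.+1, (fun i => if unlift ord0 i is Some j then k j else 1),
  (fun i => if unlift ord0 i is Some j then u j else s); split.
  by move=> i; case: unliftP.
rewrite big_ord_recl unlift_none scale1r; congr (_ + _).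
by apply: eq_bigr => i _; rewrite liftK.
Qed.

Section MoritaOfCorners.
Context {R : realType}.
Local Notation C := R[i].
Context {V : lmodType C} {S : bool -> bool -> set V} {q : V -> R} {m : V -> V -> V}.
Hypothesis S0 : forall i j, S i j 0.
Hypothesis Sl : forall i j k a b, S i j a -> S i j b -> S i j (k *: a + b).
Hypothesis q0 : q 0 = 0.
Hypothesis ql : forall i j k a b, S i j a -> S i j b ->
  q (k *: a + b) <= complex.Re `|k| * q a + q b.
Hypothesis mS : forall i j k a b, S i j a -> S j k b -> S i k (m a b).
Hypothesis ml : forall i j l k a a' b, S i j a -> S i j a' -> S j l b ->
  m (k *: a + a') b = k *: m a b + m a' b.
Hypothesis mr : forall i j l k a b b', S i j a -> S j l b -> S j l b' ->
  m a (k *: b + b') = k *: m a b + m a b'.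
Hypothesis mA : forall i j k l a b c, S i j a -> S j k b -> S k l c ->
  m a (m b c) = m (m a b) c.
Hypothesis mq : forall i j k a b, S i j a -> S j k b -> q (m a b) <= q a * q b.
Hypothesis dens : forall i j k a e, S i k a -> 0 < e ->
  exists2 w, aspan [set w | exists b c, [/\ S i j b, S j k c & w = m b c]] w & q (a - w) <= e.
Context {A D : banachAlgType C} {iA : V -> A} {iD : V -> D}.
Hypothesis AP : completion_of (S false false) q iA.
Hypothesis DP : completion_of (S true true) q iD.
Hypothesis iAM : forall a b, S false false a -> S false false b -> iA (m a b) = bmul (iA a) (iA b).
Hypothesis iDM : forall a b, S true true a -> S true true b -> iD (m a b) = bmul (iD a) (iD b).

Let bmul_cb (B : banachAlgType C) : contractive_bilinear (@bmul C B).
Proof.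
split; [exact: bmul_linl|exact: bmul_linr|exact: ler_bnormM].
Qed.

Section Family.
Context {E : bool -> bool -> completeNormedModType C} {I : forall i j, V -> E i j}.
Hypothesis IP : forall i j, completion_of (S i j) q (I i j).
Context {f : forall i j k, E i j -> E j k -> E i k}.
Hypothesis fP : forall i j k, contractive_bilinear (@f i j k).
Hypothesis fI : forall i j k a b, S i j a -> S j k b -> f (I i j a) (I j k b) = I i k (m a b).

(** Both sides are Lipschitz in each variable; the identity is carried from sections to the
    completions one variable at a time. *)
Lemma corner_assoc i j k l (x : E i j) (y : E j k) (z : E k l) :
  f x (f y z) = f (f x y) z.
Proof.
have hI a b c : S i j a -> S j k b -> S k l c ->
    f (I i j a) (f (I j k b) (I k l c)) = f (f (I i j a) (I j k b)) (I k l c).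
  move=> Sa Sb Sc; rewrite !fI//; [by rewrite (mA Sa Sb Sc)|exact: mS Sa Sb|exact: mS Sb Sc].
have step1 a b (z' : E k l) : S i j a -> S j k b ->
    f (I i j a) (f (I j k b) z') = f (f (I i j a) (I j k b)) z'.
  move=> Sa Sb; apply: (lipschitz_eq (f := fun z => f (I i j a) (f (I j k b) z))
    (g := fun z => f (f (I i j a) (I j k b)) z) (IP k l)
    (M := nrm (I i j a) * nrm (I j k b)) (M' := nrm (f (I i j a) (I j k b)))).
  - move=> u v; apply: le_trans (cb_lipr (fP _ _ _) _ _ _) _.
    by rewrite -mulrA ler_wpM2l ?nrm_ge0//; exact: (cb_lipr (fP _ _ _)).
  - by move=> u v; exact: (cb_lipr (fP _ _ _)).
  - by move=> c Sc; exact: hI.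
have step2 a (y' : E j k) (z' : E k l) : S i j a -> f (I i j a) (f y' z') = f (f (I i j a) y') z'.
  move=> Sa; apply: (lipschitz_eq (f := fun y => f (I i j a) (f y z'))
    (g := fun y => f (f (I i j a) y) z') (IP j k)
    (M := nrm (I i j a) * nrm z') (M' := nrm z' * nrm (I i j a))).
  - move=> u v; apply: le_trans (cb_lipr (fP _ _ _) _ _ _) _.
    by rewrite -mulrA ler_wpM2l ?nrm_ge0//; exact: (cb_lipl (fP _ _ _)).
  - move=> u v; apply: le_trans (cb_lipl (fP _ _ _) _ _ _) _.
    by rewrite -mulrA ler_wpM2l ?nrm_ge0//; exact: (cb_lipr (fP _ _ _)).
  - by move=> b Sb; exact: step1.
apply: (lipschitz_eq (f := fun x => f x (f y z)) (g := fun x => f (f x y) z) (IP i j)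
    (M := nrm (f y z)) (M' := nrm z * nrm y)).
- by move=> u v; exact: (cb_lipl (fP _ _ _)).
- move=> u v; apply: le_trans (cb_lipl (fP _ _ _) _ _ _) _.
  by rewrite -mulrA ler_wpM2l ?nrm_ge0//; exact: (cb_lipl (fP _ _ _)).
- by move=> a Sa; exact: step2.
Qed.

Lemma corner_dense i j k : dense_image (@f i j k).
Proof.
apply/dense_nrmP => v e e0; have e30 : 0 < e / 3 by rewrite divr_gt0.
have [a Sa va] := co_dense (IP i k) v e30.
have [w Sw aw] := dens j Sa e30.
have prods w' : aspan [set w | exists b c, [/\ S i j b, S j k c & w = m b c]] w' ->
    S i k w' /\ aspan [set w | exists x y, w = @f i j k x y] (I i k w').
  elim=> [|_ u [b [c [Sb Sc ->]]] _ [Su fu]].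
    split; first exact: S0.
    have -> : I i k 0 = 0; last exact: aspan0.
    by apply: nrm_eq0; rewrite (co_nrm (IP i k) (S0 _ _)) q0.
  have Sm := mS Sb Sc; split.
    by have := Sl 1 Sm Su; rewrite scale1r.
  have := co_lin (IP i k) 1 Sm Su; rewrite !scale1r => ->.
  by apply: aspanD => //; exists (I i j b), (I j k c); rewrite fI.
have [Sw' fw] := prods _ Sw.
exists (I i k w); first exact: aspan_linspan.
apply: le_lt_trans (nrm_dist _ (I i k a) _) _.
have Saw : S i k (a - w) by rewrite addrC -scaleN1r; exact: Sl.
rewrite -(completion_distB (IP i k))// (co_nrm (IP i k))//; lra.
Qed.

End Family.

Let X i j : seminormed := Seminormed (S0 i j) (@Sl i j) q0 (@ql i j).

Let exE i j : exists (E : completeNormedModType C) (I : V -> E), completion_of (S i j) q I.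
Proof. exact: (completion_exists (X i j)). Qed.

(** With the completions arranged as a matrix [E] indexed by booleans, all bimodule laws and the
    associativity of the linking algebra are instances of [corner_assoc], and the density conditions
    are instances of [corner_dense]. *)
Lemma morita_of_corners : morita_equivalent A D.
Proof.
have [Eg [Ig IgP]] := exE false true.
have [El [Il IlP]] := exE true false.
pose E (i j : bool) : completeNormedModType C :=
  match i, j with false, false => A | false, true => Eg | true, false => El | true, true => D end.
pose I : forall i j, V -> E i j := fun i j =>
  match i, j with false, false => iA | false, true => Ig | true, false => Il | true, true => iD end.
have IP i j : completion_of (S i j) q (I i j) by case: i; case: j.
have exf i j k : exists f : E i j -> E j k -> E i k, contractive_bilinear f /\
    forall a b, S i j a -> S j k b -> f (I i j a) (I j k b) = I i k (m a b).
  have [| | | |f fP fI] := @bilinear_extension R V (S i j) (S j k) (S i k) q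
    (E i j) (E j k) (E i k) (I i j) (I j k) (I i k) m (IP i j) (IP j k) (IP i k)
    (@Sl i j) (@Sl j k).
  - by move=> a b; exact: mS.
  - by move=> c a a' b Sa Sa' Sb; exact: ml Sa Sa' Sb.
  - by move=> c a b b' Sa Sb Sb'; exact: mr Sa Sb Sb'.
  - by move=> a b Sa Sb; exact: mq Sa Sb.
  by exists f.
(* On the diagonal the product must be the given multiplication itself, since it is the one that
   appears in the statement; the other six maps are extensions by continuity. *)
pose f i j k := match i, j, k return E i j -> E j k -> E i k with
  | false, false, false => @bmul C A
  | true, true, true => @bmul C D
  | i, j, k => sval (cid (exf i j k)) end.
have fP i j k : contractive_bilinear (f i j k).
  case: i; case: j; case: k; try exact: (svalP (cid (exf _ _ _))).1.
    exact: bmul_cb.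
  exact: bmul_cb.
have fI i j k a b : S i j a -> S j k b -> f i j k (I i j a) (I j k b) = I i k (m a b).
  case: i; case: j; case: k; try exact: (svalP (cid (exf _ _ _))).2.
    by move=> Sa Sb; exact: esym (iDM Sa Sb).
  by move=> Sa Sb; exact: esym (iAM Sa Sb).
have fA i j k l (x : E i j) (y : E j k) (z : E k l) := corner_assoc IP fP fI x y z.
have fd i j k : dense_image (f i j k) by exact: (corner_dense IP fI).
exists Eg, El, (f false false true), (f false true true), (f true true false),
  (f true false false), (f true false true), (f false true false); split.
- split; split; [exact: (fP false false true)|exact: (fP false true true)| | | |exact: (fP true true false)|exact: (fP true false false)| | |].
  + by move=> a a' e; rewrite -(fA false false false true).
  + by move=> e b b'; exact: (fA false true true true).
  + by move=> a e b; exact: (fA false false true true).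
  + by move=> a a' e; rewrite -(fA true true true false).
  + by move=> e b b'; exact: (fA true false false false).
  + by move=> a e b; exact: (fA true true false false).
- by split; [exact: (fP true false true)|exact: (fP false true false)].
- move=> [[[a e] g] b] [[[a' e'] g'] b'] [[[a'' e''] g''] b''].
  have Dl i j k x x' y : f i j k (x + x') y = f i j k x y + f i j k x' y.
    exact: (cb_Dl (fP i j k)).
  have Dr i j k x y y' : f i j k x (y + y') = f i j k x y + f i j k x y'.
    exact: (cb_Dr (fP i j k)).
  have eA : @bmul C A = f false false false by [].
  have eD : @bmul C D = f true true true by [].
  rewrite /linking_mxmul eA eD.
  congr (_, _, _, _).
  + rewrite (Dr false false false) (Dr false true false) (Dl false false false).
    rewrite (Dl false true false) !fA; exact: addrACA.
  + rewrite (Dr false false true) (Dr false true true) (Dl false false true).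
    rewrite (Dl false true true) !fA; exact: addrACA.
  + rewrite (Dr true false false) (Dr true true false) (Dl true false false).
    rewrite (Dl true true false) !fA; exact: addrACA.
  + rewrite (Dr true false true) (Dr true true true) (Dl true false true).
    rewrite (Dl true true true) !fA; exact: addrACA.
- by split; [exact: (fd false false false)|exact: (fd true true true)|exact: (fd false false true)|exact: (fd false true true)].
- by split; [exact: (fd true true false)|exact: (fd true false false)|exact: (fd true false true)|exact: (fd false true false)].
Qed.

End MoritaOfCorners.

(** * The corners of the linking algebra *)

Lemma inf_eq (R : realType) (A B : set R) : A !=set0 -> has_lbound A -> B `<=` A ->
  (forall a, A a -> exists2 b, B b & b <= a) -> inf A = inf B.
Proof.
move=> [a0 Aa0] Al BA AB; have [b0 Bb0 _] := AB _ Aa0.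
have Bl : has_lbound B by have [l hl] := Al; exists l => b /BA; exact: hl.
apply/eqP; rewrite eq_le; apply/andP; split.
  by apply: lb_le_inf; [exists b0|move=> b /BA; exact: ge_inf].
apply: lb_le_inf; first by exists a0.
by move=> a /AB[b Bb]; apply: le_trans; exact: ge_inf.
Qed.

Section LinkingCorners.
Context {R : realType} {G H : haarGroupoid R} (Om : equivalence G H)
  (B : gBanachAlgebra G).
Local Notation C := R[i].
Notation L := (linking Om).
Notation aG g := (inl (inl g) : L).
Notation aW w := (inl (inr w) : L).
Notation aV w := (inr (inl w) : L).
Notation aH h := (inr (inr h) : L).
Let BP := gb_axioms B.
Let GP := hg_lch G.
Let HP := hg_lch H.
Let GH := hg_haar G.
Let HH := hg_haar H.
Let LP := linking_lch GP HP Om.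
Let LH := linking_haar GP HP GH HH Om.
Notation BL := (link_algebra Om B).
Let BLP : is_gBanachAlgebra BL := link_algebraP Om B.
Notation secs := (dprod (fun a : L => BL (rng a))).
Let Lh := gpd_hausdorff LP.
Let Ll := gpd_lc LP.
Local Arguments gmul : simpl never.

Definition in_H (x : units L) : bool := if x is inr _ then true else false.

Lemma in_H_near (x : units L) : \forall y \near x, in_H y = in_H x.
Proof.
case: x => x.
  have h : nbhs (inl x : units L) (inl @` [set: units G]) by apply: nbhs_inl; exact: filterT.
  by apply: filterS h => _ [y _ <-].
have h : nbhs (inr x : units L) (inr @` [set: units H]) by apply: nbhs_inr; exact: filterT.
by apply: filterS h => _ [y _ <-].
Qed.

(** Fullness of both corners: surjectivity of [rho] and [sigma] supplies the arrows between
    different parts, identity arrows the others. *)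
Lemma in_H_full i j (x : units L) : in_H x = i -> exists2 a : L, rng a = x & in_H (src a) = j.
Proof.
case: x => x _; case: j.
- by have [w <-] := equiv_rho_surj Om x; exists (aW w).
- by exists (aG (gid G x)); rewrite //= (rng_id GP).
- by exists (aH (gid H x)); rewrite //= (rng_id HP).
- by have [w <-] := equiv_sigma_surj Om x; exists (aV w).
Qed.

Notation corner := (corner (B := BL) in_H).

(** Over a unit of [H], evaluation at a point [w] is an isometric isomorphism of algebras onto the
    fibre of [B] at [rho w], with inverse [ind_ext]; density of products is transported along it. *)
Lemma ind_nondegenerate : gb_nondegenerate B -> gb_nondegenerate BL.
Proof.
move=> Bnd [x|y]; first exact: Bnd.
have [w wy] := equiv_sigma_surj Om y; subst y.
apply/dense_nrmP => v e e0; have v0 : sigma w = sigma w by [].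
have [_ [n [k [u [Su ->]]]] h] := (dense_nrmP _).1 (@Bnd (rho w)) (v w v0) e e0.
pose z : ind_fiber Om B (sigma w) := \sum_i k i *: ind_ext (u i).
have zE : z w v0 = \sum_i k i *: u i.
  rewrite /z; elim/big_ind2 : _ => // [x1 x2 y1 y2 <- <- //|i _].
  by rewrite -[in RHS](ind_extE (Om := Om) (u i) v0).
exists z; last by rewrite (ind_nrm (v - z : ind_fiber Om B (sigma w)) v0) /= zE.
exists n, k, (fun i => ind_ext (u i)); split => // i.
have [a [b uE]] := Su i; exists (ind_ext a), (ind_ext b).
by apply: (@ind_inj R G H Om B _ _ _ w v0); rewrite /= !ind_extE uE.
Qed.

Section Restriction.

Definition restrictG (xi : secs) : forall g : G, B (rng g) := fun g => xi (aG g).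

Definition extendG (zeta : forall g : G, B (rng g)) : secs :=
  fun a => match a as a0 return BL (rng (a0 : L)) with
  | inl (inl g) => zeta g
  | inl (inr w) => 0
  | inr (inl w) => 0
  | inr (inr h) => 0
  end.

Let contG : continuous (fun g => aG g).
Proof. by move=> x; apply: cvg_inl; exact: continuous_inl. Qed.

Let bcv_restrG (xi : secs) (g : G) :
  bcv (S := sections BL) (nbhs (aG g)) (p := @rng _ L) xi (xi (aG g)) ->
  bcv (S := sections B) (nbhs g) (p := @rng _ G) (restrictG xi) (xi (aG g)).
Proof.
move=> [_ hh]; split; first exact: (rng_continuous GP).
move=> e /hh[b [[b1 b2] vb nb]]; exists (fun x => b (inl x)); split => //.
exact: (contG nb).
Qed.

Lemma restrictG_Gamma_c (xi : secs) : Gamma_c xi -> Gamma_c (restrictG xi).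
Proof.
move=> /(Gamma_cP LP)[xc [K Kc xK]]; apply/(Gamma_cP GP); split.
  by move=> g; exact: bcv_restrG.
exists ((fun g => aG g) @^-1` K); first exact: (compact_preinl (compact_preinl Kc)).
by move=> g nK; exact: (xK (aG g) nK).
Qed.

Lemma extendG_corner zeta : Gamma_c zeta -> corner false false (extendG zeta).
Proof.
move=> /(Gamma_cP GP)[zc [K Kc zK]]; split; last first.
  by move=> [[g|w]|[w|h]] //= nc; case: nc.
have S0 := usc_zero (gb_usc BLP).
have zero (a : L) : (\forall b \near a, extendG zeta b = 0) ->
    bcv (S := sections BL) (nbhs a) (p := @rng _ L) (extendG zeta) (0 : BL (rng a)).
  move=> h; apply: (bcv_ext (eta := fun b => 0 : BL (rng b))).
    by apply: filterS h => b ->.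
  by apply: (bcv0 (gb_usc BLP)); exact: (rng_continuous LP).
apply/(Gamma_cP LP); split; last first.
  exists ((fun g => aG g) @` K).
    by apply: continuous_compact => //; apply: continuous_subspaceT; exact: contG.
  by move=> [[g|w]|[w|h]] //= nK; apply: zK => Kg; apply: nK; exists g.
move=> [[g|w]|[w|h]]; last first.
- apply: zero; have n : nbhs (aH h) (inr @` (inr @` [set: H])).
    by do 2!apply: nbhs_inr; exact: filterT.
  by apply: filterS n => _ [_ [k _ <-] <-].
- apply: zero; have n : nbhs (aV w) (inr @` (inl @` [set: Om])).
    by apply: nbhs_inr; apply: nbhs_inl; exact: filterT.
  by apply: filterS n => _ [_ [k _ <-] <-].
- apply: zero; have n : nbhs (aW w) (inl @` (inr @` [set: Om])).
    by apply: nbhs_inl; apply: nbhs_inr; exact: filterT.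
  by apply: filterS n => _ [_ [k _ <-] <-].
have [_ hh] := zc g; split; first exact: (rng_continuous LP).
move=> e /hh[b [Sb vb nb]].
exists (fun x => match x as x0 return BL x0 with inl x => b x | inr y => 0 end); split => //.
  by split => //; exact: S0.2.
have := nbhs_inl (Y := (Om + H)%type) (nbhs_inl (Y := Om) nb).
by apply: filterS => _ [_ [k hk <-] <-].
Qed.

Lemma corner_supportG (xi : secs) a : corner false false xi ->
  ~ (exists g, a = aG g) -> xi a = 0.
Proof.
move=> [_ x0] na; apply: x0 => -[]; case: a na => [[g|w]|[w|h]] //= na _ _.
by apply: na; exists g.
Qed.

(** At a unit of [G] the Haar measure has a part on [G] and one on $\Omega$; on the latter the first
    factor vanishes. *)
Lemma restrictG_bconv (xi zeta : secs) : corner false false xi -> corner false false zeta ->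
  restrictG (bconv xi zeta) = bconv (restrictG xi) (restrictG zeta).
Proof.
move=> cx cz; apply: functional_extensionality_dep => g'.
have h1 := bconv_hint GP GH BP g' (restrictG_Gamma_c cx.1) (restrictG_Gamma_c cz.1).
have h2 := bconv_hint LP LH BLP (aG g') cx.1 cz.1.
have h3 : hint (haar L (inl (rng g'))) (integrand (G := L) xi zeta (aG g'))
    (bconv (restrictG xi) (restrictG zeta) g' + 0).
  apply: (hint_linkl GP HP GH HH).
    apply: hint_ext h1 => g _.
    congr (bmul _ _).
      exact: (esym (link_trl Om (rng g') (restrictG xi g))).
    exact: (esym (link_actG Om g (rng g') (restrictG zeta (gmul (ginv g) g')))).
  apply: hint_ext (hint0 (haar_eqv_radon HP HH Om (rng g'))) => w _.
  by rewrite /integrand (corner_supportG cx) ?(tr0 (G := L)) ?bmul0l// => -[].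
by have := hint_uniq (haar_radon LH _) Lh Ll h2 h3 (fun _ _ => erefl); rewrite addr0.
Qed.

Variable N : (L -> C) -> R.
Hypothesis NP : conv_norm N.
Variable NG : (G -> C) -> R.
Hypothesis NGE : forall f : G -> R, rCc f ->
  NG (fun g => (f g)%:C) = N (extG (Om := Om) (fun g => (f g)%:C)).

(** The two infima agree. A function on [G] that dominates the restriction extends by zero to one
    that dominates [xi], since [xi] vanishes off [G]; conversely a dominating function on the
    linking groupoid may be cut down to [G], which by monotonicity does not increase its norm. *)
Lemma unorm_restrictG (xi : secs) : corner false false xi ->
  unorm N xi = upper_norm NG (fun g => `|restrictG xi g|).
Proof.
move=> cx; rewrite /unorm /upper_norm.
have real (X : Type) (phi psi : X -> C) : (forall x, 0 <= phi x <= psi x) ->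
    psi = fun x => (complex.Re (psi x))%:C.
  move=> h; apply/funext => x; rewrite RRe_real//; apply: ger0_real.
  by have /andP[a b] := h x; exact: le_trans a b.
have extE (f : G -> R) : extG (Om := Om) (fun g => (f g)%:C) = fun a => (extl (extl f) a)%:C.
  by apply/funext => -[[g|w]|[w|h]].
apply: inf_eq.
- have [f fC xf] := Gamma_c_dominated LP BLP cx.1.
  exists (N (fun a => (f a)%:C)), (fun a => (f a)%:C) => //; split; first exact: Cc_real.
  by move=> a; rewrite nrm_le.
- exists 0 => _ [psi [psiC hp] <-].
  have pE := real _ (fun a => `|xi a|) psi (fun a => introT andP (conj (normr_ge0 _) (hp a))).
  rewrite pE; apply: (cn_ge0 NP (f := fun a => complex.Re (psi a))); first exact: Cc_Re.
  move=> a; have := hp a; rewrite pE nrm_le; apply: le_trans; exact: nrm_ge0.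
- move=> _ [psi [psiC hp] <-].
  have pE := real _ (fun a => `|restrictG xi a|) psi
    (fun a => introT andP (conj (normr_ge0 _) (hp a))).
  exists (extG psi); last by rewrite [in RHS]pE NGE -?pE//; exact: Cc_Re.
  split; first by rewrite pE extE; apply: Cc_real; do 2!apply: rCc_extl; exact: Cc_Re.
  by move=> [[g|w]|[w|h]] /=; [exact: hp| | |];
    rewrite (corner_supportG cx) ?normr0// => -[].
- move=> _ [psi [psiC hp] <-].
  have pE := real _ (fun a => `|xi a|) psi (fun a => introT andP (conj (normr_ge0 _) (hp a))).
  pose f a := complex.Re (psi a); pose fG g := f (aG g).
  have fC : rCc f by exact: Cc_Re.
  have f0 a : 0 <= f a.
    by have := hp a; rewrite pE nrm_le; apply: le_trans; exact: nrm_ge0.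
  have fGC : rCc fG.
    exact: (Cc_Re (Cc_inl (f := fun z => psi (inl z)) (Cc_inl psiC))).
  exists (NG (fun g => (fG g)%:C)).
    exists (fun g => (fG g)%:C) => //; split; first exact: Cc_real.
    by move=> g; have := hp (aG g); rewrite [in X in X -> _]pE.
  rewrite NGE// extE [in X in _ <= X]pE; apply: (cn_mono NP (f1 := extl (extl fG)) (f2 := f)) => //.
    by do 2!apply: rCc_extl.
  by move=> [[g|w]|[w|h]] /=; rewrite ?lexx ?f0.
Qed.

Lemma completion_restrictG (A : banachAlgType C) (iG : (forall g : G, B (rng g)) -> A) :
  coefficient_algebra NG iG ->
  completion_of (corner false false) (unorm N) (fun xi : secs => iG (restrictG xi)) /\
  forall xi zeta, corner false false xi -> corner false false zeta ->
    iG (restrictG (bconv xi zeta)) = bmul (iG (restrictG xi)) (iG (restrictG zeta)).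
Proof.
move=> AP; split; last first.
  move=> xi zeta cx cz; rewrite restrictG_bconv// (ca_conv AP)//.
    exact: restrictG_Gamma_c cx.1.
  exact: restrictG_Gamma_c cz.1.
split.
- move=> k xi zeta cx cz; rewrite -(ca_lin AP)//.
    exact: restrictG_Gamma_c cx.1.
  exact: restrictG_Gamma_c cz.1.
- move=> xi cx; rewrite unorm_restrictG// /nrm (ca_norm AP)//.
  exact: restrictG_Gamma_c cx.1.
- move=> v e e0; have [_ [zeta zG <-] h] := (dense_nrmP _).1 (ca_dense AP) v e e0.
  by exists (extendG zeta); [exact: extendG_corner|exact: ltW].
Qed.

End Restriction.

Section RestrictionH.
Notation IB := (Ind Om B).
Let OV := opp_equivalence GP HP Om.

Definition restrictH (xi : secs) : forall h : H, IB (rng h) := fun g => xi (aH g).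

Definition extendH (zeta : forall h : H, IB (rng h)) : secs :=
  fun a => match a as a0 return BL (rng (a0 : L)) with
  | inl (inl g) => 0
  | inl (inr w) => 0
  | inr (inl w) => 0
  | inr (inr h) => zeta h
  end.

Let contH : continuous (fun g => aH g).
Proof. by move=> x; apply: cvg_inr; exact: continuous_inr. Qed.

Let bcv_restrH (xi : secs) (g : H) :
  bcv (S := sections BL) (nbhs (aH g)) (p := @rng _ L) xi (xi (aH g)) ->
  bcv (S := sections IB) (nbhs g) (p := @rng _ H) (restrictH xi) (xi (aH g)).
Proof.
move=> [_ hh]; split; first exact: (rng_continuous HP).
move=> e /hh[b [[b1 b2] vb nb]]; exists (fun x => b (inr x)); split => //.
exact: (contH nb).
Qed.

(** The axioms are read off from those of the linking algebra at arrows of [H]. *)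
Lemma Ind_gBanachAlgebra : is_gBanachAlgebra IB.
Proof.
apply: (gBanachAlgebra_of_sections HP).
- exact: ind_usc.
- by move=> h; exact: (gact_lin BLP (g := aH h)).
- by move=> h; exact: (gact_norm BLP (g := aH h)).
- move=> b Sb; apply/(pullbackP _ (rng_continuous HP)) => h.
  pose b' (x : units L) : BL x := match x with inl x => 0 | inr y => b y end.
  have Sb' : sections BL b' by split => //; exact: (usc_zero (gb_usc BP)).
  have := (pullbackP _ (rng_continuous LP)).1 (gact_fwd LP BLP Sb') (aH h).
  exact: (bcv_restrH (xi := fun a : L => gact (b' (src a)))).
- exact: ind_sections_mul.
- move=> g g' b e.
  have := gactM BLP (g := aH g) (g' := aH g') (b : BL (src (aH g'))).
  move=> /(_ (congr1 inr e)) h.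
  rewrite -(link_actH_ind (gmul g g')) -(link_actH_ind g) -(link_actH_ind g').
  exact: h.
- by move=> h; exact: (gact_surj BLP (g := aH h)).
- by move=> h; exact: (gact_mul BLP (g := aH h)).
Qed.
Let IBP := Ind_gBanachAlgebra.

Lemma restrictH_Gamma_c (xi : secs) : Gamma_c xi -> Gamma_c (restrictH xi).
Proof.
move=> /(Gamma_cP LP)[xc [K Kc xK]]; apply/(Gamma_cP HP); split.
  by move=> g; exact: bcv_restrH.
exists ((fun g => aH g) @^-1` K); first exact: (compact_preinr (compact_preinr Kc)).
by move=> g nK; exact: (xK (aH g) nK).
Qed.

Lemma extendH_corner zeta : Gamma_c zeta -> corner true true (extendH zeta).
Proof.
move=> /(Gamma_cP HP)[zc [K Kc zK]]; split; last first.
  by move=> [[g|w]|[w|h]] //= nc; case: nc.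
have S0 := usc_zero (gb_usc BLP).
have zero (a : L) : (\forall b \near a, extendH zeta b = 0) ->
    bcv (S := sections BL) (nbhs a) (p := @rng _ L) (extendH zeta) (0 : BL (rng a)).
  move=> h; apply: (bcv_ext (eta := fun b => 0 : BL (rng b))).
    by apply: filterS h => b ->.
  by apply: (bcv0 (gb_usc BLP)); exact: (rng_continuous LP).
apply/(Gamma_cP LP); split; last first.
  exists ((fun g => aH g) @` K).
    by apply: continuous_compact => //; apply: continuous_subspaceT; exact: contH.
  by move=> [[w|w]|[w|g]] //= nK; apply: zK => Kg; apply: nK; exists g.
move=> [[g|w]|[w|g]].
- apply: zero; have n : nbhs (inl (inl g) : L) (inl @` (inl @` [set: G])).
    by do 2!apply: nbhs_inl; exact: filterT.
  by apply: filterS n => _ [_ [k _ <-] <-].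
- apply: zero; have n : nbhs (aW w) (inl @` (inr @` [set: Om])).
    by apply: nbhs_inl; apply: nbhs_inr; exact: filterT.
  by apply: filterS n => _ [_ [k _ <-] <-].
- apply: zero; have n : nbhs (aV w) (inr @` (inl @` [set: Om])).
    by apply: nbhs_inr; apply: nbhs_inl; exact: filterT.
  by apply: filterS n => _ [_ [k _ <-] <-].
have [_ hh] := zc g; split; first exact: (rng_continuous LP).
move=> e /hh[b [Sb vb nb]].
exists (fun x => match x as x0 return BL x0 with inl x => 0 | inr y => b y end); split => //.
  by split => //; exact: S0.1.
have := nbhs_inr (X := (G + Om)%type) (nbhs_inr (X := Om) nb).
by apply: filterS => _ [_ [k hk <-] <-].
Qed.

Lemma corner_supportH (xi : secs) a : corner true true xi ->
  ~ (exists g, a = aH g) -> xi a = 0.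
Proof.
move=> [_ x0] na; apply: x0 => -[]; case: a na => [[g|w]|[w|g]] //= na _ _.
by apply: na; exists g.
Qed.

Lemma restrictH_bconv (xi zeta : secs) : corner true true xi -> corner true true zeta ->
  restrictH (bconv xi zeta) = bconv (restrictH xi) (restrictH zeta).
Proof.
move=> cx cz; apply: functional_extensionality_dep => g'.
have h1 := bconv_hint HP HH IBP g' (restrictH_Gamma_c cx.1) (restrictH_Gamma_c cz.1).
have h2 := bconv_hint LP LH BLP (aH g') cx.1 cz.1.
have h3 : hint (haar L (inr (rng g'))) (integrand (G := L) xi zeta (aH g'))
    (0 + bconv (restrictH xi) (restrictH zeta) g').
  apply: (hint_linkr GP HP GH HH).
    apply: hint_ext (hint0 (haar_eqv_radon GP GH OV (rng g'))) => w _.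
    by rewrite /integrand (corner_supportH cx) ?(tr0 (G := L)) ?bmul0l// => -[].
  apply: hint_ext h1 => g _.
  congr (bmul _ _).
    exact: (esym (link_trr (Om := Om) (B := B) (rng g') (restrictH xi g))).
  exact: (esym (link_actH_ind (Om := Om) (B := B) g (rng g') (restrictH zeta (gmul (ginv g) g')))).
by have := hint_uniq (haar_radon LH _) Lh Ll h2 h3 (fun _ _ => erefl); rewrite add0r.
Qed.

Variable N : (L -> C) -> R.
Hypothesis NP : conv_norm N.
Variable NH : (H -> C) -> R.
Hypothesis NHE : forall f : H -> R, rCc f ->
  NH (fun g => (f g)%:C) = N (extH (Om := Om) (fun g => (f g)%:C)).

Lemma unorm_restrictH (xi : secs) : corner true true xi ->
  unorm N xi = upper_norm NH (fun g => `|restrictH xi g|).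
Proof.
move=> cx; rewrite /unorm /upper_norm.
have real (X : Type) (phi psi : X -> C) : (forall x, 0 <= phi x <= psi x) ->
    psi = fun x => (complex.Re (psi x))%:C.
  move=> h; apply/funext => x; rewrite RRe_real//; apply: ger0_real.
  by have /andP[a b] := h x; exact: le_trans a b.
have extE (f : H -> R) : extH (Om := Om) (fun g => (f g)%:C) = fun a => (extr (extr f) a)%:C.
  by apply/funext => -[[g|w]|[w|h]].
apply: inf_eq.
- have [f fC xf] := Gamma_c_dominated LP BLP cx.1.
  exists (N (fun a => (f a)%:C)), (fun a => (f a)%:C) => //; split; first exact: Cc_real.
  by move=> a; rewrite nrm_le.
- exists 0 => _ [psi [psiC hp] <-].
  have pE := real _ (fun a => `|xi a|) psi (fun a => introT andP (conj (normr_ge0 _) (hp a))).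
  rewrite pE; apply: (cn_ge0 NP (f := fun a => complex.Re (psi a))); first exact: Cc_Re.
  move=> a; have := hp a; rewrite pE nrm_le; apply: le_trans; exact: nrm_ge0.
- move=> _ [psi [psiC hp] <-].
  have pE := real _ (fun a => `|restrictH xi a|) psi
    (fun a => introT andP (conj (normr_ge0 _) (hp a))).
  exists (extH psi); last by rewrite [in RHS]pE NHE -?pE//; exact: Cc_Re.
  split; first by rewrite pE extE; apply: Cc_real; do 2!apply: rCc_extr; exact: Cc_Re.
  by move=> [[g|w]|[w|h]] /=; [| | |exact: hp];
    rewrite (corner_supportH cx) ?normr0// => -[].
- move=> _ [psi [psiC hp] <-].
  have pE := real _ (fun a => `|xi a|) psi (fun a => introT andP (conj (normr_ge0 _) (hp a))).
  pose f a := complex.Re (psi a); pose fH g := f (aH g).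
  have fC : rCc f by exact: Cc_Re.
  have f0 a : 0 <= f a.
    by have := hp a; rewrite pE nrm_le; apply: le_trans; exact: nrm_ge0.
  have fHC : rCc fH.
    exact: (Cc_Re (Cc_inr (f := fun z => psi (inr z)) (Cc_inr psiC))).
  exists (NH (fun g => (fH g)%:C)).
    exists (fun g => (fH g)%:C) => //; split; first exact: Cc_real.
    by move=> g; have := hp (aH g); rewrite [in X in X -> _]pE.
  rewrite NHE// extE [in X in _ <= X]pE; apply: (cn_mono NP (f1 := extr (extr fH)) (f2 := f)) => //.
    by do 2!apply: rCc_extr.
  by move=> [[g|w]|[w|h]] /=; rewrite ?lexx ?f0.
Qed.

Lemma completion_restrictH (A : banachAlgType C) (iH : (forall h : H, IB (rng h)) -> A) :
  coefficient_algebra NH iH ->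
  completion_of (corner true true) (unorm N) (fun xi : secs => iH (restrictH xi)) /\
  forall xi zeta, corner true true xi -> corner true true zeta ->
    iH (restrictH (bconv xi zeta)) = bmul (iH (restrictH xi)) (iH (restrictH zeta)).
Proof.
move=> AP; split; last first.
  move=> xi zeta cx cz; rewrite restrictH_bconv// (ca_conv AP)//.
    exact: restrictH_Gamma_c cx.1.
  exact: restrictH_Gamma_c cz.1.
split.
- move=> k xi zeta cx cz; rewrite -(ca_lin AP)//.
    exact: restrictH_Gamma_c cx.1.
  exact: restrictH_Gamma_c cz.1.
- move=> xi cx; rewrite unorm_restrictH// /nrm (ca_norm AP)//.
  exact: restrictH_Gamma_c cx.1.
- move=> v e e0; have [_ [zeta zG <-] h] := (dense_nrmP _).1 (ca_dense AP) v e e0.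
  by exists (extendH zeta); [exact: extendH_corner|exact: ltW].
Qed.

End RestrictionH.

End LinkingCorners.

(** * Conclusion *)

Section MoritaOfNorm.
Context {R : realType} {G H : haarGroupoid R} (Om : equivalence G H)
  (B : gBanachAlgebra G).
Local Notation C := R[i].
Local Notation L := (linking Om).
Let LP := linking_lch (hg_lch G) (hg_lch H) Om.
Let LH := linking_haar (hg_lch G) (hg_lch H) (hg_haar G) (hg_haar H) Om.
Let BLP := link_algebraP Om B.
Notation BL := (link_algebra Om B).

Lemma morita_of_norm (N : (L -> C) -> R) (NG : (G -> C) -> R) (NH : (H -> C) -> R)
    (AG : banachAlgType C) (iG : (forall g : G, B (rng g)) -> AG)
    (AH : banachAlgType C) (iH : (forall h : H, Ind Om B (rng h)) -> AH) :
  gb_nondegenerate B -> conv_norm N ->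
  (forall f : G -> R, rCc f -> NG (fun g => (f g)%:C) = N (extG (Om := Om) (fun g => (f g)%:C))) ->
  (forall f : H -> R, rCc f -> NH (fun g => (f g)%:C) = N (extH (Om := Om) (fun g => (f g)%:C))) ->
  coefficient_algebra NG iG -> coefficient_algebra NH iH -> morita_equivalent AG AH.
Proof.
move=> Bnd NP NGE NHE AGP AHP.
have [cG mG] := completion_restrictG NP NGE AGP.
have [cH mH] := completion_restrictH NP NHE AHP.
have cN i j k xi zeta : corner (B := BL) (@in_H R G H Om) i j xi -> corner (@in_H R G H Om) i j zeta ->
    unorm N (k *: xi + zeta) <= complex.Re `|k| * unorm N xi + unorm N zeta.
  by move=> cx cz; exact: (unorm_lin LP BLP NP k cx.1 cz.1).
apply: (@morita_of_corners R _ (corner (B := BL) (@in_H R G H Om)) (unorm N) (@bconv R L BL)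
  _ _ _ _ _ _ _ _ _ _ AG AH _ _ cG cH mG mH).
- by move=> i j; exact: corner0.
- by move=> i j k a b; exact: corner_lin.
- exact: (unorm0 LP BLP NP).
- exact: cN.
- by move=> i j k a b; exact: corner_bconv.
- by move=> i j l k a a' b ca ca' cb; exact: (bconv_linl LP LH BLP k ca.1 ca'.1 cb.1).
- by move=> i j l k a b b' ca cb cb'; exact: (bconv_linr LP LH BLP k ca.1 cb.1 cb'.1).
- by move=> i j k l a b c ca cb cc; exact: (bconvA LP LH BLP ca.1 cb.1 cc.1).
- by move=> i j k a b ca cb; exact: (unorm_bconv LP LH BLP NP ca.1 cb.1).
- move=> i j k a e ca e0.
  apply: (corner_density LP LH BLP (ind_nondegenerate Bnd) _ NP _ ca e0).
    exact: in_H_near.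
  by move=> x; exact: in_H_full.
Qed.

End MoritaOfNorm.

(** * The norm of $L^1$ *)

Section L1.
Context {R : realType} {G : groupoid_data R}.
Local Notation C := R[i].
Hypotheses (GP : is_lch_groupoid G) (GH : is_haar_system G).
Let Gh := gpd_hausdorff GP.
Let Gl := gpd_lc GP.
Implicit Types f : G -> R.
Notation N1 := (fun f : G -> R => L1norm (fun g => (f g)%:C)).

Let L1E f x : complex.Re (haar G x (fun g => `|(f g)%:C|)) = rint (haar G x) (fun g => `|f g|).
Proof.
rewrite /rint; congr (complex.Re (haar G x _)); apply/funext => g.
by rewrite (nrmE ((f g)%:C : C^o)) nrm_real.
Qed.

Let L1set f : set R := [set complex.Re (haar G x (fun g => `|(f g)%:C|)) | x in [set: units G]].

Let L1bound f : rCc f -> has_ubound (L1set f).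
Proof.
move=> fC; have [] := @rCc_bounded R (units G) (fun x => rint (haar G x) (fun g => `|f g|)).
  exact: (Cc_Re (haar_cont GH (Cc_real (rCc_norm fC)))).
move=> M _ hM; exists M => _ [x _ <-]; rewrite L1E.
by apply: le_trans (hM x); exact: ler_norm.
Qed.

Lemma le_L1norm f x : rCc f -> rint (haar G x) (fun g => `|f g|) <= N1 f.
Proof.
by move=> fC; apply: (ub_le_sup (L1bound fC)); exists x => //; exact: L1E.
Qed.

(** Nonnegativity of [M] covers a groupoid without units, where the supremum is over the empty set
    and equals 0. *)
Lemma L1norm_le f (M : R) : 0 <= M ->
  (forall x, rint (haar G x) (fun g => `|f g|) <= M) -> N1 f <= M.
Proof.
move=> M0 fM; have [[r Sr]|n0] := pselect (L1set f !=set0).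
  by apply: ge_sup; [exists r|move=> _ [x _ <-]; rewrite L1E].
rewrite /L1norm -/(L1set f) sup_out// => -[? _]; exact: n0.
Qed.

Lemma L1norm_ge0 f : rCc f -> 0 <= N1 f.
Proof.
move=> fC; have [[_ [x _ _]]|n0] := pselect (L1set f !=set0).
  apply: le_trans (le_L1norm x fC); apply: (rint_ge0 (haar_radon GH x)) => //.
  exact: rCc_norm.
by rewrite /L1norm -/(L1set f) sup_out// => -[? _]; exact: n0.
Qed.

(** By Fubini's theorem the integral is that of $f_1(g)\int f_2(g^{-1}k)\,d\lambda^x(k)$ over $g$.
    By left invariance the inner integral equals $\int f_2\,d\lambda^{s(g)}$, which is at most the
    norm of $f_2$. *)
Lemma rint_rconv f1 f2 x : rCc f1 -> rCc f2 -> (forall g, 0 <= f1 g) -> (forall g, 0 <= f2 g) ->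
  rint (haar G x) (rconv f1 f2) <= N1 f1 * N1 f2.
Proof.
move=> f1C f2C f10 f20.
have [f1c [K Kc f1K]] := f1C; have [f2c [T Tc f2T]] := f2C.
pose L : set G := [set k | exists a b, [/\ K a, T b, src a = rng b & k = gmul a b]].
have Lc : compact L by exact: (compact_gmul GP).
pose F g k : cscalar R := (f1 g * f2 (gmul (ginv g) k))%:C.
have [| | |G1 [G2 [v [h1 h2 h3 h4]]]] := @fubini R G G (cscalar R) Gh Gl Gh Gl (haar G x) (haar G x)
  (haar_radon GH _) (haar_radon GH _) F K L Kc Lc.
- by move=> g k _ _ nK; rewrite /F f1K// mul0r.
- move=> g k; rewrite !(msupport_haar GH) => rg rk nL; rewrite /F.
  have [Kg|nKg] := pselect (K g); last by rewrite f1K// mul0r.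
  rewrite f2T ?mulr0// => Tk; apply: nL; exists g, (gmul (ginv g) k); split => //.
  + by rewrite (rng_mul GP) ?(rng_inv GP)// (src_inv GP) rg.
  + by rewrite (gmulKV GP)// rg.
- move=> g k e; rewrite !(msupport_haar GH) => rg rk e0.
  pose D : set (G * G) := [set p | rng p.1 = x /\ rng p.2 = x].
  have c1 : (fun p : G * G => p.1) @ within D (nbhs (g, k)) --> g.
    by apply: cvg_within_filter; exact: cvg_fst.
  have c2 : (fun p : G * G => p.2) @ within D (nbhs (g, k)) --> k.
    by apply: cvg_within_filter; exact: cvg_snd.
  have dom : \forall p \near within D (nbhs (g, k)), D p by exact: withinT.
  have c3 : (fun p : G * G => f1 p.1 * f2 (gmul (ginv p.1) p.2)) @ within D (nbhs (g, k)) -->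
      f1 g * f2 (gmul (ginv g) k).
    apply: cvgM; first by apply: (@cvg_comp _ _ _ _ f1 _ (nbhs g)); [exact: c1|exact: f1c].
    apply: (@cvg_comp _ _ _ _ f2 _ (nbhs (gmul (ginv g) k))); last exact: f2c.
    apply: (cvg_gmul GP) => //; first exact: cvg_ginv.
      by rewrite (src_inv GP) rg.
    by apply: filterS dom => p [a b]; rewrite (src_inv GP) a.
  have h : \forall p \near within D (nbhs (g, k)), nrm (F p.1 p.2 - F g k) < e.
    move/cvgrPdist_lt : c3 => /(_ _ e0); apply: filterS => p hp.
    have -> : nrm (F p.1 p.2 - F g k) = nrm ((f1 p.1 * f2 (gmul (ginv p.1) p.2) -
        f1 g * f2 (gmul (ginv g) k))%:C : C^o) by rewrite rmorphB.
    by rewrite nrm_real distrC.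
  have {}h : \forall p \near (g, k), D p -> nrm (F p.1 p.2 - F g k) < e by exact: h.
  suff : \forall p \near nbhs (g, k), msupport (haar G x) p.1 -> msupport (haar G x) p.2 ->
    nrm (F p.1 p.2 - F g k) <= e by [].
  apply: filterS h => p hp; rewrite !(msupport_haar GH) => q1 q2; apply: ltW; exact: hp.
have N2 := L1norm_ge0 f2C.
have e1 : ((rint (haar G x) (rconv f1 f2))%:C : cscalar R) = v.
  have hr := hint_Cc (haar_radon GH x) (Cc_real (rconv_rCc GP GH f1C f2C)).
  rewrite (mu_rint (haar_radon GH x) (rconv_rCc GP GH f1C f2C)) in hr.
  apply: (hint_uniq (V := cscalar R) (haar_radon GH _) Gh Gl hr h4) => k sk.
  have rk : rng k = x by move: sk; rewrite (msupport_haar GH).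
  have hk := rconv_hint GP GH k f1C f2C; rewrite rk in hk.
  exact: (hint_uniq (V := cscalar R) (haar_radon GH _) Gh Gl hk (h2 _ sk)).
have hP := hint_Cc (haar_radon GH x) (Cc_real (rCcZ (N1 f2) f1C)).
have h := hint_le_real Gh Gl (haar_radon GH x) h3 hP.
rewrite -e1 in h.
have n1 : rint (haar G x) f1 <= N1 f1.
  have := le_L1norm x f1C; congr (rint _ _ <= _); apply/funext => g; exact: ger0_norm.
apply: le_trans (_ : N1 f2 * rint (haar G x) f1 <= _); last first.
  by rewrite mulrC ler_wpM2r.
rewrite -(rintZ (haar_radon GH x) _ f1C).
apply: le_trans (ler_norm _) _; rewrite -nrm_real; apply: h => g sg.
have rg : rng g = x by move: sg; rewrite (msupport_haar GH).
have hf2 := hint_Cc (haar_radon GH (rng (ginv g))) (Cc_real f2C).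
have := hint_haar_inv GP GH hf2; rewrite (src_inv GP) (rng_inv GP) rg => hg.
have hg' := hintZ (haar_radon GH x) (f1 g)%:C hg.
have -> : G1 g = ((f1 g)%:C *: (haar G (src g) (fun k => (f2 k)%:C) : C^o) : C^o).
  apply/esym; apply: (hint_uniq (V := C^o) (haar_radon GH _) Gh Gl hg' (h1 _ sg)) => k _.
  by rewrite /F rmorphM.
rewrite (mu_rint (haar_radon GH _) f2C) nrmZr nrm_real (ger0_norm (f10 g)) mulrC.
rewrite ler_wpM2r//.
have := le_L1norm (src g) f2C; have -> : (fun k => `|f2 k|) = f2.
  by apply/funext => k; exact: ger0_norm.
by rewrite ger0_norm// (rint_ge0 (haar_radon GH _)).
Qed.

Lemma L1norm_conv_norm : conv_norm (@L1norm R G).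
Proof.
split.
- move=> k f k0 fC; apply: L1norm_le; first by rewrite mulr_ge0// L1norm_ge0.
  move=> x; have -> : (fun g => `|k * f g|) = fun g => k * `|f g|.
    by apply/funext => g; rewrite normrM (ger0_norm k0).
  by rewrite (rintZ (haar_radon GH x) _ (rCc_norm fC)) ler_wpM2l// le_L1norm.
- move=> f1 f2 f1C f2C; apply: L1norm_le; first by rewrite addr_ge0// L1norm_ge0.
  move=> x; apply: le_trans (_ : rint (haar G x) (fun g => `|f1 g| + `|f2 g|) <= _).
    apply: (rint_le (haar_radon GH x)) => [||g]; last exact: ler_normD.
      by apply: rCc_norm; exact: rCcD.
    by apply: rCcD; exact: rCc_norm.
  rewrite (rintD (haar_radon GH x)); [|exact: rCc_norm|exact: rCc_norm].
  by apply: lerD; exact: le_L1norm.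
- move=> f1 f2 f1C f2C h; apply: L1norm_le; first exact: L1norm_ge0.
  move=> x; apply: le_trans (le_L1norm x f2C).
  apply: (rint_le (haar_radon GH x)) => [||g]; try exact: rCc_norm.
  by have /andP[a b] := h g; rewrite !ger0_norm// (le_trans a b).
- move=> f1 f2 f1C f2C f10 f20; apply: L1norm_le; first by rewrite mulr_ge0// L1norm_ge0.
  move=> x; have -> : (fun g => `|rconv f1 f2 g|) = rconv f1 f2.
    apply/funext => g; apply: ger0_norm.
    rewrite -(rint0 (haar_radon GH (rng g))).
    apply: (hint_lower (haar_radon GH (rng g)) Gh Gl (rconv_hint GP GH g f1C f2C) (@rCc0 R G)).
    by move=> k _; rewrite mulr_ge0.
  exact: rint_rconv.
Qed.

End L1.

Section L1Link.
Context {R : realType} {G H : haarGroupoid R} (Om : equivalence G H).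
Local Notation L := (linking Om).
Let GP := hg_lch G.
Let HP := hg_lch H.
Let GH := hg_haar G.
Let HH := hg_haar H.
Let LP := linking_lch GP HP Om.
Let LH := linking_haar GP HP GH HH Om.

(** Integrals over fibres at units of [G] are unchanged by the extension, and at units of [H] they
    are 0; so the supremum does not change. *)
Lemma L1norm_extG (f : G -> R) : rCc f ->
  L1norm (fun g => (f g)%:C) = L1norm (extG (Om := Om) (fun g => (f g)%:C)).
Proof.
move=> fC; have eE : extG (Om := Om) (fun g => (f g)%:C) = fun a => (extl (extl f) a)%:C.
  by apply/funext => -[[g|w]|[w|h]].
have eC : rCc (extl (extl f) : L -> R) by do 2!apply: rCc_extl.
have absE : (fun a : L => (`|extl (extl f) a|)%:C) = extG (Om := Om) (fun g => (`|f g|)%:C).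
  by apply/funext => -[[g|w]|[w|h]] /=; rewrite ?normr0.
rewrite eE; apply/eqP; rewrite eq_le; apply/andP; split.
  apply: L1norm_le; first exact: (L1norm_ge0 LH).
  move=> x; apply: le_trans (le_L1norm LH (inl x) eC).
  by rewrite /rint absE (haar_extG HP HH).
apply: L1norm_le; first exact: (L1norm_ge0 GH).
move=> [x|y]; first by rewrite /rint absE (haar_extG HP HH); exact: (le_L1norm GH x fC).
rewrite /rint absE.
have -> : haar L (inr y) (extG (fun g => (`|f g|)%:C)) =
    haar L (inr y) (extH (Om := Om) (fun=> 0)).
  by rewrite /=; congr (haar_eqv_inv _ _ + haar _ _ _).
rewrite (haar_extH GP HP GH).
have -> : complex.Re (haar H y (fun=> 0)) = rint (haar H y) (fun=> 0) by [].
by rewrite (rint0 (haar_radon HH y)) (L1norm_ge0 GH).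
Qed.

Lemma L1norm_extH (f : H -> R) : rCc f ->
  L1norm (fun g => (f g)%:C) = L1norm (extH (Om := Om) (fun g => (f g)%:C)).
Proof.
move=> fC; have eE : extH (Om := Om) (fun g => (f g)%:C) = fun a => (extr (extr f) a)%:C.
  by apply/funext => -[[g|w]|[w|h]].
have eC : rCc (extr (extr f) : L -> R) by do 2!apply: rCc_extr.
have absE : (fun a : L => (`|extr (extr f) a|)%:C) = extH (Om := Om) (fun g => (`|f g|)%:C).
  by apply/funext => -[[g|w]|[w|h]] /=; rewrite ?normr0.
rewrite eE; apply/eqP; rewrite eq_le; apply/andP; split.
  apply: L1norm_le; first exact: (L1norm_ge0 LH).
  move=> x; apply: le_trans (le_L1norm LH (inr x) eC).
  by rewrite /rint absE (haar_extH GP HP GH).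
apply: L1norm_le; first exact: (L1norm_ge0 HH).
move=> [x|y]; last by rewrite /rint absE (haar_extH GP HP GH); exact: (le_L1norm HH y fC).
rewrite /rint absE.
have -> : haar L (inl x) (extH (fun g => (`|f g|)%:C)) =
    haar L (inl x) (extG (Om := Om) (fun=> 0)).
  by rewrite /=; congr (haar _ _ _ + haar_eqv _ _).
rewrite (haar_extG HP HH).
have -> : complex.Re (haar G x (fun=> 0)) = rint (haar G x) (fun=> 0) by [].
by rewrite (rint0 (haar_radon GH x)) (L1norm_ge0 HH).
Qed.

End L1Link.

Lemma unconditional_conv_norm (R : realType) (G : groupoid_data R) (A : banachAlgType R[i])
    (i : (G -> R[i]) -> A) : is_lch_groupoid G -> is_haar_system G ->
  unconditional_completion i -> conv_norm (fun f => complex.Re `|i f|).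
Proof.
move=> GP GH iP.
have iZ (k : R) f : rCc f -> i (fun g => (k * f g)%:C) = k%:C *: i (fun g => (f g)%:C).
  (* Linearity is given for combinations [k * f1 + f2]; a multiple by [k] is written as
     [(k - 1) * f + f]. *)
  move=> fC; have := uc_lin iP (k%:C - 1) (Cc_real fC) (Cc_real fC).
  rewrite -[X in _ = _ + X]scale1r -scalerDl subrK => <-.
  by congr i; apply/funext => g; rewrite rmorphM mulrBl mul1r subrK.
split; rewrite /rnorm_of.
- by move=> k f k0 fC; rewrite iZ// -[complex.Re _]/(nrm _) nrmZr (ger0_norm k0).
- move=> f1 f2 f1C f2C; have := uc_lin iP 1 (Cc_real f1C) (Cc_real f2C).
  rewrite scale1r => h.
  have -> : (fun g => (f1 g + f2 g)%:C) = fun g => 1 * (f1 g)%:C + (f2 g)%:C.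
    by apply/funext => g; rewrite mul1r rmorphD.
  by rewrite h; exact: (nrmD (i _)).
- move=> f1 f2 f1C f2C h; rewrite -lecR.
  rewrite -!/(nrm _) -!nrmE; apply: (uc_mono iP); [exact: Cc_real|exact: Cc_real|].
  move=> g; have /andP[a b] := h g.
  by rewrite !ger0_norm ?ler0c// ?lecR// (le_trans a b).
- move=> f1 f2 f1C f2C _ _; rewrite -(conv_real GP GH f1C f2C).
  rewrite (uc_conv iP); [|exact: Cc_real|exact: Cc_real].
  exact: nrm_bmul.
Qed.

Theorem theorem5p6 (R : realType) (G H : haarGroupoid R)
    (Om : equivalence G H) (B : gBanachAlgebra G) (B_nd : gb_nondegenerate B) :
  (forall (AL : banachAlgType R[i]) (iL : (linking Om -> R[i]) -> AL),
     unconditional_completion iL ->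
   forall (AGB : banachAlgType R[i]) (iG : (forall g : G, B (rng g)) -> AGB)
          (AHB : banachAlgType R[i])
          (iH : (forall h : H, Ind Om B (rng h)) -> AHB),
     coefficient_algebra (restricted_normG iL) iG ->
     coefficient_algebra (restricted_normH iL) iH ->
     morita_equivalent AGB AHB) /\
  (forall (L1G : banachAlgType R[i]) (iG : (forall g : G, B (rng g)) -> L1G)
          (L1H : banachAlgType R[i])
          (iH : (forall h : H, Ind Om B (rng h)) -> L1H),
     coefficient_algebra (@L1norm R G) iG ->
     coefficient_algebra (@L1norm R H) iH ->
     morita_equivalent L1G L1H).
Proof.
have LP := linking_lch (hg_lch G) (hg_lch H) Om.
have LH := linking_haar (hg_lch G) (hg_lch H) (hg_haar G) (hg_haar H) Om.
split.
  move=> AL iL iLP AGB iG AHB iH AG AH.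
  exact: (morita_of_norm B_nd (unconditional_conv_norm LP LH iLP) _ _ AG AH).
move=> L1G iG L1H iH AG AH.
apply: (morita_of_norm B_nd (L1norm_conv_norm LP LH) _ _ AG AH).
  by move=> f; exact: L1norm_extG.
by move=> f; exact: L1norm_extH.
Qed.
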